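(* Let $\mathfrak g$ be a basic classical Lie superalgebra with parabolic subalgebra $\mathfrak p=\mathfrak l+\mathfrak n$ and let $\mathbb V$ be a finite dimensional irreducible $\mathfrak g$-module. Denote by $C^\bullet(\overline{\mathfrak n},\mathbb V)_0$ the generalised eigenspace with eigenvalue zero of the Kostant quabla operator $\Box=\partial\partial^\ast+\partial^\ast\partial$ on $C^\bullet(\overline{\mathfrak n},\mathbb V)$. The following statements are equivalent (isomorphisms are isomorphisms of $\mathfrak l$-modules, in each degree): (1) $\mathrm{im}\,\partial^\ast\cap\ker\Box=0$; (2) $\mathrm{im}\,\partial^\ast\cap C^\bullet(\overline{\mathfrak n},\mathbb V)_0=0$; (3) $C^\bullet(\overline{\mathfrak n},\mathbb V)_0\subset\ker\partial^\ast$; (4) $H_\bullet(\mathfrak n,\mathbb V)\cong C^\bullet(\overline{\mathfrak n},\mathbb V)_0$; (5) $\mathrm{im}\,\partial\cap\ker\Box=0$; (6) $H^\bullet(\overline{\mathfrak n},\mathbb V)\cong C^\bullet(\overline{\mathfrak n},\mathbb V)_0$; (7) $\partial$ and $\partial^\ast$ are disjoint. The same equivalences hold, for a finite dimensional irreducible $\mathfrak g$-module $\mathbb W$, with $\partial,\partial^\ast$ on $C^\bullet(\overline{\mathfrak n},\mathbb V)$ replaced by $\delta,\delta^\ast$ on $C^\bullet(\mathfrak n,\mathbb W)$, $\Box=\delta\delta^\ast+\delta^\ast\delta$, with $H_\bullet(\mathfrak n,\mathbb V)$ replaced by $H_\bullet(\overline{\mathfrak n},\mathbb W)$ and $H^\bullet(\overline{\mathfrak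 n},\mathbb V)$ replaced by $H^\bullet(\mathfrak n,\mathbb W)$.
   Context: Everything is over $\mathbb{C}$. A basic classical Lie superalgebra is one of $\mathfrak{sl}(m|n)$ ($m\neq n$), $\mathfrak{psl}(n|n)$, $\mathfrak{osp}(m|2n)$, $F(4)$, $G(3)$, $D(2,1;\alpha)$; $\mathfrak{gl}(m|n)$ is also allowed. It carries a non-degenerate supersymmetric consistent invariant bilinear form $(\cdot,\cdot)$, unique up to scalar and called the Killing form (supertrace form for $\mathfrak{gl}(m|n)$). A parabolic subalgebra $\mathfrak{p}$ is a subalgebra containing a Borel subalgebra; $\mathfrak{l}$ is its Levi subalgebra, $\mathfrak{p}=\mathfrak{l}+\mathfrak{n}$, $\mathfrak{g}=\overline{\mathfrak{n}}+\mathfrak{l}+\mathfrak{n}$, $\mathfrak p^\ast=\overline{\mathfrak n}+\mathfrak l$. $|\cdot|$ denotes parity, $\Lambda^k$ the super exterior power. Fix a basis $\{\xi_a\}$ of $\mathfrak n$ with dual basis $\{\xi_a^\ddagger\}$ of $\overline{\mathfrak n}$, $(\xi_a^\ddagger,\xi_b)=\delta_{ab}$. For a subspace $\mathfrak a$ ($=\mathfrak n$ or $\overline{\mathfrak n}$), $[A,\cdot]_{\mathfrak a}$ on $\Lambda^k\mathfrak a$ is the adjoint action of $A$ extended as a superderivation with each bracket projected to $\mathfrak a$ (along $\mathfrak p^\ast$ if $\mathfrak a=\mathfrak n$, along $\mathfrak p$ if $\mathfrak a=\overline{\mathfrak n}$). Operators on $C^k(\overline{\mathfrak n},\mathbb V)=\mathrm{Hom}(\Lambda^k\overline{\mathfrak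 n},\mathbb V)\cong\Lambda^k\mathfrak n\otimes\mathbb V=C_k(\mathfrak n,\mathbb V)$ (identification by the Killing form): boundary $\partial^\ast_k:C_k\to C_{k-1}$, $\partial_0^\ast=0$, $\partial^\ast(X\wedge f)=-X\cdot f-X\wedge\partial^\ast f$ for $X\in\mathfrak n$; coboundary $\partial_k:C^k\to C^{k+1}$, $$\partial(X_1\wedge\cdots\wedge X_k\otimes v)=\tfrac12\sum_a\xi_a\wedge[\xi_a^\ddagger,X_1\wedge\cdots\wedge X_k]_{\mathfrak n}\otimes v+(-1)^k\sum_aX_1\wedge\cdots\wedge X_k\wedge\xi_a\otimes\xi_a^\ddagger\cdot v.$$ $H_k(\mathfrak n,\mathbb V)=\ker\partial^\ast_k/\mathrm{im}\,\partial^\ast_{k+1}$, $H^k(\overline{\mathfrak n},\mathbb V)=\ker\partial_k/\mathrm{im}\,\partial_{k-1}$. Operators on $C^k(\mathfrak n,\mathbb W)=\mathrm{Hom}(\Lambda^k\mathfrak n,\mathbb W)\cong\Lambda^k\overline{\mathfrak n}\otimes\mathbb W=C_k(\overline{\mathfrak n},\mathbb W)$: boundary $\delta^\ast_0=0$, $\delta^\ast(Y\wedge f)=-Y\cdot f-Y\wedge\delta^\ast f$ for $Y\in\overline{\mathfrak n}$; coboundary $$\delta(Y_1\wedge\cdots\wedge Y_k\otimes u)=\tfrac12\sum_a(-1)^{|\xi_a|}\xi_a^\ddagger\wedge[\xi_a,Y_1\wedge\cdots\wedge Y_k]_{\overline{\mathfrak n}}\otimes u+(-1)^k\sum_a(-1)^{|\xi_a|}Y_1\wedge\cdots\wedge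 Y_k\wedge\xi_a^\ddagger\otimes\xi_a\cdot u.$$ $H_k(\overline{\mathfrak n},\mathbb W)=\ker\delta^\ast_k/\mathrm{im}\,\delta^\ast_{k+1}$, $H^k(\mathfrak n,\mathbb W)=\ker\delta_k/\mathrm{im}\,\delta_{k-1}$. All these operators are $\mathfrak l$-module morphisms. $\partial$ and $\partial^\ast$ are disjoint if $\ker\partial\cap\mathrm{im}\,\partial^\ast=0$ and $\ker\partial^\ast\cap\mathrm{im}\,\partial=0$; similarly for $\delta,\delta^\ast$. *)

(* Defs.v *)
From HB Require Import structures.
From mathcomp Require Import all_boot all_order all_algebra.
From mathcomp Require Import reals.
From mathcomp Require Export complex.

Set Implicit Arguments.
Unset Strict Implicit.
Unset Printing Implicit Defensive.

Import GRing.Theory.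
Local Open Scope ring_scope.

(** Parities are booleans: [false] is even, [true] is odd. Finite-dimensional
    super vector spaces are [vectType]s with a decomposition into the
    subspaces [part false] and [part true]. *)

Definition super_dec (F : fieldType) (vT : vectType F)
    (part : bool -> {vspace vT}) : Prop :=
  (part false + part true)%VS = fullv /\ (part false :&: part true)%VS = 0%VS.

Record lieSuperalgebra (F : fieldType) := LieSuperalgebra {
  lsa_vect :> vectType F;
  lsa_part : bool -> {vspace lsa_vect};
  lsa_br : lsa_vect -> 'End(lsa_vect);
  lsa_dec : super_dec lsa_part;
  lsa_br_linear : linear lsa_br;
  lsa_br_part : forall (p q : bool) (x y : lsa_vect),
    x \in lsa_part p -> y \in lsa_part q -> lsa_br x y \in lsa_part (p (+) q);
  lsa_br_skew : forall (p q : bool) (x y : lsa_vect),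
    x \in lsa_part p -> y \in lsa_part q ->
    lsa_br x y = - ((-1) ^+ (p && q) *: lsa_br y x);
  lsa_br_jacobi : forall (p q : bool) (x y z : lsa_vect),
    x \in lsa_part p -> y \in lsa_part q ->
    lsa_br x (lsa_br y z) =
      lsa_br (lsa_br x y) z + (-1) ^+ (p && q) *: lsa_br y (lsa_br x z) }.

Definition bracket (F : fieldType) (g : lieSuperalgebra F) (x y : g) : g :=
  lsa_br x y.

Section Subspaces.
Variables (F : fieldType) (g : lieSuperalgebra F).
Implicit Types U W : {vspace g}.

(* [x |-> (-1)^(p |x|) x], extended linearly to inhomogeneous [x] *)
Definition parity_twist (p : bool) (x : g) : g :=
  daddv_pi (lsa_part g false) (lsa_part g true) x
  + (-1) ^+ p *: daddv_pi (lsa_part g true) (lsa_part g false) x.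

Definition graded_sub (vT : vectType F) (part : bool -> {vspace vT})
    (U : {vspace vT}) : Prop :=
  U = (U :&: part false + U :&: part true)%VS.

Definition br_sub U W (Z : {vspace g}) : Prop :=
  forall x y : g, x \in U -> y \in W -> bracket x y \in Z.

Definition subalgebra U : Prop := graded_sub (@lsa_part F g) U /\ br_sub U U U.

(* [U] is an ideal of the subalgebra [W] *)
Definition ideal_of U W : Prop :=
  [/\ graded_sub (@lsa_part F g) U, (U <= W)%VS & br_sub W U U].

End Subspaces.

Section BasicClassical.
Variable F : fieldType.

Definition mx_part m n (p : bool) (M : 'M[F]_(m + n)) : Prop :=
  if p then ulsubmx M = 0 /\ drsubmx M = 0
  else ursubmx M = 0 /\ dlsubmx M = 0.

Definition supertrace m n (M : 'M[F]_(m + n)) : F :=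
  \tr (ulsubmx M) - \tr (drsubmx M).

Definition supercomm (p q : bool) k (M N : 'M[F]_k) : 'M[F]_k :=
  M *m N - (-1) ^+ (p && q) *: (N *m M).

(* injective morphism of Lie superalgebras from [g] to gl(m|n) *)
Definition gl_embedding (g : lieSuperalgebra F) m n
    (phi : g -> 'M[F]_(m + n)) : Prop :=
  [/\ linear phi, injective phi,
      forall (p : bool) (x : g), x \in lsa_part g p -> mx_part p (phi x)
    & forall (p q : bool) (x y : g), x \in lsa_part g p -> y \in lsa_part g q ->
        phi (bracket x y) = supercomm p q (phi x) (phi y)].

Definition is_sl (g : lieSuperalgebra F) (m n : nat) : Prop :=
  exists2 phi : g -> 'M[F]_(m + n), gl_embedding phi
    & forall M, (exists x, phi x = M) <-> supertrace M = 0.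

(* psl(n|n) = sl(n|n) / scalars: [psi] matters only on sl(n|n) *)
Definition is_psl (g : lieSuperalgebra F) (n : nat) : Prop :=
  exists psi : 'M[F]_(n + n) -> g,
  [/\ linear psi,
      forall (p : bool) M, supertrace M = 0 -> mx_part p M ->
        psi M \in lsa_part g p,
      forall (p q : bool) M N, supertrace M = 0 -> supertrace N = 0 ->
        mx_part p M -> mx_part q N ->
        psi (supercomm p q M N) = bracket (psi M) (psi N),
      forall x, exists2 M, supertrace M = 0 & psi M = x
    & forall M, supertrace M = 0 -> (psi M = 0 <-> exists c : F, M = c%:M)].

Definition symplectic_mx n : 'M[F]_(n + n) := block_mx 0 1%:M (- 1%:M) 0.

(* Block form of [beta (X u) v + (-1)^(|X||u|) beta u (X v) = 0] for the even
   supersymmetric form [beta] with matrix diag (1, symplectic_mx n). *)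
Definition osp_mx m n (X : 'M[F]_(m + (n + n))) : Prop :=
  let J := symplectic_mx n in
  [/\ (ulsubmx X)^T + ulsubmx X = 0,
      (drsubmx X)^T *m J + J *m drsubmx X = 0
    & (dlsubmx X)^T *m J + ursubmx X = 0].

Definition is_osp (g : lieSuperalgebra F) (m n : nat) : Prop :=
  exists2 phi : g -> 'M[F]_(m + (n + n)), gl_embedding phi
    & forall M, (exists x, phi x = M) <-> osp_mx M.

(* [g] is the contragredient Lie superalgebra with (invertible) Cartan matrix
   [A] whose i-th simple root is odd iff [odd_root i]: the free construction on
   the Chevalley relations, modulo its largest ideal meeting the Cartan
   subalgebra <<h>> trivially. *)
Definition contragredient (g : lieSuperalgebra F) r (A : 'M[F]_r)
    (odd_root : pred 'I_r) : Prop :=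
  exists e f h : r.-tuple g,
  [/\ forall i, [/\ tnth e i \in lsa_part g (odd_root i),
                    tnth f i \in lsa_part g (odd_root i)
                  & tnth h i \in lsa_part g false],
      forall i j, [/\ bracket (tnth h i) (tnth h j) = 0,
                      bracket (tnth e i) (tnth f j) = (i == j)%:R *: tnth h i,
                      bracket (tnth h i) (tnth e j) = A i j *: tnth e j
                    & bracket (tnth h i) (tnth f j) = - (A i j *: tnth f j)],
      free h,
      forall U : {vspace g}, br_sub U U U ->
        {subset e <= U} -> {subset f <= U} -> {subset h <= U} -> U = fullv
    & forall I : {vspace g}, ideal_of I fullv ->
        (I :&: <<h>>)%VS = 0%VS -> I = 0%VS].

Definition mx_of_seqs r (s : seq (seq F)) : 'M[F]_r :=
  \matrix_(i < r, j < r) nth 0 (nth [::] s i) j.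

(* Kac's distinguished Cartan matrices; only the first simple root is odd. *)
Definition cartan_D21 (alpha : F) : 'M[F]_3 :=
  mx_of_seqs 3 [:: [:: 0; 1; alpha]; [:: - 1; 2%:R; 0]; [:: - 1; 0; 2%:R]].

Definition cartan_G3 : 'M[F]_3 :=
  mx_of_seqs 3 [:: [:: 0; 1; 0]; [:: - 1; 2%:R; - 3%:R]; [:: 0; - 1; 2%:R]].

Definition cartan_F4 : 'M[F]_4 :=
  mx_of_seqs 4 [:: [:: 0; 1; 0; 0]; [:: - 1; 2%:R; - 2%:R; 0];
                   [:: 0; - 1; 2%:R; - 1]; [:: 0; 0; - 1; 2%:R]].

Definition is_D21 (g : lieSuperalgebra F) (alpha : F) : Prop :=
  contragredient g (cartan_D21 alpha) (pred1 ord0).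

Definition is_G3 (g : lieSuperalgebra F) : Prop :=
  contragredient g cartan_G3 (pred1 ord0).

Definition is_F4 (g : lieSuperalgebra F) : Prop :=
  contragredient g cartan_F4 (pred1 ord0).

Definition killing_form (g : lieSuperalgebra F) (kappa : g -> g -> F) : Prop :=
  [/\ (forall y, linear (fun x => kappa x y : F^o))
      /\ (forall x, linear (kappa x : g -> F^o)),
      forall (p q : bool) x y, x \in lsa_part g p -> y \in lsa_part g q ->
        p != q -> kappa x y = 0,
      forall (p q : bool) x y, x \in lsa_part g p -> y \in lsa_part g q ->
        kappa x y = (-1) ^+ (p && q) * kappa y x,
      forall x y z, kappa (bracket x y) z = kappa x (bracket y z)
    & forall x, (forall y, kappa x y = 0) -> x = 0].

(* For gl(m|n) the invariant form is not unique up to scalar: it is fixed to be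
   the supertrace form. *)
Definition is_gl (g : lieSuperalgebra F) (kappa : g -> g -> F) (m n : nat) :
    Prop :=
  exists phi : g -> 'M[F]_(m + n),
  [/\ gl_embedding phi, forall M, exists x, phi x = M
    & forall x y, kappa x y = supertrace (phi x *m phi y)].

(* psl(1|1) is excluded as usual: it is purely odd and abelian. *)
Definition basic_classical (g : lieSuperalgebra F) (kappa : g -> g -> F) :
    Prop :=
  killing_form kappa /\
  ((exists m n, is_gl kappa m n)
   \/ (exists m n, m <> n /\ is_sl g m n)
   \/ (exists n, (2 <= n)%N /\ is_psl g n)
   \/ (exists m n, is_osp g m n)
   \/ is_F4 g
   \/ is_G3 g
   \/ (exists alpha, [/\ alpha <> 0, alpha <> -1 & is_D21 g alpha])).

End BasicClassical.

Section Parabolic.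
Variables (F : fieldType) (g : lieSuperalgebra F).
Implicit Types h p l n nb : {vspace g}.

(* Cartan subalgebra of the reductive Lie algebra [g_0]: self-centralizing in
   [g_0] and acting diagonalizably on [g]. *)
Definition cartan_subalgebra h : Prop :=
  (forall y, y \in h <->
     y \in lsa_part g false /\ forall x, x \in h -> bracket x y = 0)
  /\ exists2 X : (\dim {:g}).-tuple g, basis_of fullv X
       & forall v x : g, v \in X -> x \in h ->
           exists c : F, bracket x v = c *: v.

(* Triangular decomposition [g = nm + h + np], with [np] and [nm] the sums of
   the positive and of the negative root spaces. It is not expressed through
   sets of roots because psl(2|2) has two-dimensional odd root spaces, which a
   Borel subalgebra may cut. *)
Definition triangular nm h np : Prop :=
  [/\ cartan_subalgebra h,
      subalgebra nm /\ subalgebra np,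
      br_sub h nm nm /\ br_sub h np np,
      (nm + h + np)%VS = fullv & directv (nm + h + np)].

(* [p = l + n] is a subalgebra containing the Borel subalgebra [h + np],
   [ps = nb + l] is the opposite one, containing [nm + h], and [l] is the common
   Levi subalgebra. As [n] is an ideal of [p] contained in [np], and [nb] one of
   [ps] contained in [nm], [l] consists of the root spaces of those roots [a]
   for which both [a] and [-a] are roots of [p]. *)
Definition parabolic_decomposition p l n nb : Prop :=
  exists nm h np : {vspace g}, let ps := (nb + l)%VS in
  [/\ triangular nm h np,
      [/\ subalgebra p, (h + np <= p)%VS & p = (l + n)%VS],
      [/\ subalgebra ps, (nm + h <= ps)%VS & subalgebra l],
      [/\ ideal_of n p, (n <= np)%VS, ideal_of nb ps & (nb <= nm)%VS]
    & (nb + l + n)%VS = fullv /\ directv (nb + l + n)].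

Definition homogeneous_basis (U : {vspace g}) d (X : d.-tuple g) : Prop :=
  basis_of U X /\ forall i, exists q : bool, tnth X i \in lsa_part g q.

End Parabolic.

(* Graded space on which the elements of [g] operate. The module axioms are a
   separate predicate, so that sub- and quotient constructions below are plain
   definitions. *)
Record actspace (F : fieldType) (g : lieSuperalgebra F) := ActSpace {
  as_vect :> vectType F;
  as_part : bool -> {vspace as_vect};
  as_act : g -> 'End(as_vect) }.

Section Modules.
Variables (F : fieldType) (g : lieSuperalgebra F).

Definition is_module (V : actspace g) : Prop :=
  [/\ super_dec (@as_part F g V), linear (as_act V),
      forall (p q : bool) x v, x \in lsa_part g p -> v \in as_part V q ->
        as_act V x v \in as_part V (p (+) q)
    & forall (p q : bool) x y v, x \in lsa_part g p -> y \in lsa_part g q ->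
        as_act V (bracket x y) v =
          as_act V x (as_act V y v)
          - (-1) ^+ (p && q) *: as_act V y (as_act V x v)].

Definition irreducible_module (V : actspace g) : Prop :=
  [/\ is_module V, ({:V} != 0)%VS
    & forall U : {vspace V}, graded_sub (@as_part F g V) U ->
        (forall x u, u \in U -> as_act V x u \in U) ->
        U = 0%VS \/ U = fullv].

Definition lmod_iso (l : {vspace g}) (M N : actspace g) : Prop :=
  exists f : 'Hom(M, N),
  [/\ bijective f,
      forall (p : bool) x, x \in as_part M p -> f x \in as_part N p
    & forall a x, a \in l -> f (as_act M a x) = as_act N a (f x)].

Definition subact (M : actspace g) (U : {vspace M}) : actspace g :=
  {| as_vect := subvs_of U;
     as_part p := (linfun (vsproj U) @: (U :&: as_part M p))%VS;
     as_act x := (linfun (vsproj U) \o as_act M x \o linfun vsval)%VF |}.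

(* The quotient of [vT] by [U] is carried by the complement [U^C], with
   [quot_pi], the projection along [U], as canonical map. *)
Definition quot_pi (vT : vectType F) (U : {vspace vT}) :
    'Hom(vT, subvs_of U^C%VS) :=
  (linfun (vsproj U^C%VS) \o daddv_pi U^C%VS U)%VF.

Definition quot_map (vT wT : vectType F) (U : {vspace vT}) (W : {vspace wT})
    (f : 'Hom(vT, wT)) : 'Hom(subvs_of U^C%VS, subvs_of W^C%VS) :=
  (quot_pi W \o f \o linfun vsval)%VF.

Definition quotact (M : actspace g) (U : {vspace M}) : actspace g :=
  {| as_vect := subvs_of U^C%VS;
     as_part p := (quot_pi U @: as_part M p)%VS;
     as_act x := quot_map U U (as_act M x) |}.

End Modules.

(* Basis [xi_a] of a nilradical [n], the dual elements [xi_a^dd] in the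
   opposite nilradical, and the projection of [g] onto [n]. *)
Record nil_frame (F : fieldType) (g : lieSuperalgebra F) := NilFrame {
  nf_dim : nat;
  nf_basis : nf_dim.-tuple g;
  nf_dual : 'I_nf_dim -> g;
  nf_proj : 'End(g) }.

Section Complex.
Variables (F : fieldType) (g : lieSuperalgebra F).
Variables (fr : nil_frame g) (V : actspace g).

Local Notation d := (nf_dim fr).
Local Notation xi a := (tnth (nf_basis fr) a).
Local Notation xidd a := (@nf_dual F g fr a).

Definition xi_par (a : 'I_d) : bool := xi a \in lsa_part g true.

(* k-th tensor power of [n], tensored with [V], in coordinates: the function
   [f] stands for the sum over [t] of
   [xi_(t_1) (x) ... (x) xi_(t_k) (x) f t]. *)
Local Notation T k := {ffun k.-tuple 'I_d -> V}.

Definition pure k (t : k.-tuple 'I_d) (v : V) : T k :=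
  [ffun s => if s == t then v else 0].

Definition prepend k (a : 'I_d) : 'Hom(T k, T k.+1) :=
  linfun (fun f : T k => \sum_(t : k.-tuple 'I_d) pure [tuple of a :: t] (f t)).

Definition slice k (a : 'I_d) : 'Hom(T k.+1, T k) :=
  linfun (fun f : T k.+1 =>
    [ffun t : k.-tuple 'I_d => f [tuple of a :: t]] : T k).

(* [X_1 ... X_k (x) v |-> X_1 ... X_k xi_a (x) phi v] *)
Definition append k (a : 'I_d) (phi : 'End(V)) : 'Hom(T k, T k.+1) :=
  linfun (fun f : T k =>
    \sum_(t : k.-tuple 'I_d) pure [tuple of rcons t a] (phi (f t))).

(* [x ^ _] for [x] in [n] *)
Definition wedge k (x : g) : 'Hom(T k, T k.+1) :=
  \sum_(a < d) coord (nf_basis fr) a x *: prepend k a.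

(* Relations [X ^ Y = - (-1)^(|X||Y|) Y ^ X] of the super exterior power. *)
Fixpoint ext_rel k : {vspace T k} :=
  match k with
  | 0 => 0%VS
  | k1.+1 =>
    (\sum_(a < d) (prepend k1 a @: ext_rel k1)
     + match k1 return {vspace T k1.+1} with
       | 0 => 0%VS
       | k2.+1 => \sum_(a < d) \sum_(b < d)
           limg ((prepend k2.+1 a \o prepend k2 b)%VF
                 + (-1) ^+ (xi_par a && xi_par b)
                   *: (prepend k2.+1 b \o prepend k2 a)%VF)%R
       end)%VS
  end.

(* Superderivation by the projected adjoint action of [x], with [x] acting on
   the coefficients through [phi]:
   [x . (X ^ w) = [x, X]_n ^ w + (-1)^(|x||X|) X ^ (x . w)]. *)
Fixpoint superder (phi : g -> 'End(V)) k (x : g) : 'End(T k) :=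
  match k return 'End(T k) with
  | 0 => linfun (fun f : T 0 => [ffun t => phi x (f t)] : T 0)
  | k'.+1 => \sum_(a < d)
      ((wedge k' (nf_proj fr (bracket x (xi a))) \o slice k' a)
       + (prepend k' a \o superder phi k' (parity_twist (xi_par a) x)
          \o slice k' a))%VF
  end.

(* [X ^ f |-> - X . f - X ^ boundary f] *)
Fixpoint tbdry k : 'Hom(T k.+1, T k) :=
  match k return 'Hom(T k.+1, T k) with
  | 0 => \sum_(a < d) - (superder (as_act V) 0 (xi a) \o slice 0 a)%VF
  | k'.+1 => \sum_(a < d)
      (- (superder (as_act V) k'.+1 (xi a) \o slice k'.+1 a)
       - (prepend k' a \o tbdry k' \o slice k'.+1 a))%VF
  end.

Definition tcobdry k : 'Hom(T k, T k.+1) :=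
  2%:R^-1 *: (\sum_(a < d)
    (prepend k a \o superder (fun=> 0) k (xidd a))%VF)
  + (-1) ^+ k *: \sum_(a < d) append k a (as_act V (xidd a)).

Definition tpart k (p : bool) : {vspace T k} :=
  (\sum_(t : k.-tuple 'I_d)
     (linfun (pure t) @: as_part V (\big[addb/p]_(a <- t) xi_par a)))%VS.

Definition tensors k : actspace g :=
  {| as_vect := T k; as_part := tpart k; as_act := superder (as_act V) k |}.

Definition chains k : actspace g := @quotact F g (tensors k) (ext_rel k).

(* degree [k.+1] to degree [k]; the boundary in degree 0 is zero *)
Definition bdry k : 'Hom(chains k.+1, chains k) :=
  quot_map (ext_rel k.+1) (ext_rel k) (tbdry k).

Definition cobdry k : 'Hom(chains k, chains k.+1) :=
  quot_map (ext_rel k) (ext_rel k.+1) (tcobdry k).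

Definition ker_bdry k : {vspace chains k} :=
  match k return {vspace chains k} with
  | 0 => fullv
  | k'.+1 => lker (bdry k')
  end.

Definition im_bdry k : {vspace chains k} := limg (bdry k).

Definition ker_cobdry k : {vspace chains k} := lker (cobdry k).

Definition im_cobdry k : {vspace chains k} :=
  match k return {vspace chains k} with
  | 0 => 0%VS
  | k'.+1 => limg (cobdry k')
  end.

Definition quabla k : 'End(chains k) :=
  match k return 'End(chains k) with
  | 0 => (bdry 0 \o cobdry 0)%VF
  | k'.+1 => ((cobdry k' \o bdry k') + (bdry k'.+1 \o cobdry k'.+1))%VF
  end.

Definition ker_quabla k : {vspace chains k} := lker (quabla k).

(* generalised eigenspace for the eigenvalue 0: the kernels of the powers of
   [quabla k] stabilise at the exponent [\dim {:chains k}] *)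
Definition quabla0 k : {vspace chains k} :=
  lker (iter (\dim {:chains k}) (fun f => quabla k \o f)%VF \1%VF).

Definition subquot k (Z B : {vspace chains k}) : actspace g :=
  @subact F g (quotact B) (quot_pi B @: Z)%VS.

Definition homology k : actspace g := subquot (ker_bdry k) (im_bdry k).

Definition cohomology k : actspace g := subquot (ker_cobdry k) (im_cobdry k).

Definition quabla0_module k : actspace g := subact (quabla0 k).

End Complex.

Section Frames.
Variables (F : fieldType) (g : lieSuperalgebra F).
Variables (p l n nb : {vspace g}) (d : nat) (xi xid : d.-tuple g).

Definition frame_n : nil_frame g :=
  NilFrame xi (tnth xid) (daddv_pi n (nb + l)%VS).

(* The basis of [nb] dual to [xi] has in its turn [(-1)^|xi_a| xi_a] as dual
   family, the form being supersymmetric; this is the origin of the signs in the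
   coboundary on [C(n, W)]. *)
Definition frame_nb : nil_frame g :=
  NilFrame xid (fun a => (-1) ^+ (tnth xi a \in lsa_part g true) *: tnth xi a)
    (daddv_pi nb p).

End Frames.

(* Main.v *)
(* The seven conditions are statements about the ranks of two differentials of
   opposite degree on a finite-dimensional complex: by Fitting's lemma for the
   quabla operator they are equivalent as soon as the boundary and the coboundary
   have the same rank in every degree. Equality of ranks comes from duality. An
   involutive anti-automorphism tau of g fixing a Cartan subalgebra and exchanging
   the two nilradicals gives a non-degenerate contravariant form on every
   irreducible module (highest weight vectors of the module and of its tau-dual are
   paired), hence a form on chains for which the boundary is adjoint to the
   coboundary up to sign. For matrix superalgebras tau is a transpose, for the
   exceptional ones it exchanges the Chevalley generators, and Cartan subalgebras
   are moved onto the split one by conjugation. When root spaces are lines tau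
   automatically exchanges n and its opposite; psl(2|2) has odd root spaces of
   dimension two, and tau is twisted there by an element of its outer SL_2. *)

Require Import Defs.
From HB Require Import structures.
From mathcomp Require Import all_boot all_order all_algebra.
From mathcomp Require Import reals ring zify.
From mathcomp Require Import boolp.

Set Implicit Arguments.
Unset Strict Implicit.
Unset Printing Implicit Defensive.

Import GRing.Theory Num.Theory.
Local Open Scope ring_scope.

(** Chains are tensors modulo the exterior relations [R], and the coboundary is manageable only
    modulo [R]. Contraction with the opposite nilradical takes the place of explicit exterior
    calculus: by Euler's identity a tensor lies in [R] once all its contractions do, so Cartan's
    formula modulo [R] shows by induction on the degree that the coboundary descends, squares to
    zero and is adjoint to the boundary. Equality of ranks enters once, to see that boundary and
    coboundary vanish together on the zero generalised eigenspace; each vanishing amounts to a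
    dimension count. The parabolic brings its own Cartan subalgebra, not the one on which tau is
    explicit. Two Borel subalgebras of the even part share an element regular for both, by a
    dimension count with the invariant form, and centralisers of such elements are conjugate. The
    obstacle is a central element posing as a nilpotent one; a condition on the centre excludes it.
    For the exceptional types no matrices are available: the graph of tau is generated inside g x g,
    and root lines come from tables of structure constants checked by computation. *)

Ltac atoms := repeat match goal with |- context C [@fun_of_lfun ?R ?a ?b ?f ?x] =>
  let t := constr:(@fun_of_lfun R a b f x) in move: t => ? end.

(** * Vectors, signs and brackets in a Lie superalgebra *)

Section Coordinates.
Variables (F : fieldType) (vT : vectType F).
Implicit Types u v : vT.

Definition crd (i : 'I_(\dim {:vT})) u : F := coord (vbasis {:vT}) i u.

Lemma crd_inj u v : (forall i, crd i u = crd i v) -> u = v.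
Proof. by move=> uv; rewrite (coord_vbasis (memvf u)) (coord_vbasis (memvf v)); apply: eq_bigr => i _; rewrite [coord _ _ _]uv. Qed.

Lemma crdD i u v : crd i (u + v) = crd i u + crd i v.
Proof. by rewrite /crd linearD. Qed.
Lemma crdN i u : crd i (- u) = - crd i u.
Proof. by rewrite /crd linearN. Qed.
Lemma crdZ i c u : crd i (c *: u) = c * crd i u.
Proof. by rewrite /crd linearZ. Qed.
Lemma crd0 i : crd i 0 = 0.
Proof. by rewrite /crd linear0. Qed.
End Coordinates.

(* Decides identities between linear combinations of vectors. *)
Ltac lincomb := apply: crd_inj => ?; rewrite ?(crdD, crdN, crdZ, crd0); ring.

(* Instances of [linearD] etc. whose head symbol makes rewriting fast. *)
Section LfunLinear.
Variables (F : fieldType) (U W : vectType F) (f : 'Hom(U, W)).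
Lemma lfD u v : f (u + v) = f u + f v. Proof. exact: linearD. Qed.
Lemma lfB u v : f (u - v) = f u - f v. Proof. exact: linearB. Qed.
Lemma lfN u : f (- u) = - f u. Proof. exact: linearN. Qed.
Lemma lfZ c u : f (c *: u) = c *: f u. Proof. exact: linearZ. Qed.
Lemma lf0 : f 0 = 0. Proof. exact: linear0. Qed.
Lemma lf_sum I (r : seq I) (P : pred I) (h : I -> U) :
  f (\sum_(i <- r | P i) h i) = \sum_(i <- r | P i) f (h i).
Proof. exact: linear_sum. Qed.
End LfunLinear.

Lemma bracket_linear_l (F : fieldType) (g : lieSuperalgebra F) (y : g) :
  linear (fun x : g => bracket x y).
Proof. by move=> c x z; rewrite /bracket lsa_br_linear add_lfunE scale_lfunE. Qed.

Section ParityTwist.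
Variables (F : fieldType) (g : lieSuperalgebra F).
Lemma parity_twist_linear p : linear (@parity_twist F g p).
Proof. by move=> c x y; rewrite /parity_twist !linearP scalerDr !scalerA -!addrA; lincomb. Qed.
HB.instance Definition _ p := GRing.isLinear.Build F g g *:%R (@parity_twist F g p) (parity_twist_linear p).

Lemma parity_twistE p q (x : g) : x \in lsa_part g q ->
  parity_twist p x = (-1) ^+ (p && q) *: x.
Proof.
have [dec cap] := lsa_dec g.
have add := daddv_pi_add (w := x) cap; rewrite dec memvf in add; move/(_ isT) in add.
case: q => xq; rewrite /parity_twist.
  have px := daddv_pi_id (etrans (capvC _ _) cap) xq.
  have -> : daddv_pi (lsa_part g false) (lsa_part g true) x = 0.
    by apply: (addIr x); rewrite add0r -[in LHS]px [in X in X + _]px.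
  by rewrite px add0r andbT.
have px := daddv_pi_id cap xq.
have -> : daddv_pi (lsa_part g true) (lsa_part g false) x = 0.
  by apply: (addrI x); rewrite addr0 -[X in X + _]px.
by rewrite px scaler0 addr0 andbF scale1r.
Qed.

End ParityTwist.

Section LieSuper.
Variables (F : fieldType) (g : lieSuperalgebra F).
Implicit Types x y z : g.

Lemma bracketDl x y z : bracket (x + y) z = bracket x z + bracket y z.
Proof. by have := bracket_linear_l z 1 x y; rewrite !scale1r. Qed.
Lemma bracketDr x y z : bracket z (x + y) = bracket z x + bracket z y.
Proof. by rewrite /bracket linearD. Qed.
Lemma bracketZl c x z : bracket (c *: x) z = c *: bracket x z.
Proof.
have := bracket_linear_l z c x 0.
by rewrite addr0 => ->; rewrite [bracket 0 z](_ : _ = 0) ?addr0 //; have := bracket_linear_l z (-1) 0 0; rewrite scaler0 addr0 scaleN1r addNr.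
Qed.
Lemma bracketZr c x z : bracket z (c *: x) = c *: bracket z x.
Proof. by rewrite /bracket linearZ. Qed.
Lemma bracket0l x : bracket 0 x = 0.
Proof. by have := bracketZl 0 0 x; rewrite !scale0r. Qed.
Lemma bracket0r x : bracket x 0 = 0.
Proof. by rewrite /bracket linear0. Qed.
Lemma bracketNl x z : bracket (- x) z = - bracket x z.
Proof. by rewrite -scaleN1r bracketZl scaleN1r. Qed.
Lemma bracketNr x z : bracket z (- x) = - bracket z x.
Proof. by rewrite /bracket linearN. Qed.

Lemma bracket_suml I (r : seq I) (P : pred I) (f : I -> g) x :
  bracket (\sum_(i <- r | P i) f i) x = \sum_(i <- r | P i) bracket (f i) x.
Proof. by elim/big_rec2: _ => [|i y z _ <-]; rewrite ?bracket0l ?bracketDl. Qed.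
Lemma bracket_sumr I (r : seq I) (P : pred I) (f : I -> g) x :
  bracket x (\sum_(i <- r | P i) f i) = \sum_(i <- r | P i) bracket x (f i).
Proof. by rewrite /bracket linear_sum. Qed.

Lemma homog_sum x : exists x0 x1, [/\ x = x0 + x1, x0 \in lsa_part g false & x1 \in lsa_part g true].
Proof.
have [dec _] := lsa_dec g; have : x \in (lsa_part g false + lsa_part g true)%VS by rewrite dec memvf.
by case/memv_addP=> x0 h0 [x1 h1 ->]; exists x0, x1.
Qed.

Lemma homog_sum0 x0 x1 : x0 \in lsa_part g false -> x1 \in lsa_part g true ->
  x0 + x1 = 0 -> x0 = 0 /\ x1 = 0.
Proof.
move=> h0 h1 /eqP; rewrite addr_eq0 => /eqP E; have [_ cap] := lsa_dec g.
have : x0 \in (lsa_part g false :&: lsa_part g true)%VS by rewrite memv_cap h0 E memvN.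
by rewrite cap memv0 => /eqP x00; move: E; rewrite x00 => /eqP; rewrite eq_sym oppr_eq0 => /eqP.
Qed.

Lemma homog_inj p q x : x \in lsa_part g p -> x \in lsa_part g q -> x != 0 -> p = q.
Proof.
have [_ cap] := lsa_dec g.
have C y : y \in lsa_part g false -> y \in lsa_part g true -> y = 0.
  by move=> h0 h1; apply/eqP; rewrite -memv0 -cap memv_cap h0.
by case: p; case: q => // h h'; rewrite [x]C ?eqxx.
Qed.

Lemma jacobi (p s : bool) x y z : x \in lsa_part g p -> y \in lsa_part g s ->
  bracket (bracket x y) z =
  bracket x (bracket y z) - (-1) ^+ (p && s) *: bracket y (bracket x z).
Proof. by move=> xp ys; rewrite /bracket (lsa_br_jacobi z xp ys) addrK. Qed.
End LieSuper.

Section KillingForm.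
Variables (F : fieldType) (g : lieSuperalgebra F) (kappa : g -> g -> F).
Hypothesis kf : killing_form kappa.

Lemma kappaDl x y z : kappa (x + y) z = kappa x z + kappa y z.
Proof. by case: kf => -[kl _] _ _ _ _; have := kl z 1 x y; rewrite !scale1r. Qed.
Lemma kappaDr x y z : kappa z (x + y) = kappa z x + kappa z y.
Proof. by case: kf => -[_ kl] _ _ _ _; have := kl z 1 x y; rewrite !scale1r. Qed.
Lemma kappa0l z : kappa 0 z = 0.
Proof. by apply: (addIr (kappa 0 z)); rewrite -kappaDl !add0r. Qed.
Lemma kappa0r z : kappa z 0 = 0.
Proof. by apply: (addIr (kappa z 0)); rewrite -kappaDr !add0r. Qed.
Lemma kappaZl c x z : kappa (c *: x) z = c * kappa x z.
Proof. by case: kf => -[kl _] _ _ _ _; have := kl z c x 0; rewrite kappa0l !addr0. Qed.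
Lemma kappaZr c x z : kappa z (c *: x) = c * kappa z x.
Proof. by case: kf => -[_ kl] _ _ _ _; have := kl z c x 0; rewrite kappa0r !addr0. Qed.
Lemma kappaNl x z : kappa (- x) z = - kappa x z.
Proof. by rewrite -scaleN1r kappaZl mulN1r. Qed.
Lemma kappaNr x z : kappa z (- x) = - kappa z x.
Proof. by rewrite -scaleN1r kappaZr mulN1r. Qed.
Lemma kappa_suml I (r : seq I) (P : pred I) (f : I -> g) x :
  kappa (\sum_(i <- r | P i) f i) x = \sum_(i <- r | P i) kappa (f i) x.
Proof. by elim/big_rec2: _ => [|i y z _ <-]; rewrite ?kappa0l ?kappaDl. Qed.
Lemma kappa_sumr I (r : seq I) (P : pred I) (f : I -> g) x :
  kappa x (\sum_(i <- r | P i) f i) = \sum_(i <- r | P i) kappa x (f i).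
Proof. by elim/big_rec2: _ => [|i y z _ <-]; rewrite ?kappa0r ?kappaDr. Qed.

Lemma kappa_inv x y z : kappa (bracket x y) z = kappa x (bracket y z).
Proof. by case: kf. Qed.
Lemma kappa_par p q x y : x \in lsa_part g p -> y \in lsa_part g q -> kappa x y != 0 -> p = q.
Proof. by case: kf => _ kp _ _ _ hx hy; apply: contraNeq => /(kp _ _ _ _ hx hy) ->. Qed.
Lemma kappa_sym p q x y : x \in lsa_part g p -> y \in lsa_part g q ->
  kappa x y = (-1) ^+ (p && q) * kappa y x.
Proof. by case: kf => _ _ ks _ _; apply: ks. Qed.
Lemma kappa_nondeg x : (forall y, kappa x y = 0) -> x = 0.
Proof. by case: kf => _ _ _ _; apply. Qed.
End KillingForm.

(* [n1] is the nilradical with basis [nf_basis fr], [m1] the opposite one and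
   [q] the parabolic subalgebra [m1 + l]. *)
Record good_frame (F : fieldType) (g : lieSuperalgebra F) (kappa : g -> g -> F)
    (fr : nil_frame g) (n1 m1 l q : {vspace g}) : Prop := GoodFrame {
  gf_killing : killing_form kappa;
  gf_basis : basis_of n1 (nf_basis fr);
  gf_hom a : tnth (nf_basis fr) a \in lsa_part g (@xi_par F g fr a);
  gf_proj x : nf_proj fr x \in n1;
  gf_proj_id x : x \in n1 -> nf_proj fr x = x;
  gf_proj_q x : x \in q -> nf_proj fr x = 0;
  gf_dec x : x - nf_proj fr x \in q;
  gf_dd_hom a : @nf_dual F g fr a \in lsa_part g (@xi_par F g fr a);
  gf_dd_m a : @nf_dual F g fr a \in m1;
  gf_dd_span y : y \in m1 -> y = \sum_a kappa y (tnth (nf_basis fr) a) *: @nf_dual F g fr a;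
  gf_mq : forall x y, x \in m1 -> y \in q -> kappa x y = 0;
  gf_dual a b : kappa (@nf_dual F g fr a) (tnth (nf_basis fr) b) = (a == b)%:R;
  gf_sub_m : (m1 <= q)%VS; gf_sub_l : (l <= q)%VS;
  gf_br_nn : br_sub n1 n1 n1; gf_br_ln : br_sub l n1 n1;
  gf_br_qm : br_sub q m1 m1; gf_br_qq : br_sub q q q;
  gf_graded_l : graded_sub (@lsa_part F g) l }.

(** * The complex on tensor powers, modulo the exterior relations *)

Ltac signs := rewrite /= ?(expr0, expr1, andbT, andbF, addbT, addbF, scale1r, scaleN1r, mul1r, mulN1r).

Ltac inspace := repeat first [assumption | apply: memvD | rewrite memvN | apply: memvZ].

(* The tensor powers of a nilradical with coefficients in a module and the
   operators on them, characterized by their values on [X (x) w]. Keeping the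
   spaces abstract avoids conversion problems with finite functions. *)
Section TensorModel.
Variables (F : numClosedFieldType) (g : lieSuperalgebra F) (kappa : g -> g -> F).
Variables (fr : nil_frame g) (n1 m1 l q : {vspace g}).
Hypothesis gf : good_frame kappa fr n1 m1 l q.
Local Notation d := (nf_dim fr).
Local Notation xi a := (tnth (nf_basis fr) a).
Local Notation xidd a := (@nf_dual F g fr a).
Local Notation par a := (@xi_par F g fr a).
Local Notation pr := (nf_proj fr).
Local Notation sg p q := ((-1) ^+ (p && q)).
Local Notation part := (lsa_part g).
Let kf := gf_killing gf.

Lemma xi_n a : xi a \in n1.
Proof. by have := gf_basis gf => /andP[/eqP <- _]; apply: memv_span; apply: mem_tnth. Qed.

Lemma xi_coord x : x \in n1 -> x = \sum_a coord (nf_basis fr) a x *: xi a.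
Proof.
by move=> xn; rewrite [LHS](coord_basis (gf_basis gf) xn); apply: eq_bigr => a _; rewrite -tnth_nth.
Qed.

Lemma coord_kappa x a : x \in n1 -> kappa (xidd a) x = coord (nf_basis fr) a x.
Proof.
move=> /xi_coord E; rewrite {1}E (kappa_sumr kf) (bigD1 a) //= big1 ?addr0.
  by rewrite (kappaZr kf) (gf_dual gf) eqxx mulr1.
by move=> b ba; rewrite (kappaZr kf) (gf_dual gf) eq_sym (negbTE ba) mulr0.
Qed.

(** The coordinate is a value of the form, which is even. In a sum over basis vectors the parity of
    [xi a] may therefore be replaced by that of [x]. *)
Lemma coord_par x p a : x \in n1 -> x \in part p -> coord (nf_basis fr) a x != 0 -> par a = p.
Proof. by move=> xn xp; rewrite -coord_kappa //; apply: (kappa_par kf) => //; apply: gf_dd_hom gf _. Qed.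

(** The coordinates of [pr x] are the values [kappa (xidd a) x], because [m1] is orthogonal to [q];
    evenness of the projection thus comes from evenness of the form. *)
Lemma proj_par p x : x \in part p -> pr x \in part p.
Proof.
move=> xp; rewrite (xi_coord (gf_proj gf x)); apply: memv_suml => a _.
have [->|ca] := eqVneq (coord (nf_basis fr) a (pr x)) 0; first by rewrite scale0r mem0v.
apply: memvZ; suff <- : par a = p by exact: gf_hom gf a.
apply: (kappa_par kf) (gf_dd_hom gf a) xp _.
have <- : kappa (xidd a) (pr x) = kappa (xidd a) x.
  apply/eqP; rewrite -subr_eq0 -(kappaNr kf) -(kappaDr kf) -oppr_eq0 -(kappaNr kf) opprB.
  by rewrite (gf_mq gf (gf_dd_m gf a) (gf_dec gf x)).
by rewrite coord_kappa ?(gf_proj gf).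
Qed.

Lemma kappa_proj y x : y \in m1 -> kappa y (pr x) = kappa y x.
Proof.
move=> ym; apply/eqP; rewrite eq_sym -subr_eq0 -(kappaNr kf) -(kappaDr kf).
by rewrite (gf_mq gf ym (gf_dec gf x)).
Qed.

Lemma kappa_coord y z : z \in n1 -> kappa y z = \sum_a coord (nf_basis fr) a z * kappa y (xi a).
Proof.
by move=> /xi_coord E; rewrite {1}E (kappa_sumr kf); apply: eq_bigr => a _; rewrite (kappaZr kf).
Qed.

Variable T : nat -> vectType F.
Variables (P : forall k, 'I_d -> 'Hom(T k, T k.+1)) (sl : forall k, 'I_d -> 'Hom(T k.+1, T k)).
Hypothesis sl_P : forall k a b (f : T k), sl k a (P k b f) = (a == b)%:R *: f.
Hypothesis P_sl : forall k (f : T k.+1), f = \sum_a P k a (sl k a f).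

Lemma tensor_slot_ind k (Q : T k.+1 -> Prop) :
  Q 0 -> (forall f h, Q f -> Q h -> Q (f + h)) ->
  (forall a f, Q (P k a f)) -> forall f, Q f.
Proof.
move=> Q0 QD Qp f; rewrite [f]P_sl.
by elim/big_rec: _ => // a x _ Px; apply: QD.
Qed.

Lemma sum_sl_P k (W : vectType F) (G : 'I_d -> 'Hom(T k, W)) b f :
  (\sum_a (G a \o sl k a)%VF) (P k b f) = G b f.
Proof.
rewrite sum_lfunE (bigD1 b) //= big1 ?addr0; last first.
  by move=> a /negbTE E; rewrite comp_lfunE sl_P E scale0r lf0.
by rewrite comp_lfunE sl_P eqxx scale1r.
Qed.

Definition W k x (f : T k) : T k.+1 := \sum_a coord (nf_basis fr) a x *: P k a f.
Arguments W k x f : clear implicits.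

Lemma WD k x y f : W k (x + y) f = W k x f + W k y f.
Proof. by rewrite /W -big_split; apply: eq_bigr => a _; rewrite linearD scalerDl. Qed.
Lemma WZ k c x f : W k (c *: x) f = c *: W k x f.
Proof. by rewrite /W scaler_sumr; apply: eq_bigr => a _; rewrite linearZ scalerA. Qed.
Lemma WN k x f : W k (- x) f = - W k x f.
Proof. by rewrite -scaleN1r WZ scaleN1r. Qed.
Lemma W0 k f : W k 0 f = 0.
Proof. by rewrite -(scale0r 0) WZ scale0r. Qed.
Lemma W_sum k I (r : seq I) (Q : pred I) (h : I -> g) f :
  W k (\sum_(i <- r | Q i) h i) f = \sum_(i <- r | Q i) W k (h i) f.
Proof. by elim/big_rec2: _ => [|i y z _ <-]; rewrite ?W0 ?WD. Qed.

Record superderivation (L : forall k, g -> 'End(T k)) : Prop := Superderivation {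
  sd_linear k : linear (L k);
  sd_P0 k p x a f : x \in part p ->
    L k.+1 x (P k a f) = W k (pr (bracket x (xi a))) f + sg (par a) p *: P k a (L k x f) }.

Section Superderivation.
Variable L : forall k, g -> 'End(T k).
Hypothesis sdL : superderivation L.

Lemma sdD k x y f : L k (x + y) f = L k x f + L k y f.
Proof. by have := sd_linear sdL k 1 x y; rewrite !scale1r => ->; rewrite add_lfunE. Qed.
Lemma sd0 k f : L k 0 f = 0.
Proof. by apply: (addIr (L k 0 f)); rewrite -sdD !add0r. Qed.
Lemma sdZ k c x f : L k (c *: x) f = c *: L k x f.
Proof. by have := sd_linear sdL k c x 0; rewrite addr0 => ->; rewrite add_lfunE scale_lfunE sd0 addr0. Qed.
Lemma sd_sum k I (r : seq I) (Q : pred I) (h : I -> g) f :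
  L k (\sum_(i <- r | Q i) h i) f = \sum_(i <- r | Q i) L k (h i) f.
Proof. by elim/big_rec2: _ => [|i y z _ <-]; rewrite ?sd0 ?sdD. Qed.

Lemma sd_P k p x a (f : T k) : x \in part p ->
  L k.+1 x (P k a f) = W k (pr (bracket x (xi a))) f + sg (par a) p *: P k a (L k x f).
Proof. exact: sd_P0 sdL _ _ _ _ _. Qed.

Lemma sd_W k p x s z (f : T k) : x \in part p -> z \in n1 -> z \in part s ->
  L k.+1 x (W k z f) = W k (pr (bracket x z)) f + sg s p *: W k z (L k x f).
Proof.
move=> xp zn zs; set c := coord (nf_basis fr).
have Ez : pr (bracket x z) = \sum_a c a z *: pr (bracket x (xi a)).
  by rewrite {1}(xi_coord zn) bracket_sumr lf_sum; apply: eq_bigr => a _; rewrite bracketZr lfZ.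
rewrite Ez W_sum [in LHS]/W lf_sum.
rewrite [W k z (L k x f)]/W scaler_sumr -big_split; apply: eq_bigr => a _.
rewrite lfZ (sd_P _ _ xp) scalerDr WZ; congr (_ + _); rewrite !scalerA mulrC.
rewrite -/(c a); have [->|ca] := eqVneq (c a z) 0; first by rewrite !(mulr0, mul0r).
by rewrite (coord_par zn zs ca).
Qed.

Lemma sd_coord k z (f : T k) : z \in n1 -> L k z f = \sum_a coord (nf_basis fr) a z *: L k (xi a) f.
Proof. by move=> zn; rewrite {1}(xi_coord zn) sd_sum; apply: eq_bigr => a _; rewrite sdZ. Qed.

Hypothesis L_rep0 : forall (p q : bool) x y f, x \in part p -> y \in part q ->
  L 0 (bracket x y) f = L 0 x (L 0 y f) - sg p q *: L 0 y (L 0 x f).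

(** The action projected to [n1] respects brackets only where the inner projection may be dropped.
    The two hypotheses say this; they hold for elements normalising [n1] and also for elements of
    [q]. *)
Lemma sd_rep k p s x y (f : T k) : x \in part p -> y \in part s ->
  (forall a, pr (bracket x (pr (bracket y (xi a)))) = pr (bracket x (bracket y (xi a)))) ->
  (forall a, pr (bracket y (pr (bracket x (xi a)))) = pr (bracket y (bracket x (xi a)))) ->
  L k (bracket x y) f = L k x (L k y f) - sg p s *: L k y (L k x f).
Proof.
move=> xp ys Hx Hy; elim: k f => [|k IH] f; first exact: L_rep0.
move: f; apply: tensor_slot_ind => [|f h IHf IHh|a f].
- by rewrite !lf0 scaler0 subr0.
- by rewrite !lfD IHf IHh; lincomb.
have xyp : bracket x y \in part (p (+) s) by apply: lsa_br_part.
rewrite (sd_P _ _ xyp) (sd_P _ _ ys) (sd_P _ _ xp) !(lfD, lfZ).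
have aP := gf_hom gf a.
have hy : pr (bracket y (xi a)) \in part (s (+) par a) by apply/proj_par/lsa_br_part.
have hx : pr (bracket x (xi a)) \in part (p (+) par a) by apply/proj_par/lsa_br_part.
rewrite (sd_W _ xp (gf_proj gf _) hy) (sd_W _ ys (gf_proj gf _) hx).
rewrite (sd_P _ _ ys) (sd_P _ _ xp).
rewrite Hx Hy IH (jacobi _ xp ys) !(lfB, lfD, lfZ) WD WN WZ.
by clear; move: p s (par a) => [] [] []; signs; atoms; lincomb.
Qed.
End Superderivation.

Section Boundary.
Variable L : forall k, g -> 'End(T k).
Hypothesis sdL : superderivation L.
Hypothesis L_rep0 : forall (p q : bool) x y f, x \in part p -> y \in part q ->
  L 0 (bracket x y) f = L 0 x (L 0 y f) - sg p q *: L 0 y (L 0 x f).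
Variable D : forall k, 'Hom(T k.+1, T k).
Hypothesis D0_P : forall a (f : T 0), D 0 (P 0 a f) = - L 0 (xi a) f.
Hypothesis D_P : forall k a (f : T k.+1), D k.+1 (P k.+1 a f) = - L k.+1 (xi a) f - P k a (D k f).

Lemma D0_W z (f : T 0) : z \in n1 -> D 0 (W 0 z f) = - L 0 z f.
Proof.
move=> zn; rewrite /W lf_sum (sd_coord sdL) // -sumrN.
by apply: eq_bigr => a _; rewrite lfZ D0_P scalerN.
Qed.

Lemma D_W k z (f : T k.+1) : z \in n1 -> D k.+1 (W k.+1 z f) = - L k.+1 z f - W k z (D k f).
Proof.
move=> zn; rewrite /W lf_sum (sd_coord sdL) // -!sumrN -big_split.
by apply: eq_bigr => a _; rewrite lfZ D_P scalerBr scalerN.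
Qed.

(** Induction on the degree: on [P k a f] the two sides differ by the representation property for
    [bracket x (xi a)]. With [x] in [n1] this leads to [DK], with [x] in [l] to equivariance of the
    boundary. *)
Lemma D_L k p x (f : T k.+1) : x \in part p -> (forall y, y \in n1 -> bracket x y \in n1) ->
  D k (L k.+1 x f) = L k x (D k f).
Proof.
move=> xp xn.
have rep j a (h : T j) : L j (bracket x (xi a)) h = L j x (L j (xi a) h) - sg p (par a) *: L j (xi a) (L j x h).
  apply: (sd_rep sdL L_rep0 _ xp (gf_hom gf a)) => b.
    by congr (pr (bracket _ _)); apply: (gf_proj_id gf); apply: (gf_br_nn gf); apply: xi_n.
  by congr (pr (bracket _ _)); apply: (gf_proj_id gf); apply: xn; apply: xi_n.
elim: k f => [|k IH]; apply: tensor_slot_ind => [|f h IHf IHh|a f].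
- by rewrite !lf0.
- by rewrite !lfD IHf IHh.
- rewrite (sd_P sdL _ _ xp) lfD lfZ D0_W ?(gf_proj gf) // !D0_P lfN.
  rewrite (gf_proj_id gf) ?xn ?xi_n // rep.
  by move: p (par a) {xp rep} => [] []; signs; atoms; lincomb.
- by rewrite !lf0.
- by rewrite !lfD IHf IHh.
- rewrite (sd_P sdL _ _ xp) lfD lfZ D_W ?(gf_proj gf) // !D_P lfB lfN.
  rewrite (gf_proj_id gf) ?xn ?xi_n // rep (sd_P sdL _ _ xp) (gf_proj_id gf) ?xn ?xi_n //.
  rewrite IH.
  by move: p (par a) {xp rep} => [] []; signs; atoms; lincomb.
Qed.

(** As [D] commutes with the action of [xi a], the two terms in which [xi a] acts on [D f] cancel,
    and [P a (D (D f))] is left for the induction. *)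
Lemma DK k (f : T k.+2) : D k (D k.+1 f) = 0.
Proof.
have DL j a (h : T j.+1) : D j (L j.+1 (xi a) h) = L j (xi a) (D j h).
  by apply: (D_L _ (gf_hom gf a)) => y; apply: (gf_br_nn gf); apply: xi_n.
elim: k f => [|k IH]; apply: tensor_slot_ind => [|f h IHf IHh|a f].
- by rewrite !lf0.
- by rewrite !lfD IHf IHh addr0.
- by rewrite D_P lfB lfN DL D0_P opprK addNr.
- by rewrite !lf0.
- by rewrite !lfD IHf IHh addr0.
- by rewrite D_P lfB lfN DL D_P IH lf0 subr0 opprK addNr.
Qed.

End Boundary.

Variable R : forall k, {vspace T k}.
Hypotheses (ext_rel0 : R 0 = 0%VS) (ext_rel1 : R 1 = 0%VS).
Hypothesis ext_rel_P : forall k a (f : T k), f \in R k -> P k a f \in R k.+1.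
Hypothesis ext_rel_PP : forall k a b (f : T k),
  P k.+1 a (P k b f) + sg (par a) (par b) *: P k.+1 b (P k a f) \in R k.+2.
Hypothesis ext_rel_sub : forall k (U : {vspace T k.+2}),
  (forall a f, f \in R k.+1 -> P k.+1 a f \in U) ->
  (forall a b f, P k.+1 a (P k b f) + sg (par a) (par b) *: P k.+1 b (P k a f) \in U) ->
  (R k.+2 <= U)%VS.

(* Linear maps respecting the relations; the base case is vacuous. *)
Lemma ext_rel_map k (X : vectType F) (h : 'Hom(T k.+2, X)) (U : {vspace X}) :
  (forall a f, f \in R k.+1 -> h (P k.+1 a f) \in U) ->
  (forall a b f, h (P k.+1 a (P k b f)) + sg (par a) (par b) *: h (P k.+1 b (P k a f)) \in U) ->
  forall f, f \in R k.+2 -> h f \in U.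
Proof.
move=> U1 U2 f fR; rewrite memv_preim; apply: (subvP (ext_rel_sub _ _)) fR => [a f' /(U1 a)|a b f'].
  by rewrite memv_preim.
by rewrite -memv_preim lfD lfZ.
Qed.

Lemma ext_rel_W k x (f : T k) : f \in R k -> W k x f \in R k.+1.
Proof. by move=> fR; rewrite /W memv_suml // => a _; rewrite memvZ // ext_rel_P. Qed.

Lemma ext_rel_WP k x p b (f : T k) : x \in n1 -> x \in part p ->
  W k.+1 x (P k b f) + sg p (par b) *: P k.+1 b (W k x f) \in R k.+2.
Proof.
move=> xn xp; rewrite !/W lf_sum scaler_sumr -big_split memv_suml //= => a _.
have [->|ca] := eqVneq (coord (nf_basis fr) a x) 0.
  by rewrite !scale0r lf0 scaler0 addr0 mem0v.
rewrite lfZ scalerA mulrC -scalerA -scalerDr memvZ // -(coord_par xn xp ca).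
exact: ext_rel_PP.
Qed.

Section Superderivation.
Variable L : forall k, g -> 'End(T k).
Hypothesis sdL : superderivation L.

Lemma ext_rel_sd k p x f : x \in part p -> f \in R k -> L k x f \in R k.
Proof.
move=> xp; elim: k f => [|[|k] IH] f.
- by rewrite ext_rel0 memv0 => /eqP->; rewrite lf0 mem0v.
- by rewrite ext_rel1 memv0 => /eqP->; rewrite lf0 mem0v.
apply: ext_rel_map => [a h hR|a b h].
  rewrite (sd_P sdL _ _ xp) memvD ?ext_rel_W // memvZ // ext_rel_P //; exact: IH.
rewrite !(sd_P sdL _ _ xp) !(lfD, lfZ).
have hx c : pr (bracket x (xi c)) \in part (p (+) par c).
  by apply/proj_par/lsa_br_part => //; apply: gf_hom gf c.
have Ra := ext_rel_WP b h (gf_proj gf _) (hx a); have Rb := ext_rel_WP a h (gf_proj gf _) (hx b).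
have Rab := ext_rel_PP a b (L k x h).
set u := (X in X \in _).
(* By the Leibniz rule a relation is carried to three relations, one for each place where [x] can
   act. *)
have -> : u = (W k.+1 (pr (bracket x (xi a))) (P k b h) + sg (p (+) par a) (par b) *: P k.+1 b (W k (pr (bracket x (xi a))) h))
  + sg (par a) (par b) *: (W k.+1 (pr (bracket x (xi b))) (P k a h) + sg (p (+) par b) (par a) *: P k.+1 a (W k (pr (bracket x (xi b))) h))
  + sg p (par a (+) par b) *: (P k.+1 a (P k b (L k x h)) + sg (par a) (par b) *: P k.+1 b (P k a (L k x h))).
  by rewrite /u; clear; move: p (par a) (par b) => [] [] []; signs; atoms; lincomb.
by apply: memvD; [apply: memvD => //|]; apply: memvZ.
Qed.

Variable D : forall k, 'Hom(T k.+1, T k).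
Hypothesis D0_P : forall a (f : T 0), D 0 (P 0 a f) = - L 0 (xi a) f.
Hypothesis D_P : forall k a (f : T k.+1), D k.+1 (P k.+1 a f) = - L k.+1 (xi a) f - P k a (D k f).

Lemma ext_rel_D k f : f \in R k.+1 -> D k f \in R k.
Proof.
elim: k f => [|k IH] f; first by rewrite ext_rel1 memv0 => /eqP->; rewrite lf0 mem0v.
have LP a h : h \in R k.+1 -> L k.+1 (xi a) h \in R k.+1.
  exact: (ext_rel_sd (gf_hom gf a)).
apply: ext_rel_map => [a h hR|a b h].
  by rewrite D_P memvD ?memvN ?LP // ext_rel_P ?IH.
rewrite !D_P !(sd_P sdL _ _ (gf_hom gf _)).
(* Super skew-symmetry cancels the two adjoint terms [W]; the mixed terms cancel in pairs, and only
   a relation for [D k h] survives. *)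
have Eab : bracket (xi a) (xi b) = - (sg (par a) (par b) *: bracket (xi b) (xi a)).
  by apply: (lsa_br_skew (gf_hom gf a) (gf_hom gf b)).
rewrite Eab lfN lfZ WN WZ.
case: k f h IH LP => [|k] f h IH LP.
  rewrite !D0_P !lfN; set u := (X in X \in _); have -> : u = 0; last exact: mem0v.
  by rewrite /u; clear; move: (par a) (par b) => [] []; signs; atoms; lincomb.
rewrite !D_P !(lfB, lfN) scalerBr.
have Rab := ext_rel_PP a b (D k h).
set u := (X in X \in _).
have -> : u = P k.+1 a (P k b (D k h)) + sg (par a) (par b) *: P k.+1 b (P k a (D k h)).
  by rewrite /u; clear; move: (par a) (par b) => [] []; signs; atoms; lincomb.
exact: Rab.
Qed.
End Superderivation.

(* Contraction with [kappa y _], as a superderivation. *)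
Fixpoint contract k (y : g) : 'Hom(T k.+1, T k) :=
  match k return 'Hom(T k.+1, T k) with
  | 0 => \sum_a ((kappa y (xi a) *: \1%VF) \o sl 0 a)%VF
  | k'.+1 => \sum_a ((kappa y (xi a) *: \1%VF
      - (P k' a \o contract k' (parity_twist (xi_par a) y))) \o sl k'.+1 a)%VF
  end.
Arguments contract : simpl never.
Local Notation J k y := (contract k y).

Lemma contract0_P y a (f : T 0) : J 0 y (P 0 a f) = kappa y (xi a) *: f.
Proof. by rewrite /contract sum_sl_P scale_lfunE id_lfunE. Qed.

Lemma contract_twist k y a (f : T k.+1) :
  J k.+1 y (P k.+1 a f) = kappa y (xi a) *: f - P k a (J k (parity_twist (par a) y) f).
Proof.
rewrite [contract _ _]/(J k.+1 y) /contract -/contract.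
by rewrite sum_sl_P add_lfunE opp_lfunE scale_lfunE id_lfunE comp_lfunE.
Qed.

Lemma contract_linear k c x y f : J k (c *: x + y) f = c *: J k x f + J k y f.
Proof.
elim: k c x y f => [|k IH] c x y; apply: tensor_slot_ind => [|f h IHf IHh|a f].
- by rewrite !lf0 scaler0 addr0.
- by rewrite !lfD IHf IHh; atoms; lincomb.
- by rewrite !contract0_P (kappaDl kf) (kappaZl kf); lincomb.
- by rewrite !lf0 scaler0 addr0.
- by rewrite !lfD IHf IHh; atoms; lincomb.
- by rewrite !contract_twist (kappaDl kf) (kappaZl kf) [parity_twist _ _]linearP IH lfD lfZ; lincomb.
Qed.

Lemma contractD k x y f : J k (x + y) f = J k x f + J k y f.
Proof. by have := contract_linear 1 x y f; rewrite !scale1r. Qed.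
Lemma contract0 k f : J k 0 f = 0.
Proof. by apply: (addIr (J k 0 f)); rewrite -contractD !add0r. Qed.
Lemma contractZ k c x f : J k (c *: x) f = c *: J k x f.
Proof. by have := contract_linear c x 0 f; rewrite contract0 !addr0. Qed.
Lemma contractN k x f : J k (- x) f = - J k x f.
Proof. by rewrite -scaleN1r contractZ scaleN1r. Qed.
Lemma contract_sum k I (r : seq I) (Q : pred I) (h : I -> g) f :
  J k (\sum_(i <- r | Q i) h i) f = \sum_(i <- r | Q i) J k (h i) f.
Proof. by elim/big_rec2: _ => [|i y z _ <-]; rewrite ?contract0 ?contractD. Qed.

Lemma contract_P k p y a (f : T k.+1) : y \in part p ->
  J k.+1 y (P k.+1 a f) = kappa y (xi a) *: f - sg (par a) p *: P k a (J k y f).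
Proof. by move=> yp; rewrite contract_twist (parity_twistE _ yp) contractZ lfZ. Qed.

Lemma contract0_W y z (f : T 0) : z \in n1 -> J 0 y (W 0 z f) = kappa y z *: f.
Proof.
move=> zn; rewrite /W lf_sum kappa_coord // scaler_suml; apply: eq_bigr => a _.
by rewrite lfZ contract0_P scalerA.
Qed.

Lemma contract_W k p s y z (f : T k.+1) : y \in part p -> z \in n1 -> z \in part s ->
  J k.+1 y (W k.+1 z f) = kappa y z *: f - sg s p *: W k z (J k y f).
Proof.
move=> yp zn zs; rewrite /W lf_sum kappa_coord // scaler_suml scaler_sumr -sumrB.
apply: eq_bigr => a _; rewrite lfZ (contract_P _ _ yp) scalerBr !scalerA.
have [->|ca] := eqVneq (coord (nf_basis fr) a z) 0; first by rewrite !(mul0r, mulr0).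
by rewrite -(coord_par zn zs ca) mulrC [_ * sg _ _]mulrC.
Qed.

(** This holds on tensors, not merely modulo [R]; it is what puts the exterior relations into the
    right radical of [tform]. *)
Lemma contractC k p s y z (f : T k.+2) : y \in part p -> z \in part s ->
  J k y (J k.+1 z f) + sg p s *: J k z (J k.+1 y f) = 0.
Proof.
move=> yp zs; have kp := kappa_par kf.
have ky a : kappa y (xi a) != 0 -> par a = p by move=> /(kp _ _ _ _ yp (gf_hom gf a)).
have kz a : kappa z (xi a) != 0 -> par a = s by move=> /(kp _ _ _ _ zs (gf_hom gf a)).
have Ez a : sg p s * sg (par a) p * kappa z (xi a) = kappa z (xi a).
  have [->|/kz ->] := eqVneq (kappa z (xi a)) 0; rewrite ?mulr0 // [s && p]andbC.
  by rewrite -signr_addb addbb mul1r.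
have Ey a : sg (par a) s * kappa y (xi a) = sg p s * kappa y (xi a).
  by have [->|/ky ->] := eqVneq (kappa y (xi a)) 0; rewrite ?mulr0.
elim: k f => [|k IH] f; move: f; apply: tensor_slot_ind => [|f h IHf IHh|a f].
- by rewrite !lf0 scaler0 addr0.
- by rewrite !lfD scalerDr addrACA IHf IHh addr0.
- rewrite (contract_P _ _ yp) (contract_P _ _ zs) !(lfB, lfZ) !contract0_P !scalerBr !scalerA.
  by rewrite Ez Ey; atoms; lincomb.
- by rewrite !lf0 scaler0 addr0.
- by rewrite !lfD scalerDr addrACA IHf IHh addr0.
- rewrite (contract_P _ _ yp) (contract_P _ _ zs) !(lfB, lfZ) (contract_P _ _ yp) (contract_P _ _ zs).
  rewrite !scalerBr !scalerA Ez Ey.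
  have := congr1 (fun h => (sg (par a) s * sg (par a) p) *: P k a h) (IH f).
  rewrite lfD lfZ lf0 scaler0 scalerDr scalerA => E; rewrite -[RHS]E; atoms; lincomb.
Qed.

Section SuperderivationContract.
Variable L : forall k, g -> 'End(T k).
Hypothesis sdL : superderivation L.

(** Invariance of [kappa] gives the commutator of an action with a contraction. [z] has to lie in
    [m1], because only then does [kappa z] not notice the projection to [n1]. *)
Lemma superder_contract k p s x z (f : T k.+1) : x \in part p -> z \in part s -> z \in m1 ->
  L k x (J k z f) = J k (bracket x z) f + sg p s *: J k z (L k.+1 x f).
Proof.
move=> xp zs zm.
have xz : bracket x z \in part (p (+) s) by apply: lsa_br_part.
have kz a : kappa z (xi a) != 0 -> par a = s by move=> /(kappa_par kf zs (gf_hom gf a)).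
have Ez a : sg p s * sg (par a) p * kappa z (xi a) = kappa z (xi a).
  have [->|/kz ->] := eqVneq (kappa z (xi a)) 0; rewrite ?mulr0 // [s && p]andbC.
  by rewrite -signr_addb addbb mul1r.
have Exz a : kappa (bracket x z) (xi a) = - (sg p s * kappa z (bracket x (xi a))).
  by rewrite [bracket x z](lsa_br_skew xp zs) (kappaNl kf) (kappaZl kf) (kappa_inv kf).
have hx a : pr (bracket x (xi a)) \in part (p (+) par a).
  by apply/proj_par/lsa_br_part => //; apply: gf_hom gf a.
elim: k f => [|k IH]; apply: tensor_slot_ind => [|f h IHf IHh|a f].
- by rewrite !lf0 scaler0 addr0.
- by rewrite !lfD IHf IHh scalerDr addrACA.
- rewrite !contract0_P (sd_P sdL _ _ xp) lfD contract0_W ?(gf_proj gf) //.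
  rewrite kappa_proj // Exz !lfZ contract0_P scalerDr !scalerA Ez.
  by clear; move: p s => [] []; signs; atoms; lincomb.
- by rewrite !lf0 scaler0 addr0.
- by rewrite !lfD IHf IHh scalerDr addrACA.
- rewrite (contract_P _ _ zs) (contract_P _ _ xz) (sd_P sdL _ _ xp) !(lfB, lfD, lfZ).
  rewrite (sd_P sdL _ _ xp) (contract_W _ zs (gf_proj gf _) (hx a)).
  rewrite (contract_P _ _ zs) kappa_proj // Exz IH lfD !lfZ !(scalerDr, scalerN, scalerA).
  rewrite Ez.
  clear; move: (kappa _ _) (kappa _ _) => c1 c2.
  by move: p s (par a) => [] [] []; signs; atoms; lincomb.
Qed.
End SuperderivationContract.

Lemma ext_rel_contract k p y f : y \in part p -> f \in R k.+1 -> J k y f \in R k.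
Proof.
move=> yp; elim: k f => [|k IH] f; first by rewrite ext_rel1 memv0 => /eqP->; rewrite lf0 mem0v.
have ky a : kappa y (xi a) != 0 -> par a = p by move=> /(kappa_par kf yp (gf_hom gf a)).
apply: ext_rel_map => [a h hR|a b h].
  by rewrite (contract_P _ _ yp) memvD ?memvN ?memvZ // ext_rel_P // IH.
rewrite !(contract_P _ _ yp).
have Ea : sg (par a) p *: (kappa y (xi b) *: P k a h) = sg (par a) (par b) *: (kappa y (xi b) *: P k a h).
  by have [->|/ky ->] := eqVneq (kappa y (xi b)) 0; rewrite ?scale0r ?scaler0.
have Eb : sg (par b) p *: (kappa y (xi a) *: P k b h) = sg (par b) (par a) *: (kappa y (xi a) *: P k b h).
  by have [->|/ky ->] := eqVneq (kappa y (xi a)) 0; rewrite ?scale0r ?scaler0.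
case: k f h IH Ea Eb => [|k] f h IH Ea Eb.
  rewrite !contract0_P !lfZ Ea scalerBr Eb; set u := (X in X \in _); have -> : u = 0; last exact: mem0v.
  by rewrite /u; clear; move: (par a) (par b) => [] []; signs; atoms; lincomb.
rewrite !(contract_P _ _ yp) !(lfB, lfZ) !scalerBr Ea Eb.
have Rab := ext_rel_PP a b (J k y h).
set u := (X in X \in _).
have -> : u = (sg (par a) p * sg (par b) p) *: (P k.+1 a (P k b (J k y h)) + sg (par a) (par b) *: P k.+1 b (P k a (J k y h))).
  by rewrite /u; clear; move: p (par a) (par b) => [] [] []; signs; atoms; lincomb.
exact: memvZ.
Qed.

Lemma sgK p s : sg p s * sg p s = 1 :> F.
Proof. by rewrite -signr_addb addbb. Qed.

(** Euler's identity for the degree operator: in the induction the new factor [P a] is exchanged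
    with the first factor [P b], at the price of a relation. *)
Lemma euler k (f : T k.+1) : \sum_a P k a (J k (xidd a) f) - k.+1%:R *: f \in R k.+1.
Proof.
elim: k f => [|k IH]; apply: tensor_slot_ind => [|f h IHf IHh|b f].
- by rewrite big1 ?scaler0 ?subr0 ?mem0v // => a _; rewrite !lf0.
- under eq_bigr do rewrite !lfD.
  by rewrite big_split scalerDr opprD addrACA memvD.
- rewrite scale1r; under eq_bigr do rewrite contract0_P lfZ (gf_dual gf).
  rewrite (bigD1 b) //= big1 ?addr0 ?eqxx ?scale1r ?subrr ?mem0v // => a /negbTE->.
  by rewrite scale0r.
- by rewrite big1 ?scaler0 ?subr0 ?mem0v // => a _; rewrite !lf0.
- under eq_bigr do rewrite !lfD.
  by rewrite big_split scalerDr opprD addrACA memvD.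
under eq_bigr do rewrite (contract_P _ _ (gf_dd_hom gf _)) lfB !lfZ (gf_dual gf).
rewrite sumrB [X in X - _ - _](_ : _ = P k.+1 b f); last first.
  by rewrite (bigD1 b) //= big1 ?addr0 ?eqxx ?scale1r // => a /negbTE->; rewrite scale0r.
have E : P k.+1 b (\sum_a P k a (J k (xidd a) f) - k.+1%:R *: f) \in R k.+2 by apply: ext_rel_P.
rewrite lfB lfZ lf_sum in E.
have E2 : \sum_a (P k.+1 b (P k a (J k (xidd a) f)) + sg (par b) (par a) *: P k.+1 a (P k b (J k (xidd a) f))) \in R k.+2.
  by apply: memv_suml => a _; apply: ext_rel_PP.
rewrite big_split in E2; set S1 := \sum_a P _ _ _ in E E2; set S2 := \sum_a _ in E2.
rewrite [X in _ - X - _](_ : _ = S2); last by apply: eq_bigr => a _; rewrite andbC.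
have -> : k.+2%:R = k.+1%:R + 1 :> F by rewrite -natr1.
rewrite scalerDl scale1r.
have -> : P k.+1 b f - S2 - (k.+1%:R *: P k.+1 b f + P k.+1 b f) = S1 - k.+1%:R *: P k.+1 b f - (S1 + S2).
  by lincomb.
by rewrite memvD ?memvN.
Qed.

(** Divide Euler's identity by the degree, which is invertible in characteristic zero. Identities
    modulo [R] are reduced to the preceding degree in this way. *)
Lemma ext_rel_contractP k (f : T k.+1) : (forall a, J k (xidd a) f \in R k) -> f \in R k.+1.
Proof.
move=> Jf; have E := euler f.
have S : \sum_a P k a (J k (xidd a) f) \in R k.+1 by apply: memv_suml => a _; apply: ext_rel_P.
have : k.+1%:R *: f \in R k.+1.
  by rewrite -[_ *: f](subKr (\sum_a P k a (J k (xidd a) f))) memvD ?memvN.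
by move/(memvZ (k.+1%:R)^-1); rewrite scalerA mulVf ?scale1r // pnatr_eq0.
Qed.

Section Coboundary.
Variables (L0 : forall k, g -> 'End(T k)).
Hypothesis sdL0 : superderivation L0.
Hypothesis L00 : forall x f, L0 0 x f = 0.

(* The action of [y] on [n = g / q] is dual to its adjoint action on [m1]. *)
Lemma sum_wedge_dual k p y (h : T k) : y \in m1 -> y \in part p ->
  forall b, \sum_a kappa (bracket (xidd a) y) (xi b) *: P k a h = W k (pr (bracket y (xi b))) h.
Proof.
move=> ym yp b; rewrite /W; apply: eq_bigr => a _; congr (_ *: _).
by rewrite -coord_kappa ?(gf_proj gf) // kappa_proj ?(gf_dd_m gf) // (kappa_inv kf).
Qed.

(** The coadjoint expression obeys the Leibniz rule modulo [R], and in degree one it is the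
    projected bracket by [sum_wedge_dual]. *)
Lemma coadjoint_superder k p y (f : T k.+1) : y \in m1 -> y \in part p ->
  \sum_a P k a (J k (bracket (xidd a) y) f) - L0 k.+1 y f \in R k.+1.
Proof.
move=> ym yp; have ayp a : bracket (xidd a) y \in part (par a (+) p).
  by apply: lsa_br_part => //; apply: gf_dd_hom gf a.
elim: k f => [|k IH]; apply: tensor_slot_ind => [|f h IHf IHh|b f].
- by rewrite lf0 big1 ?subr0 ?mem0v // => a _; rewrite !lf0.
- under eq_bigr do rewrite !lfD.
  by rewrite big_split lfD opprD addrACA memvD.
- under eq_bigr do rewrite contract0_P lfZ.
  rewrite (sum_wedge_dual _ ym yp) (sd_P sdL0 _ _ yp) L00 lf0 scaler0 addr0 subrr mem0v //.
- by rewrite lf0 big1 ?subr0 ?mem0v // => a _; rewrite !lf0.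
- under eq_bigr do rewrite !lfD.
  by rewrite big_split lfD opprD addrACA memvD.
under eq_bigr do rewrite (contract_P _ _ (ayp _)) lfB !lfZ.
rewrite sumrB (sum_wedge_dual _ ym yp) (sd_P sdL0 _ _ yp).
have E : sg (par b) p *: P k.+1 b (\sum_a P k a (J k (bracket (xidd a) y) f) - L0 k.+1 y f) \in R k.+2.
  by apply/memvZ/ext_rel_P.
rewrite lfB lf_sum scalerBr scaler_sumr in E.
have E2 : \sum_a (sg (par b) p *: (P k.+1 b (P k a (J k (bracket (xidd a) y) f)) + sg (par b) (par a) *: P k.+1 a (P k b (J k (bracket (xidd a) y) f)))) \in R k.+2.
  by apply: memv_suml => a _; apply/memvZ/ext_rel_PP.
rewrite (eq_bigr _ (fun a _ => scalerDr _ _ _)) big_split in E2; set S1 := \sum_a _ in E E2; set S2 := \sum_a _ in E2.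
rewrite [X in _ - X - _](_ : _ = S2); last first.
  apply: eq_bigr => a _; rewrite scalerA; congr (_ *: _).
  by clear; move: p (par a) (par b) => [] [] []; signs; ring.
set X1 := W _ _ _; set X2 := sg _ _ *: _ in E *.
have -> : X1 - S2 - (X1 + X2) = S1 - X2 - (S1 + S2) by lincomb.
by rewrite memvD ?memvN.
Qed.

Variable L : forall k, g -> 'End(T k).
Hypothesis sdL : superderivation L.
Hypothesis L_rep0 : forall (p q : bool) x y f, x \in part p -> y \in part q ->
  L 0 (bracket x y) f = L 0 x (L 0 y f) - sg p q *: L 0 y (L 0 x f).
Variables A dd : forall k, 'Hom(T k, T k.+1).
Hypothesis A0 : forall f, A 0 f = \sum_a P 0 a (L 0 (xidd a) f).
Hypothesis A_P : forall k a f, A k.+1 (P k a f) = P k.+1 a (A k f).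
Hypothesis ddE : forall k f, dd k f =
  2%:R^-1 *: (\sum_a P k a (L0 k (xidd a) f)) + (-1) ^+ k *: A k f.

Lemma sd_span (L1 : forall k, g -> 'End(T k)) k y (f : T k) : superderivation L1 -> y \in m1 ->
  \sum_a kappa y (xi a) *: L1 k (xidd a) f = L1 k y f.
Proof.
move=> sdL1 ym; rewrite [in RHS](gf_dd_span gf ym) (sd_sum sdL1).
by apply: eq_bigr => a _; rewrite (sdZ sdL1).
Qed.

Lemma contract_A0 y (f : T 0) : y \in m1 -> J 0 y (A 0 f) = L 0 y f.
Proof.
by move=> ym; rewrite A0 lf_sum -sd_span //; apply: eq_bigr => a _; rewrite contract0_P.
Qed.

(** [L - L0] is the action on the coefficients alone, with the sign of carrying [y] past the tensor
    factors. Contracting the appended factor, which stands last, produces it with the sign of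
    passing [k.+1] factors. *)
Lemma contract_A k p y (f : T k.+1) : y \in m1 -> y \in part p ->
  J k.+1 y (A k.+1 f) = A k (J k y f) + (-1) ^+ k.+1 *: (L k.+1 y f - L0 k.+1 y f).
Proof.
move=> ym yp; elim: k f => [|k IH]; apply: tensor_slot_ind => [|f h IHf IHh|a f].
- by rewrite !lf0 subr0 scaler0 addr0.
- by rewrite !lfD IHf IHh; atoms; lincomb.
- rewrite A_P (contract_P _ _ yp) contract_A0 // contract0_P lfZ expr1.
  by rewrite (sd_P sdL _ _ yp) (sd_P sdL0 _ _ yp) L00 lf0 scaler0 addr0; atoms; lincomb.
- by rewrite !lf0 subr0 scaler0 addr0.
- by rewrite !lfD IHf IHh; atoms; lincomb.
- rewrite A_P !(contract_P _ _ yp) lfB !lfZ A_P IH lfD lfZ lfB.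
  rewrite (sd_P sdL _ _ yp) (sd_P sdL0 _ _ yp) !exprS; atoms; lincomb.
Qed.

Lemma cartan0 y (f : T 0) : y \in m1 -> J 0 y (dd 0 f) = L 0 y f.
Proof.
move=> ym; rewrite ddE big1 ?scaler0 ?add0r ?expr0 ?scale1r ?contract_A0 // => a _.
by rewrite L00 lf0.
Qed.

(* Cartan's formula for the coboundary holds modulo the relations only. *)
Lemma cartan k p y (f : T k.+1) : y \in m1 -> y \in part p ->
  J k.+1 y (dd k.+1 f) + dd k (J k y f) - L k.+1 y f \in R k.+1.
Proof.
move=> ym yp; rewrite !ddE lfD !lfZ (contract_A _ ym yp) lf_sum.
(* Contracting the new factor gives one copy of [L0 k.+1 y f], contracting inside gives the last
   sum, which agrees with it modulo [R] by [coadjoint_superder]. The factor 1/2 of the coboundary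
   accounts for this double occurrence. *)
have E1 : \sum_a J k.+1 y (P k.+1 a (L0 k.+1 (xidd a) f)) =
   L0 k.+1 y f - \sum_a P k a (L0 k (xidd a) (J k y f)) + \sum_a P k a (J k (bracket (xidd a) y) f).
  rewrite -(sd_span _ sdL0 ym) -sumrB -big_split; apply: eq_bigr => a _.
  rewrite (contract_P _ _ yp) (superder_contract sdL0 _ (gf_dd_hom gf a) yp ym) !(lfD, lfZ).
  by rewrite /=; atoms; lincomb.
have := coadjoint_superder f ym yp; rewrite E1; set M := \sum_a P k a (J k _ f) => H.
set Z := (X in X \in _).
have -> : Z = 2%:R^-1 *: (M - L0 k.+1 y f); last exact: memvZ.
have e2 : 2%:R^-1 + 2%:R^-1 - 1 = 0 :> F.
  by rewrite -mulr2n -[_ *+ 2]mulr_natl divff ?subrr // pnatr_eq0.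
rewrite /Z exprS -signr_odd; set S := \sum_a _; set B := A k _; clearbody S B M; clear -e2.
move: (2%:R^-1) e2 => e e2; apply/eqP; rewrite -subr_eq0; apply/eqP.
rewrite -[RHS](scale0r (L0 k.+1 y f)) -e2.
by case: (odd k); signs; atoms; lincomb.
Qed.

Lemma cartan_mem k a (f : T k.+1) :
  J k.+1 (xidd a) (dd k.+1 f) + dd k (J k (xidd a) f) - L k.+1 (xidd a) f \in R k.+1.
Proof. exact: cartan (gf_dd_m gf a) (gf_dd_hom gf a). Qed.

(** Contract: Cartan's formula expresses the contraction of [dd f] through the action, which
    preserves [R], and the coboundary in lower degree. *)
Lemma ext_rel_dd k f : f \in R k -> dd k f \in R k.+1.
Proof.
elim: k f => [|k IH] f fR; first by move: fR; rewrite ext_rel0 memv0 => /eqP->; rewrite lf0 mem0v.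
apply: ext_rel_contractP => a.
have -> : J k.+1 (xidd a) (dd k.+1 f) =
    (J k.+1 (xidd a) (dd k.+1 f) + dd k (J k (xidd a) f) - L k.+1 (xidd a) f)
    + L k.+1 (xidd a) f - dd k (J k (xidd a) f) by atoms; lincomb.
apply: memvD; [apply: memvD|]; first exact: cartan_mem.
  exact: ext_rel_sd sdL _ _ _ _ (gf_dd_hom gf a) fR.
by rewrite memvN IH // (ext_rel_contract (gf_dd_hom gf a)).
Qed.

Lemma rep_q k p s x y (f : T k) : x \in part p -> y \in part s -> x \in q -> y \in q ->
  L k (bracket x y) f = L k x (L k y f) - sg p s *: L k y (L k x f).
Proof.
have Q z b : z \in q -> b - pr b \in q -> pr (bracket z (pr b)) = pr (bracket z b).
  move=> zq bq; apply/eqP; rewrite -subr_eq0 -lfB -oppr_eq0 -lfN opprB -bracketNr -bracketDr.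
  by rewrite (gf_proj_q gf) // (gf_br_qq gf).
by move=> xp ys xq yq; apply: (sd_rep sdL) => // a; apply: Q => //; apply: gf_dec gf _.
Qed.

(** Contract with [xidd a] and use Cartan's formula for [xidd a] and for [bracket x (xidd a)], which
    stays in [m1] since [x] lies in [q]. What remains is the same assertion for the contraction of
    [f]. *)
Lemma dd_L k p x (f : T k) : x \in part p -> x \in q -> L k.+1 x (dd k f) - dd k (L k x f) \in R k.+1.
Proof.
move=> xp xq; elim: k f => [|k IH] f; apply: ext_rel_contractP => a.
  have aq : xidd a \in q by apply: (subvP (gf_sub_m gf)); exact: gf_dd_m gf a.
  have am := gf_dd_m gf a; have xam : bracket x (xidd a) \in m1 by exact: (gf_br_qm gf xq am).
  have := superder_contract sdL (dd 0 f) xp (gf_dd_hom gf a) am.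
  rewrite !cartan0 // (rep_q _ xp (gf_dd_hom gf a)) // lfB => E.
  rewrite cartan0 //; set u := J _ _ _ in E *; set v := L 0 _ (L 0 x f) in E *.
  have {}E : sg p (par a) *: (u - v) = 0.
    transitivity (L 0 x (L 0 (xidd a) f) - sg p (par a) *: v + sg p (par a) *: u - L 0 x (L 0 (xidd a) f)).
      by clearbody u v; atoms; lincomb.
    by rewrite -E subrr.
  have -> : u - v = sg p (par a) *: (sg p (par a) *: (u - v)) by rewrite scalerA sgK scale1r.
  by rewrite E scaler0 mem0v.
have aq : xidd a \in q by apply: (subvP (gf_sub_m gf)); exact: gf_dd_m gf a.
have am := gf_dd_m gf a; have xam : bracket x (xidd a) \in m1 by exact: (gf_br_qm gf xq am).
have xap : bracket x (xidd a) \in part (p (+) par a) by apply: lsa_br_part => //; apply: gf_dd_hom gf a.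
have S j h := superder_contract (k := j) sdL h xp (gf_dd_hom gf a) am.
have S' j h : J j (xidd a) (L j.+1 x h) = sg p (par a) *: (L j x (J j (xidd a) h) - J j (bracket x (xidd a)) h).
  by rewrite S addrAC subrr add0r scalerA sgK scale1r.
have C1 := cartan_mem a f; have C2 := cartan_mem a (L k.+1 x f); have C3 := cartan f xam xap.
rewrite (rep_q _ xp (gf_dd_hom gf a)) // in C3.
have C1' := ext_rel_sd sdL xp C1; rewrite lfB lfD in C1'.
have E := IH (J k (xidd a) f).
rewrite lfB S'; rewrite S' lfZ lfB in C2.
set Z := (X in X \in _).
match type of C1' with is_true (?c1 \in _) => match type of C2 with is_true (?c2 \in _) =>
match type of C3 with is_true (?c3 \in _) => match type of E with is_true (?e \in _) =>
 have -> : Z = sg p (par a) *: c1 - c2 - sg p (par a) *: e - sg p (par a) *: c3 end end end end.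
  rewrite /Z; clear; have := sgK p (par a); move: (sg p (par a)) => c cc; atoms.
  apply: crd_inj => i; rewrite ?(crdD, crdN, crdZ, crd0).
  set w := crd i _; rewrite !(mulrDr, mulrN, mulrA) cc; ring.
by inspace.
Qed.

(** Two uses of Cartan's formula turn the contraction of [dd (dd f)] into the commutator of the
    action of [xidd a] with [dd], which [dd_L] controls as [xidd a] lies in [q], plus [dd (dd _)] of
    the contraction of [f]. *)
Lemma dd_dd k (f : T k) : dd k.+1 (dd k f) \in R k.+2.
Proof.
elim: k f => [|k IH] f; apply: ext_rel_contractP => a;
  have aq : xidd a \in q by apply: (subvP (gf_sub_m gf)); exact: gf_dd_m gf a.
  have C := cartan_mem a (dd 0 f); have E := dd_L f (gf_dd_hom gf a) aq.
  rewrite (cartan0 _ (gf_dd_m gf a)) in C.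
  by rewrite -[J _ _ _](subrK (L 1 (xidd a) (dd 0 f) - dd 0 (L 0 (xidd a) f))) memvD //
    opprB addrA.
have C := cartan_mem a (dd k.+1 f); have E := dd_L f (gf_dd_hom gf a) aq.
have C' := ext_rel_dd (cartan_mem a f); rewrite lfB lfD in C'.
have {}IH := IH (J k (xidd a) f).
set Z := J _ _ _.
match type of C with is_true (?c1 \in _) => match type of C' with is_true (?c2 \in _) =>
match type of IH with is_true (?c3 \in _) => match type of E with is_true (?e \in _) =>
 have -> : Z = c1 - c2 + c3 + e end end end end.
  by rewrite /Z; clear; atoms; lincomb.
by inspace.
Qed.

Section Parity.
Variable eps : forall k, 'End(T k).
Hypothesis eps_P : forall k a f, eps k.+1 (P k a f) = (-1) ^+ (par a) *: P k a (eps k f).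
Hypothesis eps_L0 : forall p x f, x \in part p -> eps 0 (L 0 x f) = (-1) ^+ p *: L 0 x (eps 0 f).

Lemma eps_W k z s (f : T k) : z \in n1 -> z \in part s -> eps k.+1 (W k z f) = (-1) ^+ s *: W k z (eps k f).
Proof.
move=> zn zs; rewrite /W lf_sum scaler_sumr; apply: eq_bigr => a _; rewrite lfZ eps_P.
have [->|ca] := eqVneq (coord (nf_basis fr) a z) 0; first by rewrite !scale0r scaler0.
by rewrite (coord_par zn zs ca) !scalerA mulrC.
Qed.

Lemma eps_L k p x f : x \in part p -> eps k (L k x f) = (-1) ^+ p *: L k x (eps k f).
Proof.
move=> xp; elim: k f => [|k IH] f; first exact: eps_L0.
move: f; apply: tensor_slot_ind => [|f h IHf IHh|a f]; first by rewrite !lf0 scaler0.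
  by rewrite !lfD IHf IHh scalerDr.
have hx : pr (bracket x (xi a)) \in part (p (+) par a).
  by apply/proj_par/lsa_br_part => //; apply: gf_hom gf a.
rewrite (sd_P sdL _ _ xp) eps_P lfD lfZ (eps_W _ (gf_proj gf _) hx) eps_P IH (lfZ (L _ _)) (sd_P sdL _ _ xp).
by rewrite lfZ; clear; move: p (par a) => [] []; signs; atoms; lincomb.
Qed.

Lemma eps_J k p y f : y \in part p -> eps k (J k y f) = (-1) ^+ p *: J k y (eps k.+1 f).
Proof.
move=> yp; have ky a : kappa y (xi a) != 0 -> par a = p by move=> /(kappa_par kf yp (gf_hom gf a)).
have Ek a : (-1) ^+ p * (-1) ^+ (par a) * kappa y (xi a) = kappa y (xi a).
  by have [->|/ky ->] := eqVneq (kappa y (xi a)) 0; rewrite ?mulr0 // -signr_addb addbb mul1r.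
elim: k f => [|k IH]; apply: tensor_slot_ind => [|f h IHf IHh|a f].
- by rewrite !lf0 scaler0.
- by rewrite !lfD IHf IHh scalerDr.
- by rewrite eps_P lfZ !contract0_P lfZ !scalerA Ek.
- by rewrite !lf0 scaler0.
- by rewrite !lfD IHf IHh scalerDr.
rewrite eps_P lfZ !(contract_P _ _ yp) lfB !lfZ eps_P IH lfZ !scalerBr !scalerA Ek.
by clear; move: p (par a) => [] []; signs; atoms; lincomb.
Qed.

Lemma ext_rel_eps k f : f \in R k -> eps k f \in R k.
Proof.
elim: k f => [|[|k] IH] f.
- by rewrite ext_rel0 memv0 => /eqP->; rewrite lf0 mem0v.
- by rewrite ext_rel1 memv0 => /eqP->; rewrite lf0 mem0v.
move: f; apply: ext_rel_map => [a h hR|a b h].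
  by rewrite eps_P memvZ // ext_rel_P // IH.
rewrite !eps_P !lfZ; have Rab := ext_rel_PP a b (eps k h).
set u := (X in X \in _).
have -> : u = ((-1) ^+ (par a) * (-1) ^+ (par b)) *: (P k.+1 a (P k b (eps k h)) + sg (par a) (par b) *: P k.+1 b (P k a (eps k h))).
  by rewrite /u; clear; move: (par a) (par b) => [] []; signs; atoms; lincomb.
exact: memvZ.
Qed.

Lemma eps_dd k f : eps k.+1 (dd k f) - dd k (eps k f) \in R k.+1.
Proof.
elim: k f => [|k IH] f; apply: ext_rel_contractP => a; have aP := gf_dd_hom gf a.
  have E h : J 0 (xidd a) (eps 1 h) = (-1) ^+ (par a) *: eps 0 (J 0 (xidd a) h).
    by rewrite (eps_J _ aP) scalerA -signr_addb addbb scale1r.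
  by rewrite lfB E !cartan0 ?(gf_dd_m gf) // (eps_L _ aP) scalerA -signr_addb addbb scale1r subrr mem0v.
have E j h : J j (xidd a) (eps j.+1 h) = (-1) ^+ (par a) *: eps j (J j (xidd a) h).
  by rewrite (eps_J _ aP) scalerA -signr_addb addbb scale1r.
have C1 := ext_rel_eps (cartan_mem a f); have C2 := cartan_mem a (eps k.+1 f).
rewrite lfB lfD (eps_L _ aP) in C1; rewrite E lfZ in C2.
have {}IH := IH (J k (xidd a) f).
rewrite lfB E; set Z := (X in X \in _).
match type of C1 with is_true (?c1 \in _) => match type of C2 with is_true (?c2 \in _) =>
match type of IH with is_true (?e \in _) =>
 have -> : Z = (-1) ^+ (par a) *: c1 - c2 - (-1) ^+ (par a) *: e end end end.
  by rewrite /Z; clear; move: (par a) => []; signs; atoms; lincomb.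
by inspace.
Qed.

Lemma eps_D (D : forall k, 'Hom(T k.+1, T k)) :
  (forall a (f : T 0), D 0 (P 0 a f) = - L 0 (xi a) f) ->
  (forall k a (f : T k.+1), D k.+1 (P k.+1 a f) = - L k.+1 (xi a) f - P k a (D k f)) ->
  forall k f, eps k (D k f) = D k (eps k.+1 f).
Proof.
move=> D0_P D_P; elim=> [|k IH]; apply: tensor_slot_ind => [|f h IHf IHh|a f].
- by rewrite !lf0.
- by rewrite !lfD IHf IHh.
- by rewrite eps_P lfZ !D0_P lfN (eps_L _ (gf_hom gf a)) scalerN.
- by rewrite !lf0.
- by rewrite !lfD IHf IHh.
by rewrite eps_P lfZ !D_P lfB lfN (eps_L _ (gf_hom gf a)) eps_P IH; atoms; lincomb.
Qed.
End Parity.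

Section Form.
Variable D : forall k, 'Hom(T k.+1, T k).
Hypothesis D0_P : forall a (f : T 0), D 0 (P 0 a f) = - L 0 (xi a) f.
Hypothesis D_P : forall k a (f : T k.+1), D k.+1 (P k.+1 a f) = - L k.+1 (xi a) f - P k a (D k f).
(* [s] is the inverse of an anti-automorphism of [g] mapping [m1] onto [n1]. *)
Variables (s : 'End(g)) (B : T 0 -> T 0 -> F).
Hypothesis s_m : forall c, c \in n1 -> s c \in m1.
Hypothesis s_par : forall p c, c \in part p -> s c \in part p.
Hypothesis s_br : forall c a, c \in n1 -> a \in n1 -> s (bracket c a) = bracket (s a) (s c).
Hypothesis s_onto : forall y, y \in m1 -> exists2 c, c \in n1 & y = s c.
Hypothesis B_linl : forall h, linear (B^~ h : T 0 -> F^o).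
Hypothesis B_linr : forall f, linear (B f : T 0 -> F^o).
Hypothesis B_adj : forall c f h, c \in n1 -> B (L 0 (s c) f) h = B f (L 0 c h).
Hypothesis B_nondeg : forall f, (forall h, B f h = 0) -> f = 0.

(** Expansion along the first factor of the second argument, which [s] carries to [m1] so that it
    can be contracted with the first argument. It descends to chains, where it is the contravariant
    form that makes boundary and coboundary adjoint. *)
Fixpoint tform k : T k -> T k -> F :=
  match k return T k -> T k -> F with
  | 0 => B
  | k'.+1 => fun f h => \sum_a @tform k' (contract k' (s (xi a)) f) (sl k' a h)
  end.
Arguments tform k : clear implicits.

Lemma tform_linl k h : linear (tform k ^~ h : T k -> F^o).
Proof.
elim: k h => [|k IH] h c f f'; first exact: B_linl.
rewrite /= scaler_sumr -big_split; apply: eq_bigr => a _.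
by rewrite lfD lfZ; exact: IH.
Qed.

Lemma tform_linr k f : linear (tform k f : T k -> F^o).
Proof.
elim: k f => [|k IH] f c h h'; first exact: B_linr.
by rewrite /= scaler_sumr -big_split; apply: eq_bigr => a _; rewrite lfD lfZ; exact: IH.
Qed.

Lemma tform0l k h : tform k 0 h = 0.
Proof. by have := tform_linl h (-1) 0 0; rewrite scaler0 addr0 scaleN1r addNr. Qed.
Lemma tformDl k f f' h : tform k (f + f') h = tform k f h + tform k f' h.
Proof. by have := tform_linl h 1 f f'; rewrite !scale1r. Qed.
Lemma tformZl k c f h : tform k (c *: f) h = c * tform k f h.
Proof. by have := tform_linl h c f 0; rewrite tform0l !addr0. Qed.
Lemma tformBl k f f' h : tform k (f - f') h = tform k f h - tform k f' h.
Proof. by rewrite tformDl -scaleN1r tformZl mulN1r. Qed.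
Lemma tform0r k f : tform k f 0 = 0.
Proof. by have := tform_linr f (-1) 0 0; rewrite scaler0 addr0 scaleN1r addNr. Qed.
Lemma tformDr k f h h' : tform k f (h + h') = tform k f h + tform k f h'.
Proof. by have := tform_linr f 1 h h'; rewrite !scale1r. Qed.
Lemma tformZr k c f h : tform k f (c *: h) = c * tform k f h.
Proof. by have := tform_linr f c h 0; rewrite tform0r !addr0. Qed.
Lemma tformNr k f h : tform k f (- h) = - tform k f h.
Proof. by rewrite -scaleN1r tformZr mulN1r. Qed.
Lemma tform_sumr k f I (r : seq I) (Q : pred I) (h : I -> T k) :
  tform k f (\sum_(i <- r | Q i) h i) = \sum_(i <- r | Q i) tform k f (h i).
Proof. by elim/big_rec2: _ => [|i y z _ <-]; rewrite ?tform0r ?tformDr. Qed.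
Lemma tform_suml k h I (r : seq I) (Q : pred I) (f : I -> T k) :
  tform k (\sum_(i <- r | Q i) f i) h = \sum_(i <- r | Q i) tform k (f i) h.
Proof. by elim/big_rec2: _ => [|i y z _ <-]; rewrite ?tform0l ?tformDl. Qed.

Lemma tform_P k f a h : tform k.+1 f (P k a h) = tform k (J k (s (xi a)) f) h.
Proof.
rewrite /= (bigD1 a) //= big1 ?addr0 => [|b /negbTE E]; rewrite sl_P ?eqxx ?scale1r //.
by rewrite E scale0r tform0r.
Qed.

Lemma tform_W k f z h : z \in n1 -> tform k.+1 f (W k z h) = tform k (J k (s z) f) h.
Proof.
move=> zn; rewrite /W tform_sumr {2}(xi_coord zn) lf_sum contract_sum tform_suml.
by apply: eq_bigr => a _; rewrite tformZr tform_P lfZ contractZ tformZl.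
Qed.

Lemma tform_radl k f h : f \in R k -> tform k f h = 0.
Proof.
elim: k f h => [|k IH] f h fR; first by move: fR; rewrite ext_rel0 memv0 => /eqP->; rewrite tform0l.
rewrite /= big1 // => a _; apply: IH.
exact: ext_rel_contract (s_par (gf_hom gf a)) fR.
Qed.

Lemma tform_radr k f h : h \in R k -> tform k f h = 0.
Proof.
elim: k f h => [|[|k] IH] f h.
- by rewrite ext_rel0 memv0 => /eqP->; rewrite tform0r.
- by rewrite ext_rel1 memv0 => /eqP->; rewrite tform0r.
pose A1 := GRing.isLinear.Build F (T k.+2) F^o *:%R (tform k.+2 f) (tform_linr f).
pose phi : {linear T k.+2 -> F^o} := HB.pack (tform k.+2 f) A1.
suff H : (R k.+2 <= lker (linfun phi))%VS.
  by move=> hR; have := subvP H _ hR; rewrite memv_ker lfunE => /eqP.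
apply: ext_rel_sub => [a h' h'R|a b h']; rewrite memv_ker lfunE; apply/eqP; rewrite -[LHS]/(tform k.+2 f _).
  by rewrite tform_P IH.
rewrite tformDr tformZr !tform_P -tformZl -tformDl andbC.
rewrite contractC ?tform0l //; apply: s_par; exact: gf_hom gf _.
Qed.

(** As [s] maps [n1] onto [m1], the contractions with [s c] include those with every [xidd a]. By
    induction they all lie in [R], and then so does [f]. *)
Lemma tform_nondeg k f : (forall h, tform k f h = 0) -> f \in R k.
Proof.
elim: k f => [|k IH] f Hf; first by rewrite ext_rel0 memv0 [f]B_nondeg.
apply: ext_rel_contractP => a; apply: IH => h.
by have [c cn ->] := s_onto (gf_dd_m gf a); rewrite -tform_W.
Qed.

Lemma tform_L k c p f h : c \in n1 -> c \in part p -> tform k (L k (s c) f) h = tform k f (L k c h).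
Proof.
move=> cn cp; elim: k f h => [|k IH] f; first by move=> h; apply: B_adj.
apply: tensor_slot_ind => [|h h' IHf IHh|a h].
- by rewrite lf0 !tform0r.
- by rewrite lfD !tformDr IHf IHh.
have an := xi_n a; have aP := gf_hom gf a.
have can : bracket c (xi a) \in n1 by exact: (gf_br_nn gf cn an).
rewrite (sd_P sdL _ _ cp) (gf_proj_id gf) // tformDr tformZr tform_W // !tform_P -IH s_br //.
have := superder_contract sdL f (s_par cp) (s_par aP) (s_m an).
have scn := lsa_br_skew (s_par cp) (s_par aP).
rewrite -[lsa_br (s c) (s (xi a))]/(bracket (s c) (s (xi a))) -[lsa_br (s (xi a)) (s c)]/(bracket (s (xi a)) (s c)) in scn.
rewrite scn contractN contractZ => ->; rewrite tformDl -scaleNr !tformZl.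
clear; move: (tform _ _ _) (tform _ _ _) => u v.
by move: p (par a) => [] []; signs; ring.
Qed.

(** Cartan's formula for contraction with [s (xi a)] mirrors the recursion defining the boundary on
    [P k a h]. Its error term lies in [R], hence in the radical of the form. *)
Lemma tform_adj k f h : tform k.+1 (dd k f) h = - tform k f (D k h).
Proof.
elim: k f h => [|k IH] f; apply: tensor_slot_ind => [|h h' IHf IHh|a h].
- by rewrite lf0 !tform0r oppr0.
- by rewrite lfD !tformDr IHf IHh opprD.
- by rewrite tform_P cartan0 ?s_m ?xi_n // D0_P tformNr opprK (tform_L _ _ (xi_n a) (gf_hom gf a)).
- by rewrite lf0 !tform0r oppr0.
- by rewrite lfD !tformDr IHf IHh opprD.
have aP := gf_hom gf a; have sm := s_m (xi_n a); have C := cartan f sm (s_par aP).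
have := tform_radl h C; rewrite tformBl tformDl => /eqP; rewrite subr_eq0 => /eqP E.
rewrite D_P !tform_P tformDr !tformNr tform_P -(tform_L _ _ (xi_n a) aP) -E IH.
by ring.
Qed.
End Form.

End Coboundary.
End TensorModel.

(** * Tensor powers as finite functions satisfy the abstract model *)

Section Tensors.
Variables (F : numClosedFieldType) (g : lieSuperalgebra F).
Variables (fr : nil_frame g) (V : actspace g).
Local Notation d := (nf_dim fr).
Local Notation xi a := (tnth (nf_basis fr) a).
Local Notation xidd a := (@nf_dual F g fr a).
Local Notation par a := (xi_par a).
Local Notation T k := {ffun k.-tuple 'I_d -> V}.

Lemma pureD k (t : k.-tuple 'I_d) (v w : V) : pure t (v + w) = pure t v + pure t w.
Proof. by apply/ffunP=> s; rewrite !ffunE; case: eqP; rewrite ?addr0. Qed.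
Lemma pureZ k (t : k.-tuple 'I_d) c (v : V) : pure t (c *: v) = c *: pure t v.
Proof. by apply/ffunP=> s; rewrite !ffunE; case: eqP; rewrite ?scaler0. Qed.

Lemma pure_linear k (t : k.-tuple 'I_d) : linear (@pure _ _ fr V k t).
Proof. by move=> c u v; rewrite pureD pureZ. Qed.
HB.instance Definition _ k (t : k.-tuple 'I_d) :=
  GRing.isLinear.Build F V (T k) *:%R (@pure _ _ fr V k t) (pure_linear t).

Lemma prependE k a (f : T k) b (s : k.-tuple 'I_d) :
  prepend V k a f [tuple of b :: s] = if b == a then f s else 0.
Proof.
have lin : linear (fun f : T k => \sum_(t : k.-tuple 'I_d) pure [tuple of a :: t] (f t)).
  move=> c u v; rewrite scaler_sumr -big_split; apply: eq_bigr => r _.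
  by rewrite !ffunE pureD pureZ.
rewrite /prepend; pose A := GRing.isLinear.Build _ _ _ _ _ lin.
pose h : {linear _ -> _} := HB.pack (fun f : T k => \sum_(t : k.-tuple 'I_d) pure [tuple of a :: t] (f t)) A.
rewrite (lfunE h) /= sum_ffunE.
under eq_bigr do rewrite ffunE.
case: (b =P a) => [->|ab].
  rewrite (bigD1 s) //= eqxx big1 ?addr0 // => r rs.
  by case: ([tuple of a :: s] =P _) => // /(congr1 val) [] /val_inj E; rewrite E eqxx in rs.
by rewrite big1 // => r _; case: ([tuple of b :: s] =P _) => // /(congr1 val) [] E _; rewrite E in ab.
Qed.

Lemma sliceE k a (f : T k.+1) (t : k.-tuple 'I_d) : slice V k a f t = f [tuple of a :: t].
Proof.
have lin : linear (fun f : T k.+1 => [ffun t : k.-tuple 'I_d => f [tuple of a :: t]] : T k).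
  by move=> c u v; apply/ffunP=> s; rewrite !ffunE.
pose A := GRing.isLinear.Build _ _ _ _ _ lin.
pose h : {linear _ -> _} := HB.pack (fun f : T k.+1 => [ffun t : k.-tuple 'I_d => f [tuple of a :: t]] : T k) A.
by rewrite /slice (lfunE h) /= ffunE.
Qed.

Lemma slice_prepend k a b (f : T k) : slice V k a (prepend V k b f) = (a == b)%:R *: f.
Proof.
apply/ffunP=> t; rewrite sliceE prependE ffunE.
by case: (a =P b); rewrite ?scale1r ?scale0r.
Qed.

Lemma prepend_slice k (f : T k.+1) : f = \sum_a prepend V k a (slice V k a f).
Proof.
apply/ffunP=> t; case/tupleP: t => b s; rewrite sum_ffunE.
under eq_bigr do rewrite prependE sliceE.
by rewrite (bigD1 b) //= eqxx big1 ?addr0 // => a /negbTE; rewrite eq_sym => ->.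
Qed.

(* A map defined slot by slot is determined on [prepend a f]. *)
Lemma sum_slice_prepend k (W : vectType F) (G : 'I_d -> 'Hom(T k, W)) b f :
  (\sum_a (G a \o slice V k a)%VF) (prepend V k b f) = G b f.
Proof.
rewrite sum_lfunE (bigD1 b) //= big1 ?addr0; last first.
  by move=> a /negbTE E; rewrite comp_lfunE slice_prepend E scale0r linear0.
by rewrite comp_lfunE slice_prepend eqxx scale1r.
Qed.

Lemma lfun_prependP k (W : vectType F) (G H : 'Hom(T k.+1, W)) :
  (forall a f, G (prepend V k a f) = H (prepend V k a f)) -> G =1 H.
Proof.
by move=> GH f; rewrite [f]prepend_slice !linear_sum; apply: eq_bigr => a _; apply: GH.
Qed.

Lemma wedgeD k x y : wedge fr V k (x + y) = wedge fr V k x + wedge fr V k y.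
Proof. by rewrite /wedge -big_split; apply: eq_bigr => a _; rewrite linearD scalerDl. Qed.
Lemma wedgeZ k c x : wedge fr V k (c *: x) = c *: wedge fr V k x.
Proof. by rewrite /wedge scaler_sumr; apply: eq_bigr => a _; rewrite linearZ scalerA. Qed.
Lemma wedge_linear k : linear (wedge fr V k).
Proof. by move=> c x y; rewrite wedgeD wedgeZ. Qed.
HB.instance Definition _ k := GRing.isLinear.Build F g 'Hom(T k, T k.+1) *:%R (wedge fr V k) (wedge_linear k).

Lemma wedge_app k x f : wedge fr V k x f = \sum_a coord (nf_basis fr) a x *: prepend V k a f.
Proof. by rewrite /wedge sum_lfunE; apply: eq_bigr => a _; rewrite scale_lfunE. Qed.

Arguments superder : simpl never.
Section Superder.
Variable phi : g -> 'End(V).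
Hypothesis phi_lin : linear phi.

Lemma superder0E x (f : T 0) t : superder fr phi 0 x f t = phi x (f t).
Proof.
have lin : linear (fun f : T 0 => [ffun t => phi x (f t)] : T 0).
  by move=> c u v; apply/ffunP=> s; rewrite !ffunE linearP.
pose A := GRing.isLinear.Build _ _ _ _ _ lin.
pose h : {linear _ -> _} := HB.pack (fun f : T 0 => [ffun t => phi x (f t)] : T 0) A.
by rewrite /superder (lfunE h) /= ffunE.
Qed.

Lemma superder_prepend k x a (f : T k) :
  superder fr phi k.+1 x (prepend V k a f) =
  wedge fr V k (nf_proj fr (bracket x (xi a))) f
  + prepend V k a (superder fr phi k (parity_twist (par a) x) f).
Proof.
rewrite [superder _ _ _ _]/=; set S := (X in (X : 'End(_)) _).
have -> : S = \sum_a ((wedge fr V k (nf_proj fr (bracket x (xi a))) + (prepend V k a \o superder fr phi k (parity_twist (par a) x))) \o slice V k a)%VF.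
  by apply: eq_bigr => b _; rewrite comp_lfunDl.
by rewrite sum_slice_prepend add_lfunE comp_lfunE.
Qed.

Lemma superder_linear k : linear (superder fr phi k).
Proof.
elim: k => [|k IH] c x y; apply/lfunP=> f.
  by apply/ffunP=> t; rewrite add_lfunE scale_lfunE !ffunE !superder0E phi_lin add_lfunE scale_lfunE.
move: f; apply: lfun_prependP => a f.
rewrite add_lfunE scale_lfunE !superder_prepend bracket_linear_l.
rewrite [nf_proj _ _]linearP wedgeD wedgeZ [parity_twist _ _]linearP IH.
rewrite !(add_lfunE, scale_lfunE) [prepend _ _ _ _]linearP; lincomb.
Qed.
End Superder.

Arguments tbdry : simpl never.
Arguments tcobdry : simpl never.
Arguments ext_rel : simpl never.
Local Notation P k a := (prepend V k a).
Local Notation sg p q := ((-1) ^+ (p && q)).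
Local Notation R k := (ext_rel fr V k).
Local Notation D k := (tbdry fr V k).
Local Notation L k x := (superder fr (as_act V) k x).

Lemma tbdry0_P a (f : T 0) : D 0 (P 0 a f) = - L 0 (xi a) f.
Proof.
rewrite /tbdry (eq_bigr (fun a => (- L 0 (xi a) \o slice V 0 a)%VF)).
  by rewrite sum_slice_prepend opp_lfunE.
by move=> b _; rewrite comp_lfunNl.
Qed.

Lemma tbdry_P k a (f : T k.+1) : D k.+1 (P k.+1 a f) = - L k.+1 (xi a) f - P k a (D k f).
Proof.
rewrite [tbdry _ _ _]/(D k.+1) /tbdry -/(tbdry fr V k).
rewrite (eq_bigr (fun a => ((- L k.+1 (xi a) - (P k a \o D k)) \o slice V k.+1 a)%VF)).
  by rewrite sum_slice_prepend !add_lfunE !opp_lfunE comp_lfunE.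
by move=> b _; rewrite comp_lfunDl !comp_lfunNl.
Qed.

Lemma ext_rel0 : R 0 = 0%VS.
Proof. by []. Qed.

Lemma ext_rel1 : R 1 = 0%VS.
Proof.
rewrite /ext_rel addv0 big1 // => a _.
by apply/eqP; rewrite -subv0; apply/subvP=> _ /memv_imgP[h /[!memv0] /eqP-> ->]; rewrite lf0.
Qed.

Lemma ext_rel_P k a (f : T k) : f \in R k -> P k a f \in R k.+1.
Proof.
move=> fR; rewrite /ext_rel; apply: (subvP (addvSl _ _)).
by apply: (subvP (sumv_sup a _ (subvv _))) => //; apply: memv_img.
Qed.

Lemma ext_rel_PP k a b (f : T k) :
  P k.+1 a (P k b f) + sg (par a) (par b) *: P k.+1 b (P k a f) \in R k.+2.
Proof.
rewrite /ext_rel; apply: (subvP (addvSr _ _)).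
apply: (subvP (sumv_sup a _ (subvv _))) => //; apply: (subvP (sumv_sup b _ (subvv _))) => //.
apply/memv_imgP; exists f; first exact: memvf.
by rewrite add_lfunE scale_lfunE !comp_lfunE.
Qed.

Lemma ext_rel_sub k (U : {vspace T k.+2}) :
  (forall a f, f \in R k.+1 -> P k.+1 a f \in U) ->
  (forall a b f, P k.+1 a (P k b f) + sg (par a) (par b) *: P k.+1 b (P k a f) \in U) ->
  (R k.+2 <= U)%VS.
Proof.
move=> U1 U2; rewrite {1}/ext_rel -/(R k.+1) subv_add; apply/andP; split.
  by apply/subv_sumP=> a _; apply/subvP=> _ /memv_imgP[f fR ->]; apply: U1.
apply/subv_sumP=> a _; apply/subv_sumP=> b _; apply/subvP=> _ /memv_imgP[f _ ->].
by rewrite add_lfunE scale_lfunE !comp_lfunE; apply: U2.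
Qed.

Lemma append_lin k a (phi : 'End(V)) :
  linear (fun f : T k => \sum_(t : k.-tuple 'I_d) pure [tuple of rcons t a] (phi (f t))).
Proof.
move=> c u v; rewrite scaler_sumr -big_split; apply: eq_bigr => r _.
by rewrite !ffunE lfD lfZ pureD pureZ.
Qed.

Lemma appendE k a (phi : 'End(V)) (f : T k) : append k a phi f =
  \sum_(t : k.-tuple 'I_d) pure [tuple of rcons t a] (phi (f t)).
Proof.
pose A := GRing.isLinear.Build _ _ _ _ _ (append_lin (k := k) a phi).
pose h : {linear _ -> _} := HB.pack (fun f : T k => \sum_(t : k.-tuple 'I_d) pure [tuple of rcons t a] (phi (f t))) A.
by rewrite /append (lfunE h).
Qed.

Lemma prepend_pure k a (t : k.-tuple 'I_d) v : P k a (pure t v) = pure [tuple of a :: t] v.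
Proof.
apply/ffunP=> s; case/tupleP: s => b s; rewrite prependE !ffunE.
have [->|ab] := eqVneq b a; last by case: ([tuple of b :: s] =P _) => // /(congr1 val) [] /eqP; rewrite (negbTE ab).
have [->|st] := eqVneq s t; first by rewrite eqxx.
by case: ([tuple of a :: s] =P _) => // /(congr1 val) [] /val_inj E; rewrite E eqxx in st.
Qed.

Lemma tensor_pure k (f : T k) : f = \sum_t pure t (f t).
Proof.
apply/ffunP=> s; rewrite sum_ffunE (bigD1 s) //= big1 ?ffunE ?eqxx ?addr0 // => t ts.
by rewrite ffunE eq_sym (negbTE ts).
Qed.

Lemma append_P k a b (phi : 'End(V)) (f : T k) :
  append k.+1 a phi (P k b f) = P k.+1 b (append k a phi f).
Proof.
rewrite {1}(tensor_pure f) [in RHS]appendE !lf_sum; apply: eq_bigr => t _.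
rewrite prepend_pure appendE (bigD1 [tuple of b :: t]) //= big1 ?addr0 => [|s ts].
  rewrite ffunE eqxx prepend_pure; apply/ffunP=> s; rewrite !ffunE.
  congr (if _ then _ else _); rewrite -!val_eqE /=; congr (val s == _).
by rewrite ffunE (negbTE ts) lf0 [pure _ 0]raddf0.
Qed.

Lemma append_0 a (phi : g -> 'End(V)) x (f : T 0) : append 0 a (phi x) f = P 0 a (superder fr phi 0 x f).
Proof.
rewrite appendE [in RHS](tensor_pure (superder fr phi 0 x f)) lf_sum; apply: eq_bigr => t _.
rewrite prepend_pure superder0E; apply/ffunP=> s; rewrite !ffunE.
by congr (if _ then _ else _); rewrite -!val_eqE /= (tuple0 t).
Qed.

End Tensors.

Section Quotients.
Variable F : fieldType.

Lemma quot_pi_vsval (vT : vectType F) (U : {vspace vT}) (c : subvs_of U^C%VS) : quot_pi U (vsval c) = c.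
Proof.
by rewrite /quot_pi comp_lfunE lfunE /= daddv_pi_id ?subvsP ?vsvalK // capvC capv_compl.
Qed.

Lemma vsval_quot_pi (vT : vectType F) (U : {vspace vT}) x : vsval (quot_pi U x) - x \in U.
Proof.
rewrite /quot_pi comp_lfunE lfunE /= vsprojK ?memv_pi //.
have E := daddv_pi_add (U := U^C%VS) (V := U) (w := x).
rewrite capvC capv_compl addvC addv_complf memvf in E; rewrite -{2}(E erefl isT) opprD addrA subrr add0r.
by rewrite memvN memv_pi.
Qed.

Lemma quot_pi_eq0 (vT : vectType F) (U : {vspace vT}) x : (quot_pi U x == 0) = (x \in U).
Proof.
apply/eqP/idP=> [E|xU].
  by have := vsval_quot_pi U x; rewrite E linear0 sub0r memvN.
have := vsval_quot_pi U x; set c := quot_pi U x => cU.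
have cU' : vsval c \in U by rewrite -[vsval c](subrK x) memvD.
have : vsval c \in (U :&: U^C)%VS by rewrite memv_cap cU' subvsP.
by rewrite capv_compl memv0 => /eqP E; rewrite -[c]vsvalK E linear0.
Qed.

Lemma quot_pi_eq (vT : vectType F) (U : {vspace vT}) x y :
  x - y \in U -> quot_pi U x = quot_pi U y.
Proof. by rewrite -quot_pi_eq0 linearB subr_eq0 => /eqP. Qed.

Lemma quot_map_pi (vT wT : vectType F) (U : {vspace vT}) (W : {vspace wT}) (f : 'Hom(vT, wT)) x :
  (forall u, u \in U -> f u \in W) -> quot_map U W f (quot_pi U x) = quot_pi W (f x).
Proof.
move=> fUW; rewrite /quot_map 2!comp_lfunE; apply: quot_pi_eq.
by rewrite [linfun _ _]lfunE -lfB; apply/fUW/vsval_quot_pi.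
Qed.
End Quotients.

(** * Fitting decomposition, opposite differentials and adjoint ranks *)

Section Fitting.
Variables (F : fieldType) (C : vectType F) (h : 'End(C)).

Definition itn n : 'End(C) := iter n (fun f => h \o f)%VF \1%VF.

Lemma itn0 x : itn 0 x = x.
Proof. by rewrite /itn /= id_lfunE. Qed.
Lemma itnS n x : itn n.+1 x = h (itn n x).
Proof. by rewrite /itn /= comp_lfunE. Qed.
Lemma itnD m n x : itn (m + n) x = itn m (itn n x).
Proof. by elim: m => [|m IH]; rewrite ?itn0 // addSn !itnS IH. Qed.
Lemma itnSr n x : itn n.+1 x = itn n (h x).
Proof. by rewrite -addn1 itnD itnS itn0. Qed.

Local Notation N := (\dim {:C}).

Lemma itn_stable_step n : (lker (itn n.+1) <= lker (itn n))%VS ->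
  forall m, (lker (itn (m + n)) <= lker (itn n))%VS.
Proof.
move=> H; elim=> [|m IH] //; apply/subvP=> x; rewrite memv_ker addSn itnSr -memv_ker => hx.
have := subvP IH _ hx; rewrite memv_ker -itnSr -memv_ker; exact: (subvP H).
Qed.

Lemma itn_stable m x : itn (m + N) x = 0 -> itn N x = 0.
Proof.
have [/existsP[n Hn]|/existsPn H] := boolP [exists n : 'I_N.+1, (lker (itn n.+1) <= lker (itn n))%VS].
  have nN : (n <= N)%N by rewrite -ltnS.
  rewrite -[X in itn (m + X)](subnK nN) addnA => hx.
  have /(subvP (itn_stable_step Hn _)) : x \in lker (itn (m + (N - n) + n)) by rewrite memv_ker hx.
  by rewrite memv_ker => /eqP E; rewrite -(subnK nN) itnD E linear0.
suff /(_ N.+1 (leqnn _)) : forall n, (n <= N.+1)%N -> (n <= \dim (lker (itn n)))%N.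
  by rewrite leqNgt ltnS dimvS ?subvf.
elim=> // n IH nN; apply: leq_ltn_trans (IH (ltnW nN)) _.
rewrite (ltn_leqif (dimv_leqif_sup _)) ?(H (Ordinal nN)) //.
by apply/subvP=> y; rewrite !memv_ker itnS => /eqP->; rewrite linear0.
Qed.

Definition gker :  {vspace C} := lker (itn N).
Definition gimg : {vspace C} := limg (itn N).

Lemma gkerP x m : itn m x = 0 -> x \in gker.
Proof. by move=> E; rewrite memv_ker (itn_stable (m := m)) // addnC itnD E linear0. Qed.

Lemma gker_gimg : (gker :&: gimg = 0)%VS.
Proof.
apply/eqP; rewrite -subv0; apply/subvP=> x; rewrite memv_cap memv_ker memv0.
by case/andP=> /eqP hx /memv_imgP[y _ E]; rewrite E (itn_stable (m := N)) // itnD -E.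
Qed.

Lemma gker_add : (gker + gimg = fullv)%VS.
Proof.
apply/eqP; rewrite eqEdim subvf dimv_disjoint_sum ?gker_gimg //=.
by rewrite addnC -{1}(limg_ker_dim (itn N) fullv) capfv addnC.
Qed.

Lemma gimgP x m : x \in gimg -> exists2 y, y \in gimg & x = itn m y.
Proof.
move=> xI.
have st j : (forall y, y \in gimg -> itn j y \in gimg).
  by move=> y /memv_imgP[z _ ->]; rewrite -itnD addnC itnD; apply/memv_img/memvf.
suff : (gimg <= itn m @: gimg)%VS by move=> /subvP/(_ _ xI)/memv_imgP[y yI E]; exists y.
rewrite -(geq_leqif (dimv_leqif_sup _)); last by apply/subvP=> _ /memv_imgP[y yI ->]; apply: st.
rewrite limg_dim_eq //; apply/eqP; rewrite -subv0 -gker_gimg.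
apply/subvP=> y; rewrite !memv_cap memv_ker => /andP[-> /eqP E]; rewrite andbT; exact: gkerP E.
Qed.

Lemma gimg_inj x : x \in gimg -> h x = 0 -> x = 0.
Proof.
move=> xI hx; apply/eqP; rewrite -memv0 -gker_gimg memv_cap xI andbT.
by apply: (gkerP (m := 1)); rewrite itnS itn0.
Qed.

Definition gpr : 'End(C) := daddv_pi gker gimg.

Lemma gpr_ker x : gpr x \in gker. Proof. exact: memv_pi. Qed.
Lemma gpr_id x : x \in gker -> gpr x = x.
Proof. exact: (daddv_pi_id gker_gimg). Qed.
Lemma gpr_sub x : x - gpr x \in gimg.
Proof.
have E := daddv_pi_add (w := x) gker_gimg; rewrite gker_add memvf in E.
by rewrite -{1}(E isT) addrAC subrr add0r memv_pi.
Qed.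
Lemma gpr_img x : x \in gimg -> gpr x = 0.
Proof.
move=> xI; apply/eqP; rewrite -memv0 -gker_gimg memv_cap gpr_ker /=.
by rewrite -[gpr x](subKr x) memvD // memvN gpr_sub.
Qed.
End Fitting.

Section Intertwiners.
Variables (F : fieldType) (C C' : vectType F) (h : 'End(C)) (h' : 'End(C')) (f : 'Hom(C, C')).
Hypothesis fh : forall x, f (h x) = h' (f x).

Lemma itn_intertwine n x : f (itn h n x) = itn h' n (f x).
Proof. by elim: n => [|n IH]; rewrite ?itn0 // !itnS fh IH. Qed.

Lemma gker_intertwine x : x \in gker h -> f x \in gker h'.
Proof.
by rewrite memv_ker => /eqP E; apply: (gkerP (m := \dim {:C})); rewrite -itn_intertwine E linear0.
Qed.

Lemma gimg_intertwine x : x \in gimg h -> f x \in gimg h'.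
Proof. by case/(gimgP (\dim {:C'}))=> y _ ->; rewrite itn_intertwine memv_img ?memvf. Qed.

Lemma gpr_intertwine x : f (gpr h x) = gpr h' (f x).
Proof.
have -> : f x = f (x - gpr h x) + f (gpr h x) by rewrite -lfD subrK.
have fk : f (gpr h x) \in gker h' by apply: gker_intertwine; apply: gpr_ker.
have fi : f (x - gpr h x) \in gimg h' by apply: gimg_intertwine; apply: gpr_sub.
by rewrite lfD (gpr_img fi) add0r (gpr_id fk).
Qed.
End Intertwiners.

(* A pair of complexes with differentials in opposite directions on the same
   spaces, and the operator [d e + e d]. *)
Section Quabla.
Variables (F : fieldType) (C : nat -> vectType F).
Variables (d : forall k, 'Hom(C k.+1, C k)) (e : forall k, 'Hom(C k, C k.+1)).
Hypothesis dd0 : forall k x, d k (d k.+1 x) = 0.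
Hypothesis ee0 : forall k x, e k.+1 (e k x) = 0.

Definition box k : 'End(C k) :=
  match k return 'End(C k) with
  | 0 => (d 0 \o e 0)%VF
  | k'.+1 => ((e k' \o d k') + (d k'.+1 \o e k'.+1))%VF
  end.
Definition kerd k : {vspace C k} :=
  match k return {vspace C k} with 0 => fullv | k'.+1 => lker (d k') end.
Definition ime k : {vspace C k} :=
  match k return {vspace C k} with 0 => 0%VS | k'.+1 => limg (e k') end.
Definition imd k : {vspace C k} := limg (d k).
Definition kere k : {vspace C k} := lker (e k).

Lemma box_d k x : d k (box k.+1 x) = box k (d k x).
Proof.
by case: k x => [|k] x; rewrite /= !(add_lfunE, comp_lfunE) lfD !dd0 ?lf0 addr0 ?add0r.
Qed.

Lemma box_e k x : e k (box k x) = box k.+1 (e k x).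
Proof.
case: k x => [|k] x; rewrite /= !(add_lfunE, comp_lfunE).
  by rewrite ee0 lf0 addr0.
by rewrite lfD !ee0 lf0 addr0 add0r.
Qed.

Lemma kerd0 k x : (x \in kerd k.+1) = (d k x == 0).
Proof. by rewrite memv_ker. Qed.

Lemma kerdP k x : x \in kerd k -> box k x = d k (e k x).
Proof.
case: k x => [|k] x; first by rewrite /= comp_lfunE.
by rewrite kerd0 /= add_lfunE !comp_lfunE => /eqP->; rewrite lf0 add0r.
Qed.

Lemma imd_kerd k : (imd k <= kerd k)%VS.
Proof.
case: k => [|k]; first exact: subvf.
by apply/subvP=> _ /memv_imgP[x _ ->]; rewrite kerd0 dd0.
Qed.

Lemma ime_kere k : (ime k <= kere k)%VS.
Proof.
case: k => [|k]; first exact: sub0v.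
by apply/subvP=> _ /memv_imgP[x _ ->]; rewrite memv_ker ee0.
Qed.

Lemma kerd_gpr k x : x \in kerd k -> gpr (box k) x \in kerd k.
Proof.
case: k x => [|k] x; first by move=> _; exact: memvf.
rewrite !kerd0 => /eqP dx; have H y := @box_d k y.
by rewrite (gpr_intertwine H) dx linear0.
Qed.

Lemma kere_gpr k x : x \in kere k -> gpr (box k) x \in kere k.
Proof.
rewrite !memv_ker => /eqP ex; have H y := @box_e k y.
by rewrite (gpr_intertwine H) ex linear0.
Qed.

Lemma imd_gpr k x : x \in imd k -> gpr (box k) x \in imd k.
Proof.
case/memv_imgP=> y _ ->; have H z := @box_d k z.
by rewrite -(gpr_intertwine H) memv_img ?memvf.
Qed.

Lemma ime_gpr k x : x \in ime k -> gpr (box k) x \in ime k.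
Proof.
case: k x => [|k] x; first by rewrite !memv0 => /eqP->; rewrite linear0.
case/memv_imgP=> y _ ->; have H z := @box_e k z.
by rewrite -(gpr_intertwine H) memv_img ?memvf.
Qed.

Lemma box_gimg k x : x \in gimg (box k) -> exists2 y, y \in gimg (box k) & x = box k y.
Proof. by case/(gimgP 1)=> y yI ->; exists y; rewrite // itnS itn0. Qed.

(** On the Fitting image [box] is invertible and commutes with [d], so a cycle there is [box y] for
    a cycle [y], and on cycles [box] equals [d e]. *)
Lemma kerd_gimg k : (kerd k :&: gimg (box k) <= imd k)%VS.
Proof.
apply/subvP=> x; rewrite memv_cap => /andP[xZ /box_gimg[y yI E]].
suff yZ : y \in kerd k by rewrite E kerdP // memv_img ?memvf.
case: k x xZ y yI E => [|k] x xZ y yI E; first exact: memvf.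
have H z := @box_d k z.
rewrite kerd0; apply/eqP/(gimg_inj (gimg_intertwine H yI)).
by rewrite -H -E; apply/eqP; rewrite -kerd0.
Qed.

Lemma kere_gimg k : (kere k :&: gimg (box k) <= ime k)%VS.
Proof.
apply/subvP=> x; rewrite memv_cap => /andP[xZ /box_gimg[y yI E]].
have H z := @box_e k z.
have ey : e k y = 0.
  apply: (gimg_inj (gimg_intertwine H yI)); rewrite -H -E; apply/eqP; rewrite -memv_ker //.
case: k x xZ y yI E H ey => [|k] x xZ y yI E H ey; rewrite E /=.
  by rewrite comp_lfunE ey lf0 mem0v.
by rewrite add_lfunE !comp_lfunE ey lf0 addr0 memv_img ?memvf.
Qed.

Local Notation C0 k := (gker (box k)).

(** [box] is nilpotent on [U :&: C0 k]; the last non-vanishing power of it on a non-zero vector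
    would give a non-zero vector of its kernel inside [U]. *)
Lemma stable_meet k (U : {vspace C k}) : (forall x, x \in U -> box k x \in U) ->
  (U :&: lker (box k) = 0 <-> U :&: C0 k = 0)%VS.
Proof.
move=> stU; split=> H; apply/eqP; rewrite -subv0; apply/subvP=> x; rewrite memv_cap memv0 => /andP[xU].
  have stn n y : y \in U -> itn (box k) n y \in U by move=> yU; elim: n => [|n IH]; rewrite ?itn0 // itnS stU.
  rewrite memv_ker; elim: (\dim _) x xU => [|n IH] x xU; first by rewrite itn0.
  rewrite itnS => hx; apply: (IH _ xU); rewrite -memv0 -H memv_cap memv_ker hx andbT; exact: stn.
move=> hx; rewrite -memv0 -H memv_cap xU /=; apply: (gkerP (m := 1)).
by rewrite itnS itn0; apply/eqP; rewrite -memv_ker.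
Qed.

Lemma imd_box k x : x \in imd k -> box k x \in imd k.
Proof. by case/memv_imgP=> y _ ->; rewrite -box_d memv_img ?memvf. Qed.
Lemma ime_box k x : x \in ime k -> box k x \in ime k.
Proof.
case: k x => [|k] x; first by rewrite !memv0 => /eqP->; rewrite linear0.
by case/memv_imgP=> y _ ->; rewrite -box_e memv_img ?memvf.
Qed.

(** The Fitting projections commute with [d], so the part of the image of [d] inside [C0 k] is [d]
    of [C0 k.+1]. One condition in degree [k] therefore matches the other in degree [k.+1]. *)
Lemma imd_meet_kerd : (forall k, imd k :&: C0 k = 0)%VS <-> (forall k, C0 k <= kerd k)%VS.
Proof.
split=> H k.
  case: k => [|k]; first exact: subvf.
  apply/subvP=> x x0; rewrite kerd0 -memv0 -(H k) memv_cap memv_img ?memvf //=.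
  by apply: gker_intertwine x0 => y; apply: box_d.
apply/eqP; rewrite -subv0; apply/subvP=> x; rewrite memv_cap memv0 => /andP[/memv_imgP[y _ E] x0].
have G z := @box_d k z.
by rewrite -(gpr_id x0) E -(gpr_intertwine G) -kerd0 (subvP (H _)) ?gpr_ker.
Qed.

Lemma ime_meet_kere : (forall k, ime k :&: C0 k = 0)%VS <-> (forall k, C0 k <= kere k)%VS.
Proof.
split=> H k.
  apply/subvP=> x x0; rewrite memv_ker -memv0 -(H k.+1) memv_cap memv_img ?memvf //=.
  by apply: gker_intertwine x0 => y; apply: box_e.
apply/eqP; rewrite -subv0; apply/subvP=> x; rewrite memv_cap memv0.
case: k x => [|k] x; first by rewrite memv0 => /andP[].
case/andP=> /memv_imgP[y _ E] x0; have G z := @box_e k z.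
by rewrite -(gpr_id x0) E -(gpr_intertwine G) -memv_ker (subvP (H _)) ?gpr_ker.
Qed.

(** On the image of [d] the operator [box] is [d e], on the image of [e] it is [e d]. Each
    disjointness removes one of the two factors. *)
Lemma disjoint_meet :
  (forall k, kere k :&: imd k = 0 /\ kerd k :&: ime k = 0)%VS <->
  (forall k, imd k :&: lker (box k) = 0)%VS /\ (forall k, ime k :&: lker (box k) = 0)%VS.
Proof.
split=> [H|[Hd He] k].
  split=> k; have [H1 H2] := H k; apply/eqP; rewrite -subv0; apply/subvP=> x;
    rewrite memv_cap memv_ker memv0 => /andP[xI /eqP bx].
    have xZ := subvP (imd_kerd k) _ xI; rewrite kerdP // in bx.
    rewrite -memv0 -H1 memv_cap xI andbT memv_ker -memv0; have [_ <-] := H k.+1.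
    by rewrite memv_cap kerd0 bx eqxx memv_img ?memvf.
  have xZ := subvP (ime_kere k) _ xI; rewrite memv_ker in xZ; rewrite -memv0 -H2 memv_cap xI andbT.
  case: k x xI bx xZ {H1 H2} => [|k] x xI bx xZ; first exact: memvf.
  rewrite /= add_lfunE !comp_lfunE (eqP xZ) lf0 addr0 in bx.
  rewrite kerd0 -memv0; have [<- _] := H k.
  by rewrite memv_cap memv_img ?memvf // memv_ker bx eqxx.
split; apply/eqP; rewrite -subv0; apply/subvP=> x; rewrite memv_cap memv0 => /andP[xZ xI].
  rewrite -memv0 -(Hd k) memv_cap xI memv_ker kerdP ?(subvP (imd_kerd k)) //=.
  by move: xZ; rewrite memv_ker => /eqP->; rewrite lf0.
rewrite -memv0 -(He k) memv_cap xI memv_ker kerdP //=.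
by move: (subvP (ime_kere k) _ xI); rewrite memv_ker => /eqP->; rewrite lf0.
Qed.

Lemma gker_gimg_dim k (U : {vspace C k}) : (forall x, x \in U -> gpr (box k) x \in U) ->
  \dim U = (\dim (U :&: C0 k) + \dim (U :&: gimg (box k)))%N.
Proof.
move=> stU; rewrite -dimv_disjoint_sum; last first.
  apply/eqP; rewrite -subv0 -(gker_gimg (box k)).
  exact: capvS (capvSr _ _) (capvSr _ _).
congr (\dim _); apply/eqP; rewrite eqEsubv subv_add !capvSl !andbT.
apply/subvP=> x xU; rewrite -[x](subrK (gpr (box k) x)) addrC memv_add //.
  by rewrite memv_cap stU ?gpr_ker.
by rewrite memv_cap gpr_sub andbT memvD ?memvN ?stU.
Qed.

(* [H = Z / B] has the dimension of [C0] only if both differentials vanish there. *)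
Lemma homology_dim k (Z B : {vspace C k}) : (B <= Z)%VS -> (Z :&: gimg (box k) <= B)%VS ->
  (forall x, x \in Z -> gpr (box k) x \in Z) -> (forall x, x \in B -> gpr (box k) x \in B) ->
  \dim Z = (\dim B + \dim (C0 k))%N <-> (C0 k <= Z)%VS /\ (B :&: C0 k = 0)%VS.
Proof.
move=> BZ ZB stZ stB; rewrite (gker_gimg_dim stZ) (gker_gimg_dim stB).
have -> : (B :&: gimg (box k) = Z :&: gimg (box k))%VS.
  apply/eqP; rewrite eqEsubv capvS //= subv_cap ZB capvSr //.
split=> [/eqP|[/capv_idPr-> ->]]; last by rewrite dimv0 add0n addnC.
rewrite addnAC eqn_add2r => /eqP E; have := dimvS (capvSr Z (C0 k)); rewrite E => H.
have {}H : \dim (B :&: C0 k) = 0%N by apply/eqP; rewrite -leqn0 -(leq_add2r (\dim (C0 k))).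
split; last by apply/eqP; rewrite -dimv_eq0 H.
apply/capv_idPr/eqP; rewrite -(geq_leqif (dimv_leqif_eq _)) ?capvSr //.
by rewrite E leq_addl.
Qed.
End Quabla.

Section Pairing.
Variables (F : fieldType).

(** A vector that pairs to zero with a basis of [U] is killed by [f], so the rank of [f] is at most
    that of the map into the [\dim U] coordinates. *)
Lemma rank_adjoint (A A' B : vectType F) (b : A -> B -> F) (f : 'Hom(A, A')) (U : {vspace B}) :
  (forall y, linear (b ^~ y : A -> F^o)) -> (forall x, linear (b x : B -> F^o)) ->
  (forall x, (forall y, y \in U -> b x y = 0) -> f x = 0) ->
  (\dim (limg f) <= \dim U)%N.
Proof.
move=> bl br H; pose r := \dim U; pose u (i : 'I_r) := tnth (vbasis U) i.
have lin : linear (fun x => \row_i (b x (u i) : F^o) : 'rV[F]_r).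
  by move=> c x y; apply/rowP=> i; rewrite !mxE bl.
pose A1 := GRing.isLinear.Build F A 'rV[F]_r *:%R _ lin.
pose phi : {linear A -> 'rV[F]_r} := HB.pack (fun x => \row_i (b x (u i) : F^o) : 'rV[F]_r) A1.
have ker : (lker (linfun phi) <= lker f)%VS.
  apply/subvP=> x; rewrite !memv_ker lfunE => /eqP/rowP px; apply/eqP/H => y yU.
  rewrite (coord_vbasis yU).
  have br0 : b x 0 = 0 by have := br x (-1) 0 0; rewrite scaler0 addr0 scaleN1r addNr.
  elim/big_rec: _ => // i z _ bz; rewrite br bz addr0.
  by have := px i; rewrite !mxE /u (tnth_nth 0) => ->; rewrite scaler0.
have D1 := limg_ker_dim f fullv; have D2 := limg_ker_dim (linfun phi) fullv.
rewrite capfv in D1; rewrite capfv in D2.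
have : (\dim (limg (linfun phi)) <= r)%N.
  by apply: leq_trans (dimvS (subvf _)) _; rewrite dimvf /dim /= mul1n.
have := dimvS ker; rewrite -(leq_add2r (\dim (limg f))) D1 -D2 leq_add2l => H1 H2.
exact: leq_trans H1 H2.
Qed.

(** If [y] were a non-zero vector of the right radical, pairing with a complement of its line would
    already detect every [x], bounding the dimension by itself minus one. *)
Lemma nondeg_flip (A : vectType F) (b : A -> A -> F) :
  (forall y, linear (b ^~ y : A -> F^o)) -> (forall x, linear (b x : A -> F^o)) ->
  (forall x, (forall y, b x y = 0) -> x = 0) -> forall y, (forall x, b x y = 0) -> y = 0.
Proof.
move=> bl br nd y by0; apply/eqP/negPn/negP => y0.
pose U := (<[y]>^C)%VS.
have H x : (forall z, z \in U -> b x z = 0) -> (\1%VF : 'End(A)) x = 0.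
  move=> bU; rewrite id_lfunE; apply: nd => z.
  have : z \in (<[y]> + U)%VS by rewrite addv_complf memvf.
  case/memv_addP=> _ /vlineP[c ->] [w wU ->].
  have := br x c y w; rewrite by0 (bU w wU) => ->.
  by rewrite -[LHS]/(c * 0 + 0) mulr0 addr0.
have N0 : (0 < \dim {:A})%N.
  rewrite lt0n dimv_eq0; apply: contraNneq y0 => E; by rewrite -memv0 -E memvf.
have := rank_adjoint bl br H.
by rewrite lim1g dimv_compl dim_vline y0 leqNgt subn1 prednK // leqnn.
Qed.
End Pairing.

Section SuperDec.
Variables (F : numClosedFieldType) (vT : vectType F) (part : bool -> {vspace vT}).
Hypothesis dec : super_dec part.

(** Records the grading as an operator: being homogeneous becomes an eigenvalue equation, and a map
    preserves parity when it commutes with [sgnop]. *)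
Definition sgnop : 'End(vT) :=
  daddv_pi (part false) (part true) - daddv_pi (part true) (part false).

Let cap' : (part true :&: part false = 0)%VS.
Proof. by rewrite capvC; case: dec. Qed.

Lemma sgnop_part (p : bool) v : v \in part p -> sgnop v = (-1) ^+ p *: v.
Proof.
have [add cap] := dec.
have E := daddv_pi_add (w := v) cap; rewrite add memvf in E; have {}E := E isT.
rewrite /sgnop add_lfunE opp_lfunE; case: p => vp.
  have px := daddv_pi_id cap' vp; rewrite px expr1 scaleN1r.
  by rewrite (_ : daddv_pi _ _ v = 0) ?sub0r //; apply: (addIr v); rewrite add0r -[in LHS]px [in X in X + _]px.
have px := daddv_pi_id cap vp; rewrite px expr0 scale1r.
by rewrite (_ : daddv_pi _ _ v = 0) ?subr0 //; apply: (addrI v); rewrite addr0 -[X in X + _]px.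
Qed.

Lemma part_sum v : exists v0 v1, [/\ v = v0 + v1, v0 \in part false & v1 \in part true].
Proof.
have [add _] := dec; have : v \in (part false + part true)%VS by rewrite add memvf.
by case/memv_addP=> v0 h0 [v1 h1 ->]; exists v0, v1.
Qed.

Lemma sgnopK v : sgnop (sgnop v) = v.
Proof.
have [v0 [v1 [-> h0 h1]]] := part_sum v.
by rewrite !(lfD, lfN, sgnop_part h0, sgnop_part h1, expr0, expr1, scale1r, scaleN1r, opprK).
Qed.

Lemma sgnopP (p : bool) v : reflect (sgnop v = (-1) ^+ p *: v) (v \in part p).
Proof.
apply: (iffP idP) => [|E]; first exact: sgnop_part.
have [v0 [v1 [Ev h0 h1]]] := part_sum v; move: E.
rewrite Ev lfD (sgnop_part h0) (sgnop_part h1) expr0 scale1r expr1 scaleN1r.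
have two0 (w : vT) : w = - w -> w = 0.
  move=> E; apply/eqP; have /eqP : 2%:R *: w = 0 by rewrite scaler_nat mulr2n {2}E subrr.
  by rewrite scaler_eq0 pnatr_eq0.
case: p => /=.
  rewrite expr1 scaleN1r opprD => /addIr/two0 ->; by rewrite add0r.
by rewrite expr0 scale1r => /addrI/esym/two0->; rewrite addr0.
Qed.
End SuperDec.

Section SubQuotientActions.
Variables (F : fieldType) (g : lieSuperalgebra F) (M : actspace g) (U : {vspace M}).

Lemma vsval_subact a (u : subvs_of U) : as_act M a (vsval u) \in U ->
  vsval (as_act (subact U) a u : subvs_of U) = as_act M a (vsval u).
Proof. by move=> aU; rewrite /= !comp_lfunE !lfunE /= vsprojK. Qed.

Lemma quotactE a (c : subvs_of U^C%VS) :
  as_act (quotact U) a c = quot_pi U (as_act M a (vsval c)).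
Proof. by rewrite -[LHS]/(quot_map U U (as_act M a) c) /quot_map 2!comp_lfunE [linfun vsval _]lfunE. Qed.
End SubQuotientActions.

(** * Chain spaces: equivariance, parity, and the seven conditions *)

Section Chains.
Variables (F : numClosedFieldType) (g : lieSuperalgebra F) (kappa : g -> g -> F).
Variables (fr : nil_frame g) (V : actspace g) (n1 m1 l q : {vspace g}).
Hypothesis gf : good_frame kappa fr n1 m1 l q.
Hypothesis modV : is_module V.
Local Notation d := (nf_dim fr).
Local Notation part := (lsa_part g).
Local Notation xi a := (tnth (nf_basis fr) a).
Local Notation xidd a := (@nf_dual F g fr a).
Local Notation par a := (@xi_par F g fr a).
Local Notation sg p q := ((-1) ^+ (p && q)).
Let T k : vectType F := {ffun k.-tuple 'I_d -> V}.
Let P k a : 'Hom(T k, T k.+1) := prepend V k a.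
Let sl k a : 'Hom(T k.+1, T k) := slice V k a.
Let R k : {vspace T k} := ext_rel fr V k.
Let D k : 'Hom(T k.+1, T k) := tbdry fr V k.
Let dd k : 'Hom(T k, T k.+1) := tcobdry fr V k.
Let L k x : 'End(T k) := superder fr (as_act V) k x.
Let L0 k x : 'End(T k) := superder fr (fun=> 0) k x.
Let A k : 'Hom(T k, T k.+1) := \sum_a append k a (as_act V (xidd a)).

Let act_lin : linear (as_act V). Proof. by case: modV. Qed.
Let zero_lin : linear (fun _ : g => 0 : 'End(V)).
Proof. by move=> c x y; rewrite scaler0 addr0. Qed.

Let sl_P k a b (f : T k) : sl k a (P k b f) = (a == b)%:R *: f.
Proof. exact: slice_prepend. Qed.
Let P_sl k (f : T k.+1) : f = \sum_a P k a (sl k a f).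
Proof. exact: prepend_slice. Qed.

Let sd (phi : g -> 'End(V)) : linear phi -> superderivation P (fun k x => superder fr phi k x : 'End(T k)).
Proof.
move=> phil; split=> [k|k p x a f xp]; first exact: superder_linear.
have lin := superder_linear fr phil k; have sZ c y h : superder fr phi k (c *: y) h = c *: superder fr phi k y h.
  have s0 : superder fr phi k 0 = 0.
    by have := lin (-1) 0 0; rewrite scaler0 addr0 scaleN1r addNr.
  by have := lin c y 0; rewrite s0 !addr0 => ->; rewrite scale_lfunE.
have := superder_prepend phi x a f; rewrite (parity_twistE _ xp) sZ lfZ wedge_app.
exact.
Qed.
Let sdL : superderivation P L. Proof. exact: sd. Qed.
Let sdL0 : superderivation P L0. Proof. exact: sd. Qed.

Let L00 x (f : T 0) : L0 0 x f = 0.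
Proof. by apply/ffunP=> t; rewrite /L0 superder0E zero_lfunE ffunE. Qed.

Let L_rep0 (p s : bool) x y (f : T 0) : x \in part p -> y \in part s ->
  L 0 (bracket x y) f = L 0 x (L 0 y f) - sg p s *: L 0 y (L 0 x f).
Proof.
move=> xp ys; apply/ffunP=> t; rewrite !ffunE /L !superder0E.
by case: modV => _ _ _; apply.
Qed.

Let A0 (f : T 0) : A 0 f = \sum_a P 0 a (L 0 (xidd a) f).
Proof. by rewrite /A sum_lfunE; apply: eq_bigr => a _; rewrite append_0. Qed.
Let A_P k b (f : T k) : A k.+1 (P k b f) = P k.+1 b (A k f).
Proof. by rewrite /A !sum_lfunE lf_sum; apply: eq_bigr => a _; rewrite /P append_P. Qed.
Let ddE k (f : T k) : dd k f =
  2%:R^-1 *: (\sum_a P k a (L0 k (xidd a) f)) + (-1) ^+ k *: A k f.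
Proof.
rewrite /dd /tcobdry add_lfunE !scale_lfunE sum_lfunE; congr (_ *: _ + _).
by apply: eq_bigr => a _; rewrite comp_lfunE.
Qed.

Let D0_P a (f : T 0) : D 0 (P 0 a f) = - L 0 (xi a) f.
Proof. exact: tbdry0_P. Qed.
Let D_P k a (f : T k.+1) : D k.+1 (P k.+1 a f) = - L k.+1 (xi a) f - P k a (D k f).
Proof. exact: tbdry_P. Qed.

Let R0 : R 0 = 0%VS. Proof. exact: ext_rel0. Qed.
Let R1 : R 1 = 0%VS. Proof. exact: ext_rel1. Qed.
Let R_P k a (f : T k) : f \in R k -> P k a f \in R k.+1.
Proof. exact: ext_rel_P. Qed.
Let R_PP k a b (f : T k) : P k.+1 a (P k b f) + sg (par a) (par b) *: P k.+1 b (P k a f) \in R k.+2.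
Proof. exact: ext_rel_PP. Qed.
Let R_sub k (U : {vspace T k.+2}) :
  (forall a f, f \in R k.+1 -> P k.+1 a f \in U) ->
  (forall a b f, P k.+1 a (P k b f) + sg (par a) (par b) *: P k.+1 b (P k a f) \in U) ->
  (R k.+2 <= U)%VS.
Proof. exact: ext_rel_sub. Qed.

Let L_R k x f : f \in R k -> L k x f \in R k.
Proof.
have [x0 [x1 [-> h0 h1]]] := homog_sum x => fR; rewrite (sdD sdL) memvD //.
  exact: (ext_rel_sd gf R0 R1 R_P R_PP R_sub sdL h0 fR).
exact: (ext_rel_sd gf R0 R1 R_P R_PP R_sub sdL h1 fR).
Qed.
Let D_R k f : f \in R k.+1 -> D k f \in R k.
Proof. exact: (ext_rel_D gf R0 R1 R_P R_PP R_sub sdL D0_P D_P). Qed.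
Let dd_R k f : f \in R k -> dd k f \in R k.+1.
Proof. exact: (ext_rel_dd gf sl_P P_sl R0 R1 R_P R_PP R_sub sdL0 L00 sdL A0 A_P ddE). Qed.

Local Notation C k := (chains fr V k).
Local Notation pi k := (@quot_pi F (T k) (R k)).

Let pi_surj k (c : C k) : c = pi k (vsval c).
Proof. by rewrite quot_pi_vsval. Qed.

Let chainP k (Q : C k -> Prop) : (forall f, Q (pi k f)) -> forall c, Q c.
Proof. by move=> H c; rewrite [c]pi_surj. Qed.

Lemma bdry_pi k f : bdry fr V k (pi k.+1 f) = pi k (D k f).
Proof. by apply: quot_map_pi => u; apply: D_R. Qed.
Lemma cobdry_pi k f : cobdry fr V k (pi k f) = pi k.+1 (dd k f).
Proof. by apply: quot_map_pi => u; apply: dd_R. Qed.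
Lemma chains_act_pi k x f : as_act (C k) x (pi k f) = pi k (L k x f).
Proof. by apply: (@quot_map_pi F (T k) (T k)) => u; apply: L_R. Qed.

Lemma bdryK k (c : C k.+2) : bdry fr V k (bdry fr V k.+1 c) = 0.
Proof.
move: c; apply: chainP => f; rewrite !bdry_pi (DK gf P_sl sdL L_rep0 D0_P D_P); exact: lf0.
Qed.

Lemma cobdryK k (c : C k) : cobdry fr V k.+1 (cobdry fr V k c) = 0.
Proof.
move: c; apply: chainP => f; rewrite !cobdry_pi; apply/eqP; rewrite quot_pi_eq0.
exact: (dd_dd gf sl_P P_sl R0 R1 R_P R_PP R_sub sdL0 L00 sdL L_rep0 A0 A_P ddE).
Qed.

Let l_homog x : x \in l -> exists x0 x1, [/\ x = x0 + x1, x0 \in l, x1 \in l, x0 \in part false & x1 \in part true].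
Proof.
rewrite {1}(gf_graded_l gf) => /memv_addP[x0 /[!memv_cap]/andP[l0 h0] [x1 /[!memv_cap]/andP[l1 h1] ->]].
by exists x0, x1.
Qed.

Lemma bdry_act k x (c : C k.+1) : x \in l ->
  bdry fr V k (as_act (C k.+1) x c) = as_act (C k) x (bdry fr V k c).
Proof.
move=> xl; move: c; apply: chainP => f; rewrite chains_act_pi !bdry_pi chains_act_pi.
have [x0 [x1 [-> l0 l1 h0 h1]]] := l_homog xl; rewrite (sdD sdL x0 x1 f) (sdD sdL x0 x1 (D k f)) lfD.
have E p y : y \in l -> y \in part p -> D k (L k.+1 y f) = L k y (D k f).
  by move=> yl yp; apply: (D_L gf P_sl sdL L_rep0 D0_P D_P _ yp) => z; apply: (gf_br_ln gf).
by rewrite (E _ _ l0 h0) (E _ _ l1 h1).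
Qed.

Lemma cobdry_act k x (c : C k) : x \in l ->
  cobdry fr V k (as_act (C k) x c) = as_act (C k.+1) x (cobdry fr V k c).
Proof.
move=> xl; move: c; apply: chainP => f; rewrite chains_act_pi !cobdry_pi chains_act_pi.
have [x0 [x1 [-> l0 l1 h0 h1]]] := l_homog xl; rewrite (sdD sdL x0 x1 f) (sdD sdL x0 x1 (dd k f)) lfD.
have E p y : y \in l -> y \in part p -> L k.+1 y (dd k f) - dd k (L k y f) \in R k.+1.
  move=> yl yp; apply: (dd_L gf sl_P P_sl R0 R1 R_P R_PP R_sub sdL0 L00 sdL L_rep0 A0 A_P ddE _ yp).
  exact: (subvP (gf_sub_l gf)).
apply/esym/quot_pi_eq; rewrite opprD addrACA; apply: memvD; [exact: E l0 h0|exact: E l1 h1].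
Qed.

Let epsV := sgnop (@as_part F g V).
Let decV : super_dec (@as_part F g V). Proof. by case: modV. Qed.

Fixpoint eps k : 'End(T k) :=
  match k return 'End(T k) with
  | 0 => linfun (fun f : T 0 => [ffun t => epsV (f t)] : T 0)
  | k'.+1 => \sum_a (((-1) ^+ par a *: (P k' a \o eps k')) \o sl k' a)%VF
  end.
Arguments eps : simpl never.

Let eps_P k a f : eps k.+1 (P k a f) = (-1) ^+ par a *: P k a (eps k f).
Proof. by rewrite /eps -/eps (sum_sl_P sl_P) scale_lfunE comp_lfunE. Qed.

Let eps0E (f : T 0) t : eps 0 f t = epsV (f t).
Proof.
have lin : linear (fun f : T 0 => [ffun t => epsV (f t)] : T 0).
  by move=> c u v; apply/ffunP=> s; rewrite !ffunE linearP.
pose A1 := GRing.isLinear.Build _ _ _ _ _ lin.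
pose h : {linear _ -> _} := HB.pack (fun f : T 0 => [ffun t => epsV (f t)] : T 0) A1.
by rewrite /eps (lfunE h) /= ffunE.
Qed.

Let eps_L0 p x (f : T 0) : x \in part p -> eps 0 (L 0 x f) = (-1) ^+ p *: L 0 x (eps 0 f).
Proof.
move=> xp; apply/ffunP=> t; rewrite ffunE eps0E /L !superder0E eps0E; move: (f t) => v.
have [v0 [v1 [-> h0 h1]]] := part_sum decV v.
have ap s w : w \in as_part V s -> as_act V x w \in as_part V (p (+) s) by case: modV => _ _ H _; apply: H.
rewrite !lfD /epsV (sgnop_part decV h0) (sgnop_part decV h1) (sgnop_part decV (ap _ _ h0)) (sgnop_part decV (ap _ _ h1)) !lfZ.
by case: (p); signs; atoms; lincomb.
Qed.

Let epsE k (f : T k) t : eps k f t = (-1) ^+ (\big[addb/false]_(a <- t) par a) *: epsV (f t).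
Proof.
elim: k f t => [|k IH] f t; first by rewrite (tuple0 t) big_nil eps0E expr0 scale1r.
case/tupleP: t => b t; rewrite {1}[f]P_sl lf_sum sum_ffunE (bigD1 b) //= big1 ?addr0.
  rewrite eps_P ffunE /P prependE eqxx IH scalerA -signr_addb /sl sliceE.
  by rewrite big_cons.
by move=> a /negbTE ab; rewrite eps_P ffunE /P prependE eq_sym ab scaler0.
Qed.

Let big_addb (p : bool) (t : seq 'I_d) :
  \big[addb/p]_(a <- t) par a = p (+) \big[addb/false]_(a <- t) par a.
Proof. by elim: t => [|a t IH]; rewrite ?big_nil ?addbF // !big_cons IH addbCA. Qed.

Let tpartP k (p : bool) (f : T k) : reflect (eps k f = (-1) ^+ p *: f) (f \in tpart fr V k p).
Proof.
have memt : (f \in tpart fr V k p) = [forall t : k.-tuple 'I_d, f t \in as_part V (\big[addb/p]_(a <- t) par a)].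
  apply/idP/forallP=> [/memv_sumP[h hP ->] t|H].
    rewrite sum_ffunE memv_suml // => s _; have /memv_imgP[v vp ->] := hP s isT.
    rewrite lfunE ffunE; case: eqP => [->//|_]; exact: mem0v.
  rewrite (tensor_pure f); apply: memv_suml => t _.
  apply: (subvP (sumv_sup t _ (subvv _))) => //; rewrite -[pure _ _](lfunE (pure t)) memv_img //; exact: H.
rewrite memt; apply: (iffP forallP) => [H|E t].
  apply/ffunP=> t; rewrite epsE ffunE /epsV (sgnop_part decV (H t)) scalerA -signr_addb.
  by rewrite big_addb addbCA addbb addbF.
apply/(sgnopP decV); have := congr1 (fun h : T k => (-1) ^+ (\big[addb/false]_(a <- t) par a) *: h t) E.
rewrite epsE ffunE !scalerA -!signr_addb addbb scale1r => ->.
by rewrite big_addb addbC.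
Qed.

Let eps_R k f : f \in R k -> eps k f \in R k.
Proof. exact: (ext_rel_eps R0 R1 R_P R_PP R_sub eps_P). Qed.

Definition chains_eps k : 'End(C k) := quot_map (R k) (R k) (eps k).

Let chains_eps_pi k f : chains_eps k (pi k f) = pi k (eps k f).
Proof. by apply: quot_map_pi => u; apply: eps_R. Qed.

Lemma bdry_eps k (c : C k.+1) : bdry fr V k (chains_eps k.+1 c) = chains_eps k (bdry fr V k c).
Proof.
move: c; apply: chainP => f; rewrite chains_eps_pi !bdry_pi chains_eps_pi.
by rewrite (eps_D gf P_sl sdL eps_P eps_L0 D0_P D_P).
Qed.

Lemma cobdry_eps k (c : C k) : cobdry fr V k (chains_eps k c) = chains_eps k.+1 (cobdry fr V k c).
Proof.
move: c; apply: chainP => f; rewrite chains_eps_pi !cobdry_pi chains_eps_pi; apply/esym/quot_pi_eq.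
exact: (eps_dd gf sl_P P_sl R0 R1 R_P R_PP R_sub sdL0 L00 sdL A0 A_P ddE eps_P eps_L0).
Qed.

Lemma chains_partP k (p : bool) (c : C k) : reflect (chains_eps k c = (-1) ^+ p *: c) (c \in as_part (C k) p).
Proof.
have epsK f : eps k (eps k f) = f.
  by apply/ffunP=> t; rewrite !epsE lfZ scalerA -signr_addb addbb scale1r /epsV sgnopK.
apply: (iffP idP) => [/memv_imgP[f /tpartP fp ->]|].
  by rewrite chains_eps_pi fp lfZ.
move: c; apply: chainP => f; rewrite chains_eps_pi => E.
(* The class is an eigenvector though [f] need not be one; averaging [f] with its image under [eps]
   gives a homogeneous tensor in the same class. *)
have -> : pi k f = pi k (2%:R^-1 *: (f + (-1) ^+ p *: eps k f)).
  rewrite lfZ lfD lfZ E scalerA -signr_addb addbb scale1r.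
  by rewrite -mulr2n -scaler_nat scalerA mulVf ?scale1r // pnatr_eq0.
apply/memv_img/tpartP; rewrite lfZ lfD lfZ epsK [in RHS]scalerA [_ * 2%:R^-1]mulrC -scalerA.
by congr (_ *: _); rewrite scalerDr scalerA -signr_addb addbb scale1r addrC.
Qed.

Section Pairing.
Variables (s : 'End(g)) (B : V -> V -> F).
Hypothesis s_m : forall c, c \in n1 -> s c \in m1.
Hypothesis s_par : forall p c, c \in part p -> s c \in part p.
Hypothesis s_br : forall c a, c \in n1 -> a \in n1 -> s (bracket c a) = bracket (s a) (s c).
Hypothesis s_onto : forall y, y \in m1 -> exists2 c, c \in n1 & y = s c.
Hypothesis B_linl : forall h, linear (B^~ h : V -> F^o).
Hypothesis B_linr : forall f, linear (B f : V -> F^o).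
Hypothesis B_adj : forall c f h, c \in n1 -> B (as_act V (s c) f) h = B f (as_act V c h).
Hypothesis B_nondeg : forall f, (forall h, B f h = 0) -> f = 0.

Let t0 : 0.-tuple 'I_d := [tuple].
Let B0 (f h : T 0) : F := B (f t0) (h t0).
Let B0_linl h : linear (B0^~ h : T 0 -> F^o).
Proof. by move=> c u v; rewrite /B0 !ffunE B_linl. Qed.
Let B0_linr f : linear (B0 f : T 0 -> F^o).
Proof. by move=> c u v; rewrite /B0 !ffunE B_linr. Qed.
Let B0_adj c f h : c \in n1 -> B0 (L 0 (s c) f) h = B0 f (L 0 c h).
Proof. by move=> cn; rewrite /B0 /L !superder0E B_adj. Qed.
Let B0_nondeg f : (forall h, B0 f h = 0) -> f = 0.
Proof.
move=> H; apply/ffunP=> t; rewrite ffunE (tuple0 t); apply: B_nondeg => v.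
by have := H [ffun=> v]; rewrite /B0 ffunE.
Qed.
Local Notation tf k := (@tform F g kappa fr T P sl s B0 k).
Let b k (c c' : C k) : F := tf k (vsval c) (vsval c').

Let b_pi k f h : b (pi k f) (pi k h) = tf k f h.
Proof.
have Hf := vsval_quot_pi (R k) f; have Hh := vsval_quot_pi (R k) h.
rewrite /b -[X in tf k X _](subrK f) (tformDl kappa P sl s B0_linl).
rewrite (tform_radl gf sl_P P_sl R0 R1 R_P R_PP R_sub s_par B0_linl _ Hf) add0r.
rewrite -[X in tf k _ X](subrK h) (tformDr kappa P sl s B0_linr).
by rewrite (tform_radr gf sl_P P_sl R0 R1 R_sub s_par B0_linl B0_linr _ Hh) add0r.
Qed.

(** Adjointness bounds the rank of the coboundary by that of the boundary. The opposite bound uses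
    the form with its arguments exchanged, which is again non-degenerate. *)
Lemma chains_rank k : \dim (limg (cobdry fr V k)) = \dim (limg (bdry fr V k)).
Proof.
have bl j y : linear ((@b j)^~ y : C j -> F^o).
  move=> c u v; rewrite /b linearP; exact: (tform_linl kappa P sl s B0_linl).
have br j x : linear (@b j x : C j -> F^o).
  move=> c u v; rewrite /b linearP; exact: (tform_linr kappa P sl s B0_linr).
have nd j x : (forall y, @b j x y = 0) -> x = 0.
  move: x; apply: chainP => f H; apply/eqP; rewrite quot_pi_eq0.
  apply: (tform_nondeg gf sl_P P_sl R0 R_P R_PP s_onto B0_linl B0_linr B0_nondeg) => h.
  by rewrite -b_pi H.
have nd' j := nondeg_flip (bl j) (br j) (nd j).
have adj j x y : @b j.+1 (cobdry fr V j x) y = - b x (bdry fr V j y).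
  move: x y; apply: chainP => f; apply: chainP => h; rewrite cobdry_pi bdry_pi !b_pi.
  exact: (tform_adj gf sl_P P_sl R0 R1 R_P R_PP R_sub sdL0 L00 sdL A0 A_P ddE D0_P D_P s_m s_par s_br B0_linl B0_linr B0_adj).
apply/eqP; rewrite eqn_leq; apply/andP; split.
  apply: (rank_adjoint (bl k) (br k)) => x H; apply: nd => y; rewrite adj H ?oppr0 //.
  by rewrite memv_img ?memvf.
apply: (rank_adjoint (b := fun y x => b x y) (br k.+1) (bl k.+1)) => y H; apply: nd' => x.
by apply: oppr_inj; rewrite -adj H ?oppr0 // memv_img ?memvf.
Qed.
End Pairing.

Local Notation qb k := (quabla fr V k).
Local Notation C0 k := (quabla0 fr V k).

Let gpr_commute k (f : 'End(C k)) x : (forall c, f (qb k c) = qb k (f c)) ->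
  f (gpr (qb k) x) = gpr (qb k) (f x).
Proof. by move=> H; apply: (gpr_intertwine H). Qed.

Lemma quabla0E c : qb 0 c = bdry fr V 0 (cobdry fr V 0 c).
Proof. exact: comp_lfunE. Qed.
Lemma quablaSE k c : qb k.+1 c =
  cobdry fr V k (bdry fr V k c) + bdry fr V k.+1 (cobdry fr V k.+1 c).
Proof. by rewrite /quabla add_lfunE; congr (_ + _); apply: comp_lfunE. Qed.

Lemma quabla_act k x c : x \in l -> as_act (C k) x (qb k c) = qb k (as_act (C k) x c).
Proof.
move=> xl; case: k c => [|k] c; rewrite ?quabla0E ?quablaSE.
  by rewrite -bdry_act // -cobdry_act.
by rewrite lfD -cobdry_act // -bdry_act // -bdry_act // -cobdry_act.
Qed.

Lemma quabla_eps k c : chains_eps k (qb k c) = qb k (chains_eps k c).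
Proof.
case: k c => [|k] c; rewrite ?quabla0E ?quablaSE.
  by rewrite -bdry_eps -cobdry_eps.
by rewrite lfD -cobdry_eps -bdry_eps -bdry_eps -cobdry_eps.
Qed.

(** The isomorphism takes a representative to its Fitting component in [C0]. It is well defined
    because [Bd] meets [C0] trivially, and injective because cycles in the Fitting image lie in
    [Bd]; it respects [l] and parity as both commute with quabla. *)
Lemma subquot_iso k (Z Bd : {vspace C k}) : (Bd <= Z)%VS -> (C0 k <= Z)%VS ->
  (Bd :&: C0 k = 0)%VS -> (Z :&: gimg (qb k) <= Bd)%VS ->
  (forall x, x \in Bd -> gpr (qb k) x \in Bd) ->
  (forall x, x \in Z -> gpr (qb k) x \in Z) ->
  (forall a x, a \in l -> x \in Z -> as_act (C k) a x \in Z) ->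
  lmod_iso l (subquot Z Bd) (quabla0_module fr V k).
Proof.
move=> BZ C0Z BC0 ZB stB stZ actZ; set q0 := qb k.
have gprB x y : x - y \in Bd -> gpr q0 x = gpr q0 y.
  move=> xy; apply/eqP; rewrite -subr_eq0 -lfB -memv0 -BC0 memv_cap stB //=; exact: gpr_ker.
pose f : 'Hom(subquot Z Bd, quabla0_module fr V k) :=
  (linfun (vsproj (C0 k)) \o gpr q0 \o linfun vsval \o linfun vsval)%VF.
have fE u : f u = vsproj (C0 k) (gpr q0 (vsval (vsval u))).
  by rewrite /f !comp_lfunE !lfunE.
have valf u : vsval (f u) = gpr q0 (vsval (vsval u)).
  by rewrite fE vsprojK //; apply: gpr_ker.
have rep (u : subquot Z Bd) : exists2 z, z \in Z & vsval u = quot_pi Bd z.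
  by have /memv_imgP[z zZ E] := subvsP u; exists z.
have fpi z (u : subquot Z Bd) : vsval u = quot_pi Bd z -> vsval (f u) = gpr q0 z.
  by move=> E; rewrite valf E; apply/gprB/vsval_quot_pi.
exists f; split.
- pose h (w : quabla0_module fr V k) : subquot Z Bd := vsproj (quot_pi Bd @: Z)%VS (quot_pi Bd (vsval w)).
  have hE w : vsval (h w) = quot_pi Bd (vsval w).
    by rewrite vsprojK // memv_img // (subvP C0Z) // subvsP.
  exists h => [u|w].
    have [z zZ E] := rep u; apply/val_inj; rewrite /= [vsval (h _)]hE (fpi z) // E.
    apply/quot_pi_eq; rewrite -memvN opprB (subvP ZB) // memv_cap gpr_sub andbT memvD ?memvN ?stZ //.
  by apply/val_inj; rewrite /= (fpi (vsval w)) ?hE // gpr_id // subvsP.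
- move=> p u /memv_imgP[w]; rewrite memv_cap => /andP[wZ /memv_imgP[x xp E]]; rewrite lfunE /= => Eu.
  have fu : vsval (f u) = gpr q0 x by apply: fpi; rewrite Eu vsprojK.
  have -> : f u = linfun (vsproj (C0 k)) (gpr q0 x) by rewrite fE -valf fu; exact: (esym (lfunE _ _)).
  apply: memv_img; rewrite memv_cap gpr_ker; apply/chains_partP.
  move/chains_partP: xp => xp.
  by rewrite (gpr_commute _ (@quabla_eps k)) xp lfZ.
move=> a u al; have [z zZ E] := rep u.
have rZ : vsval (vsval u) \in Z.
  by rewrite -[vsval (vsval u)](subrK z) memvD // (subvP BZ) // E vsval_quot_pi.
have act_gpr c : as_act (C k) a (gpr q0 c) = gpr q0 (as_act (C k) a c).
  by apply: gpr_commute => c'; apply: quabla_act.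
have actu : vsval (as_act (subquot Z Bd) a u) = quot_pi Bd (as_act (C k) a (vsval (vsval u))).
  by rewrite [LHS]vsval_subact quotactE ?memv_img ?actZ.
have H1 := fpi _ _ actu.
have H2 : vsval (as_act (quabla0_module fr V k) a (f u)) = as_act (C k) a (vsval (f u)).
  by apply: vsval_subact; rewrite valf act_gpr gpr_ker.
rewrite valf act_gpr in H2; apply: (can_inj (@vsvalK _ _ (C0 k))); exact: etrans H1 (esym H2).
Qed.

(** Of an abstract isomorphism only the dimensions are retained; by [homology_dim] they already
    force the inclusion of [C0] in [Z]. *)
Lemma iso_dim k (Z Bd : {vspace C k}) : (Bd <= Z)%VS ->
  lmod_iso l (subquot Z Bd) (quabla0_module fr V k) -> \dim Z = (\dim Bd + \dim (C0 k))%N.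
Proof.
move=> BZ [f [bf _ _]].
have kf0 : lker f = 0%VS by apply/eqP/lker0P/bij_inj.
have If : limg f = fullv.
  apply/eqP; rewrite eqEsubv subvf; apply/subvP=> y _; have [h _ fh] := bf.
  by rewrite -[y]fh memv_img ?memvf.
have := limg_ker_dim f fullv; rewrite capfv kf0 dimv0 add0n If => E.
have D1 : \dim (fullv : {vspace (subquot Z Bd)}) = \dim (quot_pi Bd @: Z)%VS by rewrite dimvf.
have D2 : \dim (fullv : {vspace (quabla0_module fr V k)}) = \dim (C0 k) by rewrite dimvf.
rewrite -D2 E D1 -(limg_ker_dim (quot_pi Bd) Z); congr (\dim _ + _)%N.
apply/vspaceP=> x; rewrite memv_cap memv_ker quot_pi_eq0.
by case xB: (x \in Bd); rewrite ?andbF // andbT (subvP BZ).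
Qed.

Hypothesis rank_eq : forall k, \dim (limg (cobdry fr V k)) = \dim (limg (bdry fr V k)).
Local Notation kd := (@kerd F (fun k => C k) (bdry fr V)).
Local Notation id := (@imd F (fun k => C k) (bdry fr V)).
Local Notation ke := (@kere F (fun k => C k) (cobdry fr V)).
Local Notation ie := (@ime F (fun k => C k) (cobdry fr V)).
Local Notation bx := (@box F (fun k => C k) (bdry fr V) (cobdry fr V)).

Let kd_dim k : (\dim (kd k) + \dim (ie k) = \dim {:C k})%N.
Proof.
case: k => [|k]; first by rewrite dimv0 addn0.
by rewrite /ime rank_eq -(limg_ker_dim (bdry fr V k) fullv) capfv.
Qed.

Let ke_dim k : (\dim (ke k) + \dim (id k) = \dim {:C k})%N.
Proof. by rewrite /imd -rank_eq -(limg_ker_dim (cobdry fr V k) fullv) capfv. Qed.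

Let dim_d k := @homology_dim F _ _ _ k _ _ (imd_kerd bdryK k) (kerd_gimg (cobdry fr V) bdryK k)
  (@kerd_gpr F _ _ (cobdry fr V) bdryK k) (@imd_gpr F _ _ (cobdry fr V) bdryK k).
Let dim_e k := @homology_dim F _ _ _ k _ _ (ime_kere cobdryK k) (kere_gimg (bdry fr V) cobdryK k)
  (@kere_gpr F _ (bdry fr V) _ cobdryK k) (@ime_gpr F _ (bdry fr V) _ cobdryK k).

Let vanish_d : (forall k, C0 k <= kd k)%VS <-> (forall k, \dim (kd k) = \dim (id k) + \dim (C0 k))%N.
Proof.
split=> [H k|H k]; last by have [/(_ (H k))[]] := dim_d k.
by apply/dim_d; split=> //; move: k; apply/(imd_meet_kerd (cobdry fr V) bdryK).
Qed.

Let vanish_e : (forall k, C0 k <= ke k)%VS <-> (forall k, \dim (ke k) = \dim (ie k) + \dim (C0 k))%N.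
Proof.
split=> [H k|H k]; last by have [/(_ (H k))[]] := dim_e k.
by apply/dim_e; split=> //; move: k; apply/(ime_meet_kere (bdry fr V) cobdryK).
Qed.

(** Equal ranks make the Euler-type difference of dimensions, kernel minus image, the same for both
    differentials in each degree. Hence the two dimension counts characterising the inclusions hold
    simultaneously. *)
Let vanish_de : (forall k, C0 k <= kd k)%VS <-> (forall k, C0 k <= ke k)%VS.
Proof.
apply: (iff_trans vanish_d); apply: (iff_sym (iff_trans vanish_e _)).
have E k : (\dim (kd k) + \dim (ie k) = \dim (ke k) + \dim (id k))%N by rewrite kd_dim ke_dim.
split=> H k; have Ek := E k; rewrite (H k) in Ek.
  by apply: (@addnI (\dim (ie k))); rewrite addnC Ek addnA addnAC.
by apply: (@addnI (\dim (id k))); rewrite addnC -Ek addnA addnAC.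
Qed.

Let iso_d : (forall k, C0 k <= kd k)%VS <->
  forall k, lmod_iso l (homology fr V k) (quabla0_module fr V k).
Proof.
split=> [H k|H]; last by apply/vanish_d => k; apply: iso_dim (H k); apply: imd_kerd bdryK k.
have stB := @imd_gpr F _ _ (cobdry fr V) bdryK k; have stZ := @kerd_gpr F _ _ (cobdry fr V) bdryK k.
apply: subquot_iso => //; first exact: (imd_kerd bdryK k).
- by move: k {stB stZ}; apply/(imd_meet_kerd (cobdry fr V) bdryK).
- exact: (kerd_gimg (cobdry fr V) bdryK k).
move=> a x al; case: k {stB stZ} x => [|k] x; first by move=> _; apply: memvf.
by rewrite !memv_ker bdry_act // => /eqP->; rewrite lf0.
Qed.

Let iso_e : (forall k, C0 k <= ke k)%VS <->
  forall k, lmod_iso l (cohomology fr V k) (quabla0_module fr V k).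
Proof.
split=> [H k|H]; last by apply/vanish_e => k; apply: iso_dim (H k); apply: ime_kere cobdryK k.
have stB := @ime_gpr F _ (bdry fr V) _ cobdryK k; have stZ := @kere_gpr F _ (bdry fr V) _ cobdryK k.
apply: subquot_iso => //; first exact: (ime_kere cobdryK k).
- by move: k {stB stZ}; apply/(ime_meet_kere (bdry fr V) cobdryK).
- exact: (kere_gimg (bdry fr V) cobdryK k).
by move=> a x al; rewrite !memv_ker cobdry_act // => /eqP->; rewrite lf0.
Qed.

Theorem kostant_equivalences :
  [<-> forall k, (im_bdry fr V k :&: ker_quabla fr V k = 0)%VS;
       forall k, (im_bdry fr V k :&: quabla0 fr V k = 0)%VS;
       forall k, (quabla0 fr V k <= ker_bdry fr V k)%VS;
       forall k, lmod_iso l (homology fr V k) (quabla0_module fr V k);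
       forall k, (im_cobdry fr V k :&: ker_quabla fr V k = 0)%VS;
       forall k, lmod_iso l (cohomology fr V k) (quabla0_module fr V k);
       forall k, (ker_cobdry fr V k :&: im_bdry fr V k = 0)%VS
                 /\ (ker_bdry fr V k :&: im_cobdry fr V k = 0)%VS].
Proof.
have smd k := @stable_meet F _ _ (cobdry fr V) k _ (@imd_box F _ _ (cobdry fr V) bdryK k).
have sme k := @stable_meet F _ (bdry fr V) _ k _ (@ime_box F _ (bdry fr V) _ cobdryK k).
have d12 : (forall k, id k :&: lker (bx k) = 0)%VS <-> (forall k, C0 k <= kd k)%VS.
  apply: iff_trans (imd_meet_kerd (cobdry fr V) bdryK).
  by split=> H k; apply/smd.
have e12 : (forall k, ie k :&: lker (bx k) = 0)%VS <-> (forall k, C0 k <= ke k)%VS.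
  apply: iff_trans (ime_meet_kere (bdry fr V) cobdryK).
  by split=> H k; apply/sme.
have dj := disjoint_meet bdryK cobdryK.
split; [|split; [|split; [|split; [|split; [|split]]]]].
- by move=> H k; apply/smd.
- by move/(imd_meet_kerd (cobdry fr V) bdryK).
- by move/iso_d.
- by move/iso_d/vanish_de/e12.
- by move/e12/iso_e.
- by move/iso_e => H; apply/dj; split; [apply/d12/vanish_de|apply/e12].
- by move/dj => [].
Qed.
End Chains.

(** * Diagonalisable and nilpotent operators, Engel's theorem *)

Section Eigenvectors.
Variables (F : fieldType) (W : vectType F) (f : 'End(W)).

(** The polynomial in [f] with roots [cs], applied to [u]. Such products take the place of
    projections to eigenspaces. *)
Definition eigprod (cs : seq F) (u : W) : W := foldr (fun c w => f w - c *: w) u cs.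

Lemma eigprod_linear cs : linear (eigprod cs).
Proof.
by elim: cs => [|c cs IH] a u v //=; rewrite IH lfD lfZ; lincomb.
Qed.
HB.instance Definition _ cs := GRing.isLinear.Build F W W *:%R (eigprod cs) (eigprod_linear cs).

Lemma eigprod_eig cs c w : f w = c *: w -> eigprod cs w = (\prod_(b <- cs) (c - b)) *: w.
Proof.
move=> fw; elim: cs => [|b cs IH]; rewrite ?big_nil ?scale1r // big_cons /= IH lfZ fw.
by lincomb.
Qed.

Lemma eigprod_stable cs (U : {vspace W}) u :
  (forall w, w \in U -> f w \in U) -> u \in U -> eigprod cs u \in U.
Proof. by move=> fU uU; elim: cs => //= c cs IH; rewrite memvB ?memvZ ?fU. Qed.

(** Lagrange interpolation: [r^-1 *: w] is the component of [u] with eigenvalue [c]; after its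
    removal the shorter product kills the vector. *)
Lemma eigprod_split (U K : {vspace W}) cs u : uniq cs ->
  (forall w, w \in U -> f w \in U) -> (forall w c, w \in U -> f w = c *: w -> w \in K) ->
  u \in U -> eigprod cs u = 0 -> u \in K.
Proof.
move=> + fU UK; elim: cs u => [|c cs IH] u /=; first by move=> _ _ ->; rewrite mem0v.
case/andP=> ccs ucs uU /eqP; rewrite subr_eq0 => /eqP E; set w := eigprod cs u in E.
have wU : w \in U by apply: eigprod_stable.
have wK := UK _ _ wU E; pose r := \prod_(b <- cs) (c - b).
have r0 : r != 0.
  apply/negP=> /eqP; rewrite /r => /eqP; rewrite prodf_seq_eq0 => /hasP[b bcs /=].
  by rewrite subr_eq0 => /eqP cb; rewrite cb bcs in ccs.
rewrite -[u](subrK (r^-1 *: w)) memvD ?memvZ //; apply: IH => //; first by rewrite memvB ?memvZ.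
by rewrite linearB linearZ /= (eigprod_eig _ E) -/w -/r scalerA mulVf // scale1r subrr.
Qed.

Definition eigenspanned (X : seq W) :=
  <<X>>%VS = fullv /\ forall v, v \in X -> exists c, f v = c *: v.

Lemma diag_eigprod X : eigenspanned X -> exists2 cs, uniq cs & forall u, eigprod cs u = 0.
Proof.
case=> spanX eigX.
have [cs ucs H] : exists2 cs, uniq cs & forall v, v \in X -> exists2 c, c \in cs & f v = c *: v.
  elim: (X) eigX => [|v s IH] eigX; first by exists [::].
  have [|cs ucs H] := IH; first by move=> w ws; apply: eigX; rewrite inE ws orbT.
  have [c fv] := eigX v (mem_head _ _); exists (undup (c :: cs)); first exact: undup_uniq.
  move=> w; rewrite inE => /predU1P[->|ws]; first by exists c; rewrite ?mem_undup ?mem_head.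
  by have [b bcs fw] := H w ws; exists b; rewrite ?mem_undup ?inE ?bcs ?orbT.
exists cs => // u; suff /subvP/(_ u) : (fullv <= lker (linfun (eigprod cs)))%VS.
  by rewrite memvf memv_ker lfunE => /(_ isT)/eqP.
rewrite -spanX; apply/span_subvP=> v /H[c ccs fv]; rewrite memv_ker lfunE /= (eigprod_eig _ fv).
by rewrite (big_rem c) //= subrr mul0r scale0r.
Qed.

(* A stable subspace is spanned by the eigenvectors it contains. *)
Lemma diag_sub X (U K : {vspace W}) : eigenspanned X ->
  (forall w, w \in U -> f w \in U) -> (forall w c, w \in U -> f w = c *: w -> w \in K) ->
  (U <= K)%VS.
Proof.
move=> /diag_eigprod[cs ucs cs0] fU UK; apply/subvP=> u uU.
exact: eigprod_split ucs fU UK uU (cs0 u).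
Qed.

(** The product over the other eigenvalues kills the members of [X] with eigenvalue different from
    [c], while on [u] it is a non-zero scalar. *)
Lemma diag_eigenspace X c u : eigenspanned X -> f u = c *: u ->
  u \in <<[seq v <- X | f v == c *: v]>>%VS.
Proof.
move=> dX fu; have [spanX eigX] := dX; have [cs ucs cs0] := diag_eigprod dX.
pose cs' := rem c cs; pose r := \prod_(b <- cs') (c - b).
have r0 : r != 0.
  apply/negP=> /eqP; rewrite /r => /eqP; rewrite prodf_seq_eq0 => /hasP[b bcs /=].
  rewrite subr_eq0 => /eqP cb; move: bcs; rewrite -cb /cs' mem_rem_uniq // inE eqxx //.
rewrite -[u](scalerK r0) memvZ // -(eigprod_eig cs' fu).
suff /subvP/(_ u) : (fullv <= linfun (eigprod cs') @^-1: <<[seq v <- X | f v == c *: v]>>)%VS.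
  by rewrite memvf -memv_preim lfunE; apply.
rewrite -spanX; apply/span_subvP=> v vX; rewrite -memv_preim lfunE /=.
have [b fv] := eigX v vX; rewrite (eigprod_eig _ fv).
have [bc|bc] := eqVneq b c; first by apply/memvZ/memv_span; rewrite mem_filter fv bc eqxx.
have [v0|v0] := eqVneq v 0; first by rewrite v0 scaler0 mem0v.
have bcs : b \in cs'.
  rewrite /cs' mem_rem_uniq // inE bc /=; apply: contraT => nb.
  have := cs0 v; rewrite (eigprod_eig _ fv) => /eqP; rewrite scaler_eq0 (negbTE v0) orbF.
  by rewrite prodf_seq_eq0 => /hasP[d dcs /=]; rewrite subr_eq0 => /eqP bd; rewrite bd dcs in nb.
by rewrite (big_rem b) //= subrr mul0r scale0r mem0v.
Qed.

Lemma eig_bound (e : nat -> F) (w : nat -> W) n : injective e ->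
  (forall k, (k < n)%N -> f (w k) = e k *: w k) -> (forall k, (k < n)%N -> w k != 0) ->
  (n <= \dim {:W})%N.
Proof.
move=> ie fw w0; pose U m := <<[seq w k | k <- iota 0 m]>>%VS.
suff H m : (m <= n)%N -> (m <= \dim (U m))%N by apply: leq_trans (H n (leqnn n)) (dimvS (subvf _)).
elim: m => // m IH mn; apply: leq_ltn_trans (IH (ltnW mn)) _.
have -> : U m.+1 = (U m + <[w m]>)%VS.
  by rewrite /U -addn1 iotaD map_cat span_cat /= span_seq1.
rewrite (ltn_leqif (dimv_leqif_sup (addvSl _ _))) subv_add subvv /=.
apply/negP=> wU; pose cs := [seq e k | k <- iota 0 m].
have H0 : (U m <= lker (linfun (eigprod cs)))%VS.
  apply/span_subvP=> v /mapP[k + ->]; rewrite mem_iota => /andP[_ km].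
  rewrite memv_ker lfunE /= (eigprod_eig _ (fw k (ltn_trans km mn))).
  by rewrite (big_rem (e k)) ?map_f ?mem_iota //= subrr mul0r scale0r.
have := subvP H0 (w m) (subvP wU _ (memv_line _)).
rewrite memv_ker lfunE /= (eigprod_eig _ (fw m mn)) scaler_eq0 (negbTE (w0 m mn)) orbF.
rewrite prodf_seq_eq0 => /hasP[_ /mapP[k + ->]] /=; rewrite mem_iota subr_eq0 => /andP[_ km] /eqP/ie E.
by rewrite -E ltnn in km.
Qed.
End Eigenvectors.

Import VectorInternalTheory.
Section NilpotentOperators.
Variables (F : numClosedFieldType) (W : vectType F).

(** The powers of [x] are eigenvectors of the commutator with [t] for the distinct eigenvalues
    [k%:R * c], so only finitely many of them are non-zero. *)
Lemma comm_nilpotent (t x : 'End(W)) c : c != 0 -> (forall v, t (x v) = x (t v) + c *: x v) ->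
  exists n, forall v, itn x n v = 0.
Proof.
move=> c0 tx; pose ad (y : 'End(W)) : 'End(W) := ((t \o y) - (y \o t))%VF.
have lin : linear ad.
  move=> a y z; apply/lfunP=> v; rewrite /ad !(add_lfunE, opp_lfunE, scale_lfunE, comp_lfunE, lfD, lfZ).
  lincomb.
pose A1 := GRing.isLinear.Build _ _ _ _ _ lin.
pose h : {linear _ -> _} := HB.pack ad A1.
have adx k : linfun h (itn x k) = (k%:R * c) *: itn x k.
  rewrite lfunE /=; apply/lfunP=> v; rewrite /ad !(add_lfunE, opp_lfunE, scale_lfunE, comp_lfunE).
  elim: k v => [|k IH] v; first by rewrite !itn0 mul0r scale0r subrr.
  rewrite !itnS tx; have -> : t (itn x k v) = itn x k (t v) + (k%:R * c) *: itn x k v.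
    by rewrite -IH addrC subrK.
  by rewrite lfD lfZ -natr1; lincomb.
pose N := \dim {: 'End(W)}.
have [/existsP[n /eqP xn]|/existsPn H] := boolP [exists n : 'I_N.+1, itn x n == 0].
  by exists n => v; rewrite xn zero_lfunE.
suff : (N < N)%N by rewrite ltnn.
apply: (@eig_bound _ _ (linfun h) (fun k => k%:R * c) (itn x)) => [j k /(mulIf c0)|k _|k kN].
- by move/eqP; rewrite eqr_nat => /eqP.
- exact: adx.
exact: H (Ordinal kN).
Qed.

Lemma eigenvector_in (U : {vspace W}) (f : 'End(W)) : U != 0%VS ->
  (forall w, w \in U -> f w \in U) -> exists c, exists2 w, w \in U & w != 0 /\ f w = c *: w.
Proof.
move=> U0 fU; pose f' : 'End(subvs_of U) := (linfun (vsproj U) \o f \o linfun vsval)%VF.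
have f'E u : vsval (f' u) = f (vsval u) by rewrite /f' !comp_lfunE !lfunE /= vsprojK ?fU ?subvsP.
have dU : (0 < \dim U)%N by rewrite lt0n dimv_eq0.
have d0 : (0 < dim (subvs_of U))%N by rewrite -dimvf dimvf.
have [c /eigenvalueP[v vA v0]] := eigenvalue_closed (f2mx f') d0.
have Ev : f' (r2v v) = c *: r2v v.
  by apply: v2r_inj; rewrite linearZ /= r2vK -vA unlock /= !r2vK.
exists c, (vsval (r2v v)); first exact: subvsP.
split; last by rewrite -f'E Ev linearZ.
apply: contraNneq v0 => E; have : r2v v = 0 :> subvs_of U by rewrite -[r2v v]vsvalK E linear0.
by move/(congr1 v2r); rewrite r2vK linear0 => ->.
Qed.

Lemma common_eigenvector_in (ops : seq 'End(W)) (U : {vspace W}) : U != 0%VS ->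
  (forall f w, f \in ops -> w \in U -> f w \in U) ->
  (forall f h w, f \in ops -> h \in ops -> w \in U -> f (h w) = h (f w)) ->
  exists2 w, w \in U & w != 0 /\ forall f, f \in ops -> exists c, f w = c *: w.
Proof.
elim: ops U => [|f ops IH] U U0 fU fC.
  exists (vpick U); first exact: memv_pick.
  by rewrite vpick0.
have [w|c [w wU [w0 fw]]] := eigenvector_in U0 (f := f); first by apply: fU; rewrite mem_head.
pose U' := (U :&: lker (f - c *: \1%VF)%R)%VS.
have mU' u : (u \in U') = (u \in U) && (f u == c *: u).
  by rewrite memv_cap memv_ker add_lfunE opp_lfunE scale_lfunE id_lfunE subr_eq0.
have wU' : w \in U' by rewrite mU' wU fw eqxx.
have [|h u hops|h h' u hops h'ops|u] := IH U'.
- by apply: contraNneq w0 => E; rewrite -memv0 -E.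
- rewrite !mU' => /andP[uU /eqP fu]; rewrite fU ?inE ?hops ?orbT //=.
  by rewrite fC ?inE ?hops ?eqxx ?orbT // fu linearZ.
- by rewrite mU' => /andP[uU _]; apply: fC; rewrite // inE ?hops ?h'ops orbT.
rewrite mU' => /andP[uU /eqP fu] [u0 H]; exists u => //; split=> // h.
by rewrite inE => /predU1P[->|/H //]; exists c.
Qed.
End NilpotentOperators.

Section Engel.
Variables (F : numClosedFieldType) (g : lieSuperalgebra F).
Local Notation part := (lsa_part g).

Definition adjoint : actspace g :=
  {| as_vect := lsa_vect g; as_part := @lsa_part F g; as_act := @lsa_br F g |}.

Lemma adjoint_module : is_module adjoint.
Proof.
split; [exact: lsa_dec|exact: lsa_br_linear|exact: lsa_br_part|].
by move=> p q x y v xp yq /=; rewrite (lsa_br_jacobi v xp yq) addrK.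
Qed.

Definition graded (U : {vspace g}) :=
  forall x, x \in U -> exists x0 x1, [/\ x = x0 + x1, x0 \in U, x1 \in U, x0 \in part false & x1 \in part true].

Lemma graded_subP U : graded_sub (@lsa_part F g) U <-> graded U.
Proof.
split=> [E x|gU].
  rewrite {1}E => /memv_addP[x0 /[!memv_cap]/andP[l0 h0] [x1 /[!memv_cap]/andP[l1 h1] ->]].
  by exists x0, x1.
apply/eqP; rewrite eqEsubv subv_add !capvSl !andbT; apply/subvP=> x /gU[x0 [x1 [-> l0 l1 h0 h1]]].
by rewrite memv_add // memv_cap ?l0 ?l1.
Qed.

(** No grading on [V] is required: the dual and the product used for the contravariant form then
    qualify with a dummy [as_part]. *)
Definition is_action (V : actspace g) :=
  linear (as_act V) /\
  forall (p q : bool) x y v, x \in part p -> y \in part q ->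
    as_act V (bracket x y) v = as_act V x (as_act V y v)
      - (-1) ^+ (p && q) *: as_act V y (as_act V x v).

Lemma module_action V : is_module V -> is_action V.
Proof. by case. Qed.

Section ModuleSpan.
Variable V : actspace g.
Hypothesis modV : is_action V.
Local Notation act := (as_act V).

Lemma actD x y v : act (x + y) v = act x v + act y v.
Proof. by have [lin _] := modV; have := lin 1 x y; rewrite !scale1r => ->; rewrite add_lfunE. Qed.
Lemma act0 v : act 0 v = 0.
Proof. by apply: (addIr (act 0 v)); rewrite -actD !add0r. Qed.
Lemma actZ c x v : act (c *: x) v = c *: act x v.
Proof. by have [lin _] := modV; have := lin c x 0; rewrite addr0 => ->; rewrite add_lfunE scale_lfunE act0 addr0. Qed.
Lemma act_bracket (p s : bool) x y v : x \in part p -> y \in part s ->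
  act (bracket x y) v = act x (act y v) - (-1) ^+ (p && s) *: act y (act x v).
Proof. by case: modV => _; apply. Qed.

Definition actsp (N : {vspace g}) (U : {vspace V}) : {vspace V} :=
  (\sum_(i < \dim N) (act (tnth (vbasis N) i) @: U))%VS.

Lemma mem_actsp (N : {vspace g}) (U : {vspace V}) x u : x \in N -> u \in U -> act x u \in actsp N U.
Proof.
move=> xN uU; rewrite (coord_vbasis xN).
have -> : act (\sum_i coord (vbasis N) i x *: (vbasis N)`_i) u =
  \sum_i coord (vbasis N) i x *: act (vbasis N)`_i u.
  by elim/big_rec2: _ => [|i a b _ <-]; rewrite ?act0 // actD actZ.
apply: memv_suml => i _; apply/memvZ/(subvP (sumv_sup i isT (subvv _))).
by rewrite -tnth_nth memv_img.
Qed.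

Lemma actsp_sub (N : {vspace g}) (U K : {vspace V}) : (forall x u, x \in N -> u \in U -> act x u \in K) ->
  (actsp N U <= K)%VS.
Proof.
move=> H; apply/subv_sumP=> i _; apply/subvP=> _ /memv_imgP[u uU ->]; apply: H => //.
by apply: vbasis_mem; apply: mem_tnth.
Qed.

Lemma actspS (N N' : {vspace g}) (U U' : {vspace V}) : (N <= N')%VS -> (U <= U')%VS -> (actsp N U <= actsp N' U')%VS.
Proof. by move=> NN UU; apply: actsp_sub => x u xN uU; apply: mem_actsp; [apply: (subvP NN)|apply: (subvP UU)]. Qed.

Definition nilpotent_on (N : {vspace g}) := exists M, iter M (actsp N) fullv = 0%VS.

End ModuleSpan.

Variable t : g.
Hypothesis t_even : t \in part false.
Variable X : seq g.
Hypothesis t_diag : eigenspanned (lsa_br t) X.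

Lemma root_nilpotent (V : actspace g) c y : is_action V -> c != 0 -> bracket t y = c *: y ->
  exists n, forall v, itn (as_act V y) n v = 0.
Proof.
move=> modV c0 ty; apply: (comm_nilpotent (t := as_act V t) c0) => v.
have [y0 [y1 [Ey h0 h1]]] := homog_sum y.
have := act_bracket modV v t_even h0; have := act_bracket modV v t_even h1; rewrite !scale1r => E1 E0.
have : as_act V (bracket t y) v = c *: as_act V y v by rewrite ty (actZ modV).
rewrite Ey bracketDr (actD modV) E0 E1 !(actD modV) lfD => <-; lincomb.
Qed.

(* Enlarging a nilpotent ideal of codimension one by a root vector. *)
Lemma nilpotent_grow (V : actspace g) (N : {vspace g}) q y c : is_action V -> c != 0 ->
  bracket t y = c *: y -> y \in part q -> graded N -> (forall x, x \in N -> bracket y x \in N) ->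
  nilpotent_on V N -> nilpotent_on V (N + <[y]>).
Proof.
move=> modV c0 ty yq gN yN [M HM]; have [n yn] := root_nilpotent modV c0 ty.
pose U i : {vspace V} := iter i (actsp N) fullv.
have yU i u : u \in U i -> as_act V y u \in U i.
  elim: i u => [|i IH] u; first by move=> _; exact: memvf.
  move=> uU; have : (U i.+1 <= as_act V y @^-1: U i.+1)%VS.
    apply: actsp_sub => x w xN wU; rewrite -memv_preim.
    have [x0 [x1 [-> l0 l1 h0 h1]]] := gN x xN; rewrite (actD modV) lfD.
    have H r z : z \in N -> z \in part r -> as_act V y (as_act V z w) \in U i.+1.
      move=> zN zr; have := act_bracket modV w yq zr; move/eqP; rewrite eq_sym subr_eq => /eqP ->.
      by rewrite memvD ?memvZ // mem_actsp ?yN ?IH.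
    by rewrite memvD ?(H _ _ l0 h0) ?(H _ _ l1 h1).
  by move/subvP/(_ _ uU); rewrite -memv_preim.
have US i : (U i.+1 <= U i)%VS.
  by elim: i => [|i IH]; [apply: subvf|apply: actspS].
have yiU i j u : u \in U i -> itn (as_act V y) j u \in U i.
  by move=> uU; elim: j => [|j IH]; rewrite ?itn0 // itnS yU.
(* Modulo [U i.+1] only the contributions of [y] survive, and [n] of them vanish; so [n] operators
   from [N + <[y]>] carry [U i] into [U i.+1]. *)
have step i j : (iter j (actsp (N + <[y]>)) (U i) <= U i.+1 + itn (as_act V y) j @: U i)%VS.
  elim: j => [|j IH].
    rewrite /= -[X in (X <= _)%VS]add0v; apply: addvS (sub0v _) _.
    by apply/subvP=> u uU; apply/memv_imgP; exists u; rewrite ?id_lfunE.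
  apply: subv_trans (actspS modV (subvv _) IH) _.
  apply: actsp_sub => _ _ /memv_addP[x xN [_ /vlineP[k ->] ->]] /memv_addP[w wU [_ /memv_imgP[u uU ->] ->]].
  rewrite (actD modV) (actZ modV) !lfD !scalerDr -itnS.
  have H1 z : z \in U i -> as_act V x z \in (U i.+1 + itn (as_act V y) j.+1 @: U i)%VS.
    by move=> zU; apply: (subvP (addvSl _ _)); apply: mem_actsp.
  apply: memvD; first by apply: memvD; apply: H1; [apply: (subvP (US i))|apply: yiU].
  apply: memvD; first by apply/memvZ/(subvP (addvSl _ _))/yU.
  by apply/memvZ/(subvP (addvSr _ _))/memv_img.
have step' i : (iter n (actsp (N + <[y]>)) (U i) <= U i.+1)%VS.
  apply: subv_trans (step i n) _; rewrite subv_add subvv; apply/subvP=> _ /memv_imgP[u _ ->].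
  by rewrite yn mem0v.
exists (M * n)%N; apply/eqP; rewrite -subv0 -HM -/(U M); elim: (M) => [|m IH]; first exact: subvf.
rewrite mulSn iterD; apply: subv_trans (step' m).
have mono j (A B : {vspace V}) : (A <= B)%VS -> (iter j (actsp (N + <[y]>)) A <= iter j (actsp (N + <[y]>)) B)%VS.
  by move=> AB; elim: j => //= j; apply: actspS.
exact: mono.
Qed.

(** A subalgebra already known to act nilpotently is enlarged by one vector normalising it, which is
    chosen to be an eigenvector of [t]. Its eigenvalue is non-zero as [t] centralises nothing in
    [N], and so it acts nilpotently by itself. *)
Lemma engel (N : {vspace g}) (V : actspace g) : (N <= part false)%VS -> br_sub N N N ->
  (forall x, x \in N -> bracket t x \in N) -> (forall x, x \in N -> bracket t x = 0 -> x = 0) ->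
  is_action V -> nilpotent_on V N.
Proof.
move=> N0 NN tN Nt modV.
(* Nilpotency is demanded on all actions at once: that on the adjoint one serves to find the next
   vector. *)
pose good (m : {vspace g}) := [/\ (m <= N)%VS, br_sub m m m, forall x, x \in m -> bracket t x \in m
  & forall W, is_action W -> nilpotent_on W m].
suff H k m : good m -> (\dim N - \dim m < k)%N -> nilpotent_on V N.
  have /H/(_ (leqnn _)) // : good 0%VS.
  split; first exact: sub0v.
  - by move=> x y; rewrite !memv0 => /eqP-> _; rewrite bracket0l.
  - by move=> x; rewrite memv0 => /eqP->; rewrite bracket0r mem0v.
  move=> W aW; exists 1%N; apply/eqP; rewrite -subv0 /=; apply: actsp_sub => x u.
  by rewrite memv0 => /eqP-> _; rewrite (act0 aW) mem0v.
elim: k m => // k IH m [mN mm tm nilm] dm.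
have [Nm|Nm] := boolP (N <= m)%VS.
  have -> : N = m by apply/eqP; rewrite eqEsubv Nm mN.
  exact: nilm.
have aA := module_action adjoint_module; have [M HM] := nilm _ aA.
pose C i : {vspace g} := iter i (@actsp adjoint m) N.
have CN i : (C i <= N)%VS.
  elim: i => [|i IHi]; first exact: subvv.
  by apply: (@actsp_sub adjoint m (C i) N) => x u xm uC; apply: NN; [apply: (subvP mN)|apply: (subvP IHi)].
have tC i x : x \in C i -> bracket t x \in C i.
  elim: i x => [|i IHi] x; first exact: tN.
  suff /subvP H : (C i.+1 <= lsa_br t @^-1: C i.+1)%VS by move=> /H; rewrite -memv_preim.
  apply: (@actsp_sub adjoint m (C i)) => y u ym uC; rewrite -memv_preim /=.
  have y0 := subvP N0 _ (subvP mN _ ym).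
  rewrite (lsa_br_jacobi u t_even y0) scale1r memvD //.
    by apply: (mem_actsp aA) => //; apply: tm.
  by apply: (mem_actsp aA) => //; apply: IHi.
(* Acting repeatedly by [m] shrinks [N] to zero. Vectors of the last term not inside [m] are sent
   into [m] by [m], that is, they normalise it. *)
have [i Ci Ci1] : exists2 i, ~~ (C i <= m)%VS & (C i.+1 <= m)%VS.
  have : (C M <= m)%VS.
    apply: subv_trans (sub0v m); rewrite -HM /C; elim: (M) => [|j IHj]; [exact: subvf|exact: (actspS aA)].
  elim: M {HM} => [|M IHM] HM; first by rewrite HM in Nm.
  by have [/IHM//|] := boolP (C M <= m)%VS; exists M.
have [y [c [yC ym ty]]] : exists y c, [/\ y \in C i, y \notin m & bracket t y = c *: y].
  apply: contrapT => H; case/negP: Ci; apply: (diag_sub t_diag) => [w|w c wC tw]; first exact: tC.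
  by apply: contrapT => wm; apply: H; exists w, c; split=> //; apply/negP.
have yN := subvP (CN i) _ yC.
have y0 : y != 0 by apply: contraNneq ym => ->; rewrite mem0v.
have c0 : c != 0 by apply: contraNneq y0 => c0; apply/eqP/Nt; rewrite // ty c0 scale0r.
have skew x : x \in N -> bracket y x = - bracket x y.
  by move=> xN; rewrite /bracket (lsa_br_skew (subvP N0 _ yN) (subvP N0 _ xN)) scale1r.
have my x : x \in m -> bracket x y \in m.
  by move=> xm; apply: (subvP Ci1); apply: (mem_actsp aA).
have ymm x : x \in m -> bracket y x \in m.
  by move=> xm; rewrite skew ?memvN ?my // (subvP mN).
apply: (IH (m + <[y]>)%VS); last first.
  have : (\dim m < \dim (m + <[y]>))%N.
    by rewrite (ltn_leqif (dimv_leqif_sup (addvSl _ _))) subv_add subvv.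
  have : (\dim (m + <[y]>) <= \dim N)%N by apply: dimvS; rewrite subv_add mN.
  by move: dm; clear; lia.
split.
- by rewrite subv_add mN.
- move=> _ _ /memv_addP[a am [_ /vlineP[k1 ->] ->]] /memv_addP[b bm [_ /vlineP[k2 ->] ->]].
  apply: (subvP (addvSl _ _)).
  have yy : bracket y y = 0.
    by have := skew y yN; move/eqP; rewrite -addr_eq0 -mulr2n -scaler_nat scaler_eq0 pnatr_eq0 /= => /eqP.
  by rewrite !(bracketDl, bracketDr, bracketZl, bracketZr) yy !scaler0 addr0; do ?[exact: mm|exact: my|exact: ymm|apply: memvD|apply: memvZ].
- move=> _ /memv_addP[a am [_ /vlineP[k1 ->] ->]].
  by rewrite bracketDr bracketZr ty memv_add ?tm // !memvZ ?memv_line.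
move=> W aW; apply: (nilpotent_grow aW c0 ty (subvP N0 _ yN)) => [x xm|//|]; last exact: nilm.
by exists x, 0; rewrite addr0 !mem0v xm; split=> //; apply/(subvP N0)/(subvP mN).
Qed.
End Engel.

(** On the line of the vectors [u + n z] each subspace not containing [z] holds at most one point,
    so a large integer avoids all the subspaces treated before, and [u] takes care of the new
    one. *)
Lemma avoid_subspaces (F : numFieldType) (vT : vectType F) (s : {vspace vT}) (Ks : seq {vspace vT}) :
  (forall K, K \in Ks -> ~~ (s <= K)%VS) ->
  exists2 z, z \in s & forall K, K \in Ks -> z \notin K.
Proof.
elim: Ks => [|K Ks IH] H; first by exists 0; rewrite ?mem0v.
have [|z zs zKs] := IH; first by move=> L LK; apply: H; rewrite inE LK orbT.
have [zK|zK] := boolP (z \in K); last by exists z => // L; rewrite inE => /predU1P[->|/zKs].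
have /subvPn[u us uK] := H K (mem_head _ _).
have [M HM] : exists M, forall n L, (M <= n)%N -> L \in Ks -> u + n%:R *: z \notin L.
  elim: (Ks) zKs => [|L Ls IHL] zL; first by exists 0%N.
  have [|M HM] := IHL; first by move=> K' K'L; apply: zL; rewrite inE K'L orbT.
  have [[m um]|no] := EM (exists m, u + m%:R *: z \in L); last first.
    exists M => n L' Mn; rewrite inE => /predU1P[->|]; last exact: HM.
    by apply/negP=> h; apply: no; exists n.
  exists (maxn M m.+1) => n L'; rewrite geq_max => /andP[Mn mn].
  rewrite inE => /predU1P[->|]; last exact: HM.
  apply/negP=> un; have /negP := zL L (mem_head _ _); apply.
  have E : (u + n%:R *: z) - (u + m%:R *: z) = (n - m)%:R *: z.
    by rewrite natrB ?(ltnW mn) //; lincomb.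
  have : (n - m)%:R *: z \in L by rewrite -E memvB.
  by move/(memvZ (n - m)%:R^-1); rewrite scalerK // pnatr_eq0 subn_eq0 -ltnNge.
exists (u + M%:R *: z); first by rewrite memvD ?memvZ.
move=> L; rewrite inE => /predU1P[->|LK]; last exact: HM.
by apply: contra uK => h; rewrite -[u](addrK (M%:R *: z)) memvB ?memvZ.
Qed.

(** * Exponentials and conjugacy of Cartan subalgebras *)

Section Automorphisms.
Variables (F : numClosedFieldType) (g : lieSuperalgebra F).
Local Notation part := (lsa_part g).

Record even_auto (th : 'End(g)) : Prop := EvenAuto {
  ea_inj : forall x, th x = 0 -> x = 0;
  ea_part : forall (p : bool) x, x \in part p -> th x \in part p;
  ea_br : forall x y, th (bracket x y) = bracket (th x) (th y) }.

Lemma even_auto_id : even_auto \1%VF.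
Proof. by split=> [x|p x|x y]; rewrite !id_lfunE. Qed.

Lemma even_auto_comp th th' : even_auto th -> even_auto th' -> even_auto (th \o th')%VF.
Proof.
move=> [i p b] [i' p' b']; split=> [x|q x xq|x y]; rewrite !comp_lfunE; [by move/i/i'| |by rewrite b' b].
by apply/p/p'.
Qed.

Lemma even_auto_ker th : even_auto th -> lker th == 0%VS.
Proof.
by move=> [i _ _]; rewrite -subv0; apply/subvP=> x; rewrite memv_ker memv0 => /eqP/i->.
Qed.

Lemma even_autoK th : even_auto th -> cancel th (th^-1)%VF.
Proof. by move/even_auto_ker; exact: lker0_lfunK. Qed.
Lemma even_autoVK th : even_auto th -> cancel (th^-1)%VF th.
Proof. by move/even_auto_ker; exact: lker0_lfunVK. Qed.

Lemma even_auto_inv th : even_auto th -> even_auto (th^-1)%VF.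
Proof.
move=> eth; have [i p b] := eth; have K := even_autoK eth; have VK := even_autoVK eth; split.
- by move=> x E; rewrite -(VK x) E lf0.
- move=> q x xq; have [y0 [y1 [E h0 h1]]] := homog_sum (th^-1%VF x).
  have Ex : x = th y0 + th y1 by rewrite -lfD -E VK.
  case: q xq => xq.
    have [|||z0 _] := @homog_sum0 _ _ (th y0) (th y1 - x); rewrite ?memvB ?p //.
      by rewrite addrA -Ex subrr.
    by rewrite E (i _ z0) add0r.
  have [|||_ z1] := @homog_sum0 _ _ (th y0 - x) (th y1); rewrite ?memvB ?p //.
    by rewrite addrAC -Ex subrr.
  by rewrite E (i _ z1) addr0.
by move=> x y; apply: (can_inj K); rewrite b !VK.
Qed.

Section Exponential.
Variables (y : g) (n : nat).
Hypothesis y0 : y \in part false.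
Hypothesis yn : forall v, itn (lsa_br y) n v = 0.
Local Notation D := (lsa_br y).

Lemma even_deriv a b : D (bracket a b) = bracket (D a) b + bracket a (D b).
Proof.
have [a0 [a1 [-> h0 h1]]] := homog_sum a.
rewrite bracketDl !lfD !bracketDl /bracket (lsa_br_jacobi b y0 h0) (lsa_br_jacobi b y0 h1) !scale1r.
by rewrite addrACA.
Qed.

Definition divpow k : 'End(g) := k`!%:R^-1 *: itn D k.

Lemma divpowE k x : divpow k x = k`!%:R^-1 *: itn D k x.
Proof. exact: scale_lfunE. Qed.
Lemma divpowS k x : k.+1%:R *: divpow k.+1 x = D (divpow k x).
Proof.
rewrite !divpowE itnS lfZ scalerA factS natrM invfM mulrA divff ?mul1r ?pnatr_eq0 //.
Qed.
Lemma itn_big k x : (n <= k)%N -> itn D k x = 0.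
Proof. by move=> nk; rewrite -(subnK nk) itnD yn lf0. Qed.
Lemma divpow_big k x : (n <= k)%N -> divpow k x = 0.
Proof. by move=> nk; rewrite divpowE itn_big // scaler0. Qed.
Lemma divpow0 x : divpow 0 x = x.
Proof. by rewrite divpowE itn0 fact0 invr1 scale1r. Qed.

Lemma leibniz k a b : divpow k (bracket a b) = \sum_(i < k.+1) bracket (divpow i a) (divpow (k - i) b).
Proof.
elim: k => [|k IH]; first by rewrite big_ord1 !divpow0.
apply: (@scalerI _ _ k.+1%:R); first by rewrite pnatr_eq0.
rewrite divpowS IH lf_sum scaler_sumr.
pose G i := bracket (divpow i a) (divpow (k.+1 - i) b).
transitivity (\sum_(i < k.+2) (i%:R *: G i) + \sum_(i < k.+2) ((k.+1 - i)%:R *: G i)).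
  rewrite [X in _ = X + _]big_ord_recl [X in _ = _ + X]big_ord_recr /= subnn !mulr0n !scale0r add0r addr0 -big_split /=.
  apply: eq_bigr => i _; rewrite even_deriv -!divpowS bracketZl bracketZr /G /bump /= add1n subSS.
  by rewrite subSn // -ltnS.
rewrite -big_split /=; apply: eq_bigr => i _; rewrite -scalerDl -natrD subnKC //.
by rewrite -ltnS.
Qed.

Definition expad : 'End(g) := \sum_(k < n) divpow k.

Lemma sum_trunc (h : nat -> g) a b : (a <= b)%N -> (forall j, (a <= j)%N -> h j = 0) ->
  \sum_(j < b) h j = \sum_(j < a) h j.
Proof.
move=> /subnK <- h0; rewrite addnC big_split_ord /= [X in _ + X]big1 ?addr0 // => i _.
by rewrite h0 ?leq_addr.
Qed.

Lemma triangle_sum (f : nat -> nat -> g) M :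
  \sum_(k < M) \sum_(i < k.+1) f i (k - i)%N = \sum_(i < M) \sum_(j < M - i) f i j.
Proof.
elim: M => [|M IH]; first by rewrite !big_ord0.
rewrite big_ord_recr /= IH [RHS]big_ord_recr /= subSnn big_ord1 big_ord_recr /= subnn addrA.
congr (_ + _); rewrite -big_split /=; apply: eq_bigr => i _.
by rewrite subSn ?big_ord_recr // ltnW.
Qed.

Lemma expad_bracket a b : expad (bracket a b) = bracket (expad a) (expad b).
Proof.
have E x : expad x = \sum_(k < n) divpow k x by rewrite sum_lfunE.
(* The range is extended to [n + n] so that the Cauchy product contains every pair of indices below
   [n]; the added terms vanish. *)
have -> : expad (bracket a b) = \sum_(k < n + n) divpow k (bracket a b).
  by rewrite E; apply/esym/(sum_trunc (h := fun k => divpow k (bracket a b))) => [|j]; [exact: leq_addr|exact: divpow_big].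
under eq_bigr do rewrite leibniz.
rewrite (triangle_sum (fun i j => bracket (divpow i a) (divpow j b))) big_split_ord /= [X in _ + X]big1.
  rewrite addr0 !E bracket_suml; apply: eq_bigr => i _; rewrite bracket_sumr.
  apply: (sum_trunc (h := fun j => bracket (divpow i a) (divpow j b))) => [|j nj].
    by rewrite -addnBA ?leq_addr // ltnW.
  by rewrite (divpow_big b nj) bracket0r.
by move=> i _; apply: big1 => j _; rewrite divpow_big ?leq_addr // bracket0l.
Qed.

Lemma expad_auto : even_auto expad.
Proof.
have E x : expad x = \sum_(k < n) divpow k x by rewrite sum_lfunE.
split=> [x Ex|p x xp|]; last exact: expad_bracket.
  (* Injectivity by descent: if [D^(m+1) x = 0], then [D^m] of the exponential of [x] is just
     [D^m x], which thus vanishes too. *)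
  suff H m : itn D m x = 0 -> x = 0 by apply: (H n).
  elim: m => [|m IH] Em; first by rewrite itn0 in Em.
  apply: IH; have : itn D m (expad x) = 0 by rewrite Ex lf0.
  rewrite E; case: (n) (yn) => [yn0|k _]; first by have := yn0 (itn D m x); rewrite itn0.
  rewrite big_ord_recl lfD divpow0 lf_sum big1 ?addr0 // => i _.
  by rewrite /bump /= divpowE lfZ ?add1n -itnD addnS -addSn addnC itnD Em lf0 scaler0.
rewrite E; apply: memv_suml => k _; rewrite divpowE memvZ //.
by elim: (val k) => [|j IH]; rewrite ?itn0 // itnS -[p]addFb; apply: lsa_br_part.
Qed.
End Exponential.

(* Moves the nilpotent part [w] of [t + w] deeper and deeper into the lower
   central series of [N]. *)
Lemma conj_move (N : {vspace g}) (t w : g) : (N <= part false)%VS -> br_sub N N N ->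
  t \in part false -> (forall x, x \in N -> bracket t x \in N) ->
  (forall x, x \in N -> bracket t x = 0 -> x = 0) -> nilpotent_on (adjoint g) N -> w \in N ->
  exists2 th, even_auto th & th (t + w) = t.
Proof.
move=> N0 NN t0 tN Nt [M HM] wN; have aA := module_action (adjoint_module g).
pose C i : {vspace g} := iter i (@actsp _ _ (adjoint g) N) N.
have CN i : (C i <= N)%VS.
  elim: i => [|i IHi]; first exact: subvv.
  by apply: (@actsp_sub _ _ (adjoint g) N (C i) N) => x u xm uC; apply: NN => //; apply: (subvP IHi).
have CS i x u : x \in N -> u \in C i -> bracket x u \in C i.+1.
  by move=> xN uC; apply: (mem_actsp aA).
have CC i : (C i.+1 <= C i)%VS.
  elim: i => [|i IHi]; last exact: (actspS aA (subvv _) IHi).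
  by apply: (@actsp_sub _ _ (adjoint g) N (C 0) N) => x u xm uC; apply: NN.
have C0 i : (M <= i)%N -> C i = 0%VS.
  move=> Mi; apply/eqP; rewrite -subv0 -HM; elim: i Mi => [|i IHi].
    by rewrite leqn0 => /eqP->; apply: subvf.
  rewrite leq_eqVlt ltnS => /predU1P[<-|Mi]; last exact: subv_trans (CC i) (IHi Mi).
  rewrite /C; elim: (M) => [|j IHj]; [exact: subvf|exact: (actspS aA)].
have tC i x : x \in C i -> bracket t x \in C i.
  elim: i x => [|i IHi] x; first exact: tN.
  suff /subvP H : (C i.+1 <= lsa_br t @^-1: C i.+1)%VS by move=> /H; rewrite -memv_preim.
  apply: (@actsp_sub _ _ (adjoint g) N (C i)) => y u ym uC; rewrite -memv_preim /=.
  rewrite (lsa_br_jacobi u t0 (subvP N0 _ ym)) scale1r memvD //.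
    by apply: CS => //; apply: tN.
  by apply: CS => //; apply: IHi.
have onto i v : v \in C i -> exists2 y, y \in C i & bracket t y = v.
  have : (lsa_br t @: C i = C i)%VS.
    apply/eqP; rewrite eqEdim; apply/andP; split.
      by apply/subvP=> _ /memv_imgP[x xC ->]; apply: tC.
    have := limg_ker_dim (lsa_br t) (C i); rewrite (_ : (_ :&: _)%VS = 0%VS) ?dimv0 ?add0n => [->//|].
    apply/eqP; rewrite -subv0; apply/subvP=> x; rewrite memv_cap memv_ker memv0 => /andP[xC /eqP tx].
    by apply/eqP/Nt => //; apply: (subvP (CN i)).
  by move=> E vC; move: vC; rewrite -{1}E => /memv_imgP[y yC ->]; exists y.
suff H k i v : v \in C i -> (M <= i + k)%N -> exists2 th, even_auto th & th (t + v) = t.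
  exact: (H M 0%N w wN).
elim: k i v => [|k IH] i v vC; rewrite ?addn0 => Mi.
  exists \1%VF; first exact: even_auto_id.
  by move: vC; rewrite C0 // memv0 id_lfunE => /eqP->; rewrite addr0.
(* With [bracket t y = v] the exponential of [y] subtracts [v] from [t] to first order; everything
   else lies one step deeper in the series. *)
have [y yC ty] := onto i v vC; have yN := subvP (CN i) _ yC.
have y0 := subvP N0 _ yN.
have yn u : itn (lsa_br y) M.+2 u = 0.
  suff H j : itn (lsa_br y) j u \in iter j (@actsp _ _ (adjoint g) N) fullv.
    by rewrite !itnS; have := H M; rewrite HM memv0 => /eqP->; rewrite !lf0.
  elim: j => [|j IHj]; first by rewrite itn0 memvf.
  by rewrite itnS /=; apply: (mem_actsp aA).
have yt : bracket y t = - v.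
  by rewrite /bracket (lsa_br_skew y0 t0) scale1r; congr (- _).
have deep j u : u \in C i -> itn (lsa_br y) j.+1 u \in C i.+1.
  move=> uC; elim: j => [|j IHj]; first by rewrite itnS itn0; apply: CS.
  by rewrite itnS; apply: (subvP (CC _)); apply: CS.
have E u : expad y M.+2 u = u + (bracket y u + \sum_(j < M) divpow y j.+2 u).
  by rewrite sum_lfunE !big_ord_recl /= divpow0 divpowE itnS itn0 /= invr1 scale1r.
have [w' w'C Ew] : exists2 w', w' \in C i.+1 & expad y M.+2 (t + v) = t + w'.
  exists (bracket y v + \sum_(j < M) divpow y j.+2 v + \sum_(j < M) divpow y j.+2 t).
    rewrite !memvD ?CS //; apply: memv_suml => j _; rewrite divpowE memvZ //; first exact: deep.
    by rewrite itnSr [X in itn _ _ X]yt lfN memvN; apply: deep.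
  rewrite lfD !E yt.
  have -> : forall a b c d e : g, a + (- b + c) + (b + (d + e)) = a + (d + e + c).
    by move=> a b c d e; lincomb.
  by [].
have [|th eth Eth] := IH i.+1 w' w'C; first by rewrite addSnnS.
exists (th \o expad y M.+2)%VF; last by rewrite comp_lfunE Ew.
exact: even_auto_comp eth (expad_auto y0 yn).
Qed.
End Automorphisms.

Section EvenTriangular.
Variables (F : numClosedFieldType) (g : lieSuperalgebra F) (kappa : g -> g -> F).
Hypothesis kf : killing_form kappa.
Local Notation part := (lsa_part g).

Record even_triangular (nm h np : {vspace g}) (X : seq g) : Prop := EvenTriangular {
  et_sum : (nm + h + np)%VS = part false;
  et_ab : forall x y, x \in h -> y \in h -> bracket x y = 0;
  et_hp : (h :&: np = 0)%VS; et_hm : (h :&: nm = 0)%VS;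
  et_dim : (\dim nm + \dim h + \dim np)%N = \dim (part false);
  et_pp : br_sub np np np; et_mm : br_sub nm nm nm;
  et_hpp : br_sub h np np; et_hmm : br_sub h nm nm;
  et_span : <<X>>%VS = fullv;
  et_eig : forall v x, v \in X -> x \in h -> exists c, bracket x v = c *: v;
  et_self : forall y, y \in part false -> (forall x, x \in h -> bracket x y = 0) -> y \in h }.

Lemma et_swap nm h np X : even_triangular nm h np X -> even_triangular np h nm X.
Proof.
case=> s ab hp hm dm pp mm hpp hmm sp eig self; split=> //; last by rewrite -dm addnC addnA [RHS]addnAC addnC.
by rewrite -s [(np + h)%VS]addvC addvC addvA.
Qed.

Lemma kappa_part x : x \in part false -> (forall y, y \in part false -> kappa x y = 0) -> x = 0.
Proof.
move=> x0 H; apply: (kappa_nondeg kf) => y; have [y0 [y1 [-> h0 h1]]] := homog_sum y.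
rewrite (kappaDr kf) H // add0r; case: kf => _ kp _ _ _; exact: (kp false true).
Qed.

Lemma orth_dim (A B : {vspace g}) : (A <= part false)%VS -> (B <= part false)%VS ->
  (forall a b, a \in A -> b \in B -> kappa a b = 0) -> (\dim A + \dim B <= \dim (part false))%N.
Proof.
move=> A0 B0 AB; pose C := (part false :\: B)%VS.
have linr x : linear (kappa x : g -> F^o) by case: kf => -[].
pose A1 x := GRing.isLinear.Build _ _ _ _ _ (linr x).
pose kx x : {linear g -> F^o} := HB.pack (kappa x : g -> F^o) (A1 x).
pose L0 x : 'Hom(subvs_of C, F^o) := (linfun (kx x) \o linfun vsval)%VF.
have L0E x c : L0 x c = kappa x (vsval c) by rewrite /L0 comp_lfunE !lfunE.
have lin : linear L0.
  move=> a x y; apply/lfunP=> c; rewrite add_lfunE scale_lfunE !L0E.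
  by rewrite (kappaDl kf) (kappaZl kf).
pose A2 := GRing.isLinear.Build _ _ _ _ _ lin.
pose L : {linear g -> _} := HB.pack L0 A2.
have := limg_ker_dim (linfun L) A.
have -> : (A :&: lker (linfun L) = 0)%VS.
  apply/eqP; rewrite -subv0; apply/subvP=> x; rewrite memv_cap memv_ker lfunE /= memv0 => /andP[xA /eqP Lx].
  apply/eqP/kappa_part => [|y]; first exact: (subvP A0).
  rewrite -{1}(addv_diff_cap (part false) B) => /memv_addP[c cC [b + ->]].
  rewrite memv_cap addrC => /andP[_ bB].
  rewrite (kappaDr kf) (AB x b) // add0r.
  by have := L0E x (Subvs cC); rewrite Lx zero_lfunE.
rewrite dimv0 add0n => <-.
have : (\dim (linfun L @: A) <= \dim C)%N.
  apply: leq_trans (dimvS (subvf _)) _.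
  by rewrite dimvf /dim /= muln1 -dimvf dimvf.
have := dimv_cap_compl (part false) B; rewrite -/C.
have -> : (part false :&: B = B)%VS by apply/capv_idPr.
lia.
Qed.

Section One.
Variables (nm h np : {vspace g}) (X : seq g).
Hypothesis et : even_triangular nm h np X.

Lemma et_sub : [/\ (nm <= part false)%VS, (h <= part false)%VS & (np <= part false)%VS].
Proof. by have := subvv (part false); rewrite -{1}(et_sum et) !subv_add => /andP[/andP[-> ->] ->]. Qed.

(** As [X] spans [g] and consists of joint eigenvectors, the centraliser of such an [r] is that of
    all of [h]. *)
Definition regular r := r \in h /\
  forall v, v \in X -> bracket r v = 0 -> forall x, x \in h -> bracket x v = 0.

Lemma diag_h r : r \in h -> eigenspanned (lsa_br r) X.
Proof. by move=> rh; split; [exact: et_span et|move=> v vX; apply: (et_eig et vX rh)]. Qed.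

Lemma cent_lker v x : (x \in lker (linfun (fun x : g => bracket x v : g)))%VS = (bracket x v == 0).
Proof.
pose A1 := GRing.isLinear.Build _ _ _ _ _ (bracket_linear_l v).
pose b : {linear g -> g} := HB.pack (fun x => bracket x v) A1.
by rewrite memv_ker (lfunE b).
Qed.

Lemma regular_ex : exists r, regular r.
Proof.
pose Ks := [seq K <- [seq (h :&: lker (linfun (fun x : g => bracket x v)))%VS | v <- X] | ~~ (h <= K)%VS].
have [|r rh rK] := @avoid_subspaces _ _ h Ks; first by move=> K; rewrite mem_filter => /andP[].
exists r; split=> // v vX rv x xh; apply/eqP; rewrite -cent_lker; apply: contraT => xv.
suff /rK : (h :&: lker (linfun (fun x : g => bracket x v)))%VS \in Ks.
  by rewrite memv_cap rh cent_lker rv eqxx.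
rewrite mem_filter andbC; apply/andP; split; first by apply/mapP; exists v.
apply: contra xv => /subvP/(_ _ xh).
by rewrite memv_cap => /andP[].
Qed.

Lemma regular_cent r y : regular r -> bracket r y = 0 -> forall x, x \in h -> bracket x y = 0.
Proof.
move=> [rh reg] ry x xh.
have := diag_eigenspace (c := 0) (u := y) (diag_h rh); rewrite scale0r => /(_ ry) ys.
apply/eqP; rewrite -[_ == _](memv_ker (lsa_br x)); apply: (subvP _ _ ys); apply/span_subvP=> v.
by rewrite mem_filter scale0r => /andP[/eqP rv vX]; rewrite memv_ker; apply/eqP/reg.
Qed.

Lemma regular_self r y : regular r -> y \in part false -> bracket r y = 0 -> y \in h.
Proof. by move=> reg y0 ry; apply: (et_self et y0) => x xh; apply: regular_cent reg ry _ xh. Qed.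

Lemma h_even x : x \in h -> x \in part false.
Proof. by case: et_sub => _ + _ => /subvP; apply. Qed.
Lemma np_even x : x \in np -> x \in part false.
Proof. by case: et_sub => _ _ /subvP; apply. Qed.

Lemma np_cent r x : regular r -> x \in np -> bracket r x = 0 -> x = 0.
Proof.
move=> reg xn rx; apply/eqP; rewrite -memv0 -(et_hp et) memv_cap xn andbT.
by apply: regular_self rx => //; apply: np_even.
Qed.

Lemma skew_even x y : x \in part false -> y \in part false -> bracket x y = - bracket y x.
Proof. by move=> x0 y0; rewrite /bracket (lsa_br_skew x0 y0) scale1r. Qed.

Lemma kappa_h_np x y : x \in h -> y \in np -> kappa x y = 0.
Proof.
have [r reg] := regular_ex; have [rh _] := reg; move=> xh.
have linr : linear (kappa x : g -> F^o) by case: kf => -[].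
pose A1 := GRing.isLinear.Build _ _ _ _ _ linr.
pose kx : {linear g -> F^o} := HB.pack (kappa x : g -> F^o) A1.
suff /subvP H : (np <= lker (linfun kx))%VS by move=> /H; rewrite memv_ker lfunE => /eqP.
apply: (diag_sub (diag_h rh)) => [w wn|w c wn rw]; first exact: (et_hpp et).
rewrite memv_ker lfunE /=; have := kappa_inv kf x r w; rewrite (et_ab et xh rh) (kappa0l kf) /bracket rw (kappaZr kf).
move/esym/eqP; rewrite mulf_eq0 => /orP[/eqP c0|//].
by rewrite (np_cent reg wn) ?(kappa0r kf) // /bracket rw c0 scale0r.
Qed.

(** Weight vectors pair non-trivially only if their weights at [r] are opposite. Their bracket is
    then a vector of [np] centralised by [r], so it is zero, and invariance against [r] makes the
    weight of [v] zero, contradicting [np_cent]. *)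
Lemma kappa_np_np x y : x \in np -> y \in np -> kappa x y = 0.
Proof.
have [r reg] := regular_ex; have [rh _] := reg; have r0 := h_even rh.
have linr u : linear (kappa u : g -> F^o) by case: kf => -[].
have linl v : linear (kappa^~ v : g -> F^o) by case: kf => -[].
pose A1 u := GRing.isLinear.Build _ _ _ _ _ (linr u).
pose kx u : {linear g -> F^o} := HB.pack (kappa u : g -> F^o) (A1 u).
pose A2 v := GRing.isLinear.Build _ _ _ _ _ (linl v).
pose ky v : {linear g -> F^o} := HB.pack (kappa^~ v : g -> F^o) (A2 v).
have eig u v c c' : u \in np -> v \in np -> bracket r u = c *: u -> bracket r v = c' *: v -> kappa u v = 0.
  move=> un vn ru rv; apply/eqP; apply: contraT => kuv.
  have u0 := np_even un; have v0 := np_even vn.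
  have E : c + c' = 0.
    have := kappa_inv kf u r v; rewrite (skew_even u0 r0) ru rv (kappaNl kf) (kappaZl kf) (kappaZr kf).
    by move/eqP; rewrite -mulNr -subr_eq0 -mulrBl mulf_eq0 (negbTE kuv) orbF -opprD oppr_eq0 => /eqP.
  have uv : bracket u v = 0.
    apply: (np_cent reg); first exact: (et_pp et).
    rewrite /bracket (lsa_br_jacobi v r0 u0) scale1r -/(bracket r u) -/(bracket r v) ru rv.
    by rewrite -![lsa_br _ _]/(bracket _ _) bracketZl bracketZr -scalerDl E scale0r.
  have := kappa_inv kf u v r; rewrite uv (kappa0l kf) (skew_even v0 r0) rv (kappaNr kf) (kappaZr kf).
  move/esym/eqP; rewrite oppr_eq0 mulf_eq0 (negbTE kuv) orbF => /eqP c'0.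
  by rewrite (np_cent reg vn) ?(kappa0r kf) ?eqxx ?rv ?c'0 ?scale0r in kuv *.
move=> xn yn.
suff /subvP/(_ x xn) : (np <= lker (linfun (ky y)))%VS by rewrite memv_ker lfunE => /eqP.
apply: (diag_sub (diag_h rh)) => [w wn|u c un ru]; first exact: (et_hpp et).
rewrite memv_ker lfunE /=.
suff /subvP/(_ y yn) : (np <= lker (linfun (kx u)))%VS by rewrite memv_ker lfunE.
apply: (diag_sub (diag_h rh)) => [w wn|v c' vn rv]; first exact: (et_hpp et).
by rewrite memv_ker lfunE /=; apply/eqP/(eig _ _ c c').
Qed.

Definition borel : {vspace g} := (h + np)%VS.

Lemma borel_dim : \dim borel = (\dim h + \dim np)%N.
Proof. by have := dimv_sum_cap h np; rewrite (et_hp et) dimv0 addn0. Qed.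

Lemma borel_even : (borel <= part false)%VS.
Proof. by case: et_sub => _ h0 n0; rewrite subv_add h0. Qed.

Lemma kappa_borel_np x y : x \in borel -> y \in np -> kappa x y = 0.
Proof.
case/memv_addP=> a ah [b bn ->] yn.
by rewrite (kappaDl kf) kappa_h_np // kappa_np_np // addr0.
Qed.

Lemma np_nilpotent : nilpotent_on (adjoint g) np.
Proof.
have [r reg] := regular_ex; have [rh _] := reg.
have [_ _ np0] := et_sub.
apply: (engel (t := r) (h_even rh) (diag_h rh)) => //; [exact: et_pp et|by move=> x; apply: et_hpp et _ _ rh| |].
  by move=> x xn; apply: np_cent.
exact/module_action/adjoint_module.
Qed.

(** For a regular [r] the bracket with [r] is injective on [np], hence maps [np] onto itself. This
    supplies the second premise of the condition on the centre. *)
Lemma np_derived x : x \in np -> x \in @actsp _ _ (adjoint g) (part false) (part false).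
Proof.
have [r reg] := regular_ex; have [rh _] := reg; move=> xn.
have : (lsa_br r @: np = np)%VS.
  apply/eqP; rewrite eqEdim; apply/andP; split.
    by apply/subvP=> _ /memv_imgP[y yn ->]; apply: et_hpp et _ _ rh yn.
  have := limg_ker_dim (lsa_br r) np; rewrite (_ : (_ :&: _)%VS = 0%VS) ?dimv0 ?add0n => [->//|].
  apply/eqP; rewrite -subv0; apply/subvP=> y; rewrite memv_cap memv_ker memv0 => /andP[yn /eqP ry].
  exact/eqP/(np_cent reg).
move=> E; move: xn; rewrite -E => /memv_imgP[y yn ->].
by apply: (mem_actsp (module_action (adjoint_module g))); [apply: h_even|apply: np_even].
Qed.

Lemma borel_move r w : r \in h -> (forall x, x \in np -> bracket r x = 0 -> x = 0) -> w \in np ->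
  exists2 th, even_auto th & th (r + w) = r.
Proof.
move=> rh rnp wn; have [_ _ np0] := et_sub.
apply: (conj_move np0 (et_pp et) (h_even rh) _ rnp np_nilpotent wn) => x.
exact: et_hpp et _ _ rh.
Qed.

(* An element of the Borel subalgebra whose adjoint action is nilpotent has
   central component in [h]: the action on the quotients of the filtration
   by the powers of [np] is that of this component. *)
Lemma borel_nilpotent k w n : k \in h -> w \in np -> (forall v, itn (lsa_br (k + w)) n v = 0) ->
  forall y, bracket k y = 0.
Proof.
move=> kh wn xn; have aA := module_action (adjoint_module g).
pose U i : {vspace g} := iter i (@actsp _ _ (adjoint g) np) fullv.
have [M UM] : exists M, U M = 0%VS by exact: np_nilpotent.
have US i : (U i.+1 <= U i)%VS.
  by elim: i => [|i IHi]; [exact: subvf|exact: (actspS aA (subvv _) IHi)].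
have wU i v : v \in U i -> bracket w v \in U i.+1 by move=> vU; apply: (mem_actsp aA).
have kU i v : v \in U i -> bracket k v \in U i.
  elim: i v => [|i IHi] v; first by rewrite !memvf.
  suff /subvP H : (U i.+1 <= lsa_br k @^-1: U i.+1)%VS by move=> /H; rewrite -memv_preim.
  apply: (@actsp_sub _ _ (adjoint g) np (U i)) => y u ym uC; rewrite -memv_preim /=.
  rewrite (lsa_br_jacobi u (h_even kh) (np_even ym)) scale1r memvD //.
    by apply: (mem_actsp aA) => //; apply: et_hpp et _ _ kh ym.
  by apply: (mem_actsp aA) => //; apply: IHi.
suff kX v : v \in X -> bracket k v = 0.
  have H : (fullv <= lker (lsa_br k))%VS.
    by rewrite -(et_span et); apply/span_subvP=> v /kX kv; rewrite memv_ker; apply/eqP.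
  by move=> y; apply/eqP; rewrite -[_ == _](memv_ker (lsa_br k)); apply: (subvP H); rewrite memvf.
move=> vX; have [c kv] := et_eig et vX kh; have [->|v0] := eqVneq v 0; first by rewrite bracket0r.
have [i vU vU1] : exists2 i, v \in U i & v \notin U i.+1.
  have : v \notin U M by rewrite UM memv0.
  elim: (M) => [|j IHj]; first by rewrite memvf.
  by have [vj|/IHj//] := boolP (v \in U j); exists j.
have H j : itn (lsa_br (k + w)) j v - c ^+ j *: v \in U i.+1.
  elim: j => [|j IHj]; first by rewrite itn0 expr0 scale1r subrr mem0v.
  set z := _ - _ in IHj; rewrite itnS; have -> : itn (lsa_br (k + w)) j v = c ^+ j *: v + z.
    by rewrite /z; lincomb.
  rewrite -/(bracket _ _) bracketDr bracketZr bracketDl kv exprS.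
  have -> : c ^+ j *: (c *: v + bracket w v) + bracket (k + w) z - (c * c ^+ j) *: v =
    c ^+ j *: bracket w v + bracket (k + w) z by lincomb.
  rewrite bracketDl; apply: memvD; first by rewrite memvZ ?wU.
  by apply: memvD; [apply: kU|apply: (subvP (US _)); apply: wU].
have := H n; rewrite xn sub0r memvN => cU.
have [c0|c0] := eqVneq c 0; first by rewrite kv c0 scale0r.
case/negP: vU1; rewrite -[v](scalerK (expf_neq0 n c0)) memvZ //.
Qed.
End One.

Section Conjugacy.
Variables (nm1 h1 np1 nm2 h2 np2 : {vspace g}) (X1 X2 : seq g).
Hypothesis et1 : even_triangular nm1 h1 np1 X1.
Hypothesis et2 : even_triangular nm2 h2 np2 X2.
Hypothesis central : forall z, (forall y, bracket z y = 0) ->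
  z \in @actsp _ _ (adjoint g) (part false) (part false) -> z = 0.

Local Notation b1 := (borel h1 np1).
Local Notation b2 := (borel h2 np2).

Lemma et_np_dim nm h np X : even_triangular nm h np X -> (\dim np <= \dim nm)%N.
Proof.
move=> et; have [_ _ np0] := et_sub et.
have := orth_dim (borel_even et) np0 (kappa_borel_np et).
rewrite (borel_dim et) -(et_dim et); lia.
Qed.

(** Write [x] of [np] as [k + w] in the other Borel subalgebra. Being ad-nilpotent, [x] has a
    central component [k], which is also a difference of elements of the derived even part; the
    hypothesis [central] then makes it zero. *)
Lemma borel_cap_np nm h np X nm' h' np' X' :
  even_triangular nm h np X -> even_triangular nm' h' np' X' ->
  (borel h np :&: borel h' np' :&: np <= np' :&: np)%VS.
Proof.
move=> et et'; apply/subvP=> x; rewrite !memv_cap => /andP[/andP[_ xb] xn]; rewrite xn andbT.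
have [M HM] := np_nilpotent et; have aA := module_action (adjoint_module g).
have [k kh [w wn Ex]] := memv_addP xb.
have xM v : itn (lsa_br (k + w)) M v = 0.
  suff H j : itn (lsa_br (k + w)) j v \in iter j (@actsp _ _ (adjoint g) np) fullv.
    by have := H M; rewrite HM memv0 => /eqP.
  elim: j => [|j IHj]; first by rewrite itn0 memvf.
  by rewrite itnS /=; apply: (mem_actsp aA); rewrite // -Ex.
have kc := borel_nilpotent et' kh wn xM.
suff -> : x = w by [].
rewrite Ex (central kc) ?add0r //.
have -> : k = x - w by rewrite Ex addrK.
by apply: (@memvB _ g); [apply: (np_derived et)|apply: (np_derived et')].
Qed.

(** The sum of the two Borel subalgebras is orthogonal to the intersection of their nilpotent parts.
    This bounds the sum from above and the intersection from below, while [borel_cap_np] bounds what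
    the intersection loses modulo [np]. *)
Lemma borel_cap_dim nm h np X nm' h' np' X' :
  even_triangular nm h np X -> even_triangular nm' h' np' X' ->
  (\dim (borel h np) + \dim np <= \dim (borel h np :&: borel h' np' + np) + \dim np')%N.
Proof.
move=> et et'; have [_ _ np0] := et_sub et; have [_ _ np0'] := et_sub et'.
have := dimv_sum_cap (borel h np :&: borel h' np') np.
have := dimvS (borel_cap_np et et').
have := dimv_sum_cap (borel h np) (borel h' np').
have : (\dim (borel h np + borel h' np') + \dim (np' :&: np) <= \dim (part false))%N.
  apply: orth_dim.
  - by rewrite subv_add (borel_even et) (borel_even et').
  - by rewrite (subv_trans (capvSr _ _) np0).
  move=> _ z /memv_addP[a ab [b bb ->]]; rewrite memv_cap => /andP[zn' zn].
  by rewrite (kappaDl kf) (kappa_borel_np et) // (kappa_borel_np et') // addr0.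
have := et_np_dim et'; have := et_dim et'; have := borel_dim et'.
have := et_np_dim (et_swap et'); lia.
Qed.

(** The estimate and its mirror image force equal dimensions of the nilpotent parts, and then
    equality: the intersection of the Borel subalgebras maps onto each Cartan quotient. *)
Lemma borel_cap_sum nm h np X nm' h' np' X' :
  even_triangular nm h np X -> even_triangular nm' h' np' X' ->
  (borel h np :&: borel h' np' + np)%VS = borel h np.
Proof.
move=> et et'.
have sub : (borel h np :&: borel h' np' + np <= borel h np)%VS.
  by rewrite subv_add capvSl addvSr.
have sub' : (borel h' np' :&: borel h np + np' <= borel h' np')%VS.
  by rewrite subv_add capvSl addvSr.
apply/eqP; rewrite eqEdim sub /=; have := borel_cap_dim et et'; have := borel_cap_dim et' et.
have := dimvS sub; have := dimvS sub'; lia.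
Qed.

Lemma borel_proper nm h np X v (s : {vspace g}) : even_triangular nm h np X ->
  (s + np)%VS = borel h np -> v \in X -> (exists2 x, x \in h & bracket x v != 0) ->
  ~~ (s <= (h :&: lker (linfun (fun x : g => bracket x v))) + np)%VS.
Proof.
move=> et sb vX [x xh]; apply: contra => /subvP sK; apply/eqP.
have : x \in (s + np)%VS by rewrite sb -[x]addr0 memv_add ?mem0v.
case/memv_addP=> z /sK/memv_addP[k /[!memv_cap]/andP[kh kv] [w wn ->]] [w' wn' Ex].
have : x - k \in (h :&: np)%VS.
  rewrite memv_cap memvB //=; have -> : x - k = w + w' by rewrite Ex; lincomb.
  by rewrite memvD.
by rewrite (et_hp et) memv0 subr_eq0 => /eqP->; apply/eqP; rewrite -cent_lker.
Qed.

(** A generic [z] in the intersection of the Borel subalgebras has a regular component in each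
    Cartan subalgebra. Removing its nilpotent part in both decompositions conjugates [z] to regular
    elements [t1] and [t2], whose centralisers in the even part are [h1] and [h2]. *)
Theorem cartan_conj : exists th, [/\ even_auto th, forall x, x \in h2 -> th x \in h1
  & forall y, y \in h1 -> exists2 x, x \in h2 & y = th x].
Proof.
pose s := (b1 :&: b2)%VS.
have s1 : (s + np1)%VS = b1 := borel_cap_sum et1 et2.
have s2 : (s + np2)%VS = b2 by rewrite /s capvC; apply: borel_cap_sum et2 et1.
pose wall h np (X : seq g) := [seq K <- [seq ((h :&: lker (linfun (fun x : g => bracket x v))) + np)%VS | v <- X] | ~~ (s <= K)%VS].
have [|z zs zK] := @avoid_subspaces _ _ s (wall h1 np1 X1 ++ wall h2 np2 X2).
  by move=> K; rewrite mem_cat !mem_filter => /orP[] /andP[].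
have reg nm h np X : even_triangular nm h np X -> (s + np)%VS = borel h np ->
    (forall K, K \in wall h np X -> z \notin K) ->
    exists t th, [/\ regular h X t, even_auto th & th z = t].
  move=> et sb zW; have : z \in borel h np by rewrite -sb -[z]addr0 memv_add ?mem0v.
  case/memv_addP=> t th [w wn Ez].
  have rt : regular h X t.
    split=> // v vX tv x xh; apply/eqP; apply: contraT => xv.
    have /zW : ((h :&: lker (linfun (fun x : g => bracket x v))) + np)%VS \in wall h np X.
      rewrite mem_filter andbC; apply/andP; split; first by apply/mapP; exists v.
      by apply: borel_proper et sb vX _; exists x.
    by rewrite Ez memv_add // memv_cap th cent_lker tv eqxx.
  have [|f ef Ef] := borel_move et th _ wn; first by move=> x xn tx; exact: (np_cent et rt xn tx).
  by exists t, f; split=> //; rewrite Ez.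
have [|t1 [f1 [r1 e1 E1]]] := reg _ _ _ _ et1 s1; first by move=> K KW; apply: zK; rewrite mem_cat KW.
have [|t2 [f2 [r2 e2 E2]]] := reg _ _ _ _ et2 s2; first by move=> K KW; apply: zK; rewrite mem_cat KW orbT.
have move_cent nm h np X nm' h' np' X' t t' f x : even_triangular nm h np X ->
    even_triangular nm' h' np' X' -> regular h X t -> regular h' X' t' -> even_auto f -> f t = t' ->
    x \in h -> f x \in h'.
  move=> et et' rt rt' [_ fp fb] ft xh; apply: (regular_self et' rt').
    by apply/fp/(h_even et).
  by rewrite -ft -fb (et_ab et _ xh) ?lf0 //; case: rt.
pose f := (f1 \o f2^-1)%VF; have ef : even_auto f by apply/(even_auto_comp e1)/even_auto_inv.
have ft : f t2 = t1 by rewrite comp_lfunE -E2 (even_autoK e2).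
exists f; split=> // [x|y yh]; first exact: move_cent et2 et1 r2 r1 ef ft.
exists ((f^-1)%VF y); last by rewrite (even_autoVK ef).
by apply: (move_cent _ _ _ _ _ _ _ _ t1 t2 _ _ et1 et2 r1 r2 (even_auto_inv ef)) => //; rewrite -ft (even_autoK ef).
Qed.
End Conjugacy.
End EvenTriangular.

(** * Split forms, highest weight vectors and contravariant forms *)

Section SplitForm.
Variables (F : numClosedFieldType) (g : lieSuperalgebra F).
Local Notation part := (lsa_part g).

(* [tau] is an anti-automorphism in the ordinary sense: no sign appears for two
   odd elements. *)
Record split_form (h : {vspace g}) (t : g) (v : seq g) (tau : 'End(g)) : Prop := SplitForm {
  sf_h0 : (h <= part false)%VS;
  sf_ab : forall x y, x \in h -> y \in h -> bracket x y = 0;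
  sf_t : t \in h;
  sf_span : (h + <<v>>)%VS = fullv;
  sf_hom : forall u, u \in v -> exists q : bool, u \in part q;
  sf_int : forall u, u \in v -> exists2 m : int, m != 0 & bracket t u = m%:~R *: u;
  sf_wt : forall u x, u \in v -> x \in h -> exists c, bracket x u = c *: u;
  sf_tau_par : forall (p : bool) x, x \in part p -> tau x \in part p;
  sf_tau_br : forall x y, tau (bracket x y) = bracket (tau y) (tau x);
  sf_tauK : forall x, tau (tau x) = x;
  sf_tau_h : forall x, x \in h -> tau x = x }.
End SplitForm.

Section Generation.
Variables (F : numClosedFieldType) (g : lieSuperalgebra F) (W : actspace g).
Local Notation part := (lsa_part g).
Local Notation act := (as_act W).
Hypothesis aW : is_action W.
Variable eps : 'End(W).
Hypothesis eps_act : forall (p : bool) x w, x \in part p -> eps (act x w) = (-1) ^+ p *: act x (eps w).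

Section Generated.
Variables (nm b : {vspace g}) (w0 : W).
Hypothesis nmb : (nm + b)%VS = fullv.
Hypothesis gnm : graded nm.
Hypothesis gb : graded b.
Hypothesis eps_w0 : eps w0 \in <[w0]>%VS.
Hypothesis b_w0 : forall x, x \in b -> act x w0 \in <[w0]>%VS.

Let Y k : {vspace W} := iter k (fun U => (U + actsp nm U)%VS) <[w0]>%VS.

Let Y_act k x w : w \in Y k -> (x \in b -> act x w \in Y k) /\ act x w \in Y k.+1.
Proof.
have fulb k' : (forall x w, x \in b -> w \in Y k' -> act x w \in Y k') ->
    forall x w, w \in Y k' -> act x w \in Y k'.+1.
  move=> H y u uY; have : y \in (nm + b)%VS by rewrite nmb memvf.
  case/memv_addP=> y1 y1n [y2 y2b ->]; rewrite (actD aW) addrC memv_add ?H //.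
  exact: mem_actsp.
suff H : forall x w, x \in b -> w \in Y k -> act x w \in Y k.
  by move=> wY; split=> [xb|]; [apply: H|apply: fulb].
elim: k {x w} => [|k IH] x w xb.
  by move=> /vlineP[c ->]; rewrite lfZ memvZ ?b_w0.
case/memv_addP=> u uY [w' w'Y ->]; rewrite lfD memvD //; first exact: (subvP (addvSl _ _)) (IH _ _ xb uY).
suff /subvP H : (actsp nm (Y k) <= act x @^-1: Y k.+1)%VS by have := H _ w'Y; rewrite -memv_preim.
apply: actsp_sub => y z yn zY; rewrite -memv_preim.
have [x0 [x1 [-> x0b x1b h0 h1]]] := gb xb.
have [y0 [y1 [-> y0n y1n k0 k1]]] := gnm yn.
have one (p q : bool) x' y' : x' \in b -> y' \in nm -> x' \in part p -> y' \in part q ->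
    act x' (act y' z) \in Y k.+1.
  move=> x'b y'n x'p y'q; have := act_bracket aW z x'p y'q; move/eqP; rewrite eq_sym subr_eq => /eqP->.
  rewrite memvD ?memvZ //; first exact: (fulb k).
  by apply: (subvP (addvSr _ _)); apply: mem_actsp => //; apply: IH.
rewrite !(actD aW) !lfD; do !apply: memvD.
- exact: (one false false).
- exact: (one false true).
- exact: (one true false).
- exact: (one true true).
Qed.

Let Y_eps k w : w \in Y k -> eps w \in Y k.
Proof.
elim: k w => [|k IH] w; first by move=> /vlineP[c ->]; rewrite lfZ memvZ.
case/memv_addP=> u uY [w' w'Y ->]; rewrite lfD memv_add ?IH //.
suff /subvP H : (actsp nm (Y k) <= eps @^-1: actsp nm (Y k))%VS by have := H _ w'Y; rewrite -memv_preim.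
apply: actsp_sub => y z yn zY; rewrite -memv_preim.
have [y0 [y1 [-> y0n y1n k0 k1]]] := gnm yn.
rewrite (actD aW) lfD (eps_act _ k0) (eps_act _ k1) memvD ?memvZ //; apply: mem_actsp => //; exact: IH.
Qed.

(** Every layer obtained from [w0] by lowering operators is stable under [b], since commuting past a
    lowering operator costs only a bracket acting one layer below. Thus lowering alone generates the
    submodule, which is the line of [w0] up to a lowered part. *)
Lemma generated : exists S : {vspace W},
  [/\ w0 \in S, forall x w, w \in S -> act x w \in S, forall w, w \in S -> eps w \in S
    & (S <= <[w0]> + actsp nm S)%VS].
Proof.
have [k Yk] : exists k, (Y k.+1 <= Y k)%VS.
  apply: contrapT => no.
  have H k : (k <= \dim (Y k))%N.
    elim: k => // k IH; apply: leq_ltn_trans IH _.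
    rewrite (ltn_leqif (dimv_leqif_sup (addvSl _ _))); apply/negP=> h.
    by apply: no; exists k; rewrite subv_add subvv in h *.
  have := H (\dim {:W}).+1; rewrite leqNgt ltnS => /negP; apply; exact: dimvS (subvf _).
exists (Y k); split.
- by elim: (k) => [|j IH]; [exact: memv_line|apply: (subvP (addvSl _ _))].
- by move=> x w wY; apply: (subvP Yk); case: (Y_act x wY).
- exact: Y_eps.
elim: (k) => [|j IH]; first exact: addvSl.
rewrite {1}[Y j.+1]/= subv_add (subv_trans IH) ?addvS ?actspS ?addvSl //=.
by apply: subv_trans (addvSr _ _); apply: actspS; rewrite ?addvSl.
Qed.
End Generated.

Section Highest.
Variables (h : {vspace g}) (t : g).
Hypothesis h0 : (h <= part false)%VS.
Hypothesis h_ab : forall x y, x \in h -> y \in h -> bracket x y = 0.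
Hypothesis th : t \in h.
Hypothesis W0 : ({:W} != 0)%VS.
Hypothesis eps0 : forall w, eps (eps w) = w.

Let eig c := exists2 w, w != 0 & act t w = c *: w.

(** Otherwise eigenvalues [c0 + k] would occur for arbitrarily large [k], giving more distinct
    eigenvalues than the dimension allows. *)
Lemma top_eigenvalue : exists2 c, eig c & forall k : nat, ~ eig (c + k.+1%:R).
Proof.
have [|c0 [w0 _ [w00 tw0]]] := eigenvector_in (f := act t) W0; first by move=> *; exact: memvf.
apply: contrapT => no.
have H N : exists k, (N <= k)%N /\ eig (c0 + k%:R).
  elim: N => [|N [k [Nk ek]]]; first by exists 0%N; rewrite addr0; split=> //; exists w0.
  apply: contrapT => nk; apply: no; exists (c0 + k%:R) => // j ej; apply: nk.
  by exists (k + j.+1)%N; rewrite natrD addrA; split=> //; lia.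
have [f Hf] := choice H.
pose a := fix a n := if n is n'.+1 then f (a n').+1 else f 0%N.
have ea n : eig (c0 + (a n)%:R) by case: n => [|n] /=; [have [] := Hf 0%N|have [] := Hf (a n).+1].
have ew n : exists w : W, w != 0 /\ act t w = (c0 + (a n)%:R) *: w.
  by have [w] := ea n; exists w.
have [w Hw] := choice ew.
have inc : {homo a : i j / (i < j)%N}.
  by apply: homo_ltn => [|n]; [exact: ltn_trans|case: (Hf (a n).+1)].
have : ((\dim {:W}).+1 <= \dim {:W})%N; last by rewrite ltnn.
apply: (eig_bound (f := act t) (e := fun n => c0 + (a n)%:R) (w := w)) => [i j /addrI/eqP|k _|k _]; try by case: (Hw k).
by rewrite eqr_nat => /eqP aij; case: (ltngtP i j) => // /inc; rewrite aij ltnn.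
Qed.

(** The top eigenspace of [t] is stable under [h] and [eps], which commute there; a common
    eigenvector is taken, with [eps] included to make its line graded. A root vector of positive
    height would raise the eigenvalue beyond the top. *)
Lemma highest_vector : exists w, [/\ w != 0, eps w \in <[w]>%VS, forall x, x \in h -> act x w \in <[w]>%VS
  & forall (x : g) (k : nat), bracket t x = k.+1%:R *: x -> act x w = 0].
Proof.
have [c [w w0 tw] top] := top_eigenvalue; have t0 := subvP h0 _ th.
pose U := lker (act t - c *: \1%VF)%R.
have mU u : (u \in U) = (act t u == c *: u).
  by rewrite memv_ker add_lfunE opp_lfunE scale_lfunE id_lfunE subr_eq0.
pose ops := eps :: [seq act x | x <- vbasis h].
have hU x u : x \in h -> act t (act x u) = act x (act t u).
  move=> xh; have := act_bracket aW u t0 (subvP h0 _ xh).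
  by rewrite h_ab // (act0 aW) scale1r => /esym/eqP; rewrite subr_eq0 => /eqP.
have hh x y u : x \in h -> y \in h -> act y (act x u) = act x (act y u).
  move=> xh yh; have := act_bracket aW u (subvP h0 _ yh) (subvP h0 _ xh).
  by rewrite h_ab // (act0 aW) scale1r => /esym/eqP; rewrite subr_eq0 => /eqP.
have epsh x u : x \in h -> eps (act x u) = act x (eps u).
  by move=> xh; rewrite (eps_act _ (subvP h0 _ xh)) scale1r.
have opsE f : f \in ops -> f = eps \/ exists2 x, x \in h & f = act x.
  rewrite inE => /predU1P[->|/mapP[x xh ->]]; [by left|right; exists x => //].
  exact: vbasis_mem.
have [||f f' u|u uU [u0 Hu]] := @common_eigenvector_in _ _ ops U.
- by apply: contraNneq w0 => UE; rewrite -memv0 -UE mU tw.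
- move=> f u /opsE[->|[x xh ->]]; rewrite !mU => /eqP tu; first by rewrite -epsh // tu lfZ.
  by rewrite hU // tu lfZ.
- by move=> /opsE[->|[x xh ->]] /opsE[->|[y yh ->]] _ //; rewrite ?epsh //; apply: hh.
exists u; split=> // [|x xh|x k tx].
- by have [|d ->] := Hu eps; [rewrite mem_head|rewrite memvZ ?memv_line].
- rewrite (coord_vbasis xh); elim/big_rec: _ => [|i y _ IH]; first by rewrite (act0 aW) mem0v.
  rewrite (actD aW) (actZ aW) memvD ?memvZ //.
  have [|d ->] := Hu (act (vbasis h)`_i); last by rewrite memvZ ?memv_line.
  by rewrite inE map_f ?orbT // mem_nth // size_tuple.
apply/eqP; apply: contraT => xu; case: (top k); exists (act x u) => //.
have [x0 [x1 [Ex k0 k1]]] := homog_sum x.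
have E0 := act_bracket aW u t0 k0; have E1 := act_bracket aW u t0 k1; rewrite !scale1r in E0 E1.
have : act (bracket t x) u = k.+1%:R *: act x u by rewrite tx (actZ aW).
move: uU; rewrite mU Ex bracketDr !(actD aW) E0 E1 lfD => /eqP->; rewrite !lfZ => E.
apply/eqP; rewrite -subr_eq0 scalerDl -E; apply/eqP; lincomb.
Qed.
End Highest.
End Generation.

Section PairMaps.
Variables (F : fieldType) (A B : vectType F).

Let pair_linear (f : 'End(A)) (k : 'End(B)) : linear (fun p : A * B => (f p.1, k p.2)).
Proof. by move=> c p q; rewrite /= !lfD !lfZ. Qed.
Definition pair_end (f : 'End(A)) (k : 'End(B)) : 'End((A * B)%type) :=
  linfun (HB.pack (fun p : A * B => (f p.1, k p.2))
    (GRing.isLinear.Build _ _ _ _ _ (pair_linear f k)) : {linear _ -> _}).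
Lemma pair_endE f k p : pair_end f k p = (f p.1, k p.2).
Proof. by rewrite /pair_end lfunE. Qed.

Let fst_linear : linear (fun p : A * B => p.1). Proof. by []. Qed.
Definition fst_lfun : 'Hom((A * B)%type, A) := linfun (HB.pack (fun p : A * B => p.1)
    (GRing.isLinear.Build _ _ _ _ _ fst_linear) : {linear _ -> _}).
Lemma fst_lfunE p : fst_lfun p = p.1. Proof. by rewrite /fst_lfun lfunE. Qed.

Let snd_linear : linear (fun p : A * B => p.2). Proof. by []. Qed.
Definition snd_lfun : 'Hom((A * B)%type, B) := linfun (HB.pack (fun p : A * B => p.2)
    (GRing.isLinear.Build _ _ _ _ _ snd_linear) : {linear _ -> _}).
Lemma snd_lfunE p : snd_lfun p = p.2. Proof. by rewrite /snd_lfun lfunE. Qed.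

Let precomp_linear (f : 'End(A)) : linear (fun psi : 'Hom(A, B) => (psi \o f)%VF).
Proof. by move=> c p q; apply/lfunP=> w; rewrite !(comp_lfunE, add_lfunE, scale_lfunE). Qed.
Definition precomp (f : 'End(A)) : 'End('Hom(A, B)) :=
  linfun (HB.pack (fun psi : 'Hom(A, B) => (psi \o f)%VF)
    (GRing.isLinear.Build _ _ _ _ _ (precomp_linear f)) : {linear _ -> _}).
Lemma precompE f psi w : precomp f psi w = psi (f w).
Proof. by rewrite /precomp lfunE /= comp_lfunE. Qed.

Let ev_linear w : linear (fun psi : 'Hom(A, B) => psi w).
Proof. by move=> c p q; rewrite add_lfunE scale_lfunE. Qed.
Definition ev_lfun w : 'Hom('Hom(A, B), B) := linfun (HB.pack (fun psi : 'Hom(A, B) => psi w)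
    (GRing.isLinear.Build _ _ _ _ _ (ev_linear w)) : {linear _ -> _}).
Lemma ev_lfunE w psi : ev_lfun w psi = psi w. Proof. by rewrite /ev_lfun lfunE. Qed.
End PairMaps.

Section ContravariantForm.
Variables (F : numClosedFieldType) (g : lieSuperalgebra F).
Local Notation part := (lsa_part g).
Variables (h : {vspace g}) (t : g) (v : seq g) (tau : 'End(g)).
Hypothesis sf : split_form h t v tau.
Variable V : actspace g.
Hypothesis irr : irreducible_module V.
Local Notation act := (as_act V).

Let modV : is_module V. Proof. by case: irr. Qed.
Let aV : is_action V := module_action modV.
Let decV : super_dec (@as_part F g V). Proof. by case: modV. Qed.
Let eps := sgnop (@as_part F g V).

Let eps_act (p : bool) x w : x \in part p -> eps (act x w) = (-1) ^+ p *: act x (eps w).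
Proof.
move=> xp; have [w0 [w1 [-> h0 h1]]] := part_sum decV w; have [_ _ ap _] := modV.
rewrite /eps !lfD (sgnop_part decV h0) (sgnop_part decV h1) !lfZ.
rewrite (sgnop_part decV (ap _ _ _ _ xp h0)) (sgnop_part decV (ap _ _ _ _ xp h1)).
by rewrite scale1r scalerDr scalerA -!signr_addb addbF.
Qed.

Lemma stable_dichotomy (U : {vspace V}) : (forall x u, u \in U -> act x u \in U) ->
  (forall u, u \in U -> eps u \in U) -> U = 0%VS \/ U = fullv.
Proof.
move=> gU eU; have [_ _ H] := irr; apply: H => //.
apply/eqP; rewrite eqEsubv subv_add !capvSl !andbT; apply/subvP=> u uU.
have E : u = 2%:R^-1 *: (u + eps u) + 2%:R^-1 *: (u - eps u).
  by apply: crd_inj => i; rewrite !(crdD, crdN, crdZ); field.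
have ee w : eps (eps w) = w by apply: sgnopK decV w.
have eu := eU u uU; rewrite E; apply: memv_add; rewrite memv_cap; apply/andP; split.
- by apply/memvZ/memvD.
- by apply/memvZ/(sgnopP decV); rewrite -/eps lfD ee addrC scale1r.
- by apply/memvZ/memvB.
by apply/memvZ/(sgnopP decV); rewrite -/eps lfB ee expr1 scaleN1r opprB.
Qed.

Let D : vectType F := 'Hom(V, F^o).
Let dact x : 'End(D) := precomp F^o (act (tau x)).
Let dactE x (psi : D) w : dact x psi w = psi (act (tau x) w).
Proof. exact: precompE. Qed.

Let dual : actspace g := {| as_vect := D; as_part := fun=> 0%VS; as_act := dact |}.

Let aD : is_action dual.
Proof.
split=> [c x y|p q x y psi xp yq] /=.
  apply/lfunP=> psi; apply/lfunP=> w; rewrite !(add_lfunE, scale_lfunE, dactE).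
  by rewrite lfD lfZ (actD aV) (actZ aV) lfD lfZ.
apply/lfunP=> w; rewrite !(add_lfunE, opp_lfunE, scale_lfunE, dactE).
rewrite (sf_tau_br sf) (act_bracket aV w (sf_tau_par sf yq) (sf_tau_par sf xp)).
by rewrite lfB lfZ andbC.
Qed.

Let deps : 'End(D) := precomp F^o eps.
Let depsE (psi : D) w : deps psi w = psi (eps w).
Proof. exact: precompE. Qed.

Let deps_act (p : bool) x psi : x \in part p -> deps (dact x psi) = (-1) ^+ p *: dact x (deps psi).
Proof.
move=> xp; apply/lfunP=> w; rewrite scale_lfunE !(depsE, dactE).
by rewrite (eps_act _ (sf_tau_par sf xp)) lfZ scalerA -signr_addb addbb scale1r.
Qed.

Let P : vectType F := (V * D)%type.
Let pact x : 'End(P) := pair_end (act x) (dact x).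
Let pactE x (p : P) : pact x p = (act x p.1, dact x p.2).
Proof. exact: pair_endE. Qed.

Let prodact : actspace g :=
  {| as_vect := P; as_part := fun=> 0%VS; as_act := pact |}.

Let aP : is_action prodact.
Proof.
split=> [c x y|p q x y u xp yq] /=.
  apply/lfunP=> u; rewrite add_lfunE scale_lfunE !pactE; congr (_, _).
    by rewrite (actD aV) (actZ aV).
  by rewrite (actD aD) (actZ aD).
rewrite !pactE /= (act_bracket aV u.1 xp yq); congr (_, _).
exact: (act_bracket aD u.2 xp yq).
Qed.

Let peps : 'End(P) := pair_end eps deps.
Let pepsE (p : P) : peps p = (eps p.1, deps p.2).
Proof. exact: pair_endE. Qed.

Let peps_act (p : bool) x u : x \in part p -> peps (pact x u) = (-1) ^+ p *: pact x (peps u).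
Proof. by move=> xp; rewrite !(pactE, pepsE) /= (eps_act u.1 xp) (deps_act u.2 xp). Qed.

Let pos (u : g) := `[< exists k : nat, bracket t u = k.+1%:R *: u >].
Let neg (u : g) := `[< exists k : nat, bracket t u = - k.+1%:R *: u >].
Let b := (h + <<[seq u <- v | pos u]>>)%VS.
Let nm := <<[seq u <- v | neg u]>>%VS.

Let nmb : (nm + b)%VS = fullv.
Proof.
apply/eqP; rewrite eqEsubv subvf -(sf_span sf) subv_add /b /= addvA [(nm + h)%VS]addvC -addvA addvSl /=.
apply/span_subvP=> u uv; have [m m0 tu] := sf_int sf uv.
case: m m0 tu => [[|k]|k] // _ tu.
  apply: (subvP (addvSr _ _)); apply: (subvP (addvSr _ _)); apply: memv_span.
  by rewrite mem_filter uv andbT; apply/asboolP; exists k.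
apply: (subvP (addvSr _ _)); apply: (subvP (addvSl _ _)); apply: memv_span; rewrite mem_filter uv andbT; apply/asboolP.
by exists k; rewrite tu NegzE mulrNz.
Qed.

Let graded_span (s : seq g) : (forall u, u \in s -> exists q : bool, u \in part q) -> graded <<s>>%VS.
Proof.
move=> hs; apply/graded_subP/eqP; rewrite eqEsubv subv_add !capvSl !andbT.
apply/span_subvP=> u us; have [q uq] := hs u us; have us' := memv_span us.
case: q uq => uq; [apply: (subvP (addvSr _ _))|apply: (subvP (addvSl _ _))]; by rewrite memv_cap us' uq.
Qed.

Let gnm : graded nm.
Proof. by apply: graded_span => u; rewrite mem_filter => /andP[_ uv]; exact: (sf_hom sf uv). Qed.

Let gb : graded b.
Proof.
move=> x /memv_addP[a ah [c + ->]].
have gc : graded <<[seq u <- v | pos u]>>%VS.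
  by apply: graded_span => u; rewrite mem_filter => /andP[_ uv]; exact: (sf_hom sf uv).
move/gc=> [c0 [c1 [-> l0 l1 h0 h1]]]; exists (a + c0), c1.
rewrite addrA memv_add // (subvP (addvSr _ _) _ l1) memvD ?h0 ?h1 //.
exact: (subvP (sf_h0 sf)).
Qed.

Let b_highest (W : actspace g) w : is_action W -> (forall x, x \in h -> as_act W x w \in <[w]>%VS) ->
  (forall (x : g) (k : nat), bracket t x = k.+1%:R *: x -> as_act W x w = 0) ->
  forall x, x \in b -> as_act W x w \in <[w]>%VS /\ (x \in <<[seq u <- v | pos u]>>%VS -> as_act W x w = 0).
Proof.
move=> aW Hh Hp.
have lin : linear (fun x : g => as_act W x w) by move=> c x y; rewrite (actD aW) (actZ aW).
pose A1 := GRing.isLinear.Build _ _ _ _ _ lin.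
pose f : {linear g -> W} := HB.pack (fun x : g => as_act W x w) A1.
have /subvP H : (<<[seq u <- v | pos u]>> <= lker (linfun f))%VS.
  apply/span_subvP=> u; rewrite mem_filter => /andP[/asboolP[k tu] _].
  by rewrite memv_ker lfunE /= (Hp u k).
have {}H x : x \in <<[seq u <- v | pos u]>>%VS -> as_act W x w = 0.
  by move/H; rewrite memv_ker lfunE => /eqP.
move=> x /memv_addP[a ah [c /H cw ->]]; split; last by move=> ?; rewrite H.
by rewrite (actD aW) cw addr0 Hh.
Qed.

(** In the product of [V] with its dual twisted by [tau], the submodule [S] generated by the two
    highest weight vectors turns out to be the graph of an isomorphism; the form is evaluation of
    the image. Schur-type arguments apply since the line of highest weight occurs in [S] only
    diagonally. *)
Lemma contravariant_form : exists B : V -> V -> F,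
  [/\ forall w, linear (B^~ w : V -> F^o), forall u, linear (B u : V -> F^o),
      forall x u w, B (act (tau x) u) w = B u (act x w)
    & forall u, (forall w, B u w = 0) -> u = 0].
Proof.
have V0 : ({:V} != 0)%VS by case: irr.
have D0 : ({:dual} != 0)%VS.
  by move: V0; rewrite -!dimv_eq0 !dimvf /= /dim /= muln1.
have [v0 [v00 ev0 hv0 pv0]] := highest_vector aV eps_act (sf_h0 sf) (sf_ab sf) (sf_t sf) V0.
have [phi [phi0 ephi hphi pphi]] := @highest_vector _ _ dual aD deps deps_act h t (sf_h0 sf) (sf_ab sf) (sf_t sf) D0.
(* [tau] fixes [t] and reverses brackets, so it exchanges negative and positive eigenvalues of
   [t]. *)
have nmb_kill (W : actspace g) w : is_action W ->
    (forall (x : g) (k : nat), bracket t x = k.+1%:R *: x -> as_act W x w = 0) ->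
    forall y, y \in nm -> as_act W (tau y) w = 0.
  move=> aW Hp y.
  have lin : linear (fun x : g => as_act W (tau x) w).
    by move=> c x z; rewrite lfD lfZ (actD aW) (actZ aW).
  pose A1 := GRing.isLinear.Build _ _ _ _ _ lin.
  pose f : {linear g -> W} := HB.pack (fun x : g => as_act W (tau x) w) A1.
  suff /subvP H : (nm <= lker (linfun f))%VS by move/H; rewrite memv_ker lfunE => /eqP.
  apply/span_subvP=> u; rewrite mem_filter memv_ker lfunE /= => /andP[/asboolP[k tu] uv].
  apply/eqP/(Hp _ k); have [q uq] := sf_hom sf uv.
  have t0 := subvP (sf_h0 sf) _ (sf_t sf).
  have skew : bracket t u = - bracket u t by rewrite /bracket (lsa_br_skew t0 uq) scale1r.
  have := congr1 tau skew; rewrite tu lfN (sf_tau_br sf) (sf_tau_h sf (sf_t sf)) lfZ scaleNr.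
  by move/oppr_inj => <-.
have nmv0 := nmb_kill V v0 aV pv0.
have nmphi y w : y \in nm -> phi (act y w) = 0.
  move=> yn; have := congr1 (fun f : D => f w) (nmb_kill dual phi aD pphi y yn).
  by rewrite /= dactE (sf_tauK sf) zero_lfunE.
have phinm (U : {vspace V}) w : w \in actsp nm U -> phi w = 0.
  suff /subvP H : (actsp nm U <= lker phi)%VS by move/H; rewrite memv_ker => /eqP.
  by apply: actsp_sub => y u yn _; rewrite memv_ker nmphi.
have bv0 x : x \in b -> act x v0 \in <[v0]>%VS.
  by move=> xb; have [] := b_highest aV hv0 pv0 xb.
have [S0 [vS0 gS0 eS0 S0g]] := generated aV eps_act nmb gnm gb ev0 bv0.
have S0T : S0 = fullv.
  have [S00|//] := stable_dichotomy gS0 eS0; move: vS0; rewrite S00 memv0 => /eqP v0E.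
  by rewrite v0E eqxx in v00.
(* [phi] kills everything lowered, and [V] is the line of [v0] plus lowered vectors; were [phi v0]
   zero, [phi] would be zero. *)
have phiv0 : phi v0 != 0.
  apply: contra phi0 => /eqP pv; apply/eqP/lfunP=> w; rewrite zero_lfunE.
  have : w \in (<[v0]> + actsp nm S0)%VS by apply: (subvP S0g); rewrite S0T memvf.
  by case/memv_addP=> _ /vlineP[c ->] [u un ->]; rewrite lfD lfZ pv scaler0 add0r (phinm _ _ un).
have line (a : V) (p : D) : a \in <[v0]>%VS -> p \in <[phi]>%VS -> p v0 = phi a ->
    (a, p) \in <[(v0, phi) : P]>%VS.
  move=> /vlineP[c ->] /vlineP[d ->]; rewrite scale_lfunE lfZ => E.
  have -> : d = c by apply: (mulIf phiv0).
  by apply/vlineP; exists c.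
have [|x xb|S [wS gS eS Sg]] := @generated _ _ prodact aP peps peps_act nm b (v0, phi) nmb gnm gb.
- by rewrite pepsE; apply: line => //; rewrite depsE.
- have /b_highest : forall x, x \in h -> as_act prodact x (v0, phi) \in <[(v0, phi) : prodact]>%VS.
    move=> y yh; rewrite /= pactE; apply: line => /=; [exact: hv0|exact: hphi|].
    by rewrite dactE (sf_tau_h sf yh).
  move/(_ aP)=> H; have [|//] := H _ x xb; move=> y k ty; rewrite /= pactE /=.
  by rewrite (pv0 _ _ ty) (pphi _ _ ty).
pose p1 : 'Hom(P, V) := fst_lfun V D; pose p2 : 'Hom(P, D) := snd_lfun V D.
have p1E (p : P) : p1 p = p.1 by exact: fst_lfunE.
have p2E (p : P) : p2 p = p.2 by exact: snd_lfunE.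
have S1 : (p1 @: S = fullv)%VS.
  have [||E|//] := @stable_dichotomy (p1 @: S)%VS.
  - move=> x _ /memv_imgP[p pS ->]; have -> : act x (p1 p) = p1 (pact x p) by rewrite !p1E pactE.
    exact/memv_img/gS.
  - move=> _ /memv_imgP[p pS ->]; have -> : eps (p1 p) = p1 (peps p) by rewrite !p1E pepsE.
    exact/memv_img/eS.
  have := memv_img p1 wS; rewrite E memv0 p1E /= => /eqP v0E.
  by rewrite v0E eqxx in v00.
pose K1 := (S :&: lker p2)%VS.
(* If the first components of [K1] filled [V], then a pair with components [v0] and 0 would lie in
   [S]. Up to a lowered pair it is a multiple of the generator; evaluating the second component at
   [v0] makes the multiple zero, and [phi] of the first component then contradicts [phiv0]. *)
have K10 : K1 = 0%VS.
  have mK1 p : (p \in K1) = (p \in S) && (p.2 == 0) by rewrite memv_cap memv_ker p2E.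
  have [||E|E] := @stable_dichotomy (p1 @: K1)%VS.
  - move=> x _ /memv_imgP[p + ->]; rewrite mK1 => /andP[pS /eqP p20].
    have -> : act x (p1 p) = p1 (pact x p) by rewrite !p1E pactE.
    apply: memv_img; rewrite mK1 (gS x p pS) pactE /= p20 lf0 eqxx //.
  - move=> _ /memv_imgP[p + ->]; rewrite mK1 => /andP[pS /eqP p20].
    have -> : eps (p1 p) = p1 (peps p) by rewrite !p1E pepsE.
    by apply: memv_img; rewrite mK1 (eS p pS) pepsE /= p20 lf0 eqxx.
  - apply/eqP; rewrite -subv0; apply/subvP=> p pK; have : p1 p == 0 by rewrite -memv0 -E memv_img.
    rewrite p1E => /eqP p10.
    move: pK; rewrite mK1 => /andP[_ /eqP p20].
    have -> : p = 0 by rewrite [p]surjective_pairing p10 p20.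
    exact: mem0v.
  have : v0 \in (p1 @: K1)%VS by rewrite E memvf.
  case/memv_imgP=> p; rewrite mK1 p1E => /andP[pS /eqP p20] v0E.
  have /memv_addP[_ /vlineP[c ->] [u un Ep]] := subvP Sg p pS.
  have u1 : phi u.1 = 0.
    have /subvP/(_ u un) : (@actsp _ _ prodact nm S <= p1 @^-1: lker phi)%VS.
      by apply: actsp_sub => y z yn zS; rewrite -memv_preim memv_ker p1E /= pactE nmphi.
    by rewrite -memv_preim memv_ker p1E => /eqP.
  have u2 : u.2 v0 = 0.
    pose e : 'Hom(P, F^o) := (ev_lfun F^o v0 \o p2)%VF.
    have eE (q : P) : e q = q.2 v0 by rewrite /e comp_lfunE p2E; exact: ev_lfunE.
    have /subvP/(_ u un) : (@actsp _ _ prodact nm S <= lker e)%VS.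
      by apply: actsp_sub => y z yn zS; rewrite memv_ker eE /= pactE /= dactE nmv0 ?lf0.
    by rewrite memv_ker eE => /eqP.
  have c0 : c = 0.
    have := congr1 (fun q : P => q.2 v0) Ep; rewrite /= p20 zero_lfunE add_lfunE scale_lfunE u2 addr0.
    by move/esym/eqP; rewrite scaler_eq0 (negbTE phiv0) orbF => /eqP.
  have := congr1 (fun q : P => phi q.1) Ep.
  by rewrite /= -v0E c0 scale0r add0r u1 => pv; rewrite pv eqxx in phiv0.
(* The second projection embeds [S] in a space of dimension that of [V], and the first is onto [V],
   hence injective. *)
have inj1 p : p \in S -> p.1 = 0 -> p = 0.
  have d2 : (\dim S <= \dim {:V})%N.
    have := limg_ker_dim p2 S; rewrite -/K1 K10 dimv0 add0n => <-.
    apply: leq_trans (dimvS (subvf _)) _.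
    by rewrite !dimvf {1}/dim /= muln1.
  have := limg_ker_dim p1 S; rewrite S1 => dS.
  have : \dim (S :&: lker p1) == 0%N.
    by rewrite -leqn0 -(leq_add2r (\dim {:V})) add0n; apply: leq_trans d2; rewrite -dS.
  rewrite dimv_eq0 => /eqP E pS p10; apply/eqP; rewrite -memv0 -E memv_cap pS memv_ker p1E p10 eqxx //.
have Sex u : exists p, p \in S /\ p.1 = u.
  have : u \in (p1 @: S)%VS by rewrite S1 memvf.
  by case/memv_imgP=> q qS ->; exists q; rewrite p1E.
have [f Hf] := choice Sex.
have fS u : f u \in S by case: (Hf u).
have f1 u : (f u).1 = u by case: (Hf u).
have funi u p : p \in S -> p.1 = u -> f u = p.
  by move=> pS p1u; apply/eqP; rewrite -subr_eq0; apply/eqP/inj1; rewrite ?memvB //= f1 p1u subrr.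
exists (fun u w => (f u).2 w); split.
- move=> w c u u'; rewrite (funi _ (c *: f u + f u')) ?memvD ?memvZ //= ?f1 //.
  by rewrite add_lfunE scale_lfunE.
- by move=> u c w w'; rewrite lfD lfZ.
- move=> x u w; rewrite (funi _ (pact (tau x) (f u))) ?pactE /= ?f1 ?dactE ?(sf_tauK sf) //.
  by have := gS (tau x) (f u) (fS u); rewrite /= pactE f1.
move=> u Hu; rewrite -(f1 u) (_ : f u = 0) //; apply/eqP.
have : f u \in K1 by rewrite memv_cap fS memv_ker p2E; apply/eqP/lfunP=> w; rewrite Hu zero_lfunE.
by rewrite K10 memv0.
Qed.
End ContravariantForm.

(** * Triangular decompositions, separating elements and the effect of tau *)

Section DisjointSpectra.
Variables (F : fieldType) (W : vectType F) (f : 'End(W)).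

Lemma eig_list (P : F -> Prop) (X : seq W) :
  (forall v, v \in X -> exists2 c, P c & f v = c *: v) ->
  exists cs : seq F, (forall c, c \in cs -> P c) /\ forall u, u \in <<X>>%VS -> eigprod f cs u = 0.
Proof.
move=> eigX.
have [cs [Pcs H]] : exists cs : seq F, (forall c, c \in cs -> P c) /\
    forall v, v \in X -> exists2 c, c \in cs & f v = c *: v.
  elim: (X) eigX => [|v s IH] eigX; first by exists [::].
  have [|cs [Pcs H]] := IH; first by move=> w ws; apply: eigX; rewrite inE ws orbT.
  have [c Pc fv] := eigX v (mem_head _ _); exists (c :: cs); split.
    by move=> b; rewrite inE => /predU1P[->|/Pcs].
  move=> w; rewrite inE => /predU1P[->|ws]; first by exists c; rewrite ?mem_head.
  by have [b bcs fw] := H w ws; exists b; rewrite ?inE ?bcs ?orbT.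
exists cs; split=> // u uX; have /subvP/(_ u uX) : (<<X>> <= lker (linfun (eigprod f cs)))%VS.
  apply/span_subvP=> v /H[c ccs fv]; rewrite memv_ker lfunE /= (eigprod_eig _ fv).
  by rewrite (big_rem c) //= subrr mul0r scale0r.
by rewrite memv_ker lfunE => /eqP.
Qed.

Lemma eig_inj (X : seq W) u : (forall v, v \in X -> exists2 c, c != 0 & f v = c *: v) ->
  u \in <<X>>%VS -> f u = 0 -> u = 0.
Proof.
move=> /eig_list[cs [cs0 H]] /H + fu; have E : f u = 0 *: u by rewrite fu scale0r.
rewrite (eigprod_eig cs E); move/eqP; rewrite scaler_eq0 => /orP[|/eqP//].
rewrite prodf_seq_eq0 => /hasP[c /cs0 + /=]; by rewrite sub0r oppr_eq0 => /negbTE->.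
Qed.
End DisjointSpectra.

Lemma eig_disjoint (F : fieldType) (W : vectType F) (f : 'End(W)) (P : F -> Prop) (X1 X2 : seq W) u :
  (forall v, v \in X1 -> exists2 c, P c & f v = c *: v) ->
  (forall v, v \in X2 -> exists2 c, ~ P c & f v = c *: v) ->
  u \in <<X1>>%VS -> u \in <<X2>>%VS -> u = 0.
Proof.
move=> /eig_list[cs [Pcs H]] H2 /H u1 u2.
apply: (eig_inj (f := linfun (eigprod f cs)) _ u2); last by rewrite lfunE.
move=> v /H2[c Pc fv]; exists (\prod_(b <- cs) (c - b)); last by rewrite lfunE /= (eigprod_eig _ fv).
apply/negP; rewrite prodf_seq_eq0 => /hasP[b /Pcs Pb /=]; rewrite subr_eq0 => /eqP cb.
by rewrite cb in Pc.
Qed.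

Section EvenPart.
Variables (F : numClosedFieldType) (g : lieSuperalgebra F).
Local Notation part := (lsa_part g).

Lemma skew_even_l (t x : g) : t \in part false -> bracket t x = - bracket x t.
Proof.
move=> t0; have [x0 [x1 [-> h0 h1]]] := homog_sum x.
by rewrite bracketDl bracketDr /bracket (lsa_br_skew t0 h0) (lsa_br_skew t0 h1) !scale1r opprD.
Qed.

Lemma kappa_ad (kappa : g -> g -> F) t x y : killing_form kappa -> t \in part false ->
  kappa (bracket t x) y = - kappa x (bracket t y).
Proof. by move=> kf t0; rewrite skew_even_l // (kappaNl kf) (kappa_inv kf). Qed.

Lemma ideal_flip (n p : {vspace g}) : graded n -> graded p -> br_sub p n n -> br_sub n p n.
Proof.
move=> gn gp pn x y /gn[x0 [x1 [-> x0n x1n h0 h1]]] /gp[y0 [y1 [-> y0p y1p k0 k1]]].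
have one (q r : bool) a b : a \in n -> b \in p -> a \in part q -> b \in part r -> bracket a b \in n.
  by move=> an bp aq br; rewrite /bracket (lsa_br_skew aq br) memvN memvZ // pn.
rewrite !(bracketDl, bracketDr); do !apply: memvD.
- exact: (one false false).
- exact: (one false true).
- exact: (one true false).
- exact: (one true true).
Qed.

Lemma mk_even_triangular (nm h np : {vspace g}) (X : seq g) :
  graded nm -> graded np -> (h <= part false)%VS -> (nm + h + np)%VS = fullv ->
  (nm :&: h = 0)%VS -> ((nm + h) :&: np = 0)%VS ->
  (forall x y, x \in h -> y \in h -> bracket x y = 0) ->
  br_sub np np np -> br_sub nm nm nm -> br_sub h np np -> br_sub h nm nm ->
  <<X>>%VS = fullv -> (forall v x, v \in X -> x \in h -> exists c, bracket x v = c *: v) ->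
  (forall y, y \in part false -> (forall x, x \in h -> bracket x y = 0) -> y \in h) ->
  even_triangular (nm :&: part false)%VS h (np :&: part false)%VS X.
Proof.
move=> gm gp h0 full dm dp ab pp mm hp hm sp eig self.
have hnp : (h :&: np = 0)%VS by apply/eqP; rewrite -subv0 -dp; apply: capvS (addvSr _ _) (subvv _).
have even0 (U W Z : {vspace g}) : br_sub U W Z ->
    br_sub (U :&: part false)%VS (W :&: part false)%VS (Z :&: part false)%VS.
  move=> H x y /[!memv_cap] /andP[xU x0] /andP[yW y0]; rewrite H //=.
  exact: (lsa_br_part x0 y0).
have even1 (W : {vspace g}) : br_sub h W W -> br_sub h (W :&: part false)%VS (W :&: part false)%VS.
  by move=> /even0; rewrite (capv_idPl h0).
have sum0 : (nm :&: part false + h + np :&: part false)%VS = part false.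
  apply/eqP; rewrite eqEsubv !subv_add !capvSr h0 /=; apply/subvP=> x x0.
  have : x \in (nm + h + np)%VS by rewrite full memvf.
  case/memv_addP=> _ /memv_addP[a am [k kh ->]] [c cp Ex].
  have [a0 [a1 [Ea a0m a1m ha0 ha1]]] := gm a am; have [c0 [c1 [Ec c0p c1p hc0 hc1]]] := gp c cp.
  have [|||/eqP + _] := @homog_sum0 _ _ (a0 + k + c0 - x) (a1 + c1).
  - by rewrite memvB ?memvD // (subvP h0).
  - by rewrite memvD.
  - by rewrite Ex Ea Ec; lincomb.
  by rewrite subr_eq0 => /eqP<-; rewrite !memv_add // memv_cap ?a0m ?c0p.
split=> //; last 4 first.
- exact: even0.
- exact: even0.
- exact: even1.
- exact: even1.
- by apply/eqP; rewrite -subv0 -hnp capvS ?capvSl.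
- by apply/eqP; rewrite -subv0 -dm capvC capvS ?capvSl.
have d1 := dimv_sum_cap (nm :&: part false + h)%VS (np :&: part false)%VS.
have d2 := dimv_sum_cap (nm :&: part false)%VS h.
have E1 : ((nm :&: part false + h) :&: (np :&: part false) = 0)%VS.
  by apply/eqP; rewrite -subv0 -dp capvS ?capvSl // addvS ?capvSl.
have E2 : ((nm :&: part false) :&: h = 0)%VS.
  by apply/eqP; rewrite -subv0 -dm capvS ?capvSl.
by move: d1 d2; rewrite E1 E2 dimv0 !addn0 sum0 => -> ->.
Qed.
End EvenPart.

Section SplitTheory.
Variables (F : numClosedFieldType) (g : lieSuperalgebra F) (kappa : g -> g -> F).
Hypothesis kf : killing_form kappa.
Local Notation part := (lsa_part g).

Section One.
Variables (h : {vspace g}) (t : g) (v : seq g) (tau : 'End(g)).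
Hypothesis sf : split_form h t v tau.

Let X := vbasis h ++ v.

Lemma sf_t0 : t \in part false.
Proof. exact: (subvP (sf_h0 sf) _ (sf_t sf)). Qed.

Lemma sf_spanX : <<X>>%VS = fullv.
Proof. by rewrite span_cat (span_basis (vbasisP h)) (sf_span sf). Qed.

Lemma sf_joint u x : u \in X -> x \in h -> exists c, bracket x u = c *: u.
Proof.
rewrite mem_cat => /orP[/vbasis_mem uh|uv] xh; last exact: (sf_wt sf uv xh).
by exists 0; rewrite (sf_ab sf) // scale0r.
Qed.

Lemma sf_diag x : x \in h -> eigenspanned (lsa_br x) X.
Proof. by move=> xh; split; [exact: sf_spanX|move=> u uX; apply: sf_joint]. Qed.

Lemma sf_cent x : bracket t x = 0 -> x \in h.
Proof.
move=> tx; have := diag_eigenspace (c := 0) (u := x) (sf_diag (sf_t sf)); rewrite scale0r => /(_ tx).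
apply/subvP/span_subvP=> w; rewrite mem_filter scale0r mem_cat => /andP[/eqP tw /orP[/vbasis_mem//|wv]].
have [m m0 E] := sf_int sf wv; move/eqP: tw; rewrite [lsa_br _ _]E scaler_eq0 intr_eq0 (negbTE m0) /=.
by move/eqP->; rewrite mem0v.
Qed.

Let posv := [seq u <- v | `[< exists k : nat, bracket t u = k.+1%:R *: u >]].
Let negv := [seq u <- v | `[< exists k : nat, bracket t u = - k.+1%:R *: u >]].

Let graded_span (s : seq g) : {subset s <= v} -> graded <<s>>%VS.
Proof.
move=> hs; apply/graded_subP/eqP; rewrite eqEsubv subv_add !capvSl !andbT.
apply/span_subvP=> u us; have [q uq] := sf_hom sf (hs u us); have us' := memv_span us.
case: q uq => uq; [apply: (subvP (addvSr _ _))|apply: (subvP (addvSl _ _))]; by rewrite memv_cap us' uq.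
Qed.

Let posvP x k : bracket t x = k.+1%:R *: x -> x \in <<posv>>%VS.
Proof.
move=> tx; have := diag_eigenspace (sf_diag (sf_t sf)) tx.
apply/subvP/span_subvP=> w; rewrite mem_filter mem_cat => /andP[/eqP tw /orP[/vbasis_mem wh|wv]].
  move: tw; rewrite [lsa_br _ _](sf_ab sf (sf_t sf) wh) => /esym/eqP.
  by rewrite scaler_eq0 pnatr_eq0 /= => /eqP->; rewrite mem0v.
by apply: memv_span; rewrite mem_filter wv andbT; apply/asboolP; exists k.
Qed.

Let negvP x k : bracket t x = - k.+1%:R *: x -> x \in <<negv>>%VS.
Proof.
move=> tx; have := diag_eigenspace (sf_diag (sf_t sf)) tx.
apply/subvP/span_subvP=> w; rewrite mem_filter mem_cat => /andP[/eqP tw /orP[/vbasis_mem wh|wv]].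
  move: tw; rewrite [lsa_br _ _](sf_ab sf (sf_t sf) wh) => /esym/eqP.
  by rewrite scaler_eq0 oppr_eq0 pnatr_eq0 /= => /eqP->; rewrite mem0v.
by apply: memv_span; rewrite mem_filter wv andbT; apply/asboolP; exists k.
Qed.

Lemma br_sub_span (s1 s2 : seq g) (K : {vspace g}) :
  (forall a b, a \in s1 -> b \in s2 -> bracket a b \in K) -> br_sub <<s1>>%VS <<s2>>%VS K.
Proof.
move=> H x y xs ys.
have -> : x = \sum_i coord (in_tuple s1) i x *: s1`_i by exact: (coord_span (X := in_tuple s1) xs).
have -> : y = \sum_i coord (in_tuple s2) i y *: s2`_i by exact: (coord_span (X := in_tuple s2) ys).
rewrite bracket_suml; apply: memv_suml => i _; rewrite bracket_sumr; apply: memv_suml => j _.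
by rewrite bracketZl bracketZr !memvZ // H // mem_nth.
Qed.

Lemma bracket_eig a b c d : bracket t a = c *: a -> bracket t b = d *: b ->
  bracket t (bracket a b) = (c + d) *: bracket a b.
Proof.
move=> ta tb; have := even_deriv sf_t0 a b; rewrite -!/(bracket _ _) ta tb => ->.
by rewrite bracketZl bracketZr scalerDl.
Qed.

(** The sign of the integral eigenvalue of [t] sorts the root vectors into the two nilpotent halves,
    and eigenvalues add under brackets. *)
Lemma sf_even : exists nm np, even_triangular nm h np X.
Proof.
have spanh : <<vbasis h>>%VS = h := span_basis (vbasisP h).
exists (<<negv>> :&: part false)%VS, (<<posv>> :&: part false)%VS.
pose P (c : F) := exists k : nat, c = k.+1%:R; pose N (c : F) := exists k : nat, c = - k.+1%:R.
have pos0 (k k' : nat) : k.+1%:R <> - k'%:R :> F.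
  by move/eqP; rewrite -subr_eq0 opprK -natrD pnatr_eq0.
have posE w : w \in posv -> exists2 c, P c & lsa_br t w = c *: w.
  by rewrite mem_filter => /andP[/asboolP[k tw] _]; exists k.+1%:R => //; exists k.
have negE w : w \in negv -> exists2 c, N c & lsa_br t w = c *: w.
  by rewrite mem_filter => /andP[/asboolP[k tw] _]; exists (- k.+1%:R) => //; exists k.
have hE w : w \in (vbasis h : seq g) -> lsa_br t w = 0 *: w.
  by move/vbasis_mem=> wh; rewrite scale0r; exact: (sf_ab sf (sf_t sf) wh).
apply: mk_even_triangular; last by move=> y _ ch; apply/sf_cent/ch/(sf_t sf).
- by apply: graded_span => u; rewrite mem_filter => /andP[].
- by apply: graded_span => u; rewrite mem_filter => /andP[].
- exact: sf_h0 sf.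
- apply/eqP; rewrite eqEsubv subvf -(sf_span sf) subv_add.
  rewrite (subv_trans (addvSr <<negv>>%VS h) (addvSl _ _)) /=.
  apply/span_subvP=> u uv; have [m m0 tu] := sf_int sf uv.
  case: m m0 tu => [[|k]|k] // _ tu; first exact: (subvP (addvSr _ _)) (posvP tu).
  rewrite -addvA; apply: (subvP (addvSl _ _)); apply: (@negvP u k).
  by rewrite tu NegzE mulrNz.
- apply/eqP; rewrite -subv0; apply/subvP=> x; rewrite memv_cap -{1}spanh memv0 => /andP[xn xh].
  apply/eqP/(eig_disjoint (f := lsa_br t) (P := N) (u := x) negE _ xn xh) => w /hE tw.
  by exists 0 => // -[k] /esym/eqP; rewrite oppr_eq0 pnatr_eq0.
- apply/eqP; rewrite -subv0; apply/subvP=> x; rewrite memv_cap -spanh -span_cat memv0 => /andP[xn xp].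
  apply/eqP/(eig_disjoint (f := lsa_br t) (P := P) (u := x) posE _ xp xn) => w.
  rewrite mem_cat => /orP[/negE[_ [k ->] tw]|/hE tw].
    by exists (- k.+1%:R) => // -[k'] /esym/pos0.
  by exists 0 => // -[k] /esym/eqP; rewrite pnatr_eq0.
- exact: sf_ab sf.
- apply: br_sub_span => a b; rewrite !mem_filter => /andP[/asboolP[k ta] _] /andP[/asboolP[k' tb] _].
  by apply: (@posvP _ (k + k').+1); rewrite (bracket_eig ta tb) -natrD addSn addnS.
- apply: br_sub_span => a b; rewrite !mem_filter => /andP[/asboolP[k ta] _] /andP[/asboolP[k' tb] _].
  by apply: (@negvP _ (k + k').+1); rewrite (bracket_eig ta tb) -opprD -natrD addSn addnS.
- rewrite -{1}spanh; apply: br_sub_span => a b /vbasis_mem ah; rewrite mem_filter => /andP[pb bv].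
  by have [c ->] := sf_wt sf bv ah; rewrite memvZ // memv_span // mem_filter pb bv.
- rewrite -{1}spanh; apply: br_sub_span => a b /vbasis_mem ah; rewrite mem_filter => /andP[pb bv].
  by have [c ->] := sf_wt sf bv ah; rewrite memvZ // memv_span // mem_filter pb bv.
- exact: sf_spanX.
by move=> w x; apply: sf_joint.
Qed.

Lemma sf_transport th (h' : {vspace g}) : even_auto th -> (forall x, x \in h -> th x \in h') ->
  (forall y, y \in h' -> exists2 x, x \in h & y = th x) ->
  split_form h' (th t) [seq th u | u <- v] (th \o tau \o th^-1)%VF.
Proof.
move=> eth hh' h'h; have [ti tp tb] := eth; have K := even_autoK eth; have VK := even_autoVK eth.
have [vi vp vb] := even_auto_inv eth.
split.
- by apply/subvP=> _ /h'h[x xh ->]; apply/tp/(subvP (sf_h0 sf)).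
- by move=> _ _ /h'h[x xh ->] /h'h[y yh ->]; rewrite -tb (sf_ab sf) ?lf0.
- exact/hh'/(sf_t sf).
- apply/eqP; rewrite eqEsubv subvf; apply/subvP=> y _.
  have : (th^-1)%VF y \in (h + <<v>>)%VS by rewrite (sf_span sf) memvf.
  case/memv_addP=> a ah [c cv E]; rewrite -(VK y) E lfD memv_add ?hh' //.
  by rewrite -limg_span memv_img.
- by move=> _ /mapP[u uv ->]; have [q uq] := sf_hom sf uv; exists q; apply: tp.
- by move=> _ /mapP[u uv ->]; have [m m0 tu] := sf_int sf uv; exists m; rewrite // -tb tu lfZ.
- by move=> _ _ /mapP[u uv ->] /h'h[x xh ->]; have [c xu] := sf_wt sf uv xh; exists c; rewrite -tb xu lfZ.
- by move=> p x xp; rewrite !comp_lfunE; apply/tp/(sf_tau_par sf)/vp.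
- by move=> x y; rewrite !comp_lfunE vb (sf_tau_br sf) tb.
- by move=> x; rewrite !comp_lfunE K (sf_tauK sf) VK.
- by move=> _ /h'h[x xh ->]; rewrite !comp_lfunE K (sf_tau_h sf).
Qed.

(* The weights of the root vectors distinguish them up to scalars. *)
Definition separated := forall u w, u \in v -> w \in v -> w \in <[u]>%VS \/
  exists x c c', [/\ x \in h, c != c', bracket x u = c *: u & bracket x w = c' *: w].

Let bl w : 'End(g) := linfun (HB.pack (fun x : g => bracket x w)
  (GRing.isLinear.Build _ _ _ _ _ (bracket_linear_l w)) : {linear _ -> _}).
Let blE w x : bl w x = bracket x w. Proof. by rewrite /bl lfunE. Qed.

Let line_eigen (x u w : g) (c c' : F) : u != 0 -> w != 0 -> bracket x u = c *: u -> bracket x w = c' *: w ->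
  bracket x (u + w) \in <[u + w]>%VS -> c = c'.
Proof.
move=> u0 w0 xu xw /vlineP[d]; rewrite bracketDr xu xw => E.
apply/eqP; apply: contraT => cc'.
have E1 : (c - d) *: u = (d - c') *: w.
  by apply/eqP; rewrite -subr_eq0 -[X in _ == X](subrr (d *: (u + w))) -{1}E; apply/eqP; lincomb.
have := congr1 (bracket x) E1; rewrite !bracketZr xu xw scalerA [in RHS]scalerA -![_ * c]mulrC -!scalerA E1.
rewrite !scalerA [(d - c') * c']mulrC => /eqP; rewrite -subr_eq0 -scalerBl scaler_eq0 (negbTE w0) orbF.
rewrite -mulrBl mulf_eq0 subr_eq0 (negbTE cc') subr_eq0 /= => /eqP dc'.
move/eqP: E1; rewrite dc' subrr scale0r scaler_eq0 (negbTE u0) orbF subr_eq0 (negbTE cc') //.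
Qed.

(** Finitely many proper subspaces of [h] have to be avoided: those where some root vanishes and
    those where two non-proportional root vectors get the same eigenvalue. *)
Lemma separating : separated -> exists2 x0, x0 \in h & (forall y, bracket x0 y = 0 -> y \in h) /\
  forall y y' c, c != 0 -> y != 0 -> bracket x0 y = c *: y -> bracket x0 y' = c *: y' -> y' \in <[y]>%VS.
Proof.
move=> sep; pose v' := [seq u <- v | u != 0].
pose K1 := [seq (bl u @^-1: 0)%VS | u <- v'].
(* [u + w] is an eigenvector of [x] only if both weights agree at [x]; in this form the condition on
   [x] cuts out a subspace. *)
pose K2 := [seq (bl (p.1 + p.2) @^-1: <[p.1 + p.2]>)%VS | p <- [seq (u, w) | u <- v', w <- v']].
have [|x0 x0h x0K] := @avoid_subspaces _ _ h [seq K <- K1 ++ K2 | ~~ (h <= K)%VS].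
  by move=> K; rewrite mem_filter => /andP[].
have x0v u : u \in v' -> bracket x0 u != 0.
  move=> uv; have : (bl u @^-1: 0)%VS \in [seq K <- K1 ++ K2 | ~~ (h <= K)%VS].
    rewrite mem_filter mem_cat; apply/andP; split; last by apply/orP; left; apply/mapP; exists u.
    apply/negP=> /subvP/(_ _ (sf_t sf)); rewrite -memv_preim memv0 blE.
    move: uv; rewrite mem_filter => /andP[u0 uv].
    by have [m m0 ->] := sf_int sf uv; rewrite scaler_eq0 intr_eq0 (negbTE m0) (negbTE u0).
  by move/x0K; rewrite -memv_preim memv0 blE.
have x0s u w : u \in v' -> w \in v' -> bracket x0 (u + w) \in <[u + w]>%VS -> w \in <[u]>%VS.
  move=> uv wv E; have [u0 u_v] : u != 0 /\ u \in v by move: uv; rewrite mem_filter => /andP.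
  have [w0 w_v] : w != 0 /\ w \in v by move: wv; rewrite mem_filter => /andP.
  have [//|[x [c [c' [xh cc' xu xw]]]]] := sep u w u_v w_v.
  have : (bl (u + w) @^-1: <[u + w]>)%VS \in [seq K <- K1 ++ K2 | ~~ (h <= K)%VS].
    rewrite mem_filter mem_cat; apply/andP; split; last first.
      by apply/orP; right; apply/mapP; exists (u, w) => //; apply/allpairsP; exists (u, w).
    apply/negP=> /subvP/(_ _ xh); rewrite -memv_preim blE => /(line_eigen u0 w0 xu xw) E'.
    by rewrite E' eqxx in cc'.
  by move/x0K; rewrite -memv_preim blE E.
have eigX y c : bracket x0 y = c *: y -> y \in <<[seq w <- X | lsa_br x0 w == c *: w]>>%VS.
  exact: diag_eigenspace (sf_diag x0h).
have vE w c : w \in v -> lsa_br x0 w = c *: w -> w = 0 \/ w \in v'.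
  by move=> wv _; have [->|w0] := eqVneq w 0; [left|right; rewrite mem_filter w0].
exists x0 => //; split=> [y x0y|y y' c c0 y0 ey ey'].
  have := eigX y 0; rewrite scale0r => /(_ x0y); apply/subvP/span_subvP=> w.
  rewrite mem_filter scale0r mem_cat => /andP[/eqP tw /orP[/vbasis_mem//|wv]].
  have [->|wv'] := vE w 0 wv (etrans tw (esym (scale0r w))); first by rewrite mem0v.
  by have := x0v w wv'; rewrite [bracket _ _]tw eqxx.
have [u uv [eu span_u]] : exists2 u, u \in v' & lsa_br x0 u = c *: u /\
    (<<[seq w <- X | lsa_br x0 w == c *: w]>> <= <[u]>)%VS.
  have nz w : w \in X -> lsa_br x0 w = c *: w -> w = 0 \/ w \in v'.
    rewrite mem_cat => /orP[/vbasis_mem wh|]; last exact: vE.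
    rewrite [lsa_br _ _](sf_ab sf x0h wh) => /esym/eqP; rewrite scaler_eq0 (negbTE c0) /= => /eqP; by left.
  have [u uv eu] : exists2 u, u \in v' & lsa_br x0 u = c *: u.
    apply: contrapT => no; have := eigX y c ey.
    suff /subvP H : (<<[seq w <- X | lsa_br x0 w == c *: w]>> <= 0)%VS.
      by move/H; rewrite memv0 (negbTE y0).
    apply/span_subvP=> w; rewrite mem_filter => /andP[/eqP ew wX].
    by have [->|wv] := nz w wX ew; [rewrite mem0v|case: no; exists w].
  exists u => //; split=> //; apply/span_subvP=> w; rewrite mem_filter => /andP[/eqP ew wX].
  have [->|wv] := nz w wX ew; first by rewrite mem0v.
  apply: x0s => //; rewrite bracketDr [bracket _ u]eu [bracket _ w]ew -scalerDr.
  by rewrite memvZ ?memv_line.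
have /vlineP[a Ey] := subvP span_u _ (eigX y c ey).
have /vlineP[a' ->] := subvP span_u _ (eigX y' c ey').
have a0 : a != 0 by apply: contraNneq y0 => a0; rewrite Ey a0 scale0r.
by apply/vlineP; exists (a' / a); rewrite Ey scalerA divfK.
Qed.

(* On a subspace spanned by root spaces, [tau] is determined up to scalars by
   the invariant form. *)
Lemma tau_sub (n nb : {vspace g}) : separated ->
  (forall x y, x \in h -> y \in n -> bracket x y \in n) ->
  (forall x y, x \in h -> y \in nb -> bracket x y \in nb) ->
  (n :&: h = 0)%VS -> (forall x, x \in n -> (forall y, y \in nb -> kappa x y = 0) -> x = 0) ->
  forall x, x \in n -> tau x \in nb.
Proof.
move=> /separating[x0 x0h [cent mult]] hn hnb nh nd.
have x00 := subvP (sf_h0 sf) _ x0h.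
suff /subvP H : (n <= tau @^-1: nb)%VS by move=> x /H; rewrite -memv_preim.
apply: (diag_sub (sf_diag x0h)) => [w|x c xn ex]; first exact: hn.
rewrite -memv_preim; have [->|nz] := eqVneq x 0; first by rewrite lf0 mem0v.
have c0 : c != 0.
  apply: contraNneq nz => c0; rewrite -memv0 -nh memv_cap xn /=; apply: cent.
  by rewrite [bracket _ _]ex c0 scale0r.
have linr : linear (kappa x : g -> F^o) by case: kf => -[].
pose A1 := GRing.isLinear.Build _ _ _ _ _ linr.
pose kx : {linear g -> F^o} := HB.pack (kappa x : g -> F^o) A1.
(* Non-degeneracy yields an eigenvector [y] in [nb] that pairs with [x]. Invariance gives it the
   eigenvalue [- c], which is also that of [tau x]; as the eigenspace is a line, [tau x] is a
   multiple of [y]. *)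
have [y [c' [ynb ey kxy]]] : exists y c', [/\ y \in nb, bracket x0 y = c' *: y & kappa x y != 0].
  apply: contrapT => no; move/eqP: nz; apply; apply: nd => // y ynb.
  suff /subvP/(_ y ynb) : (nb <= lker (linfun kx))%VS by rewrite memv_ker lfunE => /eqP.
  apply: (diag_sub (sf_diag x0h)) => [w|w c' wn ew]; first exact: hnb.
  by rewrite memv_ker lfunE /=; apply: contraT => kw; case: no; exists w, c'.
have cc' : c' = - c.
  have := kappa_ad x y kf x00; rewrite [bracket _ x]ex ey (kappaZl kf) (kappaZr kf) -mulNr.
  by move/(mulIf kxy) => ->; rewrite opprK.
have y0 : y != 0 by apply: contraNneq kxy => ->; rewrite (kappa0r kf).
have etau : bracket x0 (tau x) = - c *: tau x.
  have := congr1 tau (skew_even_l x x00); rewrite [bracket _ x]ex lfN (sf_tau_br sf) (sf_tau_h sf x0h) lfZ.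
  by rewrite scaleNr => ->; rewrite opprK.
have /vlineP[a ->] : tau x \in <[y]>%VS.
  by apply: (mult y (tau x) (- c)); rewrite ?oppr_eq0 // -cc'.
by rewrite memvZ.
Qed.

(** Eigenvectors [a] of [n] and [b] of [p] pair only for opposite eigenvalues of [t]. Then their
    bracket lies in [n :&: h], which is zero; invariance against [t] makes both eigenvalues zero, so
    that [a] itself lies in [n :&: h]. *)
Lemma kappa_ideal (n p : {vspace g}) : graded n -> graded p -> t \in p -> br_sub p p p -> br_sub p n n ->
  (n :&: h = 0)%VS -> forall x y, x \in n -> y \in p -> kappa x y = 0.
Proof.
move=> gn gp tp pp pn nh x y xn yp; have t0 := sf_t0.
have linr u : linear (kappa u : g -> F^o) by case: kf => -[].
have linl w : linear (kappa^~ w : g -> F^o) by case: kf => -[].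
pose A1 u := GRing.isLinear.Build _ _ _ _ _ (linr u).
pose kx u : {linear g -> F^o} := HB.pack (kappa u : g -> F^o) (A1 u).
pose A2 w := GRing.isLinear.Build _ _ _ _ _ (linl w).
pose ky w : {linear g -> F^o} := HB.pack (kappa^~ w : g -> F^o) (A2 w).
suff /subvP/(_ x xn) : (n <= lker (linfun (ky y)))%VS by rewrite memv_ker lfunE => /eqP.
apply: (diag_sub (sf_diag (sf_t sf))) => [w wn|a c an ea]; first exact: pn.
rewrite memv_ker lfunE /=.
suff /subvP/(_ y yp) : (p <= lker (linfun (kx a)))%VS by rewrite memv_ker lfunE.
apply: (diag_sub (sf_diag (sf_t sf))) => [w wp|b c' bp eb]; first exact: pp.
rewrite memv_ker lfunE /=; apply: contraT => kab.
have cc' : c = - c'.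
  have := kappa_ad a b kf t0; rewrite [bracket _ a]ea [bracket _ b]eb (kappaZl kf) (kappaZr kf) -mulNr.
  by move/(mulIf kab).
have ab0 : bracket a b = 0.
  apply/eqP; rewrite -memv0 -nh memv_cap; apply/andP; split; last first.
    by apply: sf_cent; rewrite (bracket_eig ea eb) cc' addNr scale0r.
  exact: (ideal_flip gn gp pn).
have := kappa_inv kf a b t; rewrite ab0 (kappa0l kf) -[bracket b t]opprK -skew_even_l // [bracket t b]eb.
rewrite (kappaNr kf) (kappaZr kf) => /esym/eqP; rewrite oppr_eq0 mulf_eq0 (negbTE kab) orbF => /eqP c'0.
have : a \in (n :&: h)%VS.
  by rewrite memv_cap an; apply: sf_cent; rewrite [bracket _ _]ea cc' c'0 oppr0 scale0r.
by rewrite nh memv0 => /eqP a0; rewrite a0 (kappa0l kf) eqxx in kab.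
Qed.
End One.

End SplitTheory.

Definition kostant_tfae (F : fieldType) (g : lieSuperalgebra F) (l : {vspace g}) (fr : nil_frame g)
    (V : actspace g) : Prop :=
  [<-> forall k, (im_bdry fr V k :&: ker_quabla fr V k = 0)%VS;
       forall k, (im_bdry fr V k :&: quabla0 fr V k = 0)%VS;
       forall k, (quabla0 fr V k <= ker_bdry fr V k)%VS;
       forall k, lmod_iso l (homology fr V k) (quabla0_module fr V k);
       forall k, (im_cobdry fr V k :&: ker_quabla fr V k = 0)%VS;
       forall k, lmod_iso l (cohomology fr V k) (quabla0_module fr V k);
       forall k, (ker_cobdry fr V k :&: im_bdry fr V k = 0)%VS
                 /\ (ker_bdry fr V k :&: im_cobdry fr V k = 0)%VS].

(** * The equivalences for superalgebras with a split form *)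

Section Assembly.
Variables (F : numClosedFieldType) (g : lieSuperalgebra F) (kappa : g -> g -> F).
Variables (p l n nb : {vspace g}) (d : nat) (xi xid : d.-tuple g).
Local Notation part := (lsa_part g).
Hypothesis kf : killing_form kappa.
Hypothesis xi_basis : homogeneous_basis n xi.
Hypothesis xid_basis : homogeneous_basis nb xid.
Hypothesis dual : forall a b : 'I_d, kappa (tnth xid a) (tnth xi b) = (a == b)%:R.

Definition kostant_statement :=
  (forall V : actspace g, irreducible_module V -> kostant_tfae l (frame_n l n nb xi xid) V) /\
  (forall W : actspace g, irreducible_module W -> kostant_tfae l (frame_nb p nb xi xid) W).

Lemma xi_hom a : tnth xi a \in part (tnth xi a \in part true).
Proof.
have [_ /(_ a)[q xq]] := xi_basis; have [xt|/negbTE xt] := boolP (tnth xi a \in part true); rewrite ?xt //.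
by case: q xq => // xq; rewrite xq in xt.
Qed.

Lemma xid_hom a : tnth xid a \in part (tnth xi a \in part true).
Proof.
have [_ /(_ a)[q xq]] := xid_basis.
have : kappa (tnth xid a) (tnth xi a) != 0 by rewrite dual eqxx oner_eq0.
by move/(kappa_par kf xq (xi_hom a)) => <-.
Qed.

Lemma xid_par a : (tnth xid a \in part true) = (tnth xi a \in part true).
Proof.
have xd0 : tnth xid a != 0.
  by apply/eqP=> E; have := dual a a; rewrite E (kappa0l kf) eqxx => /esym/eqP; rewrite oner_eq0.
apply/idP/idP => [xt|xt]; last by rewrite -[X in part X]xt xid_hom.
by have := homog_inj xt (xid_hom a) xd0 => <-.
Qed.

Lemma dual_sym a b : kappa (tnth xi a) (tnth xid b) =
  (-1) ^+ (tnth xi a \in part true) * (a == b)%:R.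
Proof.
rewrite (kappa_sym kf (xi_hom a) (xid_hom b)) dual [b == a]eq_sym.
by have [->|_] := eqVneq a b; rewrite ?andbb ?mulr0.
Qed.

Lemma xid_span y : y \in nb -> y = \sum_a kappa y (tnth xi a) *: tnth xid a.
Proof.
move=> ynb; have [bb _] := xid_basis.
rewrite {1}(coord_basis bb ynb); apply: eq_bigr => a _.
rewrite [in RHS](coord_basis bb ynb) (kappa_suml kf) (bigD1 a) //= big1 => [|b ba].
  by rewrite (kappaZl kf) -tnth_nth dual eqxx mulr1 addr0.
by rewrite (kappaZl kf) -tnth_nth dual (negbTE ba) mulr0.
Qed.

Lemma xi_span y : y \in n ->
  y = \sum_a kappa y (tnth xid a) *: ((-1) ^+ (tnth xi a \in part true) *: tnth xi a).
Proof.
move=> yn; have [bb _] := xi_basis.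
rewrite {1}(coord_basis bb yn); apply: eq_bigr => a _.
rewrite [in RHS](coord_basis bb yn) (kappa_suml kf) (bigD1 a) //= big1 => [|b ba].
  rewrite (kappaZl kf) -!tnth_nth dual_sym eqxx mulr1 addr0 scalerA -mulrA -signr_addb addbb mulr1 //.
by rewrite (kappaZl kf) -tnth_nth dual_sym (negbTE ba) !mulr0.
Qed.

Section Adapted.
Variables (nm h np : {vspace g}).
Hypothesis tri : triangular nm h np.
Let ps := (nb + l)%VS.
Hypothesis pP : [/\ subalgebra p, (h + np <= p)%VS & p = (l + n)%VS].
Hypothesis psP : [/\ subalgebra ps, (nm + h <= ps)%VS & subalgebra l].
Hypothesis nP : [/\ ideal_of n p, (n <= np)%VS, ideal_of nb ps & (nb <= nm)%VS].
Hypothesis dec : (nb + l + n)%VS = fullv /\ directv (nb + l + n).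

Lemma triangular_caps : [/\ (nm :&: h = 0)%VS, ((nm + h) :&: np = 0)%VS, (np :&: h = 0)%VS
  & (h <= part false)%VS].
Proof.
have [[self _] _ _ _] := tri; rewrite directvE /= => /eqP dd; clear dec.
have d1 := dimv_sum_cap (nm + h)%VS np; have d2 := dimv_sum_cap nm h.
have E1 : ((nm + h) :&: np = 0)%VS by apply/eqP; rewrite -dimv_eq0; move: d1 d2 dd; lia.
have E2 : (nm :&: h = 0)%VS by apply/eqP; rewrite -dimv_eq0; move: d1 d2 dd; lia.
split=> //.
  by apply/eqP; rewrite -subv0 -E1 capvC; apply: capvS (addvSr _ _) (subvv _).
by apply/subvP=> x /self[].
Qed.

Lemma triangular_even : exists nm0 np0 X, even_triangular nm0 h np0 X.
Proof.
have [E2 E1 _ h0] := triangular_caps.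
have [[self [X bX eX]] [[gm mm] [gp pp]] [hm hp] full _] := tri.
exists (nm :&: part false)%VS, (np :&: part false)%VS, X.
apply: mk_even_triangular => //; try exact/graded_subP.
- by move=> x y xh /self[_]; apply.
- exact: span_basis bX.
by move=> y y0 H; apply/self.
Qed.

Variables (t : g) (v : seq g) (tau : 'End(g)).
Hypothesis sf : split_form h t v tau.

Lemma nil_caps : [/\ (n :&: h = 0)%VS, (nb :&: h = 0)%VS, (n :&: (nb + l) = 0)%VS & (nb :&: p = 0)%VS].
Proof.
have [E2 _ E3 _] := triangular_caps; have [_ nnp _ nbnm] := nP; have [_ _ pE] := pP.
have [_] := dec; rewrite directvE /= => /eqP dd.
have d1 := dimv_sum_cap (nb + l)%VS n; have d2 := dimv_sum_cap nb l.
have d3 := dimv_sum_cap nb (l + n)%VS; have d4 := dimv_sum_cap l n; rewrite addvA in d3.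
split.
- by apply/eqP; rewrite -subv0 -E3 capvS.
- by apply/eqP; rewrite -subv0 -E2 capvS.
- by apply/eqP; rewrite capvC -dimv_eq0; move: d1 d2 dd; lia.
by apply/eqP; rewrite -dimv_eq0 pE; move: d1 d2 d3 d4 dd; lia.
Qed.

Lemma kappa_n_p x y : x \in n -> y \in p -> kappa x y = 0.
Proof.
have [[gp pp] hp _] := pP; have [[gn _ pn] _ _ _] := nP; have [nh _ _ _] := nil_caps.
apply: (kappa_ideal kf sf) => //; try exact/graded_subP.
by apply: (subvP hp); apply: (subvP (addvSl _ _)); apply: sf_t sf.
Qed.

Lemma kappa_nb_ps x y : x \in nb -> y \in ps -> kappa x y = 0.
Proof.
have [[gp pp] hp _] := psP; have [_ _ [gn _ pn] _] := nP; have [_ nh _ _] := nil_caps.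
apply: (kappa_ideal kf sf) => //; try exact/graded_subP.
by apply: (subvP hp); apply: (subvP (addvSr _ _)); apply: sf_t sf.
Qed.

Lemma good_frame_n : good_frame kappa (frame_n l n nb xi xid) n nb l ps.
Proof.
have [[gp pp] hp pE] := pP; have [[gps pps] hps [gl ll]] := psP.
have [[gn np' pn] nnp [gnb nbps pnb] nbnm] := nP; have [_ _ nps _] := nil_caps; have [full _] := dec.
have lp : (l <= p)%VS by rewrite pE addvSl.
split=> //=.
- by case: xi_basis.
- exact: xi_hom.
- by move=> x; apply: memv_pi.
- by move=> x; apply: daddv_pi_id.
- by move=> x xq; have := daddv_pi_add (w := x) nps; rewrite -/ps addvC full memvf => /(_ isT) E;
    apply: (addIr x); rewrite add0r -{2}(daddv_pi_id (etrans (capvC _ _) nps) xq) E.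
- by move=> x; have := daddv_pi_add (w := x) nps; rewrite -/ps addvC full memvf => /(_ isT) E;
    rewrite -{1}E [X in X - _]addrC addrK memv_pi.
- exact: xid_hom.
- by move=> a; have [/basis_mem H _] := xid_basis; apply/H/mem_tnth.
- exact: xid_span.
- exact: kappa_nb_ps.
- exact: addvSr.
- by move=> x y xn; apply: pn; apply: (subvP np').
- by move=> x y xl; apply: pn; apply: (subvP lp).
Qed.

Lemma good_frame_nb : good_frame kappa (frame_nb p nb xi xid) nb n l p.
Proof.
have [[gp pp] hp pE] := pP; have [[gps pps] hps [gl ll]] := psP.
have [[gn np' pn] nnp [gnb nbps pnb] nbnm] := nP; have [_ _ _ nbp] := nil_caps; have [full _] := dec.
have fullp : (nb + p)%VS = fullv by rewrite pE addvA.
split=> //=.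
- by case: xid_basis.
- by move=> a; rewrite /xi_par /= xid_par xid_hom.
- by move=> x; apply: memv_pi.
- by move=> x; apply: daddv_pi_id.
- by move=> x xq; have := daddv_pi_add (w := x) nbp; rewrite fullp memvf => /(_ isT) E;
    apply: (addIr x); rewrite add0r -{2}(daddv_pi_id (etrans (capvC _ _) nbp) xq) E.
- by move=> x; have := daddv_pi_add (w := x) nbp; rewrite fullp memvf => /(_ isT) E;
    rewrite -{1}E [X in X - _]addrC addrK memv_pi.
- by move=> a; rewrite /xi_par /= xid_par memvZ // xi_hom.
- by move=> a; have [/basis_mem H _] := xi_basis; apply/memvZ/H/mem_tnth.
- exact: xi_span.
- exact: kappa_n_p.
- by move=> a b; rewrite (kappaZl kf) dual_sym mulrA -signr_addb addbb mul1r.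
- by rewrite pE addvSl.
- by move=> x y xn; apply: pnb; apply: (subvP nbps).
- by move=> x y xl; apply: pnb; apply: (subvP (addvSr _ _)).
Qed.

Theorem adapted_kostant : (forall x, x \in n -> tau x \in nb) -> (forall x, x \in nb -> tau x \in n) ->
  kostant_statement.
Proof.
move=> tn tnb; split=> V irr; have modV : is_module V by case: irr.
  have [B [Bl Br Badj Bnd]] := contravariant_form sf irr.
  apply: (kostant_equivalences good_frame_n modV) => k.
  apply: (chains_rank good_frame_n modV (s := tau) (B := B)) => //.
  - by move=> q c; exact: (sf_tau_par sf).
  - by move=> c a _ _; rewrite (sf_tau_br sf).
  - by move=> y ynb; exists (tau y); rewrite ?tnb ?(sf_tauK sf).
have [B [Bl Br Badj Bnd]] := contravariant_form sf irr.
apply: (kostant_equivalences good_frame_nb modV) => k.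
apply: (chains_rank good_frame_nb modV (s := tau) (B := B)) => //.
- by move=> q c; exact: (sf_tau_par sf).
- by move=> c a _ _; rewrite (sf_tau_br sf).
- by move=> y yn; exists (tau y); rewrite ?tn ?(sf_tauK sf).
Qed.

Theorem separated_kostant : separated h v -> kostant_statement.
Proof.
move=> sep; have [nh nbh _ _] := nil_caps.
have [_ hp _] := pP; have [_ hps _] := psP; have [[_ _ pn] _ [_ _ pnb] _] := nP.
have hn x y : x \in h -> y \in n -> bracket x y \in n.
  by move=> xh; apply: pn; apply: (subvP hp); apply: (subvP (addvSl _ _)).
have hnb x y : x \in h -> y \in nb -> bracket x y \in nb.
  by move=> xh; apply: pnb; apply: (subvP hps); apply: (subvP (addvSr _ _)).
apply: adapted_kostant; apply: (tau_sub kf sf sep) => // x xn H.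
  rewrite (xi_span xn) big1 // => a _; rewrite H ?scale0r //.
  by have [/basis_mem Hb _] := xid_basis; apply/Hb/mem_tnth.
rewrite (xid_span xn) big1 // => a _; rewrite H ?scale0r //.
by have [/basis_mem Hb _] := xi_basis; apply/Hb/mem_tnth.
Qed.
End Adapted.

(** The centre must not meet the derived algebra of the even part. This is what the conjugacy of
    Cartan subalgebras requires, and it still admits the centre of gl. *)
Definition central_condition := forall z : g, (forall y, bracket z y = 0) ->
  z \in @actsp _ _ (adjoint g) (part false) (part false) -> z = 0.

(** The split Cartan subalgebra is moved onto the one underlying the parabolic, and [tau] along with
    it. Since root spaces are lines, the transported [tau] then exchanges [n] and [nb]. *)
Theorem split_kostant (hs : {vspace g}) t v (tau : 'End(g)) : parabolic_decomposition p l n nb ->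
  split_form hs t v tau -> separated hs v -> central_condition -> kostant_statement.
Proof.
move=> [nm [h [np [tri pP psP nP dec]]]] sf sep cc.
have [nm1 [np1 [X1 et1]]] := triangular_even tri; have [nm2 [np2 et2]] := sf_even sf.
have [th [eth hh hh']] := cartan_conj kf et1 et2 cc.
have sf' := sf_transport sf eth hh hh'; have [_ _ tb] := eth.
apply: (separated_kostant tri pP psP nP dec sf') => _ _ /mapP[u uv ->] /mapP[w wv ->].
have [/vlineP[c ->]|[x [c [c' [xh cc' xu xw]]]]] := sep u w uv wv.
  by left; rewrite lfZ memvZ ?memv_line.
by right; exists (th x), c, c'; rewrite -!tb xu xw !lfZ; split=> //; apply: hh.
Qed.
End Assembly.

Definition has_split (F : numClosedFieldType) (g : lieSuperalgebra F) :=
  exists (h : {vspace g}) (t : g) (v : seq g) (tau : 'End(g)),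
    [/\ split_form h t v tau, separated h v & central_condition g].

(** As long as [U] does not exhaust [P], excluded middle provides a vector to adjoin, and the
    dimension limits the number of steps. It turns propositional conditions on vectors into
    subspaces. *)
Lemma vspace_of_pred (F : fieldType) (vT : vectType F) (P : vT -> Prop) : P 0 ->
  (forall c u w, P u -> P w -> P (c *: u + w)) -> exists U : {vspace vT}, forall u, u \in U <-> P u.
Proof.
move=> P0 Plin.
suff H k (U : {vspace vT}) : (forall u, u \in U -> P u) -> (\dim {:vT} - \dim U < k)%N ->
    exists W : {vspace vT}, forall u, u \in W <-> P u.
  by apply: (H _ 0%VS _ (leqnn _)) => u; rewrite memv0 => /eqP->.
elim: k U => // k IH U UP dU.
have [all|/existsNP[u /not_implyP[Pu uU]]] := EM (forall u, P u -> u \in U).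
  by exists U => u; split; [apply: UP|apply: all].
apply: (IH (U + <[u]>)%VS).
  move=> _ /memv_addP[a aU [_ /vlineP[c ->] ->]]; rewrite addrC; exact: Plin (UP _ aU).
have : (\dim U < \dim (U + <[u]>))%N.
  by rewrite (ltn_leqif (dimv_leqif_sup (addvSl _ _))) subv_add subvv /=; apply/negP.
have := dimvS (subvf (U + <[u]>)); lia.
Qed.

(** * Matrix superalgebras: the common model, gl, sl and psl *)

Section MatrixModel.
Variables (F : numClosedFieldType) (g : lieSuperalgebra F) (m n : nat).
Local Notation part := (lsa_part g).
Local Notation M_ := 'M[F]_(m + n).
Implicit Types (M N d : M_).

Variables (psi : M_ -> g) (mm : {vspace M_}) (T : M_ -> M_).
Hypothesis psi_lin : linear psi.
Hypothesis psi_par : forall (p : bool) M, M \in mm -> mx_part p M -> psi M \in part p.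
Hypothesis psi_br : forall (p q : bool) M N, M \in mm -> N \in mm -> mx_part p M -> mx_part q N ->
  psi (supercomm p q M N) = bracket (psi M) (psi N).
Hypothesis psi_onto : forall x, exists2 M, M \in mm & psi M = x.
Hypothesis mm_gr : forall M, M \in mm -> exists M0 M1,
  [/\ M = M0 + M1, M0 \in mm, M1 \in mm, mx_part false M0 & mx_part true M1].
Hypothesis mm_br : forall (p q : bool) M N, M \in mm -> N \in mm -> mx_part p M -> mx_part q N ->
  supercomm p q M N \in mm.
Hypothesis T_lin : linear T.
Hypothesis T_mm : forall M, M \in mm -> T M \in mm.
Hypothesis T_ker : forall M, M \in mm -> psi M = 0 -> psi (T M) = 0.
Hypothesis TK : forall M, T (T M) = M.
Hypothesis T_par : forall (p : bool) M, mx_part p M -> mx_part p (T M).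
Hypothesis T_mul : forall M N, T (M *m N) = T N *m T M.
Hypothesis T_diag : forall d, is_diag_mx d -> T d = d.

Let psi_add M N : psi (M + N) = psi M + psi N.
Proof. by have := psi_lin 1 M N; rewrite !scale1r. Qed.
Let psi0 : psi 0 = 0. Proof. by apply: (addIr (psi 0)); rewrite -psi_add !add0r. Qed.
Let psi_scale c M : psi (c *: M) = c *: psi M.
Proof. by have := psi_lin c M 0; rewrite psi0 !addr0. Qed.
Let T_add M N : T (M + N) = T M + T N.
Proof. by have := T_lin 1 M N; rewrite !scale1r. Qed.
Let T0 : T 0 = 0. Proof. by apply: (addIr (T 0)); rewrite -T_add !add0r. Qed.
Let T_scale c M : T (c *: M) = c *: T M.
Proof. by have := T_lin c M 0; rewrite T0 !addr0. Qed.

Let psiL : 'Hom(M_, g) := linfun (HB.pack psi (GRing.isLinear.Build _ _ _ _ _ psi_lin) : {linear _ -> _}).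
Let psiLE M : psiL M = psi M. Proof. by rewrite /psiL lfunE. Qed.

Lemma psi_homog (p : bool) x : x \in part p -> exists M, [/\ M \in mm, mx_part p M & psi M = x].
Proof.
move=> xp; have [M Mm EM] := psi_onto x; have [M0 [M1 [E M0m M1m h0 h1]]] := mm_gr Mm.
have k0 := psi_par M0m h0; have k1 := psi_par M1m h1.
rewrite E psi_add in EM; case: p xp => xp.
  have [|||z0 _] := @homog_sum0 _ _ (psi M0) (psi M1 - x); rewrite ?memvB //; last by exists M1; rewrite -EM z0 add0r.
  by rewrite addrA EM subrr.
have [|||_ z1] := @homog_sum0 _ _ (psi M0 - x) (psi M1); rewrite ?memvB //; last by exists M0; rewrite -EM z1 addr0.
by rewrite addrAC EM subrr.
Qed.

(** [T] preserves the kernel of [psi] on [mm], so a choice of preimages defines the descended map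
    independently of the choice. The kernel consists of the scalars for psl. *)
Lemma model_tau : exists tau : 'End(g), forall M, M \in mm -> tau (psi M) = psi (T M).
Proof.
have [sec Hsec] := choice (fun x => let: ex_intro2 M a b := psi_onto x in ex_intro _ M (conj a b)).
have secm x : sec x \in mm by case: (Hsec x).
have secK x : psi (sec x) = x by case: (Hsec x).
have E M : M \in mm -> psi (T (sec (psi M))) = psi (T M).
  move=> Mm; apply/eqP; rewrite -subr_eq0; apply/eqP.
  have -> : psi (T (sec (psi M))) - psi (T M) = psi (T (sec (psi M) - M)).
    by rewrite -!scaleN1r T_add psi_add T_scale psi_scale.
  by apply: T_ker; [rewrite memvB|rewrite -scaleN1r psi_add psi_scale secK scaleN1r subrr].
have lin : linear (fun x => psi (T (sec x))).
  move=> c x y; have -> : c *: x + y = psi (c *: sec x + sec y) by rewrite psi_lin !secK.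
  by rewrite E ?memvD ?memvZ // T_lin psi_lin.
exists (linfun (HB.pack (fun x => psi (T (sec x))) (GRing.isLinear.Build _ _ _ _ _ lin) : {linear g -> g})).
by move=> M Mm; rewrite lfunE /= E.
Qed.

Let diagv : {vspace M_} := <<[seq delta_mx i i | i : 'I_(m + n)]>>%VS.

Let diagvP M : reflect (is_diag_mx M) (M \in diagv).
Proof.
apply: (iffP idP) => [|/diag_mxP[d ->]]; last first.
  have -> : diag_mx d = \sum_i d 0 i *: delta_mx i i.
    apply/matrixP=> i j; rewrite mxE summxE (bigD1 i) //= big1 => [|k ki].
      by rewrite !mxE eqxx /= addr0 eq_sym; case: eqP; rewrite ?mulr1 ?mulr0 ?mulr1n ?mulr0n.
    by rewrite !mxE [i == k]eq_sym (negbTE ki) mulr0.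
  by apply: memv_suml => i _; apply/memvZ/memv_span/image_f.
have lin0 : forall M', M' \in diagv -> forall i j, i != j -> M' i j = 0.
  move=> M' M'd i j ij.
  have lin : linear (fun A : M_ => A i j : F^o) by move=> c A B; rewrite !mxE.
  pose e : {linear M_ -> F^o} := HB.pack (fun A : M_ => A i j : F^o) (GRing.isLinear.Build _ _ _ _ _ lin).
  have /subvP/(_ _ M'd) : (diagv <= lker (linfun e))%VS.
    apply/span_subvP=> _ /imageP[k _ ->]; rewrite memv_ker lfunE /= mxE.
    by have [ik|//] := eqVneq i k; rewrite -ik [j == i]eq_sym (negbTE ij).
  by rewrite memv_ker lfunE => /eqP.
by move=> Md; apply/is_diag_mxP=> i j ij; apply: lin0.
Qed.

Lemma diag_even d : is_diag_mx d -> mx_part false d.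
Proof.
move/is_diag_mxP=> H; split; apply/matrixP=> i j; rewrite !mxE H //=.
  by rewrite neq_ltn ltn_addr.
by rewrite neq_ltn (ltn_addr _ (ltn_ord j)) orbT.
Qed.

Lemma diag_comm d d' : is_diag_mx d -> is_diag_mx d' -> d *m d' = d' *m d.
Proof.
by move=> /diag_mxP[a ->] /diag_mxP[b ->]; apply: diag_mxC.
Qed.

Variables (rt : 'I_(m + n) -> 'I_(m + n) -> M_) (pairs : seq ('I_(m + n) * 'I_(m + n))) (t0 : M_).
Hypothesis rt_mm : forall a b, rt a b \in mm.
Hypothesis rt_hom : forall a b, exists p, mx_part p (rt a b).
Hypothesis rt_wt : forall d a b, d \in mm -> is_diag_mx d ->
  d *m rt a b - rt a b *m d = (d a a - d b b) *: rt a b.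
Hypothesis mm_span : forall M, M \in mm -> exists d, [/\ d \in mm, is_diag_mx d
  & M - d \in <<[seq rt p.1 p.2 | p <- pairs]>>%VS].
Hypothesis t0_mm : t0 \in mm.
Hypothesis t0_diag : is_diag_mx t0.
Hypothesis t0_int : forall p, p \in pairs ->
  exists2 k : int, k != 0 & t0 p.1 p.1 - t0 p.2 p.2 = k%:~R.

Let hs : {vspace g} := (psiL @: (mm :&: diagv))%VS.
Let v : seq g := [seq psi (rt p.1 p.2) | p <- pairs].

Let hsP x : x \in hs -> exists d, [/\ d \in mm, is_diag_mx d & x = psi d].
Proof. by move=> /memv_imgP[d /[!memv_cap]/andP[dm /diagvP dd] ->]; exists d; rewrite psiLE. Qed.

Lemma diag_hs d : d \in mm -> is_diag_mx d -> psi d \in hs.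
Proof. by move=> dm dd; rewrite -psiLE memv_img // memv_cap dm; apply/diagvP. Qed.

Lemma root_bracket d a b : d \in mm -> is_diag_mx d ->
  bracket (psi d) (psi (rt a b)) = (d a a - d b b) *: psi (rt a b).
Proof.
move=> dm dd; have [p hp] := rt_hom a b.
by rewrite -(psi_br dm (rt_mm a b) (diag_even dd) hp) /supercomm scale1r rt_wt // psi_scale.
Qed.

Lemma model_hsP x : x \in hs <-> exists d, [/\ d \in mm, is_diag_mx d & x = psi d].
Proof. by split=> [/hsP//|[d [dm dd ->]]]; apply: diag_hs. Qed.

Lemma model_split_tau : exists tau, split_form hs (psi t0) v tau /\
  forall M, M \in mm -> tau (psi M) = psi (T M).
Proof.
have [tau tauE] := model_tau; exists tau; split=> //.
have tau_par (p : bool) x : x \in part p -> tau x \in part p.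
  by move=> /psi_homog[M [Mm hM <-]]; rewrite tauE //; apply: psi_par; [apply: T_mm|apply: T_par].
split=> //.
- by apply/subvP=> x /hsP[d [dm dd ->]]; apply: psi_par => //; apply: diag_even.
- move=> _ _ /hsP[d [dm dd ->]] /hsP[d' [dm' dd' ->]].
  by rewrite -(psi_br dm dm' (diag_even dd) (diag_even dd')) /supercomm scale1r diag_comm // subrr psi0.
- exact: diag_hs.
- apply/eqP; rewrite eqEsubv subvf; apply/subvP=> x _.
  have [M Mm <-] := psi_onto x; have [d [dm dd H]] := mm_span Mm.
  rewrite -[M](subrK d) psi_add addrC memv_add ?diag_hs //.
  have -> : <<v>>%VS = (psiL @: <<[seq rt p.1 p.2 | p <- pairs]>>)%VS.
    by rewrite limg_span -map_comp; congr <<_>>%VS; apply: eq_map => p /=; rewrite psiLE.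
  by rewrite -psiLE memv_img.
- by move=> _ /mapP[p _ ->]; have [q hq] := rt_hom p.1 p.2; exists q; apply: psi_par.
- by move=> _ /mapP[p pp ->]; have [k k0 E] := t0_int pp; exists k; rewrite // root_bracket // E.
- move=> _ x /mapP[p pp ->] /hsP[d [dm dd ->]]; exists (d p.1 p.1 - d p.2 p.2); exact: root_bracket.
- have hom (p q : bool) x y : x \in part p -> y \in part q -> tau (bracket x y) = bracket (tau y) (tau x).
    move=> /psi_homog[M [Mm hM <-]] /psi_homog[N [Nm hN <-]].
    have cm := mm_br Mm Nm hM hN.
    rewrite -(psi_br Mm Nm hM hN) tauE // !tauE // -(psi_br (T_mm Nm) (T_mm Mm) (T_par hN) (T_par hM)).
    by rewrite /supercomm -!scaleN1r !T_add !T_scale !T_mul andbC.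
  move=> x y; have [x0 [x1 [-> h0 h1]]] := homog_sum x; have [y0 [y1 [-> k0 k1]]] := homog_sum y.
  rewrite !(bracketDl, bracketDr) !lfD !(bracketDl, bracketDr).
  rewrite (hom _ _ _ _ h0 k0) (hom _ _ _ _ h0 k1) (hom _ _ _ _ h1 k0) (hom _ _ _ _ h1 k1).
  by rewrite addrACA.
- by move=> x; have [M Mm <-] := psi_onto x; rewrite !tauE ?T_mm // TK.
by move=> _ /hsP[d [dm dd ->]]; rewrite tauE // T_diag.
Qed.

Lemma model_split : exists tau, split_form hs (psi t0) v tau.
Proof. by have [tau [sf _]] := model_split_tau; exists tau. Qed.

Lemma model_separated : (forall p q, p \in pairs -> q \in pairs ->
    rt q.1 q.2 \in <[rt p.1 p.2]>%VS \/
    exists d, [/\ d \in mm, is_diag_mx d & d p.1 p.1 - d p.2 p.2 != d q.1 q.1 - d q.2 q.2]) ->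
  separated hs v.
Proof.
move=> H _ _ /mapP[p pp ->] /mapP[q qp ->].
have [/vlineP[c ->]|[d [dm dd ne]]] := H p q pp qp; first by left; rewrite psi_scale memvZ ?memv_line.
right; exists (psi d), (d p.1 p.1 - d p.2 p.2), (d q.1 q.1 - d q.2 q.2).
by rewrite !root_bracket //; split=> //; apply: diag_hs.
Qed.

Lemma model_central z : (forall y, bracket z y = 0) -> exists d, [/\ d \in mm, is_diag_mx d, z = psi d
  & forall p, p \in pairs -> psi (rt p.1 p.2) != 0 -> d p.1 p.1 = d p.2 p.2].
Proof.
move=> zc; have [tau sf] := model_split.
have tz : bracket (psi t0) z = 0 by rewrite (skew_even_l _ (sf_t0 sf)) zc oppr0.
have [d [dm dd Ez]] := hsP (sf_cent sf tz); exists d; split=> // p pp r0.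
have := zc (psi (rt p.1 p.2)); rewrite Ez root_bracket // => /eqP.
by rewrite scaler_eq0 (negbTE r0) orbF subr_eq0 => /eqP.
Qed.
End MatrixModel.

Section MatrixParity.
Variables (F : numClosedFieldType) (m n : nat).
Local Notation M_ := 'M[F]_(m + n).
Implicit Types (M N d : M_).

Definition ipar (i : 'I_(m + n)) : bool := (m <= i)%N.

Lemma ipar_l (i : 'I_m) : ipar (lshift n i) = false.
Proof. by rewrite /ipar /= leqNgt ltn_ord. Qed.
Lemma ipar_r (i : 'I_n) : ipar (rshift m i) = true.
Proof. by rewrite /ipar /= leq_addr. Qed.

Lemma mx_partP (p : bool) M : mx_part p M <-> forall i j, ipar i (+) ipar j != p -> M i j = 0.
Proof.
split=> [|H].
  move=> H i j; rewrite -(splitK i) -(splitK j); case: (split i) (split j) => i' [] j' /=;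
    rewrite ?ipar_l ?ipar_r; case: p H => -[/matrixP Hu /matrixP Hd] // _;
    by first [have := Hu i' j'|have := Hd i' j']; rewrite !mxE.
by case: p H => H; split; apply/matrixP=> i j; rewrite !mxE H // ?ipar_l ?ipar_r.
Qed.

Lemma supertraceE M : supertrace M = \sum_i (-1) ^+ ipar i * M i i.
Proof.
rewrite big_split_ord /= /supertrace /mxtrace -sumrN; congr (_ + _); apply: eq_bigr => i _.
  by rewrite ipar_l expr0 mul1r !mxE.
by rewrite ipar_r expr1 mulN1r !mxE.
Qed.

Lemma mx_parity_split M : exists M0 M1, [/\ M = M0 + M1, mx_part false M0, mx_part true M1
  & forall i j, M0 i j = (if ipar i (+) ipar j then 0 else M i j)].
Proof.
exists (\matrix_(i, j) if ipar i (+) ipar j then 0 else M i j),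
  (\matrix_(i, j) if ipar i (+) ipar j then M i j else 0); split.
- by apply/matrixP=> i j; rewrite !mxE; case: ifP; rewrite ?add0r ?addr0.
- by apply/mx_partP=> i j; rewrite !mxE; case: ifP.
- by apply/mx_partP=> i j; rewrite !mxE; case: ifP.
by move=> i j; rewrite !mxE.
Qed.

Lemma supertrace_swap (p q : bool) M N : mx_part p M -> mx_part q N ->
  supertrace (M *m N) = (-1) ^+ (p && q) * supertrace (N *m M).
Proof.
move=> /mx_partP hM /mx_partP hN; rewrite !supertraceE mulr_sumr.
have E (A B : M_) : \sum_i (-1) ^+ ipar i * (A *m B) i i = \sum_i \sum_j (-1) ^+ ipar i * (A i j * B j i).
  by apply: eq_bigr => i _; rewrite mxE mulr_sumr.
rewrite E -mulr_sumr E exchange_big mulr_sumr; apply: eq_bigr => i _; rewrite mulr_sumr.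
apply: eq_bigr => j _; have [hp|hp] := eqVneq (ipar j (+) ipar i) p; last by rewrite hM ?hp // mul0r !mulr0.
have [hq|hq] := eqVneq (ipar i (+) ipar j) q; last by rewrite hN ?hq // mul0r !mulr0.
by move: hp hq; case: (ipar i); case: (ipar j) => /= <- <- /=; rewrite ?expr0 ?expr1; ring.
Qed.

Lemma supertrace_linear : linear (@supertrace F m n : M_ -> F^o).
Proof. by move=> c A B; rewrite !supertraceE scaler_sumr -big_split /=; apply: eq_bigr => i _; rewrite !mxE mulrDr mulrCA. Qed.

Lemma supertrace_supercomm (p q : bool) M N : mx_part p M -> mx_part q N ->
  supertrace (supercomm p q M N) = 0.
Proof.
move=> hM hN; rewrite /supercomm -scaleN1r addrC scalerA.
have := supertrace_linear (-1 * (-1) ^+ (p && q)) (N *m M) (M *m N) => /= ->.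
by rewrite (supertrace_swap hM hN) -[_ *: _]/(_ * _) mulN1r mulNr addNr.
Qed.
End MatrixParity.

Section TypeA.
Variables (F : numClosedFieldType) (g : lieSuperalgebra F) (m n : nat).
Local Notation part := (lsa_part g).
Local Notation M_ := 'M[F]_(m + n).
Implicit Types (M N d : M_).
Variables (psi : M_ -> g) (mm : {vspace M_}).
Hypothesis psi_lin : linear psi.
Hypothesis psi_par : forall (p : bool) M, M \in mm -> mx_part p M -> psi M \in part p.
Hypothesis psi_br : forall (p q : bool) M N, M \in mm -> N \in mm -> mx_part p M -> mx_part q N ->
  psi (supercomm p q M N) = bracket (psi M) (psi N).
Hypothesis psi_onto : forall x, exists2 M, M \in mm & psi M = x.
Hypothesis psi_ker : forall M, M \in mm -> psi M = 0 -> exists c, M = c%:M.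
Hypothesis mm_br : forall (p q : bool) M N, M \in mm -> N \in mm -> mx_part p M -> mx_part q N ->
  supercomm p q M N \in mm.
Hypothesis mm_diag : forall M N, (forall i, M i i = N i i) -> M \in mm -> N \in mm.
Variable t0 : M_.
Hypothesis t0_mm : t0 \in mm.
Hypothesis t0_diag : is_diag_mx t0.
Hypothesis t0_int : forall a b, a != b -> exists2 k : int, k != 0 & t0 a a - t0 b b = k%:~R.
(** Two roots involve at most four indices. On these a diagonal matrix of [mm] has to imitate the
    unit vector at [q] only up to a scalar, which leaves room to correct the supertrace. *)
Hypothesis probe : forall (s : 4.-tuple 'I_(m + n)) q, q \in s ->
  exists d, [/\ d \in mm, is_diag_mx d & forall i j, i \in s -> j \in s ->
    d i i - d j j = (i == q)%:R - (j == q)%:R].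
Hypothesis scalar_dies : forall c, c%:M \in mm ->
  psi c%:M \in @actsp _ _ (adjoint g) (part false) (part false) -> psi c%:M = 0.

Let pairs := [seq p <- enum {: 'I_(m + n) * 'I_(m + n)} | p.1 != p.2].
Let rt (a b : 'I_(m + n)) : M_ := if a == b then 0 else delta_mx a b.

Let rt_mm a b : rt a b \in mm.
Proof.
rewrite /rt; have [_|ab] := eqVneq a b; rewrite ?mem0v //.
apply: (mm_diag _ (mem0v mm)) => i; rewrite !mxE.
by have [->|//] := eqVneq i a; rewrite (negbTE ab).
Qed.

Let diagE d i j : is_diag_mx d -> d i j = (if i == j then d i i else 0).
Proof. by move/is_diag_mxP=> H; have [->//|ij] := eqVneq i j; apply: H. Qed.

Let rt_wt d a b : d \in mm -> is_diag_mx d -> d *m rt a b - rt a b *m d = (d a a - d b b) *: rt a b.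
Proof.
move=> _ /diag_mxP[e ->]; rewrite /rt; have [_|ab] := eqVneq a b.
  by rewrite mulmx0 mul0mx subrr scaler0.
rewrite mul_diag_mx mul_mx_diag; apply/matrixP=> i j; rewrite !mxE !eqxx !mulr1n.
by have [->|] := eqVneq i a; have [->|] := eqVneq j b; rewrite /= ?mulr1 ?mulr0 ?mul0r ?mul1r ?subrr //=.
Qed.

Let mm_gr M : M \in mm -> exists M0 M1,
  [/\ M = M0 + M1, M0 \in mm, M1 \in mm, mx_part false M0 & mx_part true M1].
Proof.
have [M0 [M1 [E h0 h1 H]]] := mx_parity_split M => Mm.
have M0m : M0 \in mm by apply: mm_diag Mm => i; rewrite H addbb.
by exists M0, M1; split=> //; rewrite -[M1](addKr M0) -E addrC memvB.
Qed.

Let T_ker M : M \in mm -> psi M = 0 -> psi M^T = 0.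
Proof. by move=> Mm pM; have [c E] := psi_ker Mm pM; rewrite -pM E tr_scalar_mx. Qed.

Let T_par (p : bool) M : mx_part p M -> mx_part p M^T.
Proof. by move=> /mx_partP H; apply/mx_partP=> i j ij; rewrite mxE H // addbC. Qed.

Let mm_span M : M \in mm -> exists d, [/\ d \in mm, is_diag_mx d
  & M - d \in <<[seq rt p.1 p.2 | p <- pairs]>>%VS].
Proof.
move=> Mm; exists (diag_mx (\row_i M i i)); split.
- by apply: mm_diag Mm => i; rewrite !mxE eqxx mulr1n.
- exact: diag_mx_is_diag.
rewrite (_ : M - _ = \sum_i \sum_j M i j *: rt i j).
  apply: memv_suml => i _; apply: memv_suml => j _; apply: memvZ; have [->|ij] := eqVneq i j.
    by rewrite /rt eqxx mem0v.
  by apply: memv_span; apply/mapP; exists (i, j); rewrite // mem_filter ij mem_enum.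
apply/matrixP=> i j; rewrite !mxE summxE (bigD1 i) //= [X in _ = _ + X]big1 => [|k ki]; last first.
  rewrite summxE big1 // => l _; rewrite !mxE /rt; case: eqVneq => [_|_]; rewrite !mxE ?mulr0 //.
  by rewrite [i == k]eq_sym (negbTE ki) mulr0.
rewrite summxE (bigD1 j) //= [X in _ = _ + X + _]big1 => [|l lj]; last first.
  rewrite !mxE /rt; case: eqVneq => [_|_]; rewrite !mxE ?mulr0 //.
  by rewrite [j == l]eq_sym (negbTE lj) andbF mulr0.
rewrite !addr0 !mxE /rt; have [->|ij] := eqVneq i j; first by rewrite mxE mulr1n mulr0 subrr.
by rewrite mxE !eqxx mulr0n subr0 mulr1.
Qed.

Let rt_hom a b : exists p, mx_part p (rt a b).
Proof.
exists (ipar a (+) ipar b); apply/mx_partP=> i j ij; rewrite /rt; case: eqVneq => _; rewrite mxE //.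
by have [ia|] := eqVneq i a; have [jb|] := eqVneq j b; rewrite ?andbF //; rewrite ia jb eqxx in ij.
Qed.

Let t0_pairs p : p \in pairs -> exists2 k : int, k != 0 & t0 p.1 p.1 - t0 p.2 p.2 = k%:~R.
Proof. by rewrite mem_filter => /andP[ab _]; apply: t0_int. Qed.

Let trmx_lin : linear (trmx : M_ -> M_). Proof. by move=> c A B; rewrite linearP. Qed.

Let T_mm M : M \in mm -> M^T \in mm. Proof. by apply: mm_diag => i; rewrite mxE. Qed.

Let T_diag d : is_diag_mx d -> d^T = d.
Proof. by move=> /diag_mxP[e ->]; rewrite tr_diag_mx. Qed.

Let sep_pairs p q : p \in pairs -> q \in pairs -> rt q.1 q.2 \in <[rt p.1 p.2]>%VS \/
    exists d, [/\ d \in mm, is_diag_mx d & d p.1 p.1 - d p.2 p.2 != d q.1 q.1 - d q.2 q.2].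
Proof.
case: p => a b; case: q => c e; rewrite !mem_filter /= => /andP[ab _] /andP[ce _].
have one0 : (1 : F) != 0 by rewrite oner_eq0.
have mone : (1 : F) != -1 by rewrite -subr_eq0 opprK -(natrD _ 1 1) pnatr_eq0.
have s4 : [/\ a \in [tuple a; b; c; e], b \in [tuple a; b; c; e], c \in [tuple a; b; c; e] & e \in [tuple a; b; c; e]].
  by rewrite !inE !eqxx !orbT.
case: s4 => sa sb sc se.
have [ac|ac] := eqVneq a c.
  have [be|be] := eqVneq b e; first by left; rewrite ac be memv_line.
  right; have [d [dm dd H]] := probe sb; exists d; split=> //.
  rewrite !H // eqxx (negbTE ab) -ac (negbTE ab) [e == b]eq_sym (negbTE be) !sub0r oppr0.
  by rewrite oppr_eq0.
right; have [d [dm dd H]] := probe sa; exists d; split=> //.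
rewrite !H // eqxx [b == a]eq_sym (negbTE ab) [c == a]eq_sym (negbTE ac) subr0 sub0r.
by case: (e == a); rewrite ?oppr0.
Qed.

Lemma typeA_model : exists (hs : {vspace g}) (v : seq g) (tau : 'End(g)),
  [/\ split_form hs (psi t0) v tau, forall M, M \in mm -> tau (psi M) = psi M^T
    & forall x, x \in hs <-> exists d, [/\ d \in mm, is_diag_mx d & x = psi d]].
Proof.
have [tau [sf tauE]] := model_split_tau psi_lin psi_par psi_br psi_onto mm_gr mm_br trmx_lin T_mm T_ker
  (@trmxK _ _ _) T_par (@trmx_mul _ _ _ _) T_diag rt_mm rt_hom rt_wt mm_span t0_mm t0_diag t0_pairs.
do 2!eexists; exists tau; split; [exact: sf|exact: tauE|].
by move=> x; apply: model_hsP.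
Qed.

Lemma typeA_central : central_condition g.
Proof.
move=> z zc zd.
have [d [dm dd Ez Hd]] := model_central psi_lin psi_par psi_br psi_onto mm_gr mm_br trmx_lin T_mm T_ker
  (@trmxK _ _ _) T_par (@trmx_mul _ _ _ _) T_diag rt_mm rt_hom rt_wt mm_span t0_mm t0_diag t0_pairs zc.
have dE a b : d a a = d b b.
  have [->//|ab] := eqVneq a b; apply: (Hd (a, b)); first by rewrite mem_filter ab mem_enum.
  apply/eqP=> /(psi_ker (rt_mm _ _))[c] /matrixP/(_ a b); rewrite /rt /= (negbTE ab) !mxE !eqxx (negbTE ab).
  by move/eqP; rewrite oner_eq0.
have [c Ec] : exists c, d = c%:M.
  case: (posnP (m + n)) => [mn0|mn].
    by exists 0; apply/matrixP=> i; have := ltn_ord i; rewrite {2}mn0.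
  exists (d (Ordinal mn) (Ordinal mn)); apply/matrixP=> i j; rewrite mxE diagE //.
  by case: eqVneq => _; rewrite ?mulr0n // mulr1n.
by rewrite Ez Ec scalar_dies // -Ec // -Ez.
Qed.

Lemma typeA_split : has_split g.
Proof.
have [tau sf] := model_split psi_lin psi_par psi_br psi_onto mm_gr mm_br trmx_lin T_mm T_ker
  (@trmxK _ _ _) T_par (@trmx_mul _ _ _ _) T_diag rt_mm rt_hom rt_wt mm_span t0_mm t0_diag t0_pairs.
do 3!eexists; exists tau; split; [exact: sf| |exact: typeA_central].
exact: (model_separated psi_lin psi_br rt_mm rt_hom rt_wt sep_pairs).
Qed.
End TypeA.

Section Embedding.
Variables (F : numClosedFieldType) (g : lieSuperalgebra F) (m n : nat).
Local Notation part := (lsa_part g).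
Local Notation M_ := 'M[F]_(m + n).
Implicit Types (M N d : M_).
Variables (phi : g -> M_) (mm : {vspace M_}).
Hypothesis emb : gl_embedding phi.
Hypothesis img : forall M, (exists x, phi x = M) <-> M \in mm.

Lemma embedding_model : exists psi : M_ -> g,
  [/\ linear psi, forall x, psi (phi x) = x & forall M, M \in mm -> phi (psi M) = M] /\
  [/\ forall (p : bool) M, M \in mm -> mx_part p M -> psi M \in part p,
      forall (p q : bool) M N, M \in mm -> N \in mm -> mx_part p M -> mx_part q N ->
        psi (supercomm p q M N) = bracket (psi M) (psi N),
      forall x, exists2 M, M \in mm & psi M = x,
      forall M, M \in mm -> psi M = 0 -> M = 0
    & forall (p q : bool) M N, M \in mm -> N \in mm -> mx_part p M -> mx_part q N ->
        supercomm p q M N \in mm].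
Proof.
have [lin inj par br] := emb.
pose phiL : 'Hom(g, M_) := linfun (HB.pack phi (GRing.isLinear.Build _ _ _ _ _ lin) : {linear _ -> _}).
have phiE x : phiL x = phi x by rewrite /phiL lfunE.
have phi0 : phi 0 = 0 by rewrite -phiE lf0.
have ker : lker phiL == 0%VS by apply/lker0P=> x y; rewrite !phiE => /inj.
pose psi M := (phiL^-1)%VF M.
have psiK x : psi (phi x) = x by rewrite /psi -phiE lker0_lfunK.
have phiK M : M \in mm -> phi (psi M) = M by move=> /img[x <-]; rewrite psiK.
have psi_par (p : bool) M : M \in mm -> mx_part p M -> psi M \in part p.
  move=> Mm /mx_partP hM; have [x0 [x1 [E h0 h1]]] := homog_sum (psi M).
  have EM : M = phi x0 + phi x1 by rewrite -!phiE -lfD phiE -E phiK.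
  have /mx_partP k0 := par _ _ h0; have /mx_partP k1 := par _ _ h1.
  case: p hM => hM.
    have z0 : phi x0 = 0.
      apply/matrixP=> i j; rewrite [RHS]mxE; have [e|e] := eqVneq (ipar i (+) ipar j) false; last exact: k0.
      by have := hM i j; rewrite e => /(_ isT); rewrite EM mxE k1 ?e // addr0.
    by rewrite E (inj _ _ (etrans z0 (esym phi0))) add0r.
  have z1 : phi x1 = 0.
    apply/matrixP=> i j; rewrite [RHS]mxE; have [e|e] := eqVneq (ipar i (+) ipar j) true; last exact: k1.
    by have := hM i j; rewrite e => /(_ isT); rewrite EM mxE k0 ?e // add0r.
  by rewrite E (inj _ _ (etrans z1 (esym phi0))) addr0.
have psi_br (p q : bool) M N : M \in mm -> N \in mm -> mx_part p M -> mx_part q N ->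
    supercomm p q M N = phi (bracket (psi M) (psi N)).
  by move=> Mm Nm hM hN; rewrite (br p q) ?psi_par // !phiK.
exists psi; split; split=> //.
- by move=> c A B; rewrite /psi linearP.
- by move=> p q M N Mm Nm hM hN; rewrite (psi_br p q) // psiK.
- by move=> x; exists (phi x); rewrite ?psiK //; apply/img; exists x.
- by move=> M Mm E; rewrite -(phiK M Mm) E.
by move=> p q M N Mm Nm hM hN; apply/img; exists (bracket (psi M) (psi N)); rewrite (psi_br p q).
Qed.
End Embedding.

Section GlSl.
Variables (F : numClosedFieldType) (g : lieSuperalgebra F) (m n : nat).
Local Notation part := (lsa_part g).
Local Notation M_ := 'M[F]_(m + n).
Implicit Types (M N d : M_).

Lemma nat_diff (a b : nat) : a != b -> exists2 k : int, k != 0 & (a%:R - b%:R : F) = k%:~R.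
Proof.
move=> ab; exists (a%:Z - b%:Z); first by rewrite subr_eq0.
by rewrite rmorphB.
Qed.

Lemma gl_split kappa : is_gl (g := g) kappa m n -> has_split g.
Proof.
case=> phi [emb onto _]; pose mm := fullv : {vspace M_}.
have img M : (exists x, phi x = M) <-> M \in mm by split=> // _; rewrite memvf.
have [psi [[lin psiK phiK] [ppar pbr ponto pker pmm]]] := embedding_model emb img.
have [_ inj par br] := emb; have [plin _ _ _] := emb.
pose t0 : M_ := diag_mx (\row_i (val i)%:R).
apply: (typeA_split lin ppar pbr ponto _ pmm _ (t0 := t0)) => //.
- by move=> M _ /(pker _ (memvf _)) ->; exists 0; rewrite -scalemx1 scale0r.
- by move=> *; exact: memvf.
- exact: memvf.
- exact: diag_mx_is_diag.
- by move=> a b ab; rewrite !mxE !eqxx !mulr1n; apply: nat_diff.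
- move=> s q qs; exists (diag_mx (\row_i (i == q)%:R)); split; [exact: memvf|exact: diag_mx_is_diag|].
  by move=> i j _ _; rewrite !mxE !eqxx !mulr1n.
(* Brackets of even elements have trace zero in each of the two diagonal blocks, and a scalar matrix
   with this property is zero. *)
move=> c _ cd; pose P1 (x : g) := \tr (ulsubmx (phi x)) = 0 /\ \tr (drsubmx (phi x)) = 0.
have [U HU] : exists U : {vspace g}, forall u, u \in U <-> P1 u.
  apply: vspace_of_pred.
    have phi0 : phi 0 = 0 by have := plin (-1) 0 0; rewrite scaler0 addr0 scaleN1r addNr.
    by rewrite /P1 phi0; split; apply: big1 => i _; rewrite !mxE.
  move=> a x y [x1 x2] [y1 y2]; rewrite /P1 plin; split.
    transitivity (a * \tr (ulsubmx (phi x)) + \tr (ulsubmx (phi y))); last by rewrite x1 y1 mulr0 addr0.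
    by rewrite /mxtrace mulr_sumr -big_split; apply: eq_bigr => i _; rewrite !mxE.
  transitivity (a * \tr (drsubmx (phi x)) + \tr (drsubmx (phi y))); last by rewrite x2 y2 mulr0 addr0.
    by rewrite /mxtrace mulr_sumr -big_split; apply: eq_bigr => i _; rewrite !mxE.
have : psi c%:M \in U.
  apply: (subvP (@actsp_sub _ _ (adjoint g) (part false) (part false) U _)); last exact: cd.
  move=> x y x0 y0; apply/HU; rewrite /P1 [as_act _ _ _]/(bracket x y) (br _ _ _ _ x0 y0).
  have [ux dx] := par _ _ x0; have [uy dy] := par _ _ y0; rewrite /supercomm scale1r.
  rewrite -(submxK (phi x)) -(submxK (phi y)) ux dx uy dy !mulmx_block !mulmx0 !mul0mx !addr0 !add0r.
  rewrite opp_block_mx add_block_mx block_mxKul block_mxKdr; split; by rewrite raddfB /= mxtrace_mulC subrr.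
case/HU; rewrite phiK ?memvf // => t1 t2.
have ul : ulsubmx (c%:M : M_) = c%:M by rewrite scalar_mx_block block_mxKul.
have dr : drsubmx (c%:M : M_) = c%:M by rewrite scalar_mx_block block_mxKdr.
rewrite ul mxtrace_scalar in t1; rewrite dr mxtrace_scalar in t2.
have -> : c%:M = 0 :> M_; last by have := lin (-1) 0 0; rewrite scaler0 addr0 scaleN1r addNr.
have [->|c0] := eqVneq c 0; first by rewrite -scalemx1 scale0r.
move/eqP: t1; move/eqP: t2; rewrite -(mulr_natr c m) -(mulr_natr c n) !mulf_eq0 (negbTE c0) /= !pnatr_eq0 => /eqP n0 /eqP m0.
by apply/matrixP=> i j; exfalso; move: (ltn_ord i); lia.
Qed.

Let unit_diag (q : 'I_(m + n)) : M_ := diag_mx (\row_i (i == q)%:R).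

Let unit_diagE q i j : unit_diag q i j = ((i == q) && (i == j))%:R.
Proof. by rewrite !mxE; case: (i == q); case: (i == j); rewrite ?mulr1n ?mulr0n ?mul0rn. Qed.

Let strace_mm : exists mm : {vspace M_}, forall M, M \in mm <-> supertrace M = 0.
Proof.
apply: vspace_of_pred; first by rewrite supertraceE big1 // => i _; rewrite mxE mulr0.
by move=> c A B A0 B0; rewrite (supertrace_linear c A B) A0 B0 scaler0 addr0.
Qed.

Let strace_scalar c : supertrace (c%:M : M_) = c * (m%:R - n%:R).
Proof.
rewrite supertraceE big_split_ord /= (eq_bigr (fun=> c)) => [|i _]; last first.
  by rewrite ipar_l mul1r mxE eqxx.
rewrite [X in _ + X](eq_bigr (fun=> - c)) => [|i _]; last by rewrite ipar_r mulN1r mxE eqxx.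
by rewrite !sumr_const !card_ord mulNrn mulrBr !mulr_natr.
Qed.

Lemma sl_split : m <> n -> is_sl g m n -> has_split g.
Proof.
move=> mn [phi emb onto]; have [mm Hmm] := strace_mm.
have img M : (exists x, phi x = M) <-> M \in mm by split=> [/onto/Hmm|/Hmm/onto].
have [psi [[lin psiK phiK] [ppar pbr ponto pker pmm]]] := embedding_model emb img.
have mn0 : (m%:R - n%:R : F) != 0 by rewrite subr_eq0 eqr_nat; apply/eqP.
have psi0 : psi 0 = 0 by have := lin (-1) 0 0; rewrite scaler0 addr0 scaleN1r addNr.
(* For [m <> n] a scalar matrix can have any supertrace, and subtracting it does not change
   differences of diagonal entries. *)
have fix_tr A : exists c, A - c%:M \in mm.
  exists (supertrace A / (m%:R - n%:R)); apply/Hmm; rewrite addrC -scaleN1r.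
  by rewrite (supertrace_linear (-1) _ A) strace_scalar divfK // -[_ *: _]/(_ * _) mulN1r addNr.
pose u0 : M_ := diag_mx (\row_i (val i)%:R); have [c0 t0m] := fix_tr u0.
have diag_sub A c : is_diag_mx A -> is_diag_mx (A - c%:M : M_).
  by move=> /is_diag_mxP H; apply/is_diag_mxP=> i j ij; rewrite !mxE H // -val_eqE (negbTE ij) mulr0n subrr.
have dE (A : M_) c i j : (A - c%:M) i i - (A - c%:M) j j = A i i - A j j.
  by rewrite !mxE !eqxx; ring.
apply: (typeA_split lin ppar pbr ponto _ pmm _ (t0 := u0 - c0%:M)) => //.
- by move=> M Mm /(pker _ Mm) ->; exists 0; rewrite -scalemx1 scale0r.
- by move=> M N MN /Hmm HM; apply/Hmm; rewrite -HM !supertraceE; apply: eq_bigr => i _; rewrite MN.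
- exact/diag_sub/diag_mx_is_diag.
- by move=> a b ab; rewrite dE !mxE !eqxx !mulr1n; apply: nat_diff.
- move=> s q qs; have [c um] := fix_tr (unit_diag q); exists (unit_diag q - c%:M); split=> //.
    exact/diag_sub/diag_mx_is_diag.
  by move=> i j _ _; rewrite dE !unit_diagE !eqxx !andbT.
move=> c /Hmm; rewrite strace_scalar => /eqP; rewrite mulf_eq0 (negbTE mn0) orbF => /eqP-> _.
by rewrite -scalemx1 scale0r psi0.
Qed.
End GlSl.

Section Psl.
Variables (F : numClosedFieldType) (g : lieSuperalgebra F) (n : nat).
Local Notation part := (lsa_part g).
Local Notation M_ := 'M[F]_(n + n).

(* A diagonal matrix of supertrace zero with distinct integral entries. *)
Let psl_entry (i : 'I_(n + n)) : int :=
  if (i.+1 < n + n)%N then (val i).+1%:Z else n%:Z * (2 - n%:Z).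

(** The first [n - 1] pairs of upper and lower entries contribute [- n] each and the last upper
    entry contributes [n], which dictates [n (2 - n)] as the last lower entry. It is not positive,
    so it differs from all the others. *)
Let psl_trace : (3 <= n)%N -> \sum_i (-1) ^+ ipar i * (psl_entry i)%:~R = 0 :> F.
Proof.
rewrite /psl_entry; case: n => // k _.
rewrite big_split_ord /= big_ord_recr [X in _ + X]big_ord_recr /= addrACA -big_split /=.
rewrite (eq_bigr (fun=> - k.+1%:R)) => [|i _]; last first.
  have lti := ltn_ord i; rewrite ipar_l ipar_r /= ifT; last by lia.
  rewrite ifT; last by lia.
  by rewrite expr0 expr1 mul1r mulN1r -!pmulrn -addnS natrD opprD addrCA subrr addr0.
rewrite ipar_l ipar_r /= ifT; last by lia.
rewrite ifF; last by lia.
rewrite sumr_const card_ord -[X in X + _]mulr_natr expr0 expr1 mul1r mulN1r !rmorphM !rmorphB /= -!pmulrn -natr1; ring.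
Qed.

Lemma psl_split : (3 <= n)%N -> is_psl g n -> has_split g.
Proof.
move=> n3 [psi [lin ppar pbr ponto pker]].
have [mm Hmm] : exists mm : {vspace M_}, forall M, M \in mm <-> supertrace M = 0.
  apply: vspace_of_pred; first by rewrite supertraceE big1 // => i _; rewrite mxE mulr0.
  by move=> c A B A0 B0; rewrite (supertrace_linear c A B) A0 B0 scaler0 addr0.
pose t0 : M_ := diag_mx (\row_i (psl_entry i)%:~R).
have t0_diagE i : t0 i i = (psl_entry i)%:~R by rewrite !mxE eqxx mulr1n.
have last_ge (i : 'I_(n + n)) : ~~ (i.+1 < n + n)%N -> val i = (n + n).-1.
  by case: i => i /= lt; lia.
have entry_inj a b : a != b -> psl_entry a - psl_entry b != 0.
  rewrite subr_eq0 /psl_entry -val_eqE /= => ab.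
  case: ifP => [la|/negbT/last_ge la]; case: ifP => [lb|/negbT/last_ge lb].
  - by apply: contra ab => /eqP[] ->.
  - apply/eqP => E; have : (0 : int) < n%:Z * (2 - n%:Z) by rewrite -E.
    by nia.
  - apply/eqP => E; have : (0 : int) < n%:Z * (2 - n%:Z) by rewrite E.
    by nia.
  by rewrite la lb eqxx in ab.
have t0_tr : supertrace t0 = 0.
  rewrite supertraceE (eq_bigr (fun i => (-1) ^+ ipar i * (psl_entry i)%:~R)) => [|i _]; last by rewrite t0_diagE.
  exact: psl_trace n3.
apply: (typeA_split lin _ _ _ _ _ _ (mm := mm) (t0 := t0)).
- by move=> p M /Hmm; apply: ppar.
- by move=> p q M N /Hmm hM /Hmm hN; apply: pbr.
- by move=> x; have [M hM <-] := ponto x; exists M => //; apply/Hmm.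
- by move=> M /Hmm hM /(pker _ hM).
- by move=> p q M N _ _ hM hN; apply/Hmm/supertrace_supercomm.
- by move=> M N MN /Hmm HM; apply/Hmm; rewrite -HM !supertraceE; apply: eq_bigr => i _; rewrite MN.
- exact/Hmm.
- exact: diag_mx_is_diag.
- move=> a b ab; exists (psl_entry a - psl_entry b); first exact: entry_inj.
  by rewrite !t0_diagE rmorphB.
- move=> s q qs.
  (* There are at least six indices, so some index lies outside the four of [s]; its diagonal entry
     is used to bring the supertrace to zero. *)
  have [r rs] : exists r, r \notin s.
    apply: contrapT => /forallNP H; have : (#|{: 'I_(n + n)}| <= #|s|)%N.
      by apply: subset_leq_card; apply/subsetP=> x _; apply: contraT => /H.
    move/leq_trans/(_ (card_size s)); rewrite size_tuple card_ord; lia.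
  exists (diag_mx (\row_i ((i == q)%:R - (-1) ^+ (ipar q (+) ipar r) * (i == r)%:R))); split.
  - apply/Hmm; rewrite supertraceE (bigD1 q) //= (bigD1 r) /=; last by apply: contraNneq rs => ->.
    rewrite big1 => [|i /andP[iq ir]]; rewrite !mxE ?eqxx ?mulr1n.
      have qr : (q == r) = false by apply/negbTE; apply: contraNneq rs => <-.
      rewrite qr [r == q]eq_sym qr addr0 mulr0 subr0 mulr1 sub0r mulr1 mulrN -signr_addb.
      by rewrite addbCA addbb addbF subrr.
    by rewrite (negbTE iq) (negbTE ir) mulr0 subrr mulr0.
  - exact: diag_mx_is_diag.
  move=> i j si sj; rewrite !mxE !eqxx !mulr1n.
  have ir x : x \in s -> (x == r) = false by move=> xs; apply/negbTE; apply: contraNneq rs => <-.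
  by rewrite !ir // !mulr0 !subr0.
by move=> c /Hmm hc _; apply/(pker _ hc); exists c.
Qed.
End Psl.

(** * Contragredient superalgebras and the exceptional types *)

Section RaisingClosure.
Variables (F : numClosedFieldType) (W : vectType F) (I : finType).
Variables (E L H : I -> 'End(W)) (eps t : 'End(W)) (A s d : I -> I -> F) (sg : I -> F).
Hypothesis LE : forall i j u, L j (E i u) = s i j *: E i (L j u) + d i j *: H i u.
Hypothesis HE : forall i j u, H i (E j u) = E j (H i u) + A i j *: E j u.
Hypothesis epsE : forall i u, eps (E i u) = sg i *: E i (eps u).
Hypothesis tE : forall i u, t (E i u) = E i (t u) + E i u.
Variables (ve : seq W) (Hs : {vspace W}).
Hypothesis L_ve : forall j u, u \in ve -> L j u \in Hs.
Hypothesis E_Hs : forall i u, u \in Hs -> E i u \in <<ve>>%VS.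
Hypothesis H_ve : forall i u, u \in ve -> H i u \in <<ve>>%VS.
Hypothesis eps_ve : forall u, u \in ve -> eps u \in <<ve>>%VS.
Hypothesis t_ve : forall u, u \in ve -> exists k : nat, t u = k.+1%:R *: u.

Definition posspan u := exists2 X : seq W,
  forall w, w \in X -> exists k : nat, t w = k.+1%:R *: w & u \in <<X>>%VS.

(** [N] is spanned by words in the raising operators applied to [ve]. By [LE] a lowering operator
    moves through a word until it meets [ve], where it lands in [Hs], and raising leads from there
    back to [<<ve>>]. The abstract form covers both [g] and pairs of elements of [g]. *)
Lemma raising_closure : exists N : {vspace W},
  [/\ (<<ve>> <= N)%VS, forall i u, u \in N -> E i u \in N, forall i u, u \in N -> H i u \in N,
      forall j u, u \in N -> L j u \in (N + Hs)%VS
    & (forall u, u \in N -> eps u \in N) /\ (forall u, u \in N -> posspan u)].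
Proof.
have [N HN] : exists N : {vspace W}, forall u, u \in N <-> (forall U : {vspace W},
    (<<ve>> <= U)%VS -> (forall i u, u \in U -> E i u \in U) -> u \in U).
  apply: vspace_of_pred => [U _ _|c u w Hu Hw U h1 h2]; first exact: mem0v.
  by rewrite memvD ?memvZ ?Hu ?Hw.
have veN : (<<ve>> <= N)%VS by apply/subvP=> u uve; apply/HN => U /subvP H1 _; apply: H1.
have EN i u : u \in N -> E i u \in N.
  by move=> /HN uN; apply/HN => U h1 h2; apply/h2/uN.
have ind (P : W -> Prop) : P 0 -> (forall c u w, P u -> P w -> P (c *: u + w)) ->
    (forall u, u \in ve -> P u) -> (forall i u, u \in N -> P u -> P (E i u)) -> forall u, u \in N -> P u.
  move=> P0 Plin Pve PE.
  have [U HU] : exists U : {vspace W}, forall u, u \in U <-> u \in N /\ P u.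
    apply: vspace_of_pred; first by rewrite mem0v.
    by move=> c u w [uN Pu] [wN Pw]; rewrite memvD ?memvZ //; split=> //; apply: Plin.
  move=> u /HN/(_ U) H1; suff /HU[] : u \in U by [].
  apply: H1 => [|i w /HU[wN Pw]]; last by apply/HU; split; [apply: EN|apply: PE].
  by apply/span_subvP=> w wve; apply/HU; split; [apply/(subvP veN)/memv_span|apply: Pve].
have indU (f : 'End(W)) (K : {vspace W}) : (forall u, u \in ve -> f u \in K) ->
    (forall i u, u \in N -> f u \in K -> f (E i u) \in K) -> forall u, u \in N -> f u \in K.
  move=> h1 h2; apply: (ind (fun u => f u \in K)) => //; first by rewrite lf0 mem0v.
  by move=> c u w fu fw; rewrite lfD lfZ memvD ?memvZ.
have HNN i u : u \in N -> H i u \in N.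
  apply: indU => [w wve|j w wN Hw]; first exact/(subvP veN)/H_ve.
  by rewrite HE memvD ?memvZ ?EN.
exists N; split=> //.
  move=> j; apply: indU => [w wve|i w wN Lw]; first exact/(subvP (addvSr _ _))/L_ve.
  rewrite LE memvD //; last by apply/memvZ/(subvP (addvSl _ _))/HNN.
  apply: memvZ.
  case/memv_addP: Lw => a aN [k kH ->]; rewrite lfD memvD //; apply: (subvP (addvSl _ _)); first exact: EN.
  exact/(subvP veN)/E_Hs.
split.
  apply: indU => [w wve|i w wN ew]; first exact/(subvP veN)/eps_ve.
  by rewrite epsE memvZ // EN.
apply: (ind posspan) => [|c u w [X HX uX] [Y HY wY]|u uve|i u uN [X HX uX]].
- by exists [::]; rewrite ?mem0v.
- exists (X ++ Y); first by move=> x; rewrite mem_cat => /orP[/HX|/HY].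
  by rewrite span_cat memv_add ?memvZ.
- by exists [:: u]; [move=> w; rewrite inE => /eqP->; apply: t_ve|rewrite span_seq1 memv_line].
exists [seq E i w | w <- X]; last by rewrite -limg_span memv_img.
move=> _ /mapP[w /HX[k tw] ->]; exists k.+1; rewrite tE tw lfZ -[k.+2]addn1 natrD scalerDl scale1r //.
Qed.

Lemma posspan_null u : posspan u -> t u = 0 -> u = 0.
Proof.
case=> X HX uX tu; apply: (eig_inj (f := t) _ uX tu) => w /HX[k ->].
by exists k.+1%:R; rewrite // pnatr_eq0.
Qed.
End RaisingClosure.

Section Generators.
Variables (F : numClosedFieldType) (g : lieSuperalgebra F).
Local Notation part := (lsa_part g).

Definition brl (w : g) : 'End(g) := linfun (HB.pack (fun x : g => bracket x w)
  (GRing.isLinear.Build _ _ _ _ _ (bracket_linear_l w)) : {linear _ -> _}).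
Lemma brlE w x : brl w x = bracket x w. Proof. by rewrite /brl lfunE. Qed.

(** The Jacobi identity for brackets from the right; an anti-automorphism turns left brackets into
    these. *)
Lemma jacobi_op (p q : bool) x y z : x \in part p -> y \in part q ->
  bracket (bracket z y) x = bracket z (bracket y x) + (-1) ^+ (p && q) *: bracket (bracket z x) y.
Proof.
move=> xp yq; have one (r : bool) w : w \in part r ->
    bracket (bracket w y) x = bracket w (bracket y x) + (-1) ^+ (p && q) *: bracket (bracket w x) y.
  move=> wr; rewrite /bracket (lsa_br_jacobi x wr yq) (lsa_br_skew yq (lsa_br_part wr xp)).
  rewrite scalerN scalerA -signr_addb -addrA.
  by have -> : (r && q) (+) (q && (r (+) p)) = p && q; [case: r q p {wr yq xp} => [] [] []|rewrite addNr addr0].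
have [z0 [z1 [-> h0 h1]]] := homog_sum z; rewrite !bracketDl (one _ _ h0) (one _ _ h1).
by rewrite scalerDr addrACA.
Qed.

Lemma graded_parts (U : {vspace g}) x0 x1 : graded U -> x0 \in part false -> x1 \in part true ->
  x0 + x1 \in U -> x0 \in U /\ x1 \in U.
Proof.
move=> gU h0 h1 /gU[y0 [y1 [E u0 u1 k0 k1]]].
have [|||/eqP a /eqP b] := @homog_sum0 _ _ (x0 - y0) (x1 - y1); rewrite ?memvB //.
  by rewrite addrACA -opprD E subrr.
by move: a b; rewrite !subr_eq0 => /eqP-> /eqP->.
Qed.

Variable X : seq g.
Hypothesis X_hom : forall x, x \in X -> exists q : bool, x \in part q.
Hypothesis X_gen : forall U : {vspace g}, br_sub U U U -> {subset X <= U} -> U = fullv.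

(** The elements that carry [U] into itself form a graded subalgebra containing the generators,
    hence all of [g]. *)
Lemma stable_ideal (U : {vspace g}) : graded U -> (forall x u, x \in X -> u \in U -> bracket x u \in U) ->
  br_sub fullv U U.
Proof.
move=> gU XU.
have [Q HQ] : exists Q : {vspace g}, forall z, z \in Q <-> forall u, u \in U -> bracket z u \in U.
  apply: vspace_of_pred => [u _|c z w Hz Hw u uU]; first by rewrite bracket0l mem0v.
  by rewrite bracketDl bracketZl memvD ?memvZ ?Hz ?Hw.
have gQ z : z \in Q -> exists z0 z1, [/\ z = z0 + z1, z0 \in Q, z1 \in Q, z0 \in part false & z1 \in part true].
  move=> /HQ zQ; have [z0 [z1 [Ez h0 h1]]] := homog_sum z; exists z0, z1.
  have one u (q : bool) : u \in U -> u \in part q -> bracket z0 u \in U /\ bracket z1 u \in U.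
    move=> uU uq; have := zQ u uU; rewrite Ez bracketDl; case: q uq => uq.
      by rewrite addrC => /(graded_parts gU (lsa_br_part h1 uq) (lsa_br_part h0 uq))[].
    exact: (graded_parts gU (lsa_br_part h0 uq) (lsa_br_part h1 uq)).
  split=> //; apply/HQ => u /gU[u0 [u1 [-> u0U u1U k0 k1]]]; rewrite bracketDr memvD //.
  - by case: (one _ _ u0U k0).
  - by case: (one _ _ u1U k1).
  - by case: (one _ _ u0U k0).
  by case: (one _ _ u1U k1).
have QE : Q = fullv.
  apply: X_gen => [z w /gQ[z0 [z1 [-> a0 a1 h0 h1]]] /gQ[w0 [w1 [-> b0 b1 k0 k1]]]|x xX]; last first.
    by apply/HQ => u; apply: XU.
  have one (p q : bool) x y : x \in Q -> y \in Q -> x \in part p -> y \in part q -> bracket x y \in Q.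
    move=> /HQ xQ /HQ yQ xp yq; apply/HQ => u uU; rewrite (jacobi _ xp yq).
    by apply: memvB; [apply/xQ/yQ|apply/memvZ/yQ/xQ].
  rewrite !(bracketDl, bracketDr); do !apply: memvD.
  - exact: (one false false).
  - exact: (one false true).
  - exact: (one true false).
  - exact: (one true true).
by move=> z u _; apply: (HQ z).1; rewrite QE memvf.
Qed.

Lemma stable_full (U : {vspace g}) : graded U -> (forall x u, x \in X -> u \in U -> bracket x u \in U) ->
  {subset X <= U} -> U = fullv.
Proof.
move=> gU XU sX; apply: X_gen => // x y _ yU; apply: stable_ideal gU XU _ _ _ yU; exact: memvf.
Qed.

(* An even linear map that is compatible with bracketing by generators is an
   anti-automorphism. *)
Lemma anti_gen (tau : 'End(g)) : (forall (p : bool) x, x \in part p -> tau x \in part p) ->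
  (forall x y, x \in X -> tau (bracket x y) = bracket (tau y) (tau x)) ->
  forall x y, tau (bracket x y) = bracket (tau y) (tau x).
Proof.
move=> tp tX.
have [Z HZ] : exists Z : {vspace g}, forall z, z \in Z <->
    forall y, tau (bracket z y) = bracket (tau y) (tau z).
  apply: vspace_of_pred => [y|c z w Hz Hw y]; first by rewrite bracket0l lf0 bracket0r.
  by rewrite bracketDl bracketZl !lfD !lfZ Hz Hw bracketDr bracketZr.
have gZ z : z \in Z -> exists z0 z1, [/\ z = z0 + z1, z0 \in Z, z1 \in Z, z0 \in part false & z1 \in part true].
  move=> /HZ zZ; have [z0 [z1 [Ez h0 h1]]] := homog_sum z; exists z0, z1.
  have one y (q : bool) : y \in part q -> tau (bracket z0 y) = bracket (tau y) (tau z0) /\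
      tau (bracket z1 y) = bracket (tau y) (tau z1).
    move=> yq; have := zZ y; rewrite Ez bracketDl !lfD bracketDr => /eqP.
    rewrite -subr_eq0 opprD addrACA => /eqP.
    have a0 := tp _ _ (lsa_br_part h0 yq); have a1 := tp _ _ (lsa_br_part h1 yq).
    have b0 := lsa_br_part (tp _ _ yq) (tp _ _ h0); have b1 := lsa_br_part (tp _ _ yq) (tp _ _ h1).
    move=> E; have : tau (bracket z0 y) - bracket (tau y) (tau z0) = 0 /\
        tau (bracket z1 y) - bracket (tau y) (tau z1) = 0.
      case: q yq a0 a1 b0 b1 => yq a0 a1 b0 b1; last by apply: homog_sum0; rewrite ?memvB.
      by move: E; rewrite addrC => /homog_sum0[]; rewrite ?memvB.
    by case=> /eqP + /eqP; rewrite !subr_eq0 => /eqP-> /eqP->.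
  split=> //; apply/HZ => y; have [y0 [y1 [-> k0 k1]]] := homog_sum y; rewrite bracketDr !lfD bracketDl;
    have [e0 e1] := one _ _ k0; have [e2 e3] := one _ _ k1; by rewrite ?e0 ?e1 ?e2 ?e3.
suff ZE : Z = fullv by move=> x; apply: (HZ x).1; rewrite ZE memvf.
apply: X_gen => [z w /gZ[z0 [z1 [-> a0 a1 h0 h1]]] /gZ[w0 [w1 [-> b0 b1 k0 k1]]]|x xX]; last first.
  by apply/HZ => y; apply: tX.
have one (p q : bool) x y : x \in Z -> y \in Z -> x \in part p -> y \in part q -> bracket x y \in Z.
  move=> /HZ xZ /HZ yZ xp yq; apply/HZ => u; rewrite (jacobi _ xp yq) lfB lfZ xZ yZ yZ xZ xZ.
  by rewrite (jacobi_op _ (tp _ _ xp) (tp _ _ yq)) addrK.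
rewrite !(bracketDl, bracketDr); do !apply: memvD.
- exact: (one false false).
- exact: (one false true).
- exact: (one true false).
- exact: (one true true).
Qed.
End Generators.

Section Contragredient.
Variables (F : numClosedFieldType) (g : lieSuperalgebra F) (r : nat) (A : 'M[F]_r) (odd_root : pred 'I_r).
Local Notation part := (lsa_part g).
Variables (e f h : r.-tuple g).
Hypothesis par : forall i, [/\ tnth e i \in part (odd_root i), tnth f i \in part (odd_root i)
  & tnth h i \in part false].
Hypothesis rel : forall i j, [/\ bracket (tnth h i) (tnth h j) = 0,
  bracket (tnth e i) (tnth f j) = (i == j)%:R *: tnth h i,
  bracket (tnth h i) (tnth e j) = A i j *: tnth e j
  & bracket (tnth h i) (tnth f j) = - (A i j *: tnth f j)].
Hypothesis free_h : free h.
Hypothesis gen : forall U : {vspace g}, br_sub U U U ->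
  {subset e <= U} -> {subset f <= U} -> {subset h <= U} -> U = fullv.
Hypothesis simple : forall I : {vspace g}, ideal_of I fullv -> (I :&: <<h>>)%VS = 0%VS -> I = 0%VS.
Hypothesis A_unit : A \in unitmx.

Local Notation e_ i := (tnth e i).
Local Notation f_ i := (tnth f i).
Local Notation h_ i := (tnth h i).

Let pe i : e_ i \in part (odd_root i). Proof. by case: (par i). Qed.
Let pf i : f_ i \in part (odd_root i). Proof. by case: (par i). Qed.
Let ph i : h_ i \in part false. Proof. by case: (par i). Qed.
Let rhh i j : bracket (h_ i) (h_ j) = 0. Proof. by case: (rel i j). Qed.
Let ref i j : bracket (e_ i) (f_ j) = (i == j)%:R *: h_ i. Proof. by case: (rel i j). Qed.
Let rhe i j : bracket (h_ i) (e_ j) = A i j *: e_ j. Proof. by case: (rel i j). Qed.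
Let rhf i j : bracket (h_ i) (f_ j) = - (A i j *: f_ j). Proof. by case: (rel i j). Qed.

Lemma rfe i j : bracket (f_ j) (e_ i) = (- (-1) ^+ (odd_root i && odd_root j) * (i == j)%:R) *: h_ i.
Proof. by rewrite /bracket (lsa_br_skew (pf j) (pe i)) -/(bracket _ _) ref scalerA mulNr scaleNr andbC. Qed.

(** Dual to the simple roots; this is the place where the Cartan matrix has to be inverted. *)
Definition coweight q : g := \sum_i invmx A q i *: h_ i.

Lemma coweight_h q : coweight q \in <<h>>%VS.
Proof. by apply: memv_suml => i _; apply/memvZ/memv_span/mem_tnth. Qed.

Let cw_coef q j : \sum_i invmx A q i * A i j = (q == j)%:R.
Proof. by have := congr1 (fun M : 'M[F]_r => M q j) (mulVmx A_unit); rewrite !mxE. Qed.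

Lemma coweight_e q j : bracket (coweight q) (e_ j) = (q == j)%:R *: e_ j.
Proof.
rewrite /coweight bracket_suml -cw_coef scaler_suml; apply: eq_bigr => i _.
by rewrite bracketZl rhe scalerA.
Qed.

Lemma coroot_span_even x : x \in <<h>>%VS -> x \in part false.
Proof. by apply/subvP/span_subvP=> u /tnthP[i ->]. Qed.

Lemma h_ab x y : x \in <<h>>%VS -> y \in <<h>>%VS -> bracket x y = 0.
Proof.
have /(_ x y) : br_sub <<h>>%VS <<h>>%VS 0%VS.
  by apply: br_sub_span => a b /tnthP[i ->] /tnthP[j ->]; rewrite rhh mem0v.
by move=> H xh yh; have := H xh yh; rewrite memv0 => /eqP.
Qed.

Lemma coweight_f q j : bracket (coweight q) (f_ j) = - (q == j)%:R *: f_ j.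
Proof.
rewrite /coweight bracket_suml -cw_coef scaleNr scaler_suml -sumrN; apply: eq_bigr => i _.
by rewrite bracketZl rhf scalerN scalerA.
Qed.

(** The element grading [g] by height: every simple root takes the value one on it. *)
Definition rho : g := \sum_q coweight q.

Lemma rho_h : rho \in <<h>>%VS.
Proof. by apply: memv_suml => q _; apply: coweight_h. Qed.

Lemma rho_e j : bracket rho (e_ j) = e_ j.
Proof.
rewrite /rho bracket_suml (bigD1 j) //= coweight_e eqxx scale1r big1 ?addr0 // => q qj.
by rewrite coweight_e (negbTE qj) scale0r.
Qed.

Lemma rho_f j : bracket rho (f_ j) = - f_ j.
Proof.
rewrite /rho bracket_suml (bigD1 j) //= coweight_f eqxx scaleN1r big1 ?addr0 // => q qj.
by rewrite coweight_f (negbTE qj) oppr0 scale0r.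
Qed.

Let X : seq g := e ++ f ++ h.

Let X_hom x : x \in X -> exists q : bool, x \in part q.
Proof. by rewrite !mem_cat => /or3P[] /tnthP[i ->]; [exists (odd_root i)|exists (odd_root i)|exists false]. Qed.

Let X_gen (U : {vspace g}) : br_sub U U U -> {subset X <= U} -> U = fullv.
Proof. by move=> UU XU; apply: gen => // x xX; apply: XU; rewrite !mem_cat xX ?orbT. Qed.

Let eps := sgnop (lsa_part g).
Let decg := lsa_dec g.

Let eps_part (p : bool) x : x \in part p -> eps x = (-1) ^+ p *: x.
Proof. exact: (sgnop_part decg). Qed.

Let eps_bracket (p : bool) x u : x \in part p -> eps (bracket x u) = (-1) ^+ p *: bracket x (eps u).
Proof.
move=> xp; have [u0 [u1 [-> h0 h1]]] := homog_sum u.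
rewrite bracketDr !lfD bracketDr (eps_part h0) (eps_part h1) !bracketZr.
rewrite (eps_part (lsa_br_part xp h0)) (eps_part (lsa_br_part xp h1)) scalerDr !scalerA -!signr_addb //.
Qed.

Let eps_brl (p : bool) x u : x \in part p -> eps (bracket u x) = (-1) ^+ p *: bracket (eps u) x.
Proof.
move=> xp; have [u0 [u1 [-> h0 h1]]] := homog_sum u.
rewrite bracketDl !lfD bracketDl (eps_part h0) (eps_part h1) !bracketZl.
by rewrite (eps_part (lsa_br_part h0 xp)) (eps_part (lsa_br_part h1 xp)) scalerDr !scalerA -!signr_addb; case: p {xp}.
Qed.

Let graded_eps (U : {vspace g}) : (forall u, u \in U -> eps u \in U) -> graded U.
Proof.
move=> eU u uU; have [u0 [u1 [E h0 h1]]] := homog_sum u.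
have E' : eps u = u0 - u1 by rewrite E lfD (eps_part h0) (eps_part h1) scale1r expr1 scaleN1r.
exists u0, u1; split=> //.
  have -> : u0 = 2%:R^-1 *: (u + eps u) by rewrite E' E; apply: crd_inj => i; rewrite !(crdD, crdN, crdZ); field.
  by rewrite memvZ // memvD ?eU.
have -> : u1 = 2%:R^-1 *: (u - eps u) by rewrite E' E; apply: crd_inj => i; rewrite !(crdD, crdN, crdZ); field.
by rewrite memvZ // memvB ?eU.
Qed.

Let sgn (i j : 'I_r) : F := (-1) ^+ (odd_root i && odd_root j).
Let del (i j : 'I_r) : F := (i == j)%:R.

Let jac_fe i j u : bracket (f_ j) (bracket (e_ i) u) =
  sgn i j *: bracket (e_ i) (bracket (f_ j) u) + (- sgn i j * del i j) *: bracket (h_ i) u.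
Proof.
by rewrite {1}/bracket (lsa_br_jacobi u (pf j) (pe i)) -!/(bracket _ _) rfe bracketZl addrC andbC.
Qed.

(** A vector killed by all [f_ j] generates, by raising alone, an ideal spanned by vectors of
    positive height. It meets the Cartan subalgebra trivially and so is zero. *)
Lemma null_vector (p : bool) x (k : nat) : x \in part p -> (forall i, bracket (h_ i) x \in <[x]>%VS) ->
  (forall j, bracket (f_ j) x = 0) -> bracket rho x = k.+1%:R *: x -> x = 0.
Proof.
move=> xp hx fx rx.
have [] := @raising_closure _ _ _ (fun i => lsa_br (e_ i)) (fun i => lsa_br (f_ i)) (fun i => lsa_br (h_ i))
  eps (lsa_br rho) A sgn (fun i j => - sgn i j * del i j) (fun i => (-1) ^+ odd_root i) _ _ _ _ [:: x] 0%VS.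
- exact: jac_fe.
- move=> i j u /=; rewrite (lsa_br_jacobi u (ph i) (pe j)) scale1r -!/(bracket _ _) rhe bracketZl addrC //.
- by move=> i u; apply: eps_bracket.
- by move=> i u /=; rewrite (even_deriv (coroot_span_even rho_h)) -!/(bracket _ _) rho_e addrC.
- by move=> j u; rewrite inE => /eqP->; rewrite [lsa_br _ _]fx mem0v.
- by move=> i u; rewrite memv0 => /eqP->; rewrite lf0 mem0v.
- by move=> i u; rewrite inE => /eqP->; rewrite span_seq1; apply: hx.
- by move=> u; rewrite inE => /eqP->; rewrite span_seq1 (eps_part xp) memvZ ?memv_line.
- by move=> u; rewrite inE => /eqP->; exists k.
move=> N [xN eN hN fN [epsN posN]].
suff N0 : N = 0%VS by apply/eqP; rewrite -memv0 -N0; apply: (subvP xN); rewrite span_seq1 memv_line.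
have gN := graded_eps epsN; apply: simple.
  split; [exact/graded_subP|exact: subvf|].
  apply: (stable_ideal X_gen gN) => y u; rewrite !mem_cat => /or3P[] /tnthP[i ->] uN.
  - exact: eN.
  - by have := fN i u uN; rewrite addv0.
  - exact: hN.
apply/eqP; rewrite -subv0; apply/subvP=> u; rewrite memv_cap => /andP[/posN up uh].
by rewrite (posspan_null up (h_ab rho_h uh)) mem0v.
Qed.

Lemma contra_tau : exists tau : 'End(g), [/\ forall (p : bool) x, x \in part p -> tau x \in part p,
  forall x y, tau (bracket x y) = bracket (tau y) (tau x), forall x, tau (tau x) = x,
  forall x, x \in <<h>>%VS -> tau x = x & forall i, tau (e_ i) = f_ i].
Proof.
pose P : vectType F := (g * g)%type.
(* The graph of an anti-automorphism [tau] is stable under [op x (tau x)]: a left bracket on the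
   argument is a right bracket on the value. *)
pose op x y : 'End(P) := pair_end (lsa_br x) (brl y).
have opE x y (u : P) : op x y u = (bracket x u.1, bracket u.2 y) by rewrite /op pair_endE brlE.
pose peps : 'End(P) := pair_end eps eps.
have pepsE (u : P) : peps u = (eps u.1, eps u.2) by exact: pair_endE.
pose Hs : {vspace P} := <<[seq ((h_ i, h_ i) : P) | i <- enum 'I_r]>>%VS.
pose ve : seq P := [seq ((e_ i, f_ i) : P) | i <- enum 'I_r].
pose vf : seq P := [seq ((f_ i, e_ i) : P) | i <- enum 'I_r].
have rfh i j : bracket (f_ j) (h_ i) = A i j *: f_ j.
  by rewrite -[LHS]opprK -(skew_even_l _ (ph i)) rhf opprK.
have reh i j : bracket (e_ j) (h_ i) = - (A i j *: e_ j).
  by rewrite -[LHS]opprK -(skew_even_l _ (ph i)) rhe.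
have rr x : bracket x rho = - bracket rho x by rewrite (skew_even_l _ (coroot_span_even rho_h)) opprK.
have op2 i j z : bracket (bracket z (f_ i)) (e_ j) =
    sgn i j *: bracket (bracket z (e_ j)) (f_ i) + (- sgn i j * del i j) *: bracket z (h_ i).
  rewrite (jacobi_op z (pf i) (pe j)) ref bracketZr scalerDr !scalerA /sgn /del -signr_addb addbb scale1r.
  rewrite [j == i]eq_sym; case: eqVneq => [->|_]; last by rewrite !mulr0 !scale0r add0r addr0.
  by rewrite !mulr1; lincomb.
have LE i j (u : P) : op (f_ j) (e_ j) (op (e_ i) (f_ i) u) =
    sgn i j *: op (e_ i) (f_ i) (op (f_ j) (e_ j) u) + (- sgn i j * del i j) *: op (h_ i) (h_ i) u.
  rewrite !opE /=; congr (_, _); first exact: jac_fe.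
  exact: op2.
have EL i j (u : P) : op (e_ j) (f_ j) (op (f_ i) (e_ i) u) =
    sgn i j *: op (f_ i) (e_ i) (op (e_ j) (f_ j) u) + del i j *: op (h_ i) (h_ i) u.
  have := LE j i u => E; rewrite E scalerDr !scalerA /sgn /del andbC -signr_addb addbb scale1r.
  rewrite eq_sym mulrA mulrN -signr_addb addbb mulN1r; case: eqVneq => [->|_]; last by rewrite oppr0 !scale0r !addr0.
  by rewrite -addrA -scalerDl addNr scale0r addr0.
have pairN c (x y : g) : ((- (c *: x), - (c *: y)) : P) = (- c) *: ((x, y) : P).
  by congr (_, _); rewrite /= scaleNr.
have spanf (k : 'End(P)) (q : seq P) (K : {vspace P}) : (forall w, w \in q -> k w \in K) ->
    forall u, u \in <<q>>%VS -> k u \in K.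
  move=> H u uq; rewrite memv_preim; apply: (subvP _ _ uq).
  by apply/span_subvP=> w wq; rewrite -memv_preim H.
have veP i : (e_ i, f_ i) \in <<ve>>%VS by apply/memv_span/map_f; rewrite mem_enum.
have vfP i : (f_ i, e_ i) \in <<vf>>%VS by apply/memv_span/map_f; rewrite mem_enum.
have HsP i : (h_ i, h_ i) \in Hs by apply/memv_span/map_f; rewrite mem_enum.
have Hs_diag (u : P) : u \in Hs -> u.1 \in <<h>>%VS /\ u.2 = u.1.
  move=> uH; split.
    rewrite -(fst_lfunE (u : g * g)); move: uH; rewrite memv_preim; apply/subvP/span_subvP=> _ /mapP[i _ ->].
    by rewrite -memv_preim fst_lfunE memv_span ?mem_tnth.
  have /subvP/(_ u uH) : (Hs <= lker (fst_lfun g g - snd_lfun g g)%R)%VS.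
    apply/span_subvP=> _ /mapP[i _ ->]; rewrite memv_ker add_lfunE opp_lfunE fst_lfunE snd_lfunE /= subrr //.
  by rewrite memv_ker add_lfunE opp_lfunE fst_lfunE snd_lfunE subr_eq0 => /eqP.
have opHs i (u : P) : u \in Hs -> op (h_ i) (h_ i) u = 0.
  move=> /Hs_diag[u1 u2]; rewrite opE u2.
  by rewrite (h_ab u1 (memv_span (mem_tnth i h))) (h_ab (memv_span (mem_tnth i h)) u1).
have rhoHs (u : P) : u \in Hs -> op rho rho u = 0.
  by move=> /Hs_diag[u1 u2]; rewrite opE u2 (h_ab u1 rho_h) (h_ab rho_h u1).
have epsHs (u : P) : u \in Hs -> peps u \in Hs.
  apply: spanf => _ /mapP[i _ ->]; rewrite pepsE /= (eps_part (ph i)) scale1r; exact: HsP.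
have [] := @raising_closure _ _ _ (fun i => op (e_ i) (f_ i)) (fun i => op (f_ i) (e_ i)) (fun i => op (h_ i) (h_ i))
  peps (op rho rho) A sgn (fun i j => - sgn i j * del i j) (fun i => (-1) ^+ odd_root i) _ _ _ _ ve Hs.
- exact: LE.
- move=> i j u; rewrite !opE /=; congr (_, _).
    by rewrite {1}/bracket (lsa_br_jacobi u.1 (ph i) (pe j)) scale1r -!/(bracket _ _) rhe bracketZl addrC.
  by rewrite (jacobi_op _ (ph i) (pf j)) scale1r rfh bracketZr addrC.
- move=> i u; rewrite !(opE, pepsE) /= (eps_bracket _ (pe i)) (eps_brl _ (pf i)) //.
- move=> i u; rewrite !opE /=; congr (_, _).
    by rewrite [LHS](even_deriv (coroot_span_even rho_h)) -!/(bracket _ _) rho_e addrC.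
  by rewrite (jacobi_op _ (coroot_span_even rho_h) (pf i)) scale1r rr rho_f opprK addrC.
- move=> j u /mapP[i _ ->]; rewrite opE /= !rfe.
  have -> : ((- (-1) ^+ (odd_root j && odd_root i) * (j == i)%:R) *: h_ j) =
      ((- (-1) ^+ (odd_root i && odd_root j) * (i == j)%:R) *: h_ i).
    by rewrite andbC eq_sym; case: eqVneq => [->//|_]; rewrite !mulr0 !scale0r.
  by apply: (@memvZ _ _ Hs _ ((h_ i, h_ i) : P)); apply/memv_span/map_f; rewrite mem_enum.
- move=> i; apply: spanf => _ /mapP[j _ ->]; rewrite opE /= reh rhf.
  by rewrite pairN memvZ ?veP.
- move=> i u /mapP[j _ ->]; rewrite opE /= rhe.
  have -> : bracket (f_ j) (h_ i) = A i j *: f_ j by exact: rfh.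
  exact: (memvZ (A i j) (veP j)).
- move=> u /mapP[j _ ->]; rewrite pepsE /= (eps_part (pe j)) (eps_part (pf j)).
  exact: (memvZ ((-1) ^+ odd_root j) (veP j)).
- by move=> u /mapP[j _ ->]; exists 0%N; rewrite opE /= rho_e rr rho_f opprK scale1r.
move=> Np [veN eN hN fN [epsN posN]].
have [] := @raising_closure _ _ _ (fun i => op (f_ i) (e_ i)) (fun i => op (e_ i) (f_ i)) (fun i => op (h_ i) (h_ i))
  peps (- op rho rho) (fun i j => - A i j) sgn del (fun i => (-1) ^+ odd_root i) _ _ _ _ vf Hs.
- exact: EL.
- move=> i j u; rewrite !opE /=; congr (_, _).
    by rewrite {1}/bracket (lsa_br_jacobi u.1 (ph i) (pf j)) scale1r -!/(bracket _ _) rhf bracketNl bracketZl scaleNr addrC.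
  by rewrite (jacobi_op _ (ph i) (pe j)) scale1r reh bracketNr bracketZr scaleNr addrC.
- move=> i u; rewrite !(opE, pepsE) /= (eps_bracket _ (pf i)) (eps_brl _ (pe i)) //.
- move=> i u; rewrite !opp_lfunE !opE /=.
  rewrite [bracket rho (bracket _ _)](even_deriv (coroot_span_even rho_h)) -!/(bracket _ _) rho_f.
  rewrite (jacobi_op u.2 (coroot_span_even rho_h) (pe i)) scale1r rr rho_e bracketNl bracketNr bracketNl.
  by congr (_, _) => /=; rewrite ?bracketNr; lincomb.
- move=> j u /mapP[i _ ->]; rewrite opE /= !ref.
  have -> : (j == i)%:R *: h_ j = (i == j)%:R *: h_ i by rewrite eq_sym; case: eqVneq => [->//|_]; rewrite !scale0r.
  by apply: (@memvZ _ _ Hs _ ((h_ i, h_ i) : P)); exact: HsP.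
- move=> i; apply: spanf => _ /mapP[j _ ->]; rewrite opE /= rfh rhe.
  exact: (memvZ (A j i) (vfP i)).
- move=> i u /mapP[j _ ->]; rewrite opE /= rhf reh.
  by rewrite pairN memvZ ?vfP.
- move=> u /mapP[j _ ->]; rewrite pepsE /= (eps_part (pe j)) (eps_part (pf j)).
  exact: (memvZ ((-1) ^+ odd_root j) (vfP j)).
- move=> u /mapP[j _ ->]; exists 0%N; rewrite opp_lfunE opE /= rho_f rr rho_e scale1r.
  by congr (_, _); rewrite /= opprK.
move=> Nm [vfN fM hM eM [epsM negM]].
(* The graph in triangular form, with pairs of positive, negative and zero height. *)
pose T := (Np + Nm + Hs)%VS.
have Np_T : (Np <= T)%VS by rewrite /T -addvA addvSl.
have Nm_T : (Nm <= T)%VS by rewrite /T -addvA addvC -addvA addvSl.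
have Hs_T : (Hs <= T)%VS by rewrite addvSr.
have opT (k : 'End(P)) : (forall u, u \in Np -> k u \in T) -> (forall u, u \in Nm -> k u \in T) ->
    (forall u, u \in Hs -> k u \in T) -> forall u, u \in T -> k u \in T.
  move=> h1 h2 h3 _ /memv_addP[_ /memv_addP[a aN [c cN ->]] [d dH ->]].
  rewrite !lfD; apply: memvD; last exact: h3.
  by apply: memvD; [exact: h1|exact: h2].
have eT i u : u \in T -> op (e_ i) (f_ i) u \in T.
  apply: opT => {}u uN; first exact/(subvP Np_T)/eN.
    have /subvP : (Nm + Hs <= T)%VS by rewrite subv_add Nm_T.
    by apply; apply: eM.
  apply: (subvP Np_T); apply: (subvP veN); move: u uN; apply: spanf => _ /mapP[j _ ->]; rewrite opE /= reh rhf.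
  by rewrite pairN memvZ ?veP.
have fT i u : u \in T -> op (f_ i) (e_ i) u \in T.
  apply: opT => {}u uN; last 1 first.
  - apply: (subvP Nm_T); apply: (subvP vfN); move: u uN; apply: spanf => _ /mapP[j _ ->]; rewrite opE /= rfh rhe.
    exact: (memvZ (A j i) (vfP i)).
  - have /subvP : (Np + Hs <= T)%VS by rewrite subv_add Np_T.
    by apply; apply: fN.
  exact/(subvP Nm_T)/fM.
have hT i u : u \in T -> op (h_ i) (h_ i) u \in T.
  apply: opT => {}u uN; [exact/(subvP Np_T)/hN|exact/(subvP Nm_T)/hM|].
  by rewrite opHs ?mem0v.
have epsT u : u \in T -> peps u \in T.
  by apply: opT => {}u uN; [exact/(subvP Np_T)/epsN|exact/(subvP Nm_T)/epsM|exact/(subvP Hs_T)/epsHs].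
(* A pair with components 0 and [y] has height zero; its positive and negative parts cancel, which
   leaves a diagonal pair with first component zero. *)
have graph0 y : y \in <<h>>%VS -> ((0, y) : P) \in T -> y = 0.
  move=> yh /memv_addP[_ /memv_addP[a aN [c cN ->]] [d dH E]].
  have [Xa HXa aX] := posN a aN; have [Xc HXc cX] := negM c cN.
  have ac : a + c = 0.
    apply: (eig_inj (f := op rho rho) (X := Xa ++ Xc)).
    - move=> w; rewrite mem_cat => /orP[/HXa[k ->]|/HXc[k]]; first by exists k.+1%:R; rewrite // pnatr_eq0.
      rewrite opp_lfunE => tw; exists (- k.+1%:R); first by rewrite oppr_eq0 pnatr_eq0.
      by rewrite scaleNr -tw opprK.
    - by rewrite span_cat memv_add.
    have := congr1 (op rho rho) E; rewrite [in RHS]lfD (rhoHs d dH) addr0 => <-.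
    by rewrite opE /= bracket0r (h_ab yh rho_h).
  have := E; rewrite ac add0r => Ed; have [_ ] := Hs_diag d dH; rewrite -Ed //.
(* The values over zero measure how far [T] is from being single-valued. They form an ideal, which
   meets the Cartan subalgebra trivially by [graph0]. *)
have [K HK] : exists K : {vspace g}, forall y, y \in K <-> ((0, y) : P) \in T.
  apply: vspace_of_pred => [|c x y xT yT]; first exact: (mem0v T).
  have -> : ((0, c *: x + y) : P) = c *: ((0, x) : P) + ((0, y) : P).
    by congr (_, _); rewrite /= scaler0 addr0.
  by apply: memvD => //; apply: memvZ.
have gK : graded K.
  by apply: graded_eps => y /HK yT; apply/HK; have := epsT _ yT; rewrite pepsE /= lf0.
have Kr y x : x \in X -> y \in K -> bracket y x \in K.
  rewrite !mem_cat => /or3P[] /tnthP[i ->] /HK yT; apply/HK.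
  - by have := fT i _ yT; rewrite opE /= bracket0r.
  - by have := eT i _ yT; rewrite opE /= bracket0r.
  by have := hT i _ yT; rewrite opE /= bracket0r.
have Kl x y : x \in X -> y \in K -> bracket x y \in K.
  move=> xX /gK[y0 [y1 [-> k0 k1 h0 h1]]]; have [q xq] := X_hom xX.
  rewrite bracketDr /bracket (lsa_br_skew xq h0) (lsa_br_skew xq h1).
  by rewrite memvB ?memvN // memvZ // Kr.
have K0 : K = 0%VS.
  apply: simple; first by split; [exact/graded_subP|exact: subvf|exact: (stable_ideal X_gen gK Kl)].
  apply/eqP; rewrite -subv0; apply/subvP=> y; rewrite memv_cap memv0 => /andP[/HK yT yh].
  exact/eqP/graph0.
have uniqT x y y' : ((x, y) : P) \in T -> ((x, y') : P) \in T -> y = y'.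
  move=> xy xy'; apply/eqP; rewrite -subr_eq0 -memv0 -K0; apply/HK.
  have -> : ((0, y - y') : P) = ((x, y) : P) - ((x, y') : P) by congr (_, _); rewrite /= subrr.
  by apply: memvB.
have TX : [/\ forall i, ((e_ i, f_ i) : P) \in T, forall i, ((f_ i, e_ i) : P) \in T
    & forall i, ((h_ i, h_ i) : P) \in T].
  split=> i; [exact/(subvP Np_T)/(subvP veN)|exact/(subvP Nm_T)/(subvP vfN)|exact/(subvP Hs_T)].
have [TXe TXf TXh] := TX.
have fstT x y : ((x, y) : P) \in T -> x \in (fst_lfun g g @: T)%VS.
  by move=> xy; have := memv_img (fst_lfun g g) xy; rewrite fst_lfunE.
have fullT : (fst_lfun g g @: T)%VS = fullv.
  apply: (stable_full X_gen).
  - apply: graded_eps => _ /memv_imgP[[x y] xy ->]; rewrite fst_lfunE /=.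
    by apply: fstT; have := epsT _ xy; rewrite pepsE; apply.
  - move=> z _ + /memv_imgP[[x y] xy ->]; rewrite fst_lfunE /= !mem_cat => /or3P[] /tnthP[i ->].
    + by have := eT i _ xy; rewrite opE; apply: fstT.
    + by have := fT i _ xy; rewrite opE; apply: fstT.
    by have := hT i _ xy; rewrite opE; apply: fstT.
  move=> z; rewrite !mem_cat => /or3P[] /tnthP[i ->]; apply: fstT; [exact: TXe|exact: TXf|exact: TXh].
have ex x : exists y, ((x, y) : P) \in T.
  have : x \in (fst_lfun g g @: T)%VS by rewrite fullT memvf.
  by case/memv_imgP=> -[x' y] xy ->; exists y; rewrite fst_lfunE.
have [ta Hta] := choice ex.
have taE x y : ((x, y) : P) \in T -> ta x = y by move=> xy; apply: uniqT (Hta x) xy.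
have lin : linear ta by move=> c x y; apply: taE; exact: (memvD (memvZ c (Hta x)) (Hta y)).
pose tau : 'End(g) := linfun (HB.pack ta (GRing.isLinear.Build _ _ _ _ _ lin) : {linear g -> g}).
have tauE x y : ((x, y) : P) \in T -> tau x = y by move=> /taE; rewrite lfunE.
have tauT x : ((x, tau x) : P) \in T by rewrite lfunE; apply: Hta.
have tp (p : bool) x : x \in part p -> tau x \in part p.
  move=> xp; apply/(sgnopP decg); rewrite -/eps -lfZ -(eps_part xp); apply/esym/tauE.
  by have := epsT _ (tauT x); rewrite pepsE.
have te i : tau (e_ i) = f_ i by exact/tauE/TXe.
have tf i : tau (f_ i) = e_ i by exact/tauE/TXf.
have th i : tau (h_ i) = h_ i by exact/tauE/TXh.
have tX x y : x \in X -> tau (bracket x y) = bracket (tau y) (tau x).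
  rewrite !mem_cat => /or3P[] /tnthP[i ->]; apply: tauE.
  - by rewrite te; have := eT i _ (tauT y); rewrite opE.
  - by rewrite tf; have := fT i _ (tauT y); rewrite opE.
  by rewrite th; have := hT i _ (tauT y); rewrite opE.
have tbr := anti_gen X_gen tp tX.
exists tau; split=> //; last first.
  move=> x xh; apply/eqP; rewrite -subr_eq0.
  have /subvP/(_ x xh) : (<<h>> <= lker (tau - \1%VF)%R)%VS.
    by apply/span_subvP=> _ /tnthP[i ->]; rewrite memv_ker add_lfunE opp_lfunE id_lfunE th subrr.
  by rewrite memv_ker add_lfunE opp_lfunE id_lfunE.
have tt x : x \in X -> tau (tau x) = x.
  by rewrite !mem_cat => /or3P[] /tnthP[i ->]; rewrite ?(te, tf, th).
pose U := lker ((tau \o tau)%VF - \1%VF)%R.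
have mU x : (x \in U) = (tau (tau x) == x).
  by rewrite memv_ker add_lfunE opp_lfunE comp_lfunE id_lfunE subr_eq0.
have UT : U = fullv.
  apply: (stable_full X_gen).
  - apply: graded_eps => u; rewrite !mU => /eqP uu; have [u0 [u1 [E h0 h1]]] := homog_sum u.
    move: uu; rewrite E !lfD (eps_part h0) (eps_part h1) !lfZ => /eqP; rewrite -subr_eq0 opprD addrACA => /eqP.
    case/homog_sum0; rewrite ?memvB ?tp // => /eqP + /eqP; rewrite !subr_eq0 => /eqP-> /eqP->.
    exact: eqxx.
  - by move=> x u xX; rewrite !mU !tbr => /eqP->; rewrite tt.
  by move=> x xX; rewrite mU tt.
by move=> x; apply/eqP; rewrite -mU UT memvf.
Qed.
End Contragredient.

Section IntegerPolynomials.

(* Coefficient sequences of integral polynomials in the parameter [alpha], with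
   operations that compute. *)
Fixpoint padd (a b : seq int) : seq int :=
  match a, b with
  | [::], _ => b
  | _, [::] => a
  | x :: a', y :: b' => (x + y) :: padd a' b'
  end.
Definition pscale (z : int) (a : seq int) : seq int := [seq z * x | x <- a].
Definition pmul (a b : seq int) : seq int := foldr (fun z acc => padd (pscale z b) (0 :: acc)) [::] a.
Definition peq0 (a : seq int) : bool := all (fun z => z == 0) a.

Variables (F : numClosedFieldType) (al : F).
Definition pev (a : seq int) : F := foldr (fun z acc => z%:~R + al * acc) 0 a.

Lemma pev_add a b : pev (padd a b) = pev a + pev b.
Proof.
elim: a b => [|x a IH] [|y b] //=; rewrite ?add0r ?addr0 // IH rmorphD; ring.
Qed.
Lemma pev_scale z a : pev (pscale z a) = z%:~R * pev a.
Proof. elim: a => [|x a IH] /=; rewrite ?mulr0 // IH rmorphM; ring. Qed.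
Lemma pev_mul a b : pev (pmul a b) = pev a * pev b.
Proof. elim: a => [|x a IH] /=; rewrite ?mul0r // pev_add pev_scale /= IH; ring. Qed.
Lemma pev_eq0 a : peq0 a -> pev a = 0.
Proof. by elim: a => [|x a IH] //= /andP[/eqP-> /IH->]; rewrite mulr0 addr0. Qed.
End IntegerPolynomials.

(* Positive part of a contragredient algebra on root vectors [b_k]: the weight
   of [b_k]; [e_i, b_k] and, for the vectors of height at least 2, [f_j, b_k],
   as a multiple of one root vector; for these, indices [(i, j)] such that
   [b_k = [e_i, b_j]]; the Cartan matrix. *)
Record root_table := RootTable {
  rt_wt : seq (seq nat);
  rt_E : seq (seq (seq int * nat));
  rt_F : seq (seq (seq int * nat));
  rt_def : seq (nat * nat);
  rt_A : seq (seq (seq int)) }.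

Section TableCheck.
Variables (r : nat) (T : root_table).
Let N := size (rt_wt T).
Let z : seq int * nat := ([::], 0%N).
Definition tabW k := nth [::] (rt_wt T) k.
Definition tabE k i := nth z (nth [::] (rt_E T) k) i.
Definition tabF k j := nth z (nth [::] (rt_F T) k) j.
(** The list of definitions begins with the first root vector that is not simple, hence the shift by
    [r]. *)
Definition tabD k := nth (0, 0)%N (rt_def T) (k - r).
Definition tabA i j := nth [::] (nth [::] (rt_A T) i) j.
(* the first simple root is the only odd one *)
Definition tsgn (i j : nat) : int := if (i == 0%N) && (j == 0%N) then - 1 else 1.
Definition weightp i w := foldr (fun q acc => padd (pscale (nth 0%N w q)%:Z (tabA i q)) acc) [::] (iota 0 r).
(** The double bracket of [f_j] with [[e_i, b_k]] by the Jacobi identity: a Cartan term from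
    [[f_j, e_i]], then [e_i] applied to [[f_j, b_k]]. For a simple [b_k] the latter bracket lies in
    the Cartan subalgebra, so the Cartan matrix is used in place of [tabF]. *)
Definition tab_lhs k i j : seq (seq int * nat) :=
  (if i == j then [:: (pscale (- tsgn i j) (weightp i (tabW k)), k)] else [::]) ++
  (if (k < r)%N then if j == k then [:: (pscale (tsgn i j * tsgn k j) (tabA k i), i)] else [::]
   else [:: (pscale (tsgn i j) (pmul (tabF k j).1 (tabE (tabF k j).2 i).1), (tabE (tabF k j).2 i).2)]).
Definition tab_rhs k i j : seq int * nat :=
  (pmul (tabE k i).1 (tabF (tabE k i).2 j).1, (tabF (tabE k i).2 j).2).
Definition coef_at (m : nat) (ts : seq (seq int * nat)) : seq int :=
  foldr (fun t acc => if t.2 == m then padd t.1 acc else acc) [::] ts.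
Definition check_brackets :=
  all (fun k => all (fun i => all (fun j => all (fun m =>
    peq0 (padd (coef_at m (tab_lhs k i j)) (pscale (-1) (coef_at m [:: tab_rhs k i j]))))
    (iota 0 N)) (iota 0 r)) (iota 0 r)) (iota 0 N).
Definition check_weights :=
  all (fun k => all (fun i => [&& ((tabE k i).2 < N)%N, ((tabF k i).2 < N)%N,
     ((tabE k i).1 == [::]) || ((r <= (tabE k i).2)%N && (tabW (tabE k i).2 == incr_nth (tabW k) i)) &
     ((tabF k i).1 == [::]) || (tabW k == incr_nth (tabW (tabF k i).2) i)]) (iota 0 r)) (iota 0 N)
  && all (fun k => (size (tabW k) == r) && (0 < nth 0 (tabW k) (find (fun x => 0 < x) (tabW k)))%N) (iota 0 N).
Definition check_defs :=
  all (fun k => if (k < r)%N then tabW k == incr_nth (nseq r 0%N) k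
     else [&& ((tabD k).1 < r)%N, ((tabD k).2 < k)%N & tabE (tabD k).2 (tabD k).1 == ([:: 1], k)]) (iota 0 N).
Definition check_table := [&& (r <= N)%N, uniq (rt_wt T), check_brackets, check_weights & check_defs].
End TableCheck.

Local Notation z := ([::], 0%N).
(** Coefficients are polynomials in the parameter, lowest degree first: the list with entries 0 and
    -1 is minus alpha, that with entries 1 and 1 is one plus alpha. An empty list marks a vanishing
    bracket. There are 7 positive roots here, 14 for G(3) and 18 for F(4). *)
Definition table_D21 : root_table := RootTable
  [:: [:: 1; 0; 0]; [:: 0; 1; 0]; [:: 0; 0; 1]; [:: 1; 1; 0]; [:: 1; 0; 1]; [:: 1; 1; 1]; [:: 2; 1; 1]]%N
  [:: [:: z; ([:: 1], 3%N); ([:: 1], 4%N)];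
      [:: ([:: (-1)], 3%N); z; z];
      [:: ([:: (-1)], 4%N); z; z];
      [:: z; z; ([:: 1], 5%N)];
      [:: z; ([:: 1], 5%N); z];
      [:: ([:: 1], 6%N); z; z];
      [:: z; z; z]]
  [:: [::];
      [::];
      [::];
      [:: ([:: (-1)], 1%N); ([:: 1], 0%N); z];
      [:: ([:: 0; (-1)], 2%N); z; ([:: 1], 0%N)];
      [:: z; ([:: 1], 4%N); ([:: 1], 3%N)];
      [:: ([:: 1; 1], 5%N); z; z]]
  [:: (1, 0); (2, 0); (2, 3); (0, 5)]%N
  [:: [:: [::]; [:: 1]; [:: 0; 1]]; [:: [:: (-1)]; [:: 2]; [::]]; [:: [:: (-1)]; [::]; [:: 2]]].

Definition table_G3 : root_table := RootTable
  [:: [:: 1; 0; 0]; [:: 0; 1; 0]; [:: 0; 0; 1]; [:: 1; 1; 0]; [:: 0; 1; 1]; [:: 1; 1; 1]; [:: 0; 2; 1]; [:: 1; 2; 1]; [:: 0; 3; 1]; [:: 1; 3; 1]; [:: 0; 3; 2]; [:: 1; 3; 2]; [:: 1; 4; 2]; [:: 2; 4; 2]]%N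
  [:: [:: z; ([:: 1], 3%N); z];
      [:: ([:: (-1)], 3%N); z; ([:: 1], 4%N)];
      [:: z; ([:: (-1)], 4%N); z];
      [:: z; z; ([:: 1], 5%N)];
      [:: ([:: (-1)], 5%N); ([:: 1], 6%N); z];
      [:: z; ([:: 1], 7%N); z];
      [:: ([:: (-2)], 7%N); ([:: 1], 8%N); z];
      [:: z; ([:: 1], 9%N); z];
      [:: ([:: (-3)], 9%N); z; ([:: 1], 10%N)];
      [:: z; z; ([:: 1], 11%N)];
      [:: ([:: (-3)], 11%N); z; z];
      [:: z; ([:: 1], 12%N); z];
      [:: ([:: 1], 13%N); z; z];
      [:: z; z; z]]
  [:: [::];
      [::];
      [::];
      [:: ([:: (-1)], 1%N); ([:: 1], 0%N); z];
      [:: z; ([:: (-3)], 2%N); ([:: 1], 1%N)];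
      [:: ([:: (-1)], 4%N); z; ([:: 1], 3%N)];
      [:: z; ([:: 4], 4%N); z];
      [:: ([:: (-1)], 6%N); ([:: 2], 5%N); z];
      [:: z; ([:: 3], 6%N); z];
      [:: ([:: (-1)], 8%N); ([:: 2], 7%N); z];
      [:: z; z; ([:: 1], 8%N)];
      [:: ([:: (-1)], 10%N); z; ([:: 1], 9%N)];
      [:: z; ([:: 1], 11%N); z];
      [:: ([:: 4], 12%N); z; z]]
  [:: (1, 0); (2, 1); (2, 3); (1, 4); (1, 5); (1, 6); (1, 7); (2, 8); (2, 9); (1, 11); (0, 12)]%N
  [:: [:: [::]; [:: 1]; [::]]; [:: [:: (-1)]; [:: 2]; [:: (-3)]]; [:: [::]; [:: (-1)]; [:: 2]]].

Definition table_F4 : root_table := RootTable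
  [:: [:: 1; 0; 0; 0]; [:: 0; 1; 0; 0]; [:: 0; 0; 1; 0]; [:: 0; 0; 0; 1]; [:: 1; 1; 0; 0]; [:: 0; 1; 1; 0]; [:: 0; 0; 1; 1]; [:: 1; 1; 1; 0]; [:: 0; 2; 1; 0]; [:: 0; 1; 1; 1]; [:: 1; 2; 1; 0]; [:: 1; 1; 1; 1]; [:: 0; 2; 1; 1]; [:: 1; 2; 1; 1]; [:: 0; 2; 2; 1]; [:: 1; 2; 2; 1]; [:: 1; 3; 2; 1]; [:: 2; 3; 2; 1]]%N
  [:: [:: z; ([:: 1], 4%N); z; z];
      [:: ([:: (-1)], 4%N); z; ([:: 1], 5%N); z];
      [:: z; ([:: (-1)], 5%N); z; ([:: 1], 6%N)];
      [:: z; z; ([:: (-1)], 6%N); z];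
      [:: z; z; ([:: 1], 7%N); z];
      [:: ([:: (-1)], 7%N); ([:: 1], 8%N); z; ([:: 1], 9%N)];
      [:: z; ([:: (-1)], 9%N); z; z];
      [:: z; ([:: 1], 10%N); z; ([:: 1], 11%N)];
      [:: ([:: (-2)], 10%N); z; z; ([:: 1], 12%N)];
      [:: ([:: (-1)], 11%N); ([:: 1], 12%N); z; z];
      [:: z; z; z; ([:: 1], 13%N)];
      [:: z; ([:: 1], 13%N); z; z];
      [:: ([:: (-2)], 13%N); z; ([:: 1], 14%N); z];
      [:: z; z; ([:: 1], 15%N); z];
      [:: ([:: (-2)], 15%N); z; z; z];
      [:: z; ([:: 1], 16%N); z; z];
      [:: ([:: 1], 17%N); z; z; z];
      [:: z; z; z; z]]
  [:: [::];
      [::];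
      [::];
      [::];
      [:: ([:: (-1)], 1%N); ([:: 1], 0%N); z; z];
      [:: z; ([:: (-2)], 2%N); ([:: 1], 1%N); z];
      [:: z; z; ([:: (-1)], 3%N); ([:: 1], 2%N)];
      [:: ([:: (-1)], 5%N); z; ([:: 1], 4%N); z];
      [:: z; ([:: 2], 5%N); z; z];
      [:: z; ([:: (-2)], 6%N); z; ([:: 1], 5%N)];
      [:: ([:: (-1)], 8%N); ([:: 1], 7%N); z; z];
      [:: ([:: (-1)], 9%N); z; z; ([:: 1], 7%N)];
      [:: z; ([:: 2], 9%N); z; ([:: 1], 8%N)];
      [:: ([:: (-1)], 12%N); ([:: 1], 11%N); z; ([:: 1], 10%N)];
      [:: z; z; ([:: 1], 12%N); z];
      [:: ([:: (-1)], 14%N); z; ([:: 1], 13%N); z];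
      [:: z; ([:: 1], 15%N); z; z];
      [:: ([:: 3], 16%N); z; z; z]]
  [:: (1, 0); (2, 1); (3, 2); (2, 4); (1, 5); (3, 5); (1, 7); (3, 7); (3, 8); (3, 10); (2, 12); (2, 13); (1, 15); (0, 16)]%N
  [:: [:: [::]; [:: 1]; [::]; [::]]; [:: [:: (-1)]; [:: 2]; [:: (-2)]; [::]]; [:: [::]; [:: (-1)]; [:: 2]; [:: (-1)]]; [:: [::]; [::]; [:: (-1)]; [:: 2]]].

Lemma check_D21 : check_table 3 table_D21. Proof. by vm_compute. Qed.
Lemma check_G3 : check_table 3 table_G3. Proof. by vm_compute. Qed.
Lemma check_F4 : check_table 4 table_F4. Proof. by vm_compute. Qed.

Section RootTables.
Variables (F : numClosedFieldType) (g : lieSuperalgebra F) (r : nat) (A : 'M[F]_r).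
Local Notation part := (lsa_part g).
Let odd_root : pred 'I_r := fun i => val i == 0%N.
Variables (e f h : r.-tuple g).
Hypothesis par : forall i, [/\ tnth e i \in part (odd_root i), tnth f i \in part (odd_root i)
  & tnth h i \in part false].
Hypothesis rel : forall i j, [/\ bracket (tnth h i) (tnth h j) = 0,
  bracket (tnth e i) (tnth f j) = (i == j)%:R *: tnth h i,
  bracket (tnth h i) (tnth e j) = A i j *: tnth e j
  & bracket (tnth h i) (tnth f j) = - (A i j *: tnth f j)].
Hypothesis free_h : free h.
Hypothesis gen : forall U : {vspace g}, br_sub U U U ->
  {subset e <= U} -> {subset f <= U} -> {subset h <= U} -> U = fullv.
Hypothesis simple : forall I : {vspace g}, ideal_of I fullv -> (I :&: <<h>>)%VS = 0%VS -> I = 0%VS.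
Hypothesis A_unit : A \in unitmx.
Variables (al : F) (T : root_table).
Hypothesis A_tab : forall i j, A i j = pev al (tabA T i j).
Hypothesis chk : check_table r T.

Local Notation N := (size (rt_wt T)).
Local Notation W k := (tabW T k).
Local Notation en i := (tnth e i).
Local Notation fn i := (tnth f i).
Local Notation hn i := (tnth h i).
Local Notation cw q := (coweight A h q).
Local Notation rhov := (rho A h).

Let rN : (r <= N)%N. Proof. by case/and5P: chk. Qed.
Let uniqW : uniq (rt_wt T). Proof. by case/and5P: chk. Qed.
Let iotaP (k n : nat) : (k < n)%N -> k \in iota 0 n. Proof. by rewrite mem_iota. Qed.

Let chkE k (i : 'I_r) : (k < N)%N -> [/\ ((tabE T k i).2 < N)%N, ((tabF T k i).2 < N)%N,
  (tabE T k i).1 <> [::] -> (r <= (tabE T k i).2)%N /\ W (tabE T k i).2 = incr_nth (W k) i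
  & (tabF T k i).1 <> [::] -> W k = incr_nth (W (tabF T k i).2) i].
Proof.
move=> kN; case/and5P: chk => _ _ _ /andP[/allP/(_ k (iotaP kN))/allP/(_ i (iotaP (ltn_ord i))) + _] _.
case/and4P=> -> -> a b; split=> //.
  by move/eqP/negbTE=> E; move: a; rewrite E /= => /andP[-> /eqP].
by move/eqP/negbTE=> E; move: b; rewrite E /= => /eqP.
Qed.

Let chkW k : (k < N)%N -> size (W k) = r /\ exists2 q : 'I_r, true & (0 < nth 0 (W k) q)%N.
Proof.
move=> kN; case/and5P: chk => _ _ _ /andP[_ /allP/(_ k (iotaP kN))/andP[/eqP sz pos]] _; split=> //.
set q := find _ _ in pos; have qr : (q < r)%N.
  by rewrite ltnNge -sz; apply/negP=> H; rewrite nth_default in pos.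
by exists (Ordinal qr).
Qed.

Let chkS k : (k < r)%N -> W k = incr_nth (nseq r 0%N) k.
Proof.
move=> kr; case/and5P: chk => _ _ _ _ /allP/(_ k (iotaP (leq_trans kr rN))); by rewrite kr => /eqP.
Qed.

Let chkD k : (r <= k)%N -> (k < N)%N ->
  exists i : 'I_r, exists2 j, (j < k)%N & tabD r T k = (val i, j) /\ tabE T j i = ([:: 1], k).
Proof.
move=> rk kN; case/and5P: chk => _ _ _ _ /allP/(_ k (iotaP kN)); rewrite ltnNge rk /=.
case: (tabD r T k) => i j /= /and3P[ir jk /eqP E].
by exists (Ordinal ir), j.
Qed.

Let chkB k (i j : 'I_r) m : (k < N)%N -> (m < N)%N ->
  pev al (coef_at m (tab_lhs r T k i j)) = pev al (coef_at m [:: tab_rhs T k i j]).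
Proof.
move=> kN mN; case/and5P: chk => _ _ /allP/(_ k (iotaP kN))/allP/(_ i (iotaP (ltn_ord i))) + _ _.
move/allP/(_ j (iotaP (ltn_ord j)))/allP/(_ m (iotaP mN))/(pev_eq0 al).
rewrite pev_add pev_scale => /eqP; rewrite mulN1r subr_eq0 => /eqP -> //.
Qed.

Let aw (i : 'I_r) w : F := pev al (weightp r T i w).

Let awE i w : aw i w = \sum_(q < r) (nth 0%N w q)%:R * A i q.
Proof.
rewrite (eq_bigr (fun q : 'I_r => (nth 0%N w q)%:R * pev al (tabA T i q))) => [|q _]; last by rewrite A_tab.
rewrite -(big_mkord xpredT (fun q => (nth 0%N w q)%:R * pev al (tabA T i q))) /index_iota subn0 /aw /weightp.
by elim: (iota 0 r) => [|q s IH]; rewrite ?big_nil // big_cons /= pev_add pev_scale IH pmulrn.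
Qed.

Let sum_incr (K : 'I_r -> F) w (i : 'I_r) :
  \sum_(q < r) (nth 0%N (incr_nth w i) q)%:R * K q = K i + \sum_(q < r) (nth 0%N w q)%:R * K q.
Proof.
rewrite (eq_bigr (fun q : 'I_r => (i == q)%:R * K q + (nth 0%N w q)%:R * K q)) => [|q _]; last first.
  by rewrite nth_incr_nth natrD mulrDl.
rewrite big_split /= (bigD1 i) //= eqxx mul1r big1 ?addr0 // => q qi.
by rewrite eq_sym (negbTE qi) mul0r.
Qed.

Definition has_weight w (x : g) := [/\ x \in part (odd (nth 0%N w 0%N)),
  forall i, bracket (hn i) x = aw i w *: x & forall q, bracket (cw q) x = (nth 0%N w q)%:R *: x].

Let hn_even i : hn i \in part false. Proof. by case: (par i). Qed.
Let cw_even q : cw q \in part false. Proof. exact: coroot_span_even par _ (coweight_h A h q). Qed.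

Lemma has_weight_e (i : 'I_r) w x : has_weight w x -> has_weight (incr_nth w i) (bracket (en i) x).
Proof.
move=> [xp hx cx]; split.
- have [ep _ _] := par i; have := lsa_br_part ep xp; congr (_ \in part _).
  by rewrite nth_incr_nth oddD /odd_root; case: (val i == 0)%N.
- move=> j; rewrite [LHS](even_deriv (hn_even j)) -!/(bracket _ _) hx bracketZr.
  have [_ _ -> _] := rel j i; rewrite bracketZl -scalerDl /aw -!/(aw _ _) !awE sum_incr //.
move=> q; rewrite [LHS](even_deriv (cw_even q)) -!/(bracket _ _) cx bracketZr.
by rewrite (coweight_e rel A_unit) bracketZl -scalerDl nth_incr_nth natrD eq_sym.
Qed.

Lemma has_weightD w c x y : has_weight w x -> has_weight w y -> has_weight w (x + c *: y).
Proof.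
move=> [xp hx cx] [yp hy cy]; split; first by rewrite memvD ?memvZ.
  by move=> i; rewrite bracketDr bracketZr hx hy; lincomb.
by move=> q; rewrite bracketDr bracketZr cx cy; lincomb.
Qed.

Lemma root_vectors : exists b : nat -> g, (forall i : 'I_r, b i = en i) /\
  forall k, (r <= k)%N -> (k < N)%N -> forall (i : 'I_r) j, tabD r T k = (val i, j) -> b k = bracket (en i) (b j).
Proof.
have e0 (i : 'I_r) : nth 0 e i = en i by rewrite (tnth_nth 0).
suff H n : exists b : nat -> g, (forall i : 'I_r, b i = en i) /\
  forall k, (r <= k)%N -> (k < N)%N -> (k < n)%N -> forall (i : 'I_r) j, tabD r T k = (val i, j) -> b k = bracket (en i) (b j).
  by have [b [b1 b2]] := H N; exists b; split=> // k rk kN; apply: b2.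
elim: n => [|n [b [b1 b2]]]; first by exists (nth 0 e).
have [rn|nr] := leqP r n; last first.
  by exists b; split=> // k rk kN kn; exfalso; lia.
exists (fun k => if k == n then bracket (nth 0 e (tabD r T n).1) (b (tabD r T n).2) else b k); split.
  by move=> i; rewrite ifN // neq_ltn (leq_trans (ltn_ord i) rn).
move=> k rk kN; rewrite ltnS => kn i j E.
have jk : (j < k)%N by have [i' [j' j'k [E' _]]] := chkD rk kN; move: E'; rewrite E => -[_ ->].
rewrite [j == n](_ : _ = false); last by apply/eqP; lia.
have [kn'|kn'] := eqVneq k n; first by rewrite -kn' E /= e0.
by apply: b2 => //; lia.
Qed.

Section Vectors.
Variable b : nat -> g.
Hypothesis b_e : forall i : 'I_r, b i = en i.
Hypothesis b_def : forall k, (r <= k)%N -> (k < N)%N ->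
  forall (i : 'I_r) j, tabD r T k = (val i, j) -> b k = bracket (en i) (b j).

Lemma b_weight k : (k < N)%N -> has_weight (W k) (b k).
Proof.
elim/ltn_ind: k => k IH kN; have [rk|kr] := leqP r k.
  have [i [j jk [Dk Ej]]] := chkD rk kN; rewrite (b_def rk kN Dk).
  have jN := ltn_trans jk kN; have [_ _ + _] := chkE i jN; rewrite Ej /= => H.
  by have [//|_ ->] := H; apply/has_weight_e/IH.
have -> : b k = en (Ordinal kr) by rewrite -b_e.
rewrite (chkS kr); have nz q : nth 0%N (nseq r 0%N) q = 0%N by rewrite nth_nseq if_same.
have [ep _ _] := par (Ordinal kr); split.
- by rewrite nth_incr_nth nz addn0 oddb.
- move=> i; have [_ _ -> _] := rel i (Ordinal kr); rewrite awE (sum_incr _ _ (Ordinal kr)) big1 ?addr0 // => q _.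
  by rewrite nz mul0r.
by move=> q; rewrite (coweight_e rel A_unit) nth_incr_nth nz addn0 eq_sym.
Qed.

Let tev (ts : seq (seq int * nat)) : g := \sum_(t <- ts) pev al t.1 *: b t.2.

Let tev_coef ts : all (fun t : seq int * nat => (t.2 < N)%N) ts ->
  tev ts = \sum_(m < N) pev al (coef_at m ts) *: b m.
Proof.
elim: ts => [|[c l] ts IH] /=; first by rewrite /tev big_nil big1 // => m _; rewrite scale0r.
case/andP=> lN /IH E; rewrite /tev big_cons -/(tev ts) E /=.
rewrite (bigD1 (Ordinal lN)) // [in RHS](bigD1 (Ordinal lN)) //= eqxx pev_add scalerDl addrA; congr (_ + _).
apply: eq_bigr => m ml; rewrite ifN //; apply: contra ml => /eqP E'; exact/eqP/val_inj.
Qed.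

Definition Fok k := forall j : 'I_r, bracket (fn j) (b k) = pev al (tabF T k j).1 *: b (tabF T k j).2.
Definition Eok k := forall i : 'I_r, bracket (en i) (b k) = pev al (tabE T k i).1 *: b (tabE T k i).2.

(** The Jacobi identity produces the terms of [tab_lhs]; the checked identity of integral
    polynomials is then evaluated at [al]. *)
Lemma bracket_fe k (i j : 'I_r) : (k < N)%N -> ((r <= k)%N -> Fok k) ->
  ((r <= k)%N -> (tabF T k j).1 <> [::] -> Eok (tabF T k j).2) ->
  bracket (fn j) (bracket (en i) (b k)) = pev al (tab_rhs T k i j).1 *: b (tab_rhs T k i j).2.
Proof.
move=> kN kF kE; have [_ fp _] := par j; have [ep _ _] := par i.
have sgE (i' j' : 'I_r) : (tsgn i' j')%:~R = (-1) ^+ (odd_root i' && odd_root j') :> F.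
  by rewrite /tsgn /odd_root; case: ifP => _; rewrite ?rmorphN1.
have allN : all (fun t : seq int * nat => (t.2 < N)%N) (tab_lhs r T k i j).
  have [_ lN _ _] := chkE j kN; have [lN' _ _ _] := chkE i lN.
  rewrite /tab_lhs all_cat; apply/andP; split; first by case: ifP => //= _; rewrite kN.
  by case: ifP => _; [case: ifP => //= _; rewrite (leq_trans (ltn_ord i) rN)|rewrite /= lN'].
have lN : ((tab_rhs T k i j).2 < N)%N.
  by have [lN _ _ _] := chkE i kN; have [_ lN' _ _] := chkE j lN.
have -> : pev al (tab_rhs T k i j).1 *: b (tab_rhs T k i j).2 = tev [:: tab_rhs T k i j].
  by rewrite /tev big_seq1.
transitivity (tev (tab_lhs r T k i j)); last first.
  rewrite !tev_coef /= ?lN // -?/(all _ _); apply: eq_bigr => m _; by rewrite chkB.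
have [_ hk _] := b_weight kN.
rewrite {1}/bracket (lsa_br_jacobi (b k) fp ep) -!/(bracket _ _) (rfe par rel) bracketZl hk scalerA.
rewrite /tev /tab_lhs big_cat /=; congr (_ + _).
  rewrite -val_eqE /=; case: eqP => _; last by rewrite big_nil mulr0 mul0r scale0r.
  by rewrite big_seq1 /= pev_scale rmorphN /= sgE mulr1 -/(aw i _).
have [rk|kr] := leqP r k.
  rewrite big_seq1 /= pev_scale pev_mul sgE (kF rk j) bracketZr scalerA andbC.
  case Ec: (tabF T k j).1 => [|a s]; first by rewrite /= mulr0 mul0r mulr0 !scale0r.
  rewrite (kE rk) ?Ec // !scalerA -Ec; congr (_ *: _); ring.
have -> : b k = en (Ordinal kr) by rewrite -b_e.
rewrite (rfe par rel) bracketZr -[bracket (en i) (hn _)]opprK -skew_even_l //.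
have [_ _ -> _] := rel (Ordinal kr) i; rewrite -val_eqE /= eq_sym; case: eqP => jk; last first.
  by rewrite big_nil mulr0 scale0r scaler0.
rewrite big_seq1 /= pev_scale rmorphM /= sgE -[k in tsgn k]/(val (Ordinal kr)) sgE -b_e -[k in tabA _ k]/(val (Ordinal kr)) -A_tab.
by rewrite [odd_root j && odd_root i]andbC /=; lincomb.
Qed.
Let ht k := (\sum_(q < r) nth 0 (W k) q)%N.

Let ht_incr k l (i : 'I_r) : W l = incr_nth (W k) i -> ht l = (ht k).+1.
Proof.
move=> E; rewrite /ht E (eq_bigr (fun q : 'I_r => (i == q) + nth 0 (W k) q)%N) => [|q _]; last first.
  by rewrite nth_incr_nth.
rewrite big_split /= (bigD1 i) //= eqxx big1 // => q qi; by rewrite eq_sym (negbTE qi).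
Qed.

Let rho_weight w x : has_weight w x -> bracket rhov x = (\sum_(q < r) nth 0 w q)%N%:R *: x.
Proof.
move=> [_ _ cx]; rewrite /rho bracket_suml natr_sum scaler_suml; apply: eq_bigr => q _; exact: cx.
Qed.

(** Induction on the height. The lowering relations follow from the definition of [b k] as a
    bracket. For a raising relation, the difference between the bracket and its tabulated value is
    killed by every [f_ j], and [null_vector] disposes of it; no Serre relations are needed. *)
Lemma root_relations k : (k < N)%N -> ((r <= k)%N -> Fok k) /\ Eok k.
Proof.
suff S d : (forall k, (k < N)%N -> (r <= k)%N -> (ht k <= d)%N -> Fok k) /\
    (forall k, (k < N)%N -> (ht k < d)%N -> Eok k).
  by move=> kN; have [S1 S2] := S (ht k).+1; split; [move=> rk; apply: S1|apply: S2].
have ht0 k' : (k' < N)%N -> (0 < ht k')%N.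
  by move=> /chkW[_ [q _ pos]]; rewrite /ht (bigD1 q) //=; apply: leq_trans pos (leq_addr _ _).
elim: d => [|d [SF SE]]; first by split=> // k' kN _; rewrite leqNgt ht0.
have J k' (i j : 'I_r) : (k' < N)%N -> (ht k' <= d)%N ->
    bracket (fn j) (bracket (en i) (b k')) = pev al (tab_rhs T k' i j).1 *: b (tab_rhs T k' i j).2.
  move=> kN kd; apply: bracket_fe => // rk; first exact: SF.
  move=> c0; have [_ lN _ /(_ c0) E] := chkE j kN; apply: SE => //.
  by have := ht_incr E; lia.
have F1 k' : (k' < N)%N -> (r <= k')%N -> (ht k' <= d.+1)%N -> Fok k'.
  move=> kN rk kd m; have [i [j jk [Dk Ej]]] := chkD rk kN; have jN := ltn_trans jk kN.
  rewrite (b_def rk kN Dk) J //; last first.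
    have [_ _ + _] := chkE i jN; rewrite Ej /= => H; have [//|_ E] := H.
    by have := ht_incr E; lia.
  by rewrite /tab_rhs Ej pev_mul /= mulr0 addr0 mul1r.
split=> // k' kN; rewrite ltnS => kd i.
have [lN _ cl _] := chkE i kN; set c := tabE T k' i in lN cl *.
apply/eqP; rewrite -subr_eq0; apply/eqP; set x := _ - _.
have wx : has_weight (incr_nth (W k') i) x.
  have we := has_weight_e i (b_weight kN); case Ec: c.1 => [|a s].
    by rewrite /x Ec /= scale0r subr0.
  have [|_ Wl] := cl; first by rewrite Ec.
  have := has_weightD (- pev al c.1) we; rewrite -Wl => H; rewrite /x -scaleNr; apply: H; exact: b_weight.
have fx j : bracket (fn j) x = 0.
  rewrite /x bracketDr bracketNr bracketZr J // /tab_rhs -/c; case Ec: c.1 => [|a s].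
    by rewrite pev_mul /= mul0r !scale0r subrr.
  have [|rl Wl] := cl; first by rewrite Ec.
  by rewrite F1 // ?(ht_incr Wl) // -Ec pev_mul scalerA subrr.
have [xp hx _] := wx.
apply: (null_vector par rel gen simple A_unit xp (k := (\sum_(q < r) nth 0 (W k') q)%N)) => //.
  by move=> j; rewrite hx memvZ ?memv_line.
rewrite (rho_weight wx); congr (_%:R *: _).
rewrite (eq_bigr (fun q : 'I_r => (i == q) + nth 0 (W k') q)%N) => [|q _]; last by rewrite nth_incr_nth.
rewrite big_split /= (bigD1 i) //= eqxx big1 // => q qi; by rewrite eq_sym (negbTE qi).
Qed.

Lemma table_split_aux : has_split g.
Proof.
have [tau [tp tbr tK th te]] := contra_tau par rel gen simple A_unit.
pose v1 := [seq b k | k <- iota 0 N]; pose v2 := [seq tau (b k) | k <- iota 0 N].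
pose v := v1 ++ v2; pose U := (<<h>> + <<v>>)%VS.
have h0 := coroot_span_even par; have hU x : x \in <<h>>%VS -> x \in U by apply: (subvP (addvSl _ _)).
have bU k : (k < N)%N -> b k \in U.
  move=> kN; apply/(subvP (addvSr _ _))/memv_span; rewrite mem_cat; apply/orP; left.
  by apply: map_f; rewrite mem_iota.
have tU k : (k < N)%N -> tau (b k) \in U.
  move=> kN; apply/(subvP (addvSr _ _))/memv_span; rewrite mem_cat; apply/orP; right.
  by apply: (map_f (fun k => tau (b k))); rewrite mem_iota.
have inU u : u \in v -> exists k, (k < N)%N /\ (u = b k \/ u = tau (b k)).
  by rewrite mem_cat => /orP[] /mapP[k]; rewrite mem_iota => /andP[_ kN] ->; exists k; split; auto.
have tauU x : x \in U -> tau x \in U.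
  move=> /memv_addP[a ah [c cv ->]]; rewrite lfD; apply: memvD; first by rewrite th // hU.
  rewrite memv_preim; apply: (subvP _ _ cv); apply/span_subvP=> u /inU[k [kN [->|->]]]; rewrite -memv_preim ?tK; auto.
have iN (i : 'I_r) : (i < N)%N := leq_trans (ltn_ord i) rN.
have fb k (j : 'I_r) : (k < N)%N -> bracket (fn j) (b k) \in U.
  move=> kN; have [rk|kr] := leqP r k.
    by have [/(_ rk) -> _] := root_relations kN; apply/memvZ/bU; have [] := chkE j kN.
  by rewrite -[k]/(val (Ordinal kr)) b_e (rfe par rel) memvZ // hU // memv_span ?mem_tnth.
have eb k (i : 'I_r) : (k < N)%N -> bracket (en i) (b k) \in U.
  by move=> kN; have [_ ->] := root_relations kN; apply/memvZ/bU; have [] := chkE i kN.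
have flip x y : x \in U -> forall p q : bool, x \in part p -> y \in part q -> bracket x y \in U -> bracket y x \in U.
  by move=> _ p q xp yq; rewrite /bracket (lsa_br_skew yq xp) memvN => xy; apply: memvZ.
have bp k : (k < N)%N -> b k \in part (odd (nth 0%N (W k) 0%N)) by case/b_weight.
have ft k (j : 'I_r) : (k < N)%N -> bracket (fn j) (tau (b k)) \in U.
  move=> kN; rewrite -te -tbr; apply: tauU; have [ep _ _] := par j.
  by rewrite /bracket (lsa_br_skew (bp k kN) ep) memvN memvZ // eb.
have et k (j : 'I_r) : (k < N)%N -> bracket (en j) (tau (b k)) \in U.
  move=> kN; rewrite -(tK (en j)) te -tbr; apply: tauU; have [_ fp _] := par j.
  by rewrite /bracket (lsa_br_skew (bp k kN) fp) memvN memvZ // fb.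
have bh k x : (k < N)%N -> x \in <<h>>%VS -> exists c, bracket x (b k) = c *: b k.
  move=> kN xh; have [_ hk _] := b_weight kN.
  have -> : x = \sum_i coord h i x *: h`_i := coord_span xh.
  exists (\sum_i coord h i x * aw i (W k)); rewrite bracket_suml scaler_suml; apply: eq_bigr => i _.
  by rewrite bracketZl -tnth_nth hk scalerA.
have tneg x y c : x \in <<h>>%VS -> bracket x y = c *: y -> bracket x (tau y) = - c *: tau y.
  move=> xh xy; have := congr1 tau (skew_even_l y (h0 _ xh)); rewrite xy lfN tbr lfZ (th _ xh) => E.
  by rewrite scaleNr E opprK.
have th' k x : (k < N)%N -> x \in <<h>>%VS -> exists c, bracket x (tau (b k)) = c *: tau (b k).
  by move=> kN xh; have [c /(tneg _ _ _ xh) E] := bh k x kN xh; exists (- c).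
have homv u : u \in v -> exists q : bool, u \in part q.
  by move=> /inU[k [kN [->|->]]]; exists (odd (nth 0%N (W k) 0%N)); [|apply: tp]; apply: bp.
have spanU (w : g) : (forall u, u \in (h : seq g) -> bracket w u \in U) -> (forall u, u \in v -> bracket w u \in U) ->
    forall u, u \in U -> bracket w u \in U.
  move=> H1 H2 u; rewrite {1}/U -span_cat => uU; rewrite [bracket w u \in U]memv_preim; apply: (subvP _ _ uU).
  apply/span_subvP=> x.
  by rewrite mem_cat -memv_preim => /orP[/H1|/H2].
have hX (x : g) : x \in <<h>>%VS -> forall u, u \in U -> bracket x u \in U.
  move=> xh; apply: spanU => u.
    by move=> uh; rewrite (h_ab rel xh (memv_span uh)) mem0v.
  by move=> /inU[k [kN [->|->]]]; [have [c ->] := bh k x kN xh|have [c ->] := th' k x kN xh]; apply: memvZ; auto.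
(* By the table and by [tau], brackets with the Chevalley generators stay inside this span, so the
   root vectors listed are all there are. *)
have fullU : (<<h>> + <<v>>)%VS = fullv.
  apply: (stable_full (X := e ++ f ++ h)).
  - move=> V VV XV; apply: gen => // x xX; apply: XV; rewrite !mem_cat xX ?orbT //.
  - move=> u /memv_addP[a ah [c cv ->]].
    have gv : graded <<v>>%VS.
      apply/graded_subP/eqP; rewrite eqEsubv subv_add !capvSl !andbT.
      apply/span_subvP=> w wv; have [q wq] := homv w wv; have wv' := memv_span wv.
      case: q wq => wq; [apply: (subvP (addvSr _ _))|apply: (subvP (addvSl _ _))]; by rewrite memv_cap wv' wq.
    have [c0 [c1 [-> k0 k1 q0 q1]]] := gv c cv; exists (a + c0), c1.
    by rewrite addrA memv_add // (subvP (addvSr _ _) _ k1) memvD // h0.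
  - move=> x u; rewrite !mem_cat => /or3P[] /tnthP[i ->]; last by apply: hX; apply/memv_span/mem_tnth.
      move: u; apply: spanU => u; last by move=> /inU[k [kN [->|->]]]; auto.
      move=> /tnthP[j ->]; rewrite -[bracket _ _]opprK -skew_even_l ?memvN; last by case: (par j).
      by have [_ _ -> _] := rel j i; rewrite -b_e memvZ ?bU.
    move: u; apply: spanU => u; last by move=> /inU[k [kN [->|->]]]; auto.
    move=> /tnthP[j ->]; rewrite -[bracket _ _]opprK -skew_even_l ?memvN; last by case: (par j).
    by have [_ _ _ ->] := rel j i; rewrite memvN -te -b_e memvZ ?tU.
  - move=> x; rewrite !mem_cat => /or3P[] /tnthP[i ->]; last by apply/hU/memv_span/mem_tnth.
      by rewrite -b_e bU.
    by rewrite -te -b_e tU.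
have rb k : (k < N)%N -> bracket rhov (b k) = (ht k)%:R *: b k by move=> kN; apply/rho_weight/b_weight.
have htp k : (k < N)%N -> (0 < ht k)%N.
  by move=> /chkW[_ [q _ pos]]; rewrite /ht (bigD1 q) //=; apply: leq_trans pos (leq_addr _ _).
have sf : split_form <<h>>%VS rhov v tau.
  split=> //; [exact/subvP|exact: h_ab rel|exact: rho_h| |].
    move=> u /inU[k [kN [->|->]]].
      by exists (ht k)%:Z; [rewrite eqz_nat -lt0n htp|rewrite rb].
    exists (- (ht k)%:Z); first by rewrite oppr_eq0 eqz_nat -lt0n htp.
    by rewrite (tneg _ _ _ (rho_h A h) (rb k kN)) rmorphN.
  by move=> u x /inU[k [kN [->|->]]] xh; auto.
exists <<h>>%VS, rhov, v, tau; split=> //.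
  have cb k q : (k < N)%N -> bracket (cw q) (b k) = (nth 0%N (W k) q)%:R *: b k by move=> kN; have [_ _] := b_weight kN.
  have ct k q : (k < N)%N -> bracket (cw q) (tau (b k)) = - (nth 0%N (W k) q)%:R *: tau (b k).
    by move=> kN; apply: tneg (coweight_h A h q) (cb k q kN).
  have ne (a c : nat) : (0 < a)%N -> (a%:R : F) != - c%:R.
    by move=> a0; rewrite -subr_eq0 opprK -natrD pnatr_eq0; lia.
  have diff k l : (k < N)%N -> (l < N)%N -> k <> l -> exists q : 'I_r, ((nth 0%N (W k) q)%:R : F) != (nth 0%N (W l) q)%:R.
    move=> kN lN kl; apply: contrapT => H; apply: kl; apply/eqP; rewrite -(nth_uniq [::] kN lN uniqW); apply/eqP.
    have [sk _] := chkW kN; have [sl _] := chkW lN.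
    apply: (eq_from_nth (x0 := 0%N)); first by rewrite [LHS]sk [RHS]sl.
    move=> q; rewrite [size _]sk => qr; apply/eqP; apply: contraT => neq; case: H; exists (Ordinal qr).
    by rewrite eqr_nat.
  move=> u w /inU[k [kN uE]] /inU[l [lN wE]].
  have [q _ pos] := (chkW kN).2; have cq := coweight_h A h.
  case: uE wE => -> [] ->.
  - have [->|/diff[//|//|q' nq]] := EM (k = l); first by left; rewrite memv_line.
    by right; exists (cw q'), (nth 0%N (W k) q')%:R, (nth 0%N (W l) q')%:R; rewrite !cb.
  - by right; exists (cw q), (nth 0%N (W k) q)%:R, (- (nth 0%N (W l) q)%:R); rewrite cb // ct //; split=> //; apply: ne.
  - right; exists (cw q), (- (nth 0%N (W k) q)%:R), (nth 0%N (W l) q)%:R; rewrite cb // ct //; split=> //.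
    by rewrite -subr_eq0 -opprD oppr_eq0 -natrD pnatr_eq0 -lt0n addn_gt0 pos.
  have [->|/diff[//|//|q' nq]] := EM (k = l); first by left; rewrite memv_line.
  by right; exists (cw q'), (- (nth 0%N (W k) q')%:R), (- (nth 0%N (W l) q')%:R); rewrite !ct //; split=> //; rewrite eqr_opp.
move=> z zc _; have rz : bracket rhov z = 0 by rewrite (skew_even_l _ (h0 _ (rho_h A h))) zc oppr0.
have zh := sf_cent sf rz; pose c : 'rV[F]_r := \row_i coord h i z.
have Ez : z = \sum_i c 0 i *: hn i.
  by rewrite {1}(coord_span zh); apply: eq_bigr => i _; rewrite mxE (tnth_nth 0).
have e0 j : en j != 0.
  apply/eqP=> E; have [_ + _ _] := rel j j; rewrite E bracket0l eqxx scale1r => /esym hj.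
  by have := free_not0 free_h (mem_tnth j h); rewrite hj eqxx.
have cA : c *m A = 0.
  apply/matrixP=> i j; rewrite ord1 !mxE; apply/eqP; have := zc (en j); rewrite {1}Ez bracket_suml.
  rewrite (eq_bigr (fun i' => (c 0 i' * A i' j) *: en j)) => [|i' _]; last first.
    by have [_ _ E _] := rel i' j; rewrite bracketZl E scalerA.
  by rewrite -scaler_suml => /eqP; rewrite scaler_eq0 (negbTE (e0 j)) orbF.
have c0 : c = 0 by rewrite -[c]mulmx1 -(mulmxV A_unit) mulmxA cA mul0mx.
by rewrite Ez big1 // => i _; rewrite c0 mxE scale0r.
Qed.
End Vectors.

Lemma table_split : has_split g.
Proof. by have [b [b1 b2]] := root_vectors; apply: table_split_aux b1 b2. Qed.
End RootTables.

Section Exceptional.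
Variables (F : numClosedFieldType) (g : lieSuperalgebra F).

Lemma contra_split r (A : 'M[F]_r.+1) (al : F) T : contragredient g A (pred1 ord0) -> A \in unitmx ->
  (forall i j, A i j = pev al (tabA T i j)) -> check_table r.+1 T -> has_split g.
Proof.
move=> [e [f [h [par rel fr gen simp]]]] Au At chk.
by apply: (table_split (e := e) (f := f) (h := h) _ rel fr gen simp Au At chk).
Qed.

Lemma D21_split al : al <> -1 -> is_D21 g al -> has_split g.
Proof.
move=> a1 H; apply: (contra_split (al := al) H _ _ check_D21); last first.
  move=> i j; rewrite mxE; case: i j => -[|[|[|]]] // ? [] [|[|[|]]] // ? /=; rewrite /pev /=; ring.
(* [2 (1 + al)] is the determinant of the Cartan matrix; its non-vanishing is the exclusion of alpha
   = -1. *)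
have d0 : 2%:R * (1 + al) != 0.
  by rewrite mulf_neq0 ?pnatr_eq0 // addrC addr_eq0; apply/eqP.
have d1 : 1 + al != 0 by move: d0; rewrite mulf_eq0 negb_or => /andP[].
have /mulmx1_unit[] // : cartan_D21 al *m ((2%:R * (1 + al))^-1 *: mx_of_seqs 3
  [:: [:: 4%:R; - 2%:R; - (2%:R * al)]; [:: 2%:R; al; - al]; [:: 2%:R; -1; 1]]) = 1%:M.
apply/matrixP=> i j; rewrite !mxE !big_ord_recl big_ord0 !mxE.
by case: i j => -[|[|[|]]] // ? [] [|[|[|]]] // ? /=; field.
Qed.

Lemma G3_split : is_G3 g -> has_split g.
Proof.
move=> H; apply: (contra_split (al := 0) H _ _ check_G3); last first.
  move=> i j; rewrite mxE; case: i j => -[|[|[|]]] // ? [] [|[|[|]]] // ? /=; rewrite /pev /=; ring.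
have /mulmx1_unit[] // : cartan_G3 F *m mx_of_seqs 3
  [:: [:: 2%:R^-1; -1; - (3%:R / 2%:R)]; [:: 1; 0; 0]; [:: 2%:R^-1; 0; 2%:R^-1]] = 1%:M.
apply/matrixP=> i j; rewrite !mxE !big_ord_recl big_ord0 !mxE.
by case: i j => -[|[|[|]]] // ? [] [|[|[|]]] // ? /=; field.
Qed.

Lemma F4_split : is_F4 g -> has_split g.
Proof.
move=> H; apply: (contra_split (al := 0) H _ _ check_F4); last first.
  move=> i j; rewrite mxE; case: i j => -[|[|[|[|]]]] // ? [] [|[|[|[|]]]] // ? /=; rewrite /pev /=; ring.
have /mulmx1_unit[] // : cartan_F4 F *m mx_of_seqs 4
  [:: [:: 2%:R / 3%:R; -1; - (4%:R / 3%:R); - (2%:R / 3%:R)]; [:: 1; 0; 0; 0];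
      [:: 2%:R / 3%:R; 0; 2%:R / 3%:R; 3%:R^-1]; [:: 3%:R^-1; 0; 3%:R^-1; 2%:R / 3%:R]] = 1%:M.
apply/matrixP=> i j; rewrite !mxE !big_ord_recl big_ord0 !mxE.
by case: i j => -[|[|[|[|]]]] // ? [] [|[|[|[|]]]] // ? /=; field.
Qed.
End Exceptional.

(** * Orthosymplectic superalgebras *)

Section OspSplit.
Variables (F : numClosedFieldType) (g : lieSuperalgebra F) (m n : nat).
Local Notation part := (lsa_part g).
Local Notation I_ := 'I_(m + (n + n)).
Local Notation M_ := 'M[F]_(m + (n + n)).
Implicit Types (M X d : M_).

(* The form is anti-diagonal in the basis used here: [opp a] is the index of the
   basis vector that is dual to the [a]-th one. *)
Definition opp (a : I_) : I_ :=
  match split a with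
  | inl i => lshift (n + n) (rev_ord i)
  | inr k => rshift m (match split k with inl j => rshift n j | inr j => lshift n j end)
  end.
Definition osgn (a : I_) : F :=
  match split a with
  | inl i => 1
  | inr k => match split k with inl j => 1 | inr j => -1 end
  end.
(** The sign by which reflection in the anti-diagonal basis acts on matrix entries of osp;
    [osp_entries] is its justification. *)
Definition eta a b : F := if ipar a then - (osgn a * osgn b) else if ipar b then osgn b else -1.

Let split_l (i : 'I_m) : split (lshift (n + n) i) = inl i. Proof. exact: (unsplitK (inl i)). Qed.
Let split_r (k : 'I_(n + n)) : split (rshift m k) = inr k. Proof. exact: (unsplitK (inr k)). Qed.
Let splitn_l (i : 'I_n) : split (lshift n i) = inl i. Proof. exact: (unsplitK (inl i)). Qed.
Let splitn_r (i : 'I_n) : split (rshift n i) = inr i. Proof. exact: (unsplitK (inr i)). Qed.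
Let splits := (split_l, split_r, splitn_l, splitn_r).

Variant index_spec : I_ -> Type :=
  | IndexO (i : 'I_m) : index_spec (lshift (n + n) i)
  | IndexP (j : 'I_n) : index_spec (rshift m (lshift n j))
  | IndexQ (j : 'I_n) : index_spec (rshift m (rshift n j)).
Lemma indexP a : index_spec a.
Proof.
rewrite -(splitK a); case: (split a) => [i|k] /=; first exact: IndexO.
by rewrite -(splitK k); case: (split k) => j /=; [exact: IndexP|exact: IndexQ].
Qed.

Lemma oppO i : opp (lshift _ i) = lshift _ (rev_ord i). Proof. by rewrite /opp splits. Qed.
Lemma oppP j : opp (rshift m (lshift n j)) = rshift m (rshift n j). Proof. by rewrite /opp !splits. Qed.
Lemma oppQ j : opp (rshift m (rshift n j)) = rshift m (lshift n j). Proof. by rewrite /opp !splits. Qed.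
Lemma sgnO i : osgn (lshift _ i) = 1. Proof. by rewrite /osgn splits. Qed.
Lemma sgnP j : osgn (rshift m (lshift n j)) = 1. Proof. by rewrite /osgn !splits. Qed.
Lemma sgnQ j : osgn (rshift m (rshift n j)) = -1. Proof. by rewrite /osgn !splits. Qed.
Let oppE := (oppO, oppP, oppQ, sgnO, sgnP, sgnQ, @ipar_l m (n + n), @ipar_r m (n + n)).

Lemma oppK : involutive opp.
Proof. by move=> a; case: (indexP a) => i; rewrite !oppE ?rev_ordK. Qed.
Lemma opp_inj : injective opp. Proof. exact: inv_inj oppK. Qed.
Lemma ipar_opp a : ipar (opp a) = ipar a.
Proof. by case: (indexP a) => i; rewrite !oppE. Qed.

(** Only the middle orthogonal index, present for odd [m], is its own opposite. *)
Lemma opp_fix a b : opp a = a -> opp b = b -> a = b.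
Proof.
have no (j j' : 'I_n) : rshift m (rshift n j) <> rshift m (lshift n j') :> I_.
  by move=> /rshift_inj/eqP; rewrite eq_rlshift.
case: (indexP a) => [i|j|j]; rewrite !oppE; [|by move/no|by move/esym/no].
case: (indexP b) => [i'|j|j]; rewrite !oppE; [|by move=> _ /no|by move=> _ /esym/no].
move=> /lshift_inj/(congr1 val)/= E /lshift_inj/(congr1 val)/= E'; congr (lshift _ _); apply: val_inj => /=.
by have := ltn_ord i; have := ltn_ord i'; lia.
Qed.

Lemma eta_opp a b : eta (opp b) (opp a) = eta a b.
Proof. by case: (indexP a) => i; case: (indexP b) => j; rewrite /eta !oppE; ring. Qed.
Lemma eta_sq a b : eta a b * eta a b = 1.
Proof. by case: (indexP a) => i; case: (indexP b) => j; rewrite /eta !oppE; ring. Qed.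
Lemma eta_diag a : eta a a = -1.
Proof. by case: (indexP a) => i; rewrite /eta !oppE; ring. Qed.

Let ii : F := 'i.
Let iiE : ii * ii = -1. Proof. by rewrite -expr2 sqrCi. Qed.
Let ii0 : ii != 0. Proof. exact: neq0Ci. Qed.

Let Ga : 'M[F]_m := \matrix_(i, j) (i == rev_ord j)%:R.
Let GaGa : Ga *m Ga = 1%:M.
Proof.
apply/matrixP=> i j; rewrite !mxE (bigD1 (rev_ord j)) //= big1 => [|k kj]; last first.
  by rewrite !mxE (negbTE kj) mulr0.
by rewrite !mxE eqxx rev_ordK mulr1 addr0.
Qed.
Let GaT : Ga^T = Ga.
Proof. by apply/matrixP=> i j; rewrite !mxE -(inj_eq rev_ord_inj) rev_ordK eq_sym. Qed.
Let Gmul p (B : 'M[F]_(m, p)) i j : (Ga *m B) i j = B (rev_ord i) j.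
Proof.
rewrite mxE (bigD1 (rev_ord i)) //= big1 => [|k ki]; rewrite !mxE.
  by rewrite rev_ordK eqxx mul1r addr0.
by case: eqP => [E|_]; [rewrite E rev_ordK eqxx in ki|rewrite mul0r].
Qed.
Let mulG p (B : 'M[F]_(p, m)) i j : (B *m Ga) i j = B i (rev_ord j).
Proof.
rewrite mxE (bigD1 (rev_ord j)) //= big1 => [|k kj]; rewrite !mxE.
  by rewrite eqxx mulr1 addr0.
by rewrite (negbTE kj) mulr0.
Qed.

Let lin2 (x y z w : F) : (x%:M + y *: Ga) *m (z%:M + w *: Ga) = (x * z + y * w)%:M + (x * w + y * z) *: Ga.
Proof.
rewrite mulmxDl !mulmxDr -!scalemxAl -!scalemxAr GaGa !mul_scalar_mx !mul_mx_scalar.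
by rewrite !scalerA scalemx1 scale_scalar_mx raddfD /= scalerDl; lincomb.
Qed.

(* A symmetric square root of [Ga]. *)
Let P1 : 'M[F]_m := (2%:R^-1 * (1 + ii))%:M + (2%:R^-1 * (1 - ii)) *: Ga.
Let P1' : 'M[F]_m := (2%:R^-1 * (1 - ii))%:M + (2%:R^-1 * (1 + ii)) *: Ga.

Let tr2 (x y : F) : (x%:M + y *: Ga)^T = x%:M + y *: Ga.
Proof. by rewrite linearD linearZ /= tr_scalar_mx GaT. Qed.
Let P1T : P1^T = P1. Proof. exact: tr2. Qed.
Let P1T' : P1'^T = P1'. Proof. exact: tr2. Qed.
Let P1P1 : P1 *m P1 = Ga.
Proof.
rewrite lin2; have -> : 2%:R^-1 * (1 + ii) * (2%:R^-1 * (1 + ii)) + 2%:R^-1 * (1 - ii) * (2%:R^-1 * (1 - ii)) = 0.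
  have -> : 2%:R^-1 * (1 + ii) * (2%:R^-1 * (1 + ii)) + 2%:R^-1 * (1 - ii) * (2%:R^-1 * (1 - ii)) =
    2%:R^-1 * (1 + ii * ii) by field.
  by rewrite iiE subrr mulr0.
have -> : 2%:R^-1 * (1 + ii) * (2%:R^-1 * (1 - ii)) + 2%:R^-1 * (1 - ii) * (2%:R^-1 * (1 + ii)) =
    2%:R^-1 * (1 - ii * ii) by field.
by rewrite iiE opprK -(natrD _ 1 1) mulVf ?pnatr_eq0 // scale1r -scalemx1 scale0r add0r.
Qed.
Let P1K : P1 *m P1' = 1%:M.
Proof.
rewrite lin2; have -> : 2%:R^-1 * (1 + ii) * (2%:R^-1 * (1 - ii)) + 2%:R^-1 * (1 - ii) * (2%:R^-1 * (1 + ii)) =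
    2%:R^-1 * (1 - ii * ii) by field.
have -> : 2%:R^-1 * (1 + ii) * (2%:R^-1 * (1 + ii)) + 2%:R^-1 * (1 - ii) * (2%:R^-1 * (1 - ii)) =
    2%:R^-1 * (1 + ii * ii) by field.
by rewrite iiE subrr mulr0 scale0r addr0 opprK -(natrD _ 1 1) mulVf ?pnatr_eq0.
Qed.
Let P1K' : P1' *m P1 = 1%:M. Proof. exact: mulmx1C P1K. Qed.

Let P : M_ := block_mx P1 0 0 1%:M.
Let P' : M_ := block_mx P1' 0 0 1%:M.
Let PK : P *m P' = 1%:M.
Proof. by rewrite mulmx_block !mulmx0 !mul0mx !addr0 !add0r P1K mulmx1 -scalar_mx_block. Qed.
Let PK' : P' *m P = 1%:M. Proof. exact: mulmx1C PK. Qed.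

Let J : 'M[F]_(n + n) := symplectic_mx F n.
Let Jmul p (B : 'M[F]_(n + n, p)) (j : 'I_n) i :
  (J *m B) (lshift n j) i = B (rshift n j) i /\ (J *m B) (rshift n j) i = - B (lshift n j) i.
Proof.
rewrite -(vsubmxK B) /J /symplectic_mx mul_block_col !mul0mx !mulNmx !mul1mx add0r addr0.
by rewrite !col_mxEu !col_mxEd !mxE.
Qed.
Let mulJ p (B : 'M[F]_(p, n + n)) i (j : 'I_n) :
  (B *m J) i (lshift n j) = - B i (rshift n j) /\ (B *m J) i (rshift n j) = B i (lshift n j).
Proof.
rewrite -(hsubmxK B) /J /symplectic_mx mul_row_block !mulmx0 !mulmxN !mulmx1 add0r addr0.
by rewrite !row_mxEl !row_mxEr !mxE.
Qed.

(** For the orthogonal form with identity matrix, diagonal matrices of the algebra are zero on the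
    orthogonal block. Conjugation by [P], whose orthogonal block squares to [Ga], makes that form
    anti-diagonal, and the diagonal matrices then provide a Cartan subalgebra. *)
Lemma osp_entries M : osp_mx (P *m M *m P') <-> forall a b, M a b = eta a b * M (opp b) (opp a).
Proof.
rewrite -{1}(submxK M); set A := ulsubmx M; set B := ursubmx M; set C := dlsubmx M; set D := drsubmx M.
rewrite !mulmx_block !mulmx0 !mul0mx !addr0 !add0r !mul1mx !mulmx1.
rewrite /osp_mx block_mxKul block_mxKdr block_mxKdl block_mxKur -/J.
have EA : (P1 *m A *m P1')^T + P1 *m A *m P1' = P1' *m (A^T *m Ga + Ga *m A) *m P1'.
  rewrite !trmx_mul P1T P1T' mulmxDr mulmxDl -P1P1 !mulmxA; congr (_ + _).
    by rewrite -[RHS]mulmxA P1K mulmx1.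
  by rewrite P1K' mul1mx.
have EC : (C *m P1')^T *m J + P1 *m B = P1' *m (C^T *m J + Ga *m B).
  by rewrite trmx_mul P1T' mulmxDr -P1P1 !mulmxA P1K' mul1mx.
have cA : ((P1 *m A *m P1')^T + P1 *m A *m P1' = 0) <-> (A^T *m Ga + Ga *m A = 0).
  rewrite EA; split=> [H|->]; last by rewrite mulmx0 mul0mx.
  have := congr1 (fun X : 'M[F]_m => P1 *m X *m P1) H; rewrite mulmx0 mul0mx !mulmxA P1K mul1mx.
  by rewrite -mulmxA P1K' mulmx1.
have cC : ((C *m P1')^T *m J + P1 *m B = 0) <-> (C^T *m J + Ga *m B = 0).
  rewrite EC; split=> [H|->]; last by rewrite mulmx0.
  by have := congr1 (fun X : 'M[F]_(m, n + n) => P1 *m X) H; rewrite mulmx0 mulmxA P1K mul1mx.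
have entA (A0 : 'M[F]_m) : (A0^T *m Ga + Ga *m A0 = 0) <-> forall i j, A0 i j = - A0 (rev_ord j) (rev_ord i).
  split=> [/matrixP H i j|H]; last first.
    by apply/matrixP=> i j; rewrite mxE mulG Gmul !mxE [A0 (rev_ord i) j]H !rev_ordK subrr.
  have := H (rev_ord i) j; rewrite mxE mulG Gmul mxE rev_ordK [RHS]mxE => /eqP.
  by rewrite addrC addr_eq0 => /eqP.
split=> [[/cA/entA HA /matrixP HD /cC/matrixP HC] a b|H].
  case: (indexP a) => i; case: (indexP b) => j; rewrite /eta !oppE.
  - by have := HA i j; rewrite !mxE => ->; rewrite mulN1r.
  - by have := HC (rev_ord i) (lshift n j); rewrite mxE Gmul (mulJ _ _ _).1 !mxE rev_ordK => /eqP; rewrite addrC subr_eq0 => /eqP->; rewrite mul1r.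
  - by have := HC (rev_ord i) (rshift n j); rewrite mxE Gmul (mulJ _ _ _).2 !mxE rev_ordK => /eqP; rewrite addrC addr_eq0 => /eqP->; rewrite mulN1r.
  - by have := HC j (rshift n i); rewrite mxE Gmul (mulJ _ _ _).2 !mxE => /eqP; rewrite addr_eq0 => /eqP->; rewrite mulr1 mulN1r.
  - by have := HD (rshift n i) (lshift n j); rewrite mxE (mulJ _ _ _).1 (Jmul _ _ _).2 !mxE => /eqP; rewrite addrC -opprD oppr_eq0 addr_eq0 => /eqP->; rewrite mulr1 mulN1r.
  - by have := HD (rshift n i) (rshift n j); rewrite mxE (mulJ _ _ _).2 (Jmul _ _ _).2 !mxE => /eqP; rewrite subr_eq0 => /eqP->; ring.
  - by have := HC j (lshift n i); rewrite mxE Gmul (mulJ _ _ _).1 !mxE => /eqP; rewrite addrC subr_eq0 => /eqP->; ring.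
  - by have := HD (lshift n i) (lshift n j); rewrite mxE (mulJ _ _ _).1 (Jmul _ _ _).1 !mxE => /eqP; rewrite addrC subr_eq0 => /eqP->; ring.
  by have := HD (lshift n i) (rshift n j); rewrite mxE (mulJ _ _ _).2 (Jmul _ _ _).1 !mxE => /eqP; rewrite addrC addr_eq0 => /eqP->; ring.
split.
- apply/cA/entA => i j; have := H (lshift _ i) (lshift _ j).
  by rewrite /eta !oppE mulN1r !mxE.
- apply/matrixP=> a b; rewrite [LHS]mxE [RHS]mxE.
  rewrite -(splitK a) -(splitK b); case: (split a) => i; case: (split b) => j /=.
  + have := H (rshift m (rshift n i)) (rshift m (lshift n j)).
    by rewrite (mulJ _ _ _).1 (Jmul _ _ _).1 /eta !oppE !mxE => ->; ring.
  + have := H (rshift m (rshift n i)) (rshift m (rshift n j)).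
    by rewrite (mulJ _ _ _).2 (Jmul _ _ _).1 /eta !oppE !mxE => ->; ring.
  + have := H (rshift m (lshift n i)) (rshift m (lshift n j)).
    by rewrite (mulJ _ _ _).1 (Jmul _ _ _).2 /eta !oppE !mxE => ->; ring.
  have := H (rshift m (lshift n i)) (rshift m (rshift n j)).
  by rewrite (mulJ _ _ _).2 (Jmul _ _ _).2 /eta !oppE !mxE => ->; ring.
apply/cC/matrixP=> i b; rewrite [LHS]mxE [RHS]mxE Gmul -(splitK b); case: (split b) => j /=.
  have := H (lshift _ (rev_ord i)) (rshift m (lshift n j)).
  by rewrite (mulJ _ _ _).1 /eta !oppE rev_ordK !mxE => ->; ring.
have := H (lshift _ (rev_ord i)) (rshift m (rshift n j)).
by rewrite (mulJ _ _ _).2 /eta !oppE rev_ordK !mxE => ->; ring.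
Qed.

Let conj_part (p : bool) M : mx_part p M -> mx_part p (P *m M *m P').
Proof.
rewrite -(submxK M) !mulmx_block !mulmx0 !mul0mx !addr0 !add0r !mul1mx !mulmx1 /mx_part.
rewrite !block_mxKul !block_mxKdr !block_mxKdl !block_mxKur.
by case: p => -[-> ->]; rewrite !(mulmx0, mul0mx).
Qed.

(** The matrix unit symmetrised into osp. For [b = opp a] the two terms cancel on orthogonal indices
    and add up on symplectic ones. *)
Let rt a b : M_ := delta_mx a b + eta a b *: delta_mx (opp b) (opp a).
Let pairs := [seq p <- enum {: I_ * I_} | p.1 != p.2].

(** Distinct integers, odd under [opp]: the orthogonal values have absolute value below [m], the
    symplectic ones above it. *)
Let tval (a : I_) : int :=
  match split a with
  | inl i => m%:Z - 1 - 2 * (val i)%:Z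
  | inr k => match split k with inl j => m%:Z + (val j)%:Z + 1 | inr j => - (m%:Z + (val j)%:Z + 1) end
  end.

Let tval_opp a : tval (opp a) = - tval a.
Proof.
case: (indexP a) => i; rewrite /tval !oppE !splits ?opprK //=.
by have := ltn_ord i; lia.
Qed.

Let tval_inj : injective tval.
Proof.
move=> a b; case: (indexP a) => i; case: (indexP b) => j; rewrite /tval !splits /= => E;
  have := ltn_ord i; have := ltn_ord j => lj li; first [congr (lshift _ _)|congr (rshift _ (lshift _ _))|congr (rshift _ (rshift _ _))|exfalso];
  try apply: val_inj => /=; clear -E li lj; lia.
Qed.

Let diag_of (e : I_ -> F) : M_ := diag_mx (\row_i e i).
Let diag_ofE e i : diag_of e i i = e i. Proof. by rewrite !mxE eqxx mulr1n. Qed.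

(** A root is a sum of two weights, where opposite indices carry opposite weights. The hypothesis
    compares multiplicities of weights and the conclusion recovers the unordered pair; the
    self-opposite index, of weight zero, needs its own case. *)
Let opp_pairs x1 x2 y1 y2 : x2 != opp x1 -> y2 != opp y1 ->
  (forall q, (x1 == q) + (x2 == q) + ((opp y1 == q) + (opp y2 == q)) =
    (y1 == q) + (y2 == q) + ((opp x1 == q) + (opp x2 == q)))%N -> 
  (x1 = y1 /\ x2 = y2) \/ (x1 = y2 /\ x2 = y1).
Proof.
have can1 (a b c d e f : nat) : (a + b + (c + d) = a + e + (c + f) -> b + d = e + f)%N by lia.
have can2 (a b c d e f : nat) : (a + b + (c + d) = e + a + (d + f) -> b + c = e + f)%N by lia.
have main u1 u2 w1 w2 : u2 != opp u1 -> w2 != opp w1 -> opp u1 != u1 ->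
    (forall q, (u1 == q) + (u2 == q) + ((opp w1 == q) + (opp w2 == q)) =
      (w1 == q) + (w2 == q) + ((opp u1 == q) + (opp u2 == q)))%N ->
    (u1 = w1 /\ u2 = w2) \/ (u1 = w2 /\ u2 = w1).
  move=> hu hw fu E.
  have red w : (forall q, (u2 == q) + (opp w == q) = (w == q) + (opp u2 == q))%N -> u2 = w.
    move=> H; have := H u2; rewrite eqxx; have [//|wu] := eqVneq w u2.
    case: (eqVneq (opp u2) u2) => [fu2 E2|]; last by case: eqP.
    have := H w; rewrite eqxx fu2 [u2 == w]eq_sym (negbTE wu); case: eqP => // fw _.
    exact: opp_fix.
  have := E u1; rewrite eqxx (negbTE fu).
  have -> : (opp u2 == u1) = false by apply/negbTE; apply: contra hu => /eqP<-; rewrite oppK.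
  have [e _|n1] := eqVneq w1 u1.
    by left; subst w1; split=> //; apply: red => q; apply: can1 (E q).
  have [e _|n2] := eqVneq w2 u1; last by case: (_ == u1); case: (_ == u1); case: (_ == u1).
  by right; subst w2; split=> //; apply: red => q; apply: can2 (E q).
move=> hx hy E; have [fx|fx] := eqVneq (opp x1) x1; last exact: main.
have fx2 : opp x2 != x2 by apply: contra hx => /eqP fx2; rewrite fx; apply/eqP/opp_fix.
have hx' : x1 != opp x2 by apply: contra hx => /eqP->; rewrite oppK.
have E' q : ((x2 == q) + (x1 == q) + ((opp y1 == q) + (opp y2 == q)) =
    (y1 == q) + (y2 == q) + ((opp x2 == q) + (opp x1 == q)))%N by rewrite [(_ + (x1 == q))%N]addnC [((opp x2 == q) + _)%N]addnC.
by have [[-> ->]|[-> ->]] := main x2 x1 y1 y2 hx' hy fx2 E'; [right|left].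
Qed.

(** Plain transposition does not preserve the algebra, since [eta a b] and [eta b a] differ by a
    sign in the odd blocks. Rescaling odd indices by a square root of -1 repairs this, and the map
    remains involutive. *)
Let theta (a : I_) : F := if ipar a then ii else 1.
Let T M : M_ := \matrix_(i, j) (theta i / theta j * M j i).
Let theta0 a : theta a != 0.
Proof. by rewrite /theta; case: ifP; rewrite ?oner_eq0. Qed.
Let theta_opp a : theta (opp a) = theta a. Proof. by rewrite /theta ipar_opp. Qed.
Let eta_theta a b : theta a / theta b * eta b a = eta a b * (theta b / theta a).
Proof.
have iV : ii^-1 = - ii by apply: (mulfI ii0); rewrite mulfV // mulrN iiE opprK.
by case: (indexP a) => i; case: (indexP b) => j; rewrite /eta /theta !oppE ?iV ?invr1; ring.
Qed.

Lemma osp_split : is_osp g m n -> has_split g.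
Proof.
case=> phi emb onto; have [plin _ _ _] := emb.
have phi0 : phi 0 = 0 by have := plin (-1) 0 0; rewrite scaler0 addr0 scaleN1r addNr.
have [mm0 Hmm0] : exists mm0 : {vspace M_}, forall M, M \in mm0 <-> exists x, phi x = M.
  apply: vspace_of_pred; first by exists 0.
  by move=> c u w [x <-] [y <-]; exists (c *: x + y); apply: plin.
have [mm Hmm] : exists mm : {vspace M_}, forall M, M \in mm <-> forall a b, M a b = eta a b * M (opp b) (opp a).
  apply: vspace_of_pred => [a b|c A B hA hB a b]; rewrite !mxE ?mulr0 // hA hB; ring.
have img M : (exists x, phi x = M) <-> M \in mm0 by split=> /Hmm0.
have [psi0 [[lin psiK phiK] [ppar pbr ponto pker pmm]]] := embedding_model emb img.
have conj_mm M : M \in mm <-> P *m M *m P' \in mm0.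
  by split=> [/Hmm/osp_entries/onto/Hmm0|/Hmm0/onto/osp_entries/Hmm].
have conj_mul M N : P *m (M *m N) *m P' = (P *m M *m P') *m (P *m N *m P').
  by rewrite !mulmxA -(mulmxA (P *m M) P' P) PK' mulmx1.
have conj_super (p q : bool) M N : P *m supercomm p q M N *m P' = supercomm p q (P *m M *m P') (P *m N *m P').
  by rewrite /supercomm mulmxBr mulmxBl conj_mul -scalemxAr -scalemxAl conj_mul.
pose psi M := psi0 (P *m M *m P').
have psi_lin : linear psi by move=> c A B; rewrite /psi mulmxDr mulmxDl -scalemxAr -scalemxAl lin.
have psi_par (p : bool) M : M \in mm -> mx_part p M -> psi M \in part p.
  by move=> /conj_mm Mm /conj_part; apply: ppar.
have psi_br (p q : bool) M N : M \in mm -> N \in mm -> mx_part p M -> mx_part q N ->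
    psi (supercomm p q M N) = bracket (psi M) (psi N).
  by move=> /conj_mm Mm /conj_mm Nm /conj_part hM /conj_part hN; rewrite /psi conj_super pbr.
have psi_onto x : exists2 M, M \in mm & psi M = x.
  have [X Xm <-] := ponto x.
  have E : P *m (P' *m X *m P) *m P' = X by rewrite !mulmxA PK mul1mx -mulmxA PK mulmx1.
  by exists (P' *m X *m P); [apply/conj_mm; rewrite E|rewrite /psi E].
have psi_ker M : M \in mm -> psi M = 0 -> M = 0.
  move=> /conj_mm Mm /(pker _ Mm) E.
  have := congr1 (fun X : M_ => P' *m X *m P) E.
  by rewrite mulmx0 mul0mx !mulmxA PK' mul1mx -mulmxA PK' mulmx1.
have mm_br (p q : bool) M N : M \in mm -> N \in mm -> mx_part p M -> mx_part q N -> supercomm p q M N \in mm.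
  by move=> /conj_mm Mm /conj_mm Nm /conj_part hM /conj_part hN; apply/conj_mm; rewrite conj_super pmm.
have mm_gr M : M \in mm -> exists M0 M1,
    [/\ M = M0 + M1, M0 \in mm, M1 \in mm, mx_part false M0 & mx_part true M1].
  have [M0 [M1 [E h0 h1 H]]] := mx_parity_split M => Mm.
  have M0m : M0 \in mm.
    apply/Hmm=> a b; rewrite !H !ipar_opp addbC; case: ifP; rewrite ?mulr0 // => _.
    exact: (Hmm M).1 Mm a b.
  by exists M0, M1; split=> //; rewrite -[M1](addKr M0) -E addrC memvB.
have T_lin : linear T by move=> c A B; apply/matrixP=> i j; rewrite !mxE; ring.
have T_mm M : M \in mm -> T M \in mm.
  move=> /Hmm H; apply/Hmm=> a b; rewrite !mxE !theta_opp H; move: (M _ _) => z.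
  by rewrite [LHS]mulrA eta_theta -[LHS]mulrA.
have T_ker M : M \in mm -> psi M = 0 -> psi (T M) = 0.
  by move=> Mm /(psi_ker _ Mm) ->; have := T_lin (-1) 0 0; rewrite scaler0 addr0 scaleN1r addNr => ->;
     have := psi_lin (-1) 0 0; rewrite scaler0 addr0 scaleN1r addNr.
have TK M : T (T M) = M.
  by apply/matrixP=> i j; rewrite !mxE mulrA mulrA divfK // divff // mul1r.
have T_par (p : bool) M : mx_part p M -> mx_part p (T M).
  by move=> /mx_partP H; apply/mx_partP=> i j ij; rewrite mxE H ?mulr0 // addbC.
have T_mul M N : T (M *m N) = T N *m T M.
  apply/matrixP=> i j; rewrite !mxE mulr_sumr; apply: eq_bigr => k _; rewrite !mxE.
  by field; rewrite !theta0.
have T_diag d : is_diag_mx d -> T d = d.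
  move=> /is_diag_mxP H; apply/matrixP=> i j; rewrite mxE.
  by have [->|ij] := eqVneq i j; [rewrite divff // mul1r|rewrite !H ?mulr0 // eq_sym].
have diag_mm e : (forall a, e (opp a) = - e a) -> diag_of e \in mm.
  move=> H; apply/Hmm=> a b; have [->|ab] := eqVneq a b; first by rewrite !diag_ofE eta_diag H mulN1r opprK.
  by rewrite !mxE (negbTE ab) (inj_eq opp_inj) [b == a]eq_sym (negbTE ab) !mulr0n mulr0.
have dopp d a : d \in mm -> d (opp a) (opp a) = - d a a.
  by move/Hmm/(_ a a); rewrite eta_diag mulN1r => ->; rewrite opprK.
have rtE a b i j : rt a b i j = ((i == a) && (j == b))%:R + eta a b * ((i == opp b) && (j == opp a))%:R.
  by rewrite !mxE.
have rt_mm a b : rt a b \in mm.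
  apply/Hmm=> i j; rewrite !rtE !(inj_eq opp_inj) mulrDr.
  have oe x y : (opp x == y) = (x == opp y) by rewrite -(inj_eq opp_inj) oppK.
  rewrite !oe addrC; congr (_ + _).
    have [->|_] := eqVneq i (opp b); have [->|_] := eqVneq j (opp a); rewrite ?andbF ?mulr0 //=.
    by rewrite eta_opp.
  have [->|_] := eqVneq i a; have [->|_] := eqVneq j b; rewrite ?andbF ?mulr0 //=.
  by rewrite mulr1 eta_sq.
have rt_hom a b : exists p, mx_part p (rt a b).
  exists (ipar a (+) ipar b); apply/mx_partP=> i j ij; rewrite rtE.
  have -> : (i == a) && (j == b) = false by apply: contraNF ij => /andP[/eqP-> /eqP->].
  have -> : (i == opp b) && (j == opp a) = false.
    by apply: contraNF ij => /andP[/eqP-> /eqP->]; rewrite !ipar_opp addbC.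
  by rewrite mulr0 addr0.
have rt_wt d a b : d \in mm -> is_diag_mx d -> d *m rt a b - rt a b *m d = (d a a - d b b) *: rt a b.
  move=> dm /diag_mxP[e Ee]; have oa := dopp d a dm; have ob := dopp d b dm; move: oa ob.
  have dE i : d i i = e 0 i by rewrite Ee mxE eqxx mulr1n.
  rewrite !dE Ee mul_diag_mx mul_mx_diag => oa ob.
  apply/matrixP=> i j; rewrite !mxE.
  have li x y : e 0 i * ((i == x) && (j == y))%:R = e 0 x * ((i == x) && (j == y))%:R.
    by have [->|_] := eqVneq i x; rewrite /= ?mulr0.
  have lj x y : ((i == x) && (j == y))%:R * e 0 j = e 0 y * ((i == x) && (j == y))%:R.
    by have [->|_] := eqVneq j y; rewrite ?andbF ?mulr0 ?mul0r // mulrC.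
  rewrite mulrDr mulrDl mulrCA -[eta a b * _ * _]mulrA !li !lj oa ob; ring.
pose t0 := diag_of (fun a => (tval a)%:~R).
have t0_mm : t0 \in mm by apply: diag_mm => a; rewrite tval_opp rmorphN.
have t0_diag : is_diag_mx t0 by exact: diag_mx_is_diag.
have t0_pairs p : p \in pairs -> exists2 k : int, k != 0 & t0 p.1 p.1 - t0 p.2 p.2 = k%:~R.
  rewrite mem_filter => /andP[ab _]; exists (tval p.1 - tval p.2); last by rewrite !diag_ofE rmorphB.
  by rewrite subr_eq0 (inj_eq tval_inj).
have mm_span M : M \in mm -> exists d, [/\ d \in mm, is_diag_mx d
    & M - d \in <<[seq rt p.1 p.2 | p <- pairs]>>%VS].
  move=> Mm; have MH := (Hmm M).1 Mm; exists (diag_of (fun a => M a a)); split.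
  - by apply: diag_mm => a; apply: dopp.
  - exact: diag_mx_is_diag.
  (* Summation over ordered pairs meets each root vector twice, as [rt i j] and, up to sign, as
     [rt (opp j) (opp i)]; hence the factor 1/2. *)
  have -> : M - diag_of (fun a => M a a) = 2%:R^-1 *: \sum_i \sum_j (if i == j then 0 else M i j) *: rt i j.
    have sumE (f : I_ -> I_ -> F) : \sum_i \sum_j f i j *: delta_mx i j = \matrix_(i, j) f i j :> M_.
      by rewrite [RHS]matrix_sum_delta; apply: eq_bigr => i _; apply: eq_bigr => j _; rewrite mxE.
    have -> : \sum_i \sum_j (if i == j then 0 else M i j) *: rt i j =
        (M - diag_of (fun a => M a a)) + (M - diag_of (fun a => M a a)).
      have dM : M - diag_of (fun a => M a a) = \matrix_(i, j) (if i == j then 0 else M i j).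
        by apply/matrixP=> i j; rewrite !mxE; case: eqVneq => [->|]; rewrite ?mulr1n ?mulr0n ?subrr ?subr0.
      rewrite dM -sumE.
      have E : \sum_i \sum_j (if i == j then 0 else M i j) *: delta_mx i j =
          \sum_i \sum_j ((if i == j then 0 else M i j) * eta i j) *: delta_mx (opp j) (opp i) :> M_.
        rewrite (reindex_inj opp_inj) exchange_big (reindex_inj opp_inj) /=.
        apply: eq_bigr => i _; apply: eq_bigr => j _; rewrite (inj_eq opp_inj) eq_sym.
        case: ifP => _; first by rewrite mul0r !scale0r.
        by rewrite [M i j]MH mulrAC eta_sq mul1r.
      rewrite [X in _ + X]E -big_split; apply: eq_bigr => i _; rewrite -big_split; apply: eq_bigr => j _.
      by rewrite /rt scalerDr scalerA.
    by rewrite -[X in _ *: X]mulr2n -scaler_nat scalerA mulVf ?pnatr_eq0 // scale1r.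
  apply: memvZ; apply: memv_suml => i _; apply: memv_suml => j _.
  have [->|ij] := eqVneq i j; first by rewrite scale0r mem0v.
  by apply/memvZ/memv_span/mapP; exists (i, j); rewrite // mem_filter ij mem_enum.
have sep p q : p \in pairs -> q \in pairs -> rt q.1 q.2 \in <[rt p.1 p.2]>%VS \/
    exists d, [/\ d \in mm, is_diag_mx d & d p.1 p.1 - d p.2 p.2 != d q.1 q.1 - d q.2 q.2].
  case: p => a b; case: q => c e; rewrite !mem_filter /= => /andP[ab _] /andP[ce _].
  have [|/forallNP none] := EM (exists d, [/\ d \in mm, is_diag_mx d & d a a - d b b != d c c - d e e]); first by right.
  left; pose pr q := diag_of (fun i => (i == q)%:R - (opp i == q)%:R).
  have pr_mm q : pr q \in mm by apply: diag_mm => i; rewrite oppK opprB.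
  have pr_eq q : pr q a a - pr q b b = pr q c c - pr q e e.
    by apply/eqP; apply: contraT => ne; case: (none (pr q)); split=> //; apply: diag_mx_is_diag.
  have [||q|[Ea Eb]|[Ea Eb]] := @opp_pairs a (opp b) c (opp e).
  - by rewrite (inj_eq opp_inj) eq_sym.
  - by rewrite (inj_eq opp_inj) eq_sym.
  - apply/eqP; rewrite -(eqr_nat F) !natrD -subr_eq0; have := pr_eq q; rewrite !diag_ofE !oppK => /eqP.
    by rewrite -subr_eq0 => /eqP E; rewrite -E; apply/eqP; ring.
  - by rewrite Ea (opp_inj Eb) memv_line.
  have -> : rt c e = eta c e *: rt a b; last by rewrite memvZ ?memv_line.
  have Eb' : b = opp c by rewrite -Eb oppK.
  by rewrite /rt Ea Eb' !oppK scalerDr scalerA eta_opp eta_sq scale1r addrC.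
have [tau sf] := model_split psi_lin psi_par psi_br psi_onto mm_gr mm_br T_lin T_mm T_ker
  TK T_par T_mul T_diag rt_mm rt_hom rt_wt mm_span t0_mm t0_diag t0_pairs.
do 3!eexists; exists tau; split; first exact: sf.
  exact: (model_separated psi_lin psi_br rt_mm rt_hom rt_wt sep).
move=> z zc zd.
have [d [dm dd Ez Hd]] := model_central psi_lin psi_par psi_br psi_onto mm_gr mm_br T_lin T_mm T_ker
  TK T_par T_mul T_diag rt_mm rt_hom rt_wt mm_span t0_mm t0_diag t0_pairs zc.
have psi00 : psi 0 = 0 by have := psi_lin (-1) 0 0; rewrite scaler0 addr0 scaleN1r addNr.
have rt_eq a b : a != b -> rt a b != 0 -> d a a = d b b.
  move=> ab r0; apply: (Hd (a, b)); first by rewrite mem_filter ab mem_enum.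
  by apply: contra r0 => /eqP/(psi_ker _ (rt_mm _ _))->.
(* A central diagonal matrix that is not zero forces all root vectors to vanish, as in so(2). The
   algebra is then abelian and its derived algebra zero. *)
have [d0|[a da]] : d = 0 \/ exists a, d a a != 0.
  have [|/forallNP none] := EM (exists a, d a a != 0); [by right|left].
  apply/matrixP=> i j; rewrite mxE; have [->|ij] := eqVneq i j; last by move/is_diag_mxP: dd => ->.
  by apply/eqP; apply: contraT => /none.
  by rewrite Ez d0 psi00.
have dN : d a a != - d a a.
  by rewrite -subr_eq0 opprK -mulr2n mulrn_eq0.
have ao : a != opp a by apply: contraNneq dN => ao; rewrite -dopp // -ao.
have rt0 b c : b != c -> rt b c = 0.
  move=> bc; apply/eqP; apply: contraT => r0.
  have two x : x = a \/ x = opp a.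
    have [|xa] := eqVneq x a; [by left|]; have [|xo] := eqVneq x (opp a); [by right|].
    case/negP: dN; rewrite -dopp //; apply/eqP; transitivity (d x x).
      apply: rt_eq; first by rewrite eq_sym.
      apply/eqP=> /matrixP/(_ a x); rewrite rtE !eqxx mxE.
      have -> : (a == opp x) = false by apply/negbTE; apply: contra xo => /eqP->; rewrite oppK.
      by rewrite mulr0 addr0 => /eqP; rewrite pnatr_eq0.
    apply: rt_eq => //; apply/eqP=> /matrixP/(_ x (opp a)); rewrite rtE !eqxx mxE oppK.
    by rewrite (negbTE xa) mulr0 addr0 => /eqP; rewrite pnatr_eq0.
  case/negP: dN; have := rt_eq _ _ bc r0; rewrite -dopp //.
  by have [eb|eb] := two b; have [ec|ec] := two c; rewrite eb ec // => E; [rewrite eb ec eqxx in bc|rewrite E|rewrite E|rewrite eb ec eqxx in bc].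
have all_diag M : M \in mm -> is_diag_mx M.
  move=> /mm_span[d' [_ dd' H]]; have : M - d' \in 0%VS.
    apply: subvP H; apply/span_subvP=> u /mapP[p]; rewrite mem_filter => /andP[pp _] ->.
    by rewrite rt0 // mem0v.
  by rewrite memv0 subr_eq0 => /eqP->.
have : z \in (0%VS : {vspace g}); last by rewrite memv0 => /eqP.
apply: (subvP (@actsp_sub _ _ (adjoint g) (part false) (part false) 0%VS _)); last exact: zd.
move=> x y x0 y0; rewrite [as_act _ _ _]/(bracket x y).
have [X Xm <-] := psi_onto x; have [Y Ym <-] := psi_onto y.
have [dX dY] := (all_diag _ Xm, all_diag _ Ym).
rewrite -[lsa_br _ _]/(bracket (psi X) (psi Y)) -(psi_br _ _ _ _ Xm Ym (diag_even dX) (diag_even dY)).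
by rewrite /supercomm scale1r (diag_comm dX dY) subrr psi00 mem0v.
Qed.
End OspSplit.

(** Lagrange interpolation at the eigenvalue [k] is a polynomial in [f], so it respects [U] and [K].
    Applied to both summands of [y] it turns them into eigenvectors while reproducing [y]. *)
Lemma eigen_split (F : fieldType) (W : vectType F) (f : 'End(W)) (X : seq W) (U K : {vspace W}) y k :
  eigenspanned f X -> (forall w, w \in U -> f w \in U) -> (forall w, w \in K -> f w \in K) ->
  y \in (U + K)%VS -> f y = k *: y -> exists a, [/\ a \in U, f a = k *: a & y - a \in K].
Proof.
move=> dX fU fK yUK fy; have [spanX eigX] := dX; have [cs ucs cs0] := diag_eigprod dX.
pose cs' := [seq b <- cs | b != k]; pose r := \prod_(b <- cs') (k - b).
have r0 : r != 0.
  apply/negP; rewrite prodf_seq_eq0 => /hasP[b]; rewrite mem_filter => /andP[bk _] /=.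
  by rewrite subr_eq0 eq_sym (negbTE bk).
have eigP u : f (eigprod f cs' u) = k *: eigprod f cs' u.
  apply/eqP; rewrite -subr_eq0; apply/eqP.
  pose P : 'End(W) := linfun (eigprod f cs').
  have /subvP/(_ u (memvf u)) : (fullv <= lker (f \o P - k *: P)%VF)%VS.
    rewrite -spanX; apply/span_subvP=> v vX; have [c fv] := eigX v vX.
    rewrite memv_ker add_lfunE opp_lfunE scale_lfunE comp_lfunE lfunE /= (eigprod_eig _ fv) lfZ fv !scalerA.
    have [->|v0] := eqVneq v 0; first by rewrite !scaler0 subrr.
    have [->|ck] := eqVneq c k; first by rewrite mulrC subrr.
    have := cs0 v; rewrite (eigprod_eig _ fv) => /eqP; rewrite scaler_eq0 (negbTE v0) orbF.
    rewrite prodf_seq_eq0 => /hasP[b bcs /=]; rewrite subr_eq0 => /eqP cb; subst b.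
    have ccs : c \in cs' by rewrite mem_filter ck.
    by rewrite (big_rem c) //= subrr !(mul0r, mulr0, scale0r) subrr.
  by rewrite memv_ker add_lfunE opp_lfunE scale_lfunE comp_lfunE lfunE /= => /eqP.
have [a aU [b bK Ey]] := memv_addP yUK.
exists (r^-1 *: eigprod f cs' a); split.
- by apply/memvZ/eigprod_stable.
- by rewrite lfZ eigP !scalerA mulrC.
have -> : y - r^-1 *: eigprod f cs' a = r^-1 *: eigprod f cs' b.
  have Ey' : y = r^-1 *: eigprod f cs' y by rewrite (eigprod_eig _ fy) scalerA mulVf // scale1r.
  by rewrite {1}Ey' Ey [eigprod f cs' (a + b)]linearD scalerDr addrC addKr.
by apply/memvZ/eigprod_stable.
Qed.

Ltac case4 := move=> [|[|[|[|//]]]] [|[|[|[|//]]]] _ _.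

(** * The exceptional case psl(2|2) *)

Section FourByFour.
Variable F : numClosedFieldType.
Local Notation M4 := 'M[F]_(2 + 2).
Implicit Types M N : M4.

Definition ent M (a b : nat) : F := M (inord a : 'I_4) (inord b : 'I_4).
Definition mx4 (f : nat -> nat -> F) : M4 := \matrix_(a, b) f a b.

Lemma mx4P M N : (forall a b, (a < 4)%N -> (b < 4)%N -> ent M a b = ent N a b) -> M = N.
Proof.
move=> H; apply/matrixP=> i j; have := H i j (ltn_ord i) (ltn_ord j).
have E (k : 'I_(2 + 2)) : inord k = k :> 'I_4 by apply: val_inj; rewrite /= inordK.
by rewrite /ent !E.
Qed.
Lemma ent_mx4 f a b : (a < 4)%N -> (b < 4)%N -> ent (mx4 f) a b = f a b.
Proof. by move=> a4 b4; rewrite /ent mxE !inordK. Qed.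
Lemma entD M N a b : ent (M + N) a b = ent M a b + ent N a b. Proof. by rewrite /ent mxE. Qed.
Lemma entN M a b : ent (- M) a b = - ent M a b. Proof. by rewrite /ent mxE. Qed.
Lemma entZ c M a b : ent (c *: M) a b = c * ent M a b. Proof. by rewrite /ent mxE. Qed.
Lemma entT M a b : ent M^T a b = ent M b a. Proof. by rewrite /ent mxE. Qed.
Lemma entC c a b : (a < 4)%N -> (b < 4)%N -> ent c%:M a b = (if eqn a b then c else 0).
Proof. by move=> a4 b4; rewrite /ent mxE -val_eqE /= !inordK // eqnE; case: eqP. Qed.
Lemma entM M N a b : ent (M *m N) a b =
  ent M a 0 * ent N 0 b + ent M a 1 * ent N 1 b + ent M a 2 * ent N 2 b + ent M a 3 * ent N 3 b.
Proof.
rewrite /ent mxE; transitivity (\sum_(k < 4) ent M a k * ent N k b).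
  by apply: eq_bigr => k _; rewrite /ent; congr (M _ _ * N _ _); apply: val_inj; rewrite /= inordK.
by rewrite !big_ord_recr big_ord0 /= add0r.
Qed.
Lemma entS p q M N a b : ent (supercomm p q M N) a b = ent (M *m N) a b - (-1) ^+ (p && q) * ent (N *m M) a b.
Proof. by rewrite /supercomm entD entN entZ. Qed.
Lemma supertrace4 M : supertrace M = ent M 0 0 + ent M 1 1 - ent M 2 2 - ent M 3 3.
Proof.
rewrite supertraceE; transitivity (\sum_(k < 4) (-1) ^+ (2 <= k)%N * ent M k k).
  by apply: eq_bigr => k _; rewrite /ent; congr (_ * M _ _); apply: val_inj; rewrite /= inordK.
by rewrite !big_ord_recr big_ord0 /= add0r; ring.
Qed.
Lemma mx_part4 (p : bool) M : mx_part p M <->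
  forall a b, (a < 4)%N -> (b < 4)%N -> (1 < a)%N (+) (1 < b)%N != p -> ent M a b = 0.
Proof.
split=> [/mx_partP H a b a4 b4 ab|H]; first by apply: H; rewrite /ipar !inordK.
apply/mx_partP=> i j ij; have := H i j (ltn_ord i) (ltn_ord j) ij.
have E (k : 'I_(2 + 2)) : inord k = k :> 'I_4 by apply: val_inj; rewrite /= inordK.
by rewrite /ent !E.
Qed.

Section Twist.
Variables a b c d : F.
(* SL_2 acts on psl(2|2) by mixing the upper odd block with the adjugate of the lower one. *)
Definition twistf (f : nat -> nat -> F) (i j : nat) : F :=
  match i, j with
  | 0%N, 2%N => a * f 0%N 2%N + b * f 3%N 1%N | 0%N, 3%N => a * f 0%N 3%N - b * f 2%N 1%N
  | 1%N, 2%N => a * f 1%N 2%N - b * f 3%N 0%N | 1%N, 3%N => a * f 1%N 3%N + b * f 2%N 0%N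
  | 2%N, 0%N => c * f 1%N 3%N + d * f 2%N 0%N | 2%N, 1%N => - (c * f 0%N 3%N) + d * f 2%N 1%N
  | 3%N, 0%N => - (c * f 1%N 2%N) + d * f 3%N 0%N | 3%N, 1%N => c * f 0%N 2%N + d * f 3%N 1%N
  | _, _ => f i j
  end.
Definition twist M : M4 := mx4 (twistf (ent M)).
Lemma ent_twist M i j : (i < 4)%N -> (j < 4)%N -> ent (twist M) i j = twistf (ent M) i j.
Proof. exact: ent_mx4. Qed.
Lemma twist_linear : linear twist.
Proof. by move=> x M N; apply: mx4P; case4; rewrite entD entZ !ent_twist //= !entD !entZ; ring. Qed.
Lemma twistN M : twist (- M) = - twist M.
Proof. by apply: mx4P; case4; rewrite ent_twist // entN ent_twist //= !entN; ring. Qed.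
Lemma twist_part (p : bool) M : mx_part p M -> mx_part p (twist M).
Proof.
move=> /mx_part4 H; apply/mx_part4; case4; rewrite ent_twist //= => hp; rewrite ?H //; ring.
Qed.
Lemma twist_str M : supertrace (twist M) = supertrace M.
Proof. by rewrite !supertrace4 !ent_twist. Qed.
Lemma twist_scalar x : twist x%:M = x%:M.
Proof. by apply: mx4P; case4; rewrite ent_twist //= !entC //=; ring. Qed.
Lemma twist_even M : mx_part false M -> twist M = M.
Proof. by move=> /mx_part4 H; apply: mx4P; case4; rewrite ent_twist //= !H //; ring. Qed.

(** Even with determinant one the bracket is preserved only up to a scalar matrix: the outer SL_2
    acts on psl(2|2) and not on sl(2|2). *)
Lemma twist_bracket_odd M N : mx_part true M -> mx_part true N -> exists s,
  supercomm true true (twist M) (twist N) = (a * d - b * c) *: supercomm true true M N + s%:M.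
Proof.
move=> /mx_part4 hM /mx_part4 hN; set L := supercomm _ _ _ _; set R := _ *: _.
exists (ent L 0 0 - ent R 0 0); apply: mx4P; case4; rewrite [RHS]entD entC //= /R /L !entZ !entS !entM !ent_twist //=;
  rewrite ?(hM 0 0, hM 0 1, hM 1 0, hM 1 1, hM 2 2, hM 2 3, hM 3 2, hM 3 3)%N //;
  rewrite ?(hN 0 0, hN 0 1, hN 1 0, hN 1 1, hN 2 2, hN 2 3, hN 3 2, hN 3 3)%N //; ring.
Qed.

(** Supertrace zero makes the upper odd block and the adjugate of the lower one transform alike
    under the even part, so that mixing them commutes with it. *)
Lemma twist_bracket_even M N : supertrace M = 0 -> mx_part false M -> mx_part true N ->
  twist M *m twist N - twist N *m twist M = twist (M *m N - N *m M).
Proof.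
rewrite supertrace4 => str /mx_part4 hM /mx_part4 hN.
have {}str : ent M 0 0 = ent M 2 2 + ent M 3 3 - ent M 1 1 by apply/eqP; rewrite -subr_eq0 -str; apply/eqP; ring.
apply: mx4P; case4; rewrite ent_twist //= !entD !entN !entM !ent_twist //=;
  rewrite ?(hM 0 2, hM 0 3, hM 1 2, hM 1 3, hM 2 0, hM 2 1, hM 3 0, hM 3 1)%N //;
  rewrite ?(hN 0 0, hN 0 1, hN 1 0, hN 1 1, hN 2 2, hN 2 3, hN 3 2, hN 3 3)%N // ?str; ring.
Qed.
End Twist.

Lemma twistK (a b c d : F) M : a * d - b * c = 1 -> twist a b c d (twist d (- b) (- c) a M) = M.
Proof.
move=> E; apply: mx4P; case4; rewrite ent_twist //= !ent_twist //=;
  first [by []|by rewrite -[RHS]mul1r -E; ring].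
Qed.
End FourByFour.

Lemma supercomm_even (F : numClosedFieldType) m n (p : bool) (M N : 'M[F]_(m + n)) :
  mx_part p M -> mx_part p N -> mx_part false (supercomm p p M N).
Proof.
have mul A B : mx_part p A -> mx_part p B -> forall i j, ipar i (+) ipar j != false -> (A *m B : 'M[F]_(m + n)) i j = 0.
  move=> /mx_partP hA /mx_partP hB i j ij; rewrite mxE big1 // => k _.
  have [e|e] := eqVneq (ipar i (+) ipar k) p; last by rewrite hA // mul0r.
  by rewrite hB ?mulr0 //; move: ij; rewrite -e; case: (ipar i); case: (ipar k); case: (ipar j).
move=> hM hN; apply/mx_partP=> i j ij; rewrite /supercomm.
have -> (A B : 'M[F]_(m + n)) c : (A - c *: B) i j = A i j - c * B i j by rewrite !mxE.
by rewrite !mul // mulr0 subrr.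
Qed.

Section Psl22.
Variables (F : numClosedFieldType) (g : lieSuperalgebra F).
Local Notation part := (lsa_part g).
Local Notation M4 := 'M[F]_(2 + 2).
Implicit Types M N : M4.

Definition psl2_model (psi : M4 -> g) : Prop :=
  [/\ linear psi,
      forall (p : bool) M, supertrace M = 0 -> mx_part p M -> psi M \in part p,
      forall (p q : bool) M N, supertrace M = 0 -> supertrace N = 0 -> mx_part p M -> mx_part q N ->
        psi (supercomm p q M N) = bracket (psi M) (psi N),
      forall x, exists2 M, supertrace M = 0 & psi M = x
    & forall M, supertrace M = 0 -> (psi M = 0 <-> exists c : F, M = c%:M)].

Lemma psl2_conj psi th : psl2_model psi -> even_auto th -> psl2_model (fun M => th (psi M)).
Proof.
move=> [lin par br onto ker] eth; have [ti tp tb] := eth; split.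
- by move=> c M N; rewrite lin linearP.
- by move=> p M sM hM; apply/tp/par.
- by move=> p q M N sM sN hM hN; rewrite (br p q) // tb.
- by move=> x; have [M sM E] := onto ((th^-1)%VF x); exists M; rewrite // E (even_autoVK eth).
move=> M sM; rewrite -ker //; split=> [E|->]; last by rewrite lf0.
by rewrite -(even_autoK eth (psi M)) E lf0.
Qed.

Lemma psl2_twist psi (a b c d : F) : a * d - b * c = 1 -> psl2_model psi ->
  psl2_model (fun M => psi (twist a b c d M)).
Proof.
move=> E [lin par br onto ker].
have psi0 : psi 0 = 0 by have := lin (-1) 0 0; rewrite scaler0 addr0 scaleN1r addNr.
have scal s : supertrace (s%:M : M4) = 0 by rewrite supertrace4 !entC //=; ring.
have scal0 s : psi s%:M = 0 by apply/ker; [exact: scal|exists s].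
have psiD M N : psi (M + N) = psi M + psi N by have := lin 1 M N; rewrite !scale1r.
have E' : d * a - (- b) * (- c) = 1 by rewrite -E; ring.
split.
- by move=> s M N; rewrite twist_linear lin.
- by move=> p M sM hM; apply: par; [rewrite twist_str|exact: twist_part].
- move=> p q M N sM sN hM hN.
  rewrite -(br p q) ?twist_str //; try exact: twist_part.
  case: p hM => hM; case: q hN => hN.
  + have [s ->] := twist_bracket_odd a b c d hM hN; rewrite E scale1r psiD scal0 addr0 twist_even //.
    exact: supercomm_even.
  + rewrite /supercomm !expr0 !scale1r -[twist a b c d M *m _ - _]opprB (twist_bracket_even a b c d sN hN hM).
    by rewrite -twistN opprB.
  + by rewrite /supercomm !expr0 !scale1r (twist_bracket_even a b c d sM hM hN).
  rewrite (twist_even _ _ _ _ hM) (twist_even _ _ _ _ hN) twist_even //.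
  exact: supercomm_even.
- move=> x; have [M sM Ex] := onto x; exists (twist d (- b) (- c) a M); first by rewrite twist_str.
  by rewrite twistK.
move=> M sM; rewrite ker ?twist_str //; split=> -[s Es]; last by exists s; rewrite Es twist_scalar.
exists s; have := twistK M E'; rewrite !opprK Es twist_scalar => <- //.
Qed.

(** The supertrace vanishes, and differences of two distinct entries coincide only for pairs of
    positions spanning one odd root space, such as (0, 2) and (3, 1). *)
Definition psl2_weight (a : nat) : F := nth 0 [:: 2%:R; - 2%:R; 1; - 1] a.
Definition psl2_grading : M4 := mx4 (fun a b => if eqn a b then psl2_weight a else 0).
Lemma ent_grading a b : (a < 4)%N -> (b < 4)%N -> ent psl2_grading a b = (if eqn a b then psl2_weight a else 0).
Proof. exact: ent_mx4. Qed.
Lemma grading_diag : is_diag_mx psl2_grading.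
Proof. by apply/is_diag_mxP=> i j ij; rewrite mxE eqnE (negbTE ij). Qed.
Lemma grading_str : supertrace psl2_grading = 0.
Proof. by rewrite supertrace4 !ent_grading //= /psl2_weight /=; ring. Qed.

Lemma psl2_split psi : psl2_model psi ->
  (exists (hs : {vspace g}) (v : seq g) (tau : 'End(g)), [/\ split_form hs (psi psl2_grading) v tau,
     forall M, supertrace M = 0 -> tau (psi M) = psi M^T
   & forall x, x \in hs <-> exists d, [/\ supertrace d = 0, is_diag_mx d & x = psi d]])
  /\ central_condition g.
Proof.
move=> [lin par br onto ker].
have [mm Hmm] : exists mm : {vspace M4}, forall M, M \in mm <-> supertrace M = 0.
  apply: vspace_of_pred; first by rewrite supertrace4 /ent !mxE; ring.
  by move=> c A B A0 B0; rewrite (supertrace_linear c A B) A0 B0 scaler0 addr0.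
have H1 (p : bool) M : M \in mm -> mx_part p M -> psi M \in part p by move=> /Hmm; apply: par.
have H2 (p q : bool) M N : M \in mm -> N \in mm -> mx_part p M -> mx_part q N ->
  psi (supercomm p q M N) = bracket (psi M) (psi N) by move=> /Hmm hM /Hmm hN; apply: br.
have H3 x : exists2 M, M \in mm & psi M = x by have [M hM <-] := onto x; exists M => //; apply/Hmm.
have H4 M : M \in mm -> psi M = 0 -> exists c, M = c%:M by move=> /Hmm hM /(ker _ hM).
have H5 (p q : bool) M N : M \in mm -> N \in mm -> mx_part p M -> mx_part q N -> supercomm p q M N \in mm.
  by move=> _ _ hM hN; apply/Hmm/supertrace_supercomm.
have H6 M N : (forall i, M i i = N i i) -> M \in mm -> N \in mm.
  by move=> MN /Hmm HM; apply/Hmm; rewrite -HM !supertraceE; apply: eq_bigr => i _; rewrite MN.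
have H7 : psl2_grading \in mm by apply/Hmm/grading_str.
have H8 (i j : 'I_(2 + 2)) : i != j -> exists2 k : int, k != 0 & psl2_grading i i - psl2_grading j j = k%:~R.
  pose w (i : nat) : int := nth 0 [:: 2; -2; 1; -1] i.
  have wE (k : 'I_(2 + 2)) : psl2_grading k k = (w k)%:~R.
    by rewrite mxE eqnE eqxx; case: k => -[|[|[|[|//]]]] ? //=; rewrite /psl2_weight /w /= ?rmorphN.
  move=> ij; exists (w i - w j); last by rewrite !wE rmorphB.
  by move: ij; case: i => -[|[|[|[|//]]]] ?; case: j => -[|[|[|[|//]]]] ?.
have H9 c : c%:M \in mm -> psi c%:M \in @actsp _ _ (adjoint g) (part false) (part false) -> psi c%:M = 0.
  by move=> /Hmm hc _; apply/(ker _ hc); exists c.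
split; last exact: (typeA_central lin H1 H2 H3 H4 H5 H6 H7 grading_diag H8 H9).
have [hs [v [tau [sf tauE hsE]]]] := typeA_model lin H1 H2 H3 H4 H5 H6 H7 grading_diag H8.
exists hs, v, tau; split=> // [M /Hmm|x]; first exact: tauE.
by rewrite hsE; split=> -[d [/Hmm d0 dd ->]]; exists d.
Qed.
End Psl22.

Section RootMatrices.
Variable F : numClosedFieldType.
Local Notation M4 := 'M[F]_(2 + 2).

(** The sign in the adjugate of a 2 x 2 block. With it the coordinates of all four odd root spaces
    transform by the same 2 x 2 matrix under [twist]. *)
Definition osg (i j : bool) : F := if i (+) j then -1 else 1.
Definition oddf (i j : bool) (c e : F) (a b : nat) : F :=
  if eqn a i && eqn b (2 + j)%N then c else if eqn a (2 + ~~ j)%N && eqn b (~~ i) then osg i j * e else 0.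
(* The odd root spaces of psl(2|2) are two-dimensional: they mix an upper and a lower entry. *)
Definition odd4 i j c e : M4 := mx4 (oddf i j c e).
Definition evenf (s r : bool) (a b : nat) : F := if eqn a (s + s + r)%N && eqn b (s + s + ~~ r)%N then 1 else 0.
Definition even4 s r : M4 := mx4 (evenf s r).

Lemma ent_odd4 i j c e a b : (a < 4)%N -> (b < 4)%N -> ent (odd4 i j c e) a b = oddf i j c e a b.
Proof. exact: ent_mx4. Qed.
Lemma ent_even4 s r a b : (a < 4)%N -> (b < 4)%N -> ent (even4 s r) a b = evenf s r a b.
Proof. exact: ent_mx4. Qed.

Lemma odd4_lin i j x c e c' e' : odd4 i j (x * c + c') (x * e + e') = x *: odd4 i j c e + odd4 i j c' e'.
Proof. by apply: mx4P; case: i; case: j; case4; rewrite entD entZ !ent_odd4 /oddf //=; ring. Qed.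
Lemma odd4_part i j c e : mx_part true (odd4 i j c e).
Proof. by apply/mx_part4; case: i; case: j; case4; rewrite ent_odd4 /oddf //=. Qed.
Lemma odd4_str i j c e : supertrace (odd4 i j c e) = 0.
Proof. by rewrite supertrace4; case: i; case: j; rewrite !ent_odd4 /oddf //=; ring. Qed.
Lemma even4_part s r : mx_part false (even4 s r).
Proof. by apply/mx_part4; case: s; case: r; case4; rewrite ent_even4 /evenf //=. Qed.
Lemma even4_str s r : supertrace (even4 s r) = 0.
Proof. by rewrite supertrace4; case: s; case: r; rewrite !ent_even4 /evenf //=; ring. Qed.

Definition coroot_odd i j c e c' e' : M4 :=
  mx4 (fun a b => if eqn a b then osg i j * (if eqn a i || eqn a (2 + j)%N then c * e' else e * c') else 0).
Definition coroot_even (s r : bool) : M4 :=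
  mx4 (fun a b => if eqn a b then (if eqn a (s + s + r)%N then 1 else if eqn a (s + s + ~~ r)%N then -1 else 0) else 0).

Lemma odd4_bracket i j c e c' e' :
  supercomm true true (odd4 i j c e) (odd4 (~~ i) (~~ j) c' e') = coroot_odd i j c e c' e'.
Proof.
by apply: mx4P; case: i; case: j; case4; rewrite entS !entM !ent_odd4 // ent_mx4 //= /oddf /osg /=; ring.
Qed.
Lemma even4_bracket s r : even4 s r *m even4 s (~~ r) - even4 s (~~ r) *m even4 s r = coroot_even s r.
Proof.
by apply: mx4P; case: s; case: r; case4; rewrite entD entN !entM !ent_even4 // ent_mx4 //= /evenf /=; ring.
Qed.
Lemma odd4_shift1 i j c e :
  even4 false (~~ i) *m odd4 i j c e - odd4 i j c e *m even4 false (~~ i) = odd4 (~~ i) j c e.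
Proof.
by apply: mx4P; case: i; case: j; case4; rewrite entD entN !entM !ent_even4 // !ent_odd4 //= /oddf /evenf /osg /=; ring.
Qed.
Lemma odd4_shift2 i j c e :
  even4 true j *m odd4 i j c e - odd4 i j c e *m even4 true j = odd4 i (~~ j) (- c) (- e).
Proof.
by apply: mx4P; case: i; case: j; case4; rewrite entD entN !entM !ent_even4 // !ent_odd4 //= /oddf /evenf /osg /=; ring.
Qed.
Lemma odd4_tr i j c e : (odd4 i j c e)^T = odd4 (~~ i) (~~ j) (osg i j * e) (osg i j * c).
Proof. by apply: mx4P; case: i; case: j; case4; rewrite entT !ent_odd4 //= /oddf /osg /=; ring. Qed.
Lemma even4_tr s r : (even4 s r)^T = even4 s (~~ r).
Proof. by apply: mx4P; case: s; case: r; case4; rewrite entT !ent_even4. Qed.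
Lemma odd4_twist a b c d i j x y : twist a b c d (odd4 i j x y) = odd4 i j (a * x + b * y) (c * x + d * y).
Proof. by apply: mx4P; case: i; case: j; case4; rewrite ent_twist //= !ent_odd4 //= /oddf /osg /=; ring. Qed.

Lemma diag4 (f : nat -> F) : is_diag_mx (mx4 (fun a b => if eqn a b then f a else 0) : M4).
Proof. by apply/is_diag_mxP=> i j ij; rewrite mxE eqnE (negbTE ij). Qed.
Lemma coroot_odd_str i j c e c' e' : supertrace (coroot_odd i j c e c' e') = 0.
Proof. by rewrite supertrace4; case: i; case: j; rewrite !ent_mx4 //=; ring. Qed.
Lemma coroot_even_str s r : supertrace (coroot_even s r) = 0.
Proof. by rewrite supertrace4; case: s; case: r; rewrite !ent_mx4 //=; ring. Qed.
Lemma coroot_even_scalar s r x : coroot_even s r <> x%:M.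
Proof.
move=> E; have e k : (k < 4)%N -> ent (coroot_even s r) k k = x by move=> k4; rewrite E entC // eqnE eqxx.
have := e (s + s + r)%N; have := e (s + s + ~~ r)%N.
case: s {E} e; case: r => e; rewrite !ent_mx4 //= => <- // /(_ isT)/eqP; by rewrite -subr_eq0 opprK -(natrD _ 1 1) pnatr_eq0.
Qed.
(** Modulo scalars the bracket of opposite odd root vectors is the determinant of their coordinates
    times a fixed diagonal matrix. This determinant is the pairing used throughout for cut root
    spaces. *)
Lemma coroot_odd_scalar i j c e c' e' x : coroot_odd i j c e c' e' = x%:M -> c * e' - e * c' = 0.
Proof.
move=> E; have H k : (k < 4)%N -> ent (coroot_odd i j c e c' e') k k = x by move=> k4; rewrite E entC // eqnE eqxx.
have := H 0%N isT; rewrite -(H 1%N isT); case: i {E H}; case: j; rewrite !ent_mx4 //= /osg /= => /eqP;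
  rewrite -subr_eq0 => /eqP E; apply/eqP; first [rewrite -E; apply/eqP; ring|rewrite -oppr_eq0 -E; apply/eqP; ring].
Qed.

(* [wt4 a b] is the weight of the (a, b) entry under [psl2_grading], shifted by 4. *)
Definition wt4 (a b : nat) : nat :=
  nth 0%N (nth [::] [:: [:: 4; 8; 5; 7]; [:: 0; 4; 1; 3]; [:: 3; 7; 4; 6]; [:: 1; 5; 2; 4]] a) b.
Definition wt4F a b : F := (wt4 a b)%:R - 4%:R.
Lemma wt4FE a b : (a < 4)%N -> (b < 4)%N -> psl2_weight F a - psl2_weight F b = wt4F a b.
Proof. by move: a b; case4; rewrite /psl2_weight /wt4F /wt4 /=; ring. Qed.
Lemma ent_ad_grading (M : M4) a b : (a < 4)%N -> (b < 4)%N ->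
  ent (psl2_grading F *m M - M *m psl2_grading F) a b = wt4F a b * ent M a b.
Proof.
move=> a4 b4; rewrite -wt4FE //; move: a b a4 b4.
by case4; rewrite entD entN !entM !ent_grading //=; ring.
Qed.
Lemma ad_grading_str (M : M4) : supertrace (psl2_grading F *m M - M *m psl2_grading F) = 0.
Proof. by rewrite supertrace4 !ent_ad_grading // /wt4F /wt4 /=; ring. Qed.
End RootMatrices.

Section Weights.
Variables (F : numClosedFieldType) (g : lieSuperalgebra F) (psi : 'M[F]_(2 + 2) -> g).
Local Notation part := (lsa_part g).
Local Notation M4 := 'M[F]_(2 + 2).
Implicit Types M N : M4.
Hypothesis hpsi : psl2_model psi.
Let D := psi (psl2_grading F).
Let lin : linear psi. Proof. by case: hpsi. Qed.
Let psi0 : psi 0 = 0. Proof. by have := lin (-1) 0 0; rewrite scaler0 addr0 scaleN1r addNr. Qed.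
Let psiD M N : psi (M + N) = psi M + psi N. Proof. by have := lin 1 M N; rewrite !scale1r. Qed.
Let psiZ c M : psi (c *: M) = c *: psi M. Proof. by have := lin c M 0; rewrite psi0 !addr0. Qed.
Let psiB M N : psi (M - N) = psi M - psi N. Proof. by rewrite -!scaleN1r psiD psiZ. Qed.
Let scal_str (x : F) : supertrace (x%:M : M4) = 0. Proof. by rewrite supertrace4 !entC //=; ring. Qed.
Let scal0 x : psi x%:M = 0. Proof. by case: hpsi => _ _ _ _ H; apply/(H _ (scal_str x)); exists x. Qed.

Lemma even_bracket E M : supertrace E = 0 -> mx_part false E -> supertrace M = 0 ->
  bracket (psi E) (psi M) = psi (E *m M - M *m E).
Proof.
case: hpsi => _ _ br _ _ sE hE sM.
have [M0 [M1 [EM h0 h1 _]]] := mx_parity_split M.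
have s1 : supertrace M1 = 0 by move/mx_part4: h1 => h1; rewrite supertrace4 !h1 //; ring.
have s0 : supertrace M0 = 0.
  by rewrite -[RHS]sM EM -[LHS]addr0 -[in LHS]s1 !supertrace4 !entD; ring.
rewrite EM psiD bracketDr -(br _ _ _ _ sE s0 hE h0) -(br _ _ _ _ sE s1 hE h1) -psiD; congr psi.
by rewrite /supercomm !expr0 !scale1r mulmxDr mulmxDl opprD addrACA.
Qed.

(** An eigenvector of psl(2|2) lifts to a matrix satisfying the eigenvalue equation up to a scalar
    matrix. That error sits on the diagonal, where the weight is zero and not [k], and subtracting a
    scalar from [M] removes it. *)
Lemma weight_part M k : supertrace M = 0 -> k != 0 -> bracket D (psi M) = k *: psi M ->
  psi M = psi (mx4 (fun a b => if wt4F F a b == k then ent M a b else 0)).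
Proof.
move=> sM k0 eM; case: hpsi => _ _ _ _ ker.
pose G := psl2_grading F *m M - M *m psl2_grading F - k *: M.
have sG : supertrace G = 0.
  have -> : supertrace G = supertrace (psl2_grading F *m M - M *m psl2_grading F) - k * supertrace M.
    by rewrite !supertrace4 /G !(entD, entN, entZ); ring.
  by rewrite ad_grading_str sM mulr0 subrr.
have gE : mx_part false (psl2_grading F) by apply/diag_even/grading_diag.
have [x Ex] : exists x : F, G = x%:M.
  by apply/(ker _ sG); rewrite psiB psiZ -even_bracket ?grading_str // eM subrr.
have eG a b : (a < 4)%N -> (b < 4)%N -> (wt4F F a b - k) * ent M a b = if eqn a b then x else 0.
  by move=> a4 b4; rewrite -(entC x a4 b4) -Ex entD entN entZ ent_ad_grading // mulrBl.
have w0 a : (a < 4)%N -> wt4F F a a = 0 by move: a => [|[|[|[|//]]]] _; rewrite /wt4F /= subrr.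
have -> : M = mx4 (fun a b => if wt4F F a b == k then ent M a b else 0) + (- (x / k))%:M.
  apply: mx4P => a b a4 b4; rewrite entD ent_mx4 // entC //; have := eG a b a4 b4; rewrite eqnE.
  have [<-|ab] := eqVneq a b.
    rewrite w0 // eq_sym (negbTE k0) sub0r add0r => <-.
    by rewrite !mulNr opprK mulrAC divff // mul1r.
  by rewrite addr0; have [//|wk] := eqVneq (wt4F F a b) k => /eqP; rewrite mulf_eq0 subr_eq0 (negbTE wk) => /eqP.
rewrite psiD scal0 addr0; congr psi; apply: mx4P => a b a4 b4; rewrite !ent_mx4 //.
case: ifP => // /eqP wk; rewrite entD ent_mx4 // wk eqxx entC // eqnE.
by case: eqP => [ab|_]; rewrite ?addr0 //; rewrite -wk ab w0 // eqxx in k0.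
Qed.

Lemma weight_values M k : supertrace M = 0 -> k != 0 -> bracket D (psi M) = k *: psi M -> psi M != 0 ->
  exists a b, [/\ (a < 4)%N, (b < 4)%N & k = wt4F F a b].
Proof.
move=> sM k0 eM; apply: contra_neqP => no; rewrite (weight_part sM k0 eM) -psi0; congr psi.
apply: mx4P => a b a4 b4; rewrite ent_mx4 // [RHS]/ent mxE; case: eqP => // wk.
by case: no; exists a, b.
Qed.

Definition owt (i j : bool) : F := wt4F F i (2 + j).
Definition ewt (s r : bool) : F := wt4F F (s + s + r) (s + s + ~~ r).
Let odd_root i j c e := psi (odd4 i j c e).
Let even_root s r := psi (even4 F s r).

Let gpart : mx_part false (psl2_grading F). Proof. exact/diag_even/grading_diag. Qed.

Lemma odd_root_eig i j c e : bracket D (odd_root i j c e) = owt i j *: odd_root i j c e.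
Proof.
rewrite even_bracket ?grading_str ?odd4_str // -psiZ; congr psi; apply: mx4P => a b a4 b4.
rewrite ent_ad_grading // entZ ent_odd4 // /owt /wt4F; move: a b a4 b4.
by case: i; case: j; case4; rewrite /oddf /wt4 /=; ring.
Qed.
Lemma even_root_eig s r : bracket D (even_root s r) = ewt s r *: even_root s r.
Proof.
rewrite even_bracket ?grading_str ?even4_str // -psiZ; congr psi; apply: mx4P => a b a4 b4.
rewrite ent_ad_grading // entZ ent_even4 // /ewt /wt4F; move: a b a4 b4.
by case: s; case: r; case4; rewrite /evenf /wt4 /=; ring.
Qed.

Let wt_eq (u v : nat) : (u%:R - 4%:R == v%:R - 4%:R :> F) = (u == v).
Proof. by rewrite (inj_eq (addIr _)) eqr_nat. Qed.

Let wt_nz (u : nat) : u != 4%N -> u%:R - 4%:R != 0 :> F.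
Proof. by move=> u4; rewrite subr_eq0 eqr_nat. Qed.

Lemma odd_root_space x i j : bracket D x = owt i j *: x -> exists c e, x = odd_root i j c e.
Proof.
case: hpsi => _ _ _ onto _; have [M sM <-] := onto x => eM.
have k0 : owt i j != 0 by apply: wt_nz; case: i {eM}; case: j.
exists (ent M i (2 + j)), (osg F i j * ent M (2 + ~~ j) (~~ i)).
rewrite (weight_part sM k0 eM); congr psi; apply: mx4P => a b a4 b4.
rewrite ent_mx4 // ent_odd4 // /owt /wt4F wt_eq; move: a b a4 b4 {eM k0}.
by case: i; case: j; case4; rewrite /oddf /wt4 /osg //=; ring.
Qed.
Lemma even_root_space x s r : bracket D x = ewt s r *: x -> exists c, x = c *: even_root s r.
Proof.
case: hpsi => _ _ _ onto _; have [M sM <-] := onto x => eM.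
have k0 : ewt s r != 0 by apply: wt_nz; case: s {eM}; case: r.
exists (ent M (s + s + r) (s + s + ~~ r)).
rewrite (weight_part sM k0 eM) -psiZ; congr psi; apply: mx4P => a b a4 b4.
rewrite ent_mx4 // entZ ent_even4 // /ewt /wt4F wt_eq; move: a b a4 b4 {eM k0}.
by case: s; case: r; case4; rewrite /evenf /wt4 //=; ring.
Qed.

Lemma weight_cases x k : bracket D x = k *: x -> [\/ x = 0, k = 0, exists i j, k = owt i j | exists s r, k = ewt s r].
Proof.
case: hpsi => _ _ _ onto _; have [M sM <-] := onto x => eM.
have [k0|k0] := eqVneq k 0; first by constructor 2.
have [x0|x0] := eqVneq (psi M) 0; first by constructor 1.
have [a [b [a4 b4 Ek]]] := weight_values sM k0 eM x0.
move: a b a4 b4 Ek; case4 => Ek; first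
  [by rewrite Ek /wt4F /wt4 /= subrr eqxx in k0
  |by constructor 3; exists false, false; exact: Ek|by constructor 3; exists false, true; exact: Ek
  |by constructor 3; exists true, false; exact: Ek|by constructor 3; exists true, true; exact: Ek
  |by constructor 4; exists false, false; exact: Ek|by constructor 4; exists false, true; exact: Ek
  |by constructor 4; exists true, false; exact: Ek|by constructor 4; exists true, true; exact: Ek
  |constructor 3; exists true, true; by rewrite Ek /owt /wt4F /wt4
  |constructor 3; exists true, false; by rewrite Ek /owt /wt4F /wt4
  |constructor 3; exists false, true; by rewrite Ek /owt /wt4F /wt4
  |constructor 3; exists false, false; by rewrite Ek /owt /wt4F /wt4].
Qed.
End Weights.

Section HalfTwist.
Variables (F : numClosedFieldType) (g : lieSuperalgebra F) (psi : 'M[F]_(2 + 2) -> g) (X : seq g).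
Local Notation part := (lsa_part g).
Hypothesis hpsi : psl2_model psi.
Let D := psi (psl2_grading F).
Hypothesis dX : eigenspanned (lsa_br D) X.
Variables (n p nb : {vspace g}).
Hypotheses (Dn : forall y, y \in n -> bracket D y \in n) (Dp : forall y, y \in p -> bracket D y \in p)
  (Dnb : forall y, y \in nb -> bracket D y \in nb).
Hypotheses (full : (nb + p)%VS = fullv) (np : (n <= p)%VS) (pn : br_sub p n n) (npn : br_sub n p n)
  (nbb : br_sub nb nb nb).
Hypotheses (n0 : forall d, supertrace d = 0 -> is_diag_mx d -> psi d \in n -> psi d = 0)
  (nb0 : forall d, supertrace d = 0 -> is_diag_mx d -> psi d \in nb -> psi d = 0).

Local Notation o i j c e := (psi (odd4 i j c e)).
Local Notation ev s r := (psi (even4 F s r)).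

Let lin : linear psi. Proof. by case: hpsi. Qed.
Let psi0 : psi 0 = 0. Proof. by have := lin (-1) 0 0; rewrite scaler0 addr0 scaleN1r addNr. Qed.
Let psiZ c M : psi (c *: M) = c *: psi M. Proof. by have := lin c M 0; rewrite psi0 !addr0. Qed.
Let o_lin i j x c e c' e' : o i j (x * c + c') (x * e + e') = x *: o i j c e + o i j c' e'.
Proof. by rewrite odd4_lin lin. Qed.
Let oZ i j x c e : o i j (x * c) (x * e) = x *: o i j c e.
Proof. have := o_lin i j x c e 0 0; rewrite !addr0 => ->; by have := o_lin i j (-1) 0 0 0 0; rewrite !mulr0 !addr0 scaleN1r addNr => ->; rewrite addr0. Qed.

Definition full_odd (U : {vspace g}) i j := forall c e, o i j c e \in U.
(** Coordinates of vectors of [U] in odd root spaces that [U] contains only in part. For a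
    nilradical they all lie on one line, by [cut_parallel]. *)
Definition cut_odd (U : {vspace g}) c e := exists i j, o i j c e \in U /\ ~ full_odd U i j.

Let ker_scalar M : supertrace M = 0 -> psi M = 0 -> exists c : F, M = c%:M.
Proof. by case: hpsi => _ _ _ _ ker sM /(ker _ sM). Qed.

Lemma odd_split i j c e : exists c1 e1, o i j c1 e1 \in nb /\ o i j (c - c1) (e - e1) \in p.
Proof.
have [||||a [ab ea yp]] := @eigen_split _ _ _ X nb p (o i j c e) (owt F i j) dX; rewrite ?full ?memvf //.
  exact: odd_root_eig.
have [c1 [e1 Ea]] := odd_root_space hpsi ea; exists c1, e1; split; first by rewrite -Ea.
have := o_lin i j (-1) c1 e1 c e; rewrite !mulN1r ![- _ + _]addrC => ->.
by rewrite scaleN1r addrC -Ea.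
Qed.

Lemma even_split s r : ev s r \in nb \/ ev s r \in p.
Proof.
have [||||a [ab ea yp]] := @eigen_split _ _ _ X nb p (ev s r) (ewt F s r) dX; rewrite ?full ?memvf //.
  exact: even_root_eig.
have [c Ea] := even_root_space hpsi ea; rewrite Ea in ab yp.
have [c0|c0] := eqVneq c 0; first by right; move: yp; rewrite c0 scale0r subr0.
by left; rewrite -[ev s r]scale1r -(mulVf c0) -scalerA memvZ.
Qed.

Let even_br s r : bracket (ev s r) (ev s (~~ r)) = psi (coroot_even F s r).
Proof. by rewrite (even_bracket hpsi) ?even4_str ?even4_bracket //; apply: even4_part. Qed.

Let coroot_nz s r : psi (coroot_even F s r) <> 0.
Proof. by move/(ker_scalar (coroot_even_str F s r)) => [c] /coroot_even_scalar. Qed.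

Let even_p s r : ev s r \in p \/ ev s (~~ r) \in p.
Proof.
have [hr|] := even_split s r; last by left.
have [hr'|] := even_split s (~~ r); last by right.
have := nbb hr hr'; rewrite even_br => /(nb0 (coroot_even_str F s r) (diag4 _)) /coroot_nz //.
Qed.

Lemma even_opp s r : ev s r \in n -> ev s (~~ r) \in nb.
Proof.
move=> hr; have [//|hr'] := even_split s (~~ r).
have := npn hr hr'; rewrite even_br => /(n0 (coroot_even_str F s r) (diag4 _)) /coroot_nz //.
Qed.

(** The bracket lies in [n] and in the Cartan subalgebra, so it is zero; for odd root vectors this
    means that the determinant vanishes. *)
Lemma odd_isotropic i j c e c' e' : o i j c e \in n -> o (~~ i) (~~ j) c' e' \in p -> c * e' - e * c' = 0.
Proof.
case: hpsi => _ _ br _ _ hn hp; have := npn hn hp.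
rewrite -(br _ _ _ _ (odd4_str _ _ _ _) (odd4_str _ _ _ _) (odd4_part _ _ _ _) (odd4_part _ _ _ _)) odd4_bracket.
move=> /(n0 (coroot_odd_str _ _ _ _ _ _) (diag4 _)) /(ker_scalar (coroot_odd_str _ _ _ _ _ _))[x].
exact: coroot_odd_scalar.
Qed.

(** Take any vector of non-zero determinant against the given one. Its component in [p] has
    determinant zero by isotropy, so its component in [nb] keeps the determinant. *)
Lemma odd_opp i j c e : o i j c e \in n -> (c != 0) || (e != 0) ->
  exists c' e', o (~~ i) (~~ j) c' e' \in nb /\ c * e' - e * c' != 0.
Proof.
move=> hn nz.
have pick u v : c * v - e * u != 0 -> exists c' e', o (~~ i) (~~ j) c' e' \in nb /\ c * e' - e * c' != 0.
  have [c1 [e1 [hb hp]]] := odd_split (~~ i) (~~ j) u v; move: (odd_isotropic hn hp) => E N.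
  exists c1, e1; split=> //; apply: contra N => /eqP E'; rewrite -(addr0 0) -{1}E -E'; apply/eqP; ring.
case/orP: nz => nz; [apply: (pick 0 1)|apply: (pick 1 0)]; by rewrite mulr1 mulr0 ?subr0 ?sub0r ?oppr_eq0.
Qed.

Lemma full_opp i j : full_odd n i j -> full_odd nb (~~ i) (~~ j).
Proof.
move=> H c e; have [c1 [e1 [hb hp]]] := odd_split (~~ i) (~~ j) c e.
have := odd_isotropic (H 1 0) hp; have := odd_isotropic (H 0 1) hp.
rewrite !(mul0r, mul1r, sub0r, subr0) => /eqP; rewrite oppr_eq0 subr_eq0 => /eqP-> /eqP.
by rewrite subr_eq0 => /eqP->.
Qed.

Let same_space i j c e c' e' : o i j c e \in n -> o i j c' e' \in n -> ~ full_odd n i j -> c * e' - e * c' = 0.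
Proof.
move=> h h' nf; apply/eqP; apply: contraT => dz; case: nf => u v.
pose al := (u * e' - v * c') / (c * e' - e * c'); pose be := (c * v - e * u) / (c * e' - e * c').
have -> : o i j u v = al *: o i j c e + be *: o i j c' e'.
  rewrite -(oZ i j be) -o_lin; congr (psi (odd4 i j _ _)); rewrite /al /be; field; exact: dz.
by apply: memvD; apply: memvZ.
Qed.

Let shift1 i j c e : ev false (~~ i) \in p -> o i j c e \in n -> o (~~ i) j c e \in n.
Proof.
move=> hp hn; have := pn hp hn; rewrite (even_bracket hpsi) ?even4_str ?odd4_str ?odd4_shift1 //; exact: even4_part.
Qed.
Let shift2 i j c e : ev true j \in p -> o i j c e \in n -> o i (~~ j) c e \in n.
Proof.
move=> hp hn; have := pn hp hn; rewrite (even_bracket hpsi) ?even4_str ?odd4_str ?odd4_shift2 //; last exact: even4_part.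
by have := oZ i (~~ j) (-1) c e; rewrite !mulN1r => ->; rewrite scaleN1r memvN.
Qed.

(** Of two opposite even root vectors at least one lies in [p], and bracketing with it moves between
    odd root spaces preserving coordinates up to sign. All cut lines can thus be compared in one
    root space, or in two opposite ones by isotropy; this is why a single twist suffices. *)
Lemma cut_parallel c e c' e' : cut_odd n c e -> cut_odd n c' e' -> c * e' - e * c' = 0.
Proof.
move=> [i [j [h nf]]] [i' [j' [h' nf']]].
have anti x y z w : x * w - y * z = 0 -> z * y - w * x = 0 :> F.
  by move=> E; rewrite -[RHS]oppr0 -E; ring.
have [Ei|Ei] : i' = i \/ i' = ~~ i by case: (i); case: (i'); auto.
  have [Ej|Ej] : j' = j \/ j' = ~~ j by case: (j); case: (j'); auto.
    by rewrite Ei Ej in h'; apply: same_space h h' nf.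
  rewrite Ei Ej in h' nf'; have [hp|hp] := even_p true j.
    exact: same_space (shift2 hp h) h' nf'.
  by apply: (same_space h _ nf); have := shift2 hp h'; rewrite negbK.
have [Ej|Ej] : j' = j \/ j' = ~~ j by case: (j); case: (j'); auto.
  rewrite Ei Ej in h' nf'; have [hp|hp] := even_p false i.
    by apply: (same_space h _ nf); have := @shift1 (~~ i) j c' e'; rewrite negbK => /(_ hp h').
  exact: same_space (shift1 hp h) h' nf'.
by rewrite Ei Ej in h'; apply: odd_isotropic h (subvP np _ h').
Qed.

Variables (c0 e0 c1 e1 : F) (tau : 'End(g)).
Hypotheses (det1 : c0 * e1 - e0 * c1 = 1)
  (cut_n : forall c e, cut_odd n c e -> c0 * e - e0 * c = 0)
  (cut_nb : forall c e, cut_odd nb c e -> c1 * e - e1 * c = 0)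
  (tau_line : forall i j x, exists y, tau (o i j (x * c0) (x * e0)) = o (~~ i) (~~ j) (y * c1) (y * e1))
  (tau_odd : forall i j c e, exists c' e', tau (o i j c e) = o (~~ i) (~~ j) c' e')
  (tau_even : forall s r, tau (ev s r) = ev s (~~ r))
  (nb_full : forall i j, full_odd nb i j -> full_odd n (~~ i) (~~ j))
  (n_cent : forall y, y \in n -> bracket D y = 0 -> y = 0).

(** Checked on eigenvectors of [D]. Root spaces contained in [n] are opposite to ones contained in
    [nb]; on cut ones [n] is the line of coordinates [c0], [e0], sent by [tau] to that of [c1],
    [e1], which [nb] contains. The section is symmetric enough to be used again with [n] and [nb]
    exchanged. *)
Lemma twist_opp x : x \in n -> tau x \in nb.
Proof.
suff /subvP H : (n <= tau @^-1: nb)%VS by move=> /H; rewrite -memv_preim.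
apply: (diag_sub dX) => [w|y k yn ey]; first exact: Dn.
rewrite -memv_preim.
case: (weight_cases hpsi ey) => [->|k0|[i [j Ek]]|[s [r Ek]]]; first by rewrite lf0 mem0v.
- by rewrite k0 scale0r in ey; rewrite (n_cent yn ey) lf0 mem0v.
- rewrite Ek in ey; have [c [e Ey]] := odd_root_space hpsi ey; rewrite Ey in yn *.
  have [fn|nf] := EM (full_odd n i j).
    by have [c' [e' ->]] := tau_odd i j c e; apply: full_opp.
  have pc := cut_n (ex_intro _ i (ex_intro _ j (conj yn nf))).
  have [z|nz] := boolP ((c != 0) || (e != 0)); last first.
    move: nz; rewrite negb_or !negbK => /andP[/eqP-> /eqP->].
    by have := oZ i j 0 0 0; rewrite mul0r scale0r => ->; rewrite lf0 mem0v.
  have [c' [e' [hb dz]]] := odd_opp yn z.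
  have Ec : c = (c * e1 - e * c1) * c0 by rewrite -[LHS]mulr1 -det1 -[RHS]addr0 -(mulr0 c1) -{1}pc; ring.
  have Ee : e = (c * e1 - e * c1) * e0 by rewrite -[LHS]mulr1 -det1 -[RHS]addr0 -(mulr0 e1) -{1}pc; ring.
  have -> : o i j c e = o i j ((c * e1 - e * c1) * c0) ((c * e1 - e * c1) * e0).
    by congr (psi (odd4 i j _ _)).
  have [y0 ->] := tau_line i j (c * e1 - e * c1).
  rewrite oZ; apply: memvZ.
  have [fb|nfb] := EM (full_odd nb (~~ i) (~~ j)); first exact: fb.
  have pc' := cut_nb (ex_intro _ (~~ i) (ex_intro _ (~~ j) (conj hb nfb))).
  pose mu := c0 * e' - e0 * c'.
  have Ec' : c' = mu * c1 by rewrite -[LHS]mulr1 -det1 -[RHS]subr0 -(mulr0 c0) -{1}pc' /mu; ring.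
  have Ee' : e' = mu * e1 by rewrite -[LHS]mulr1 -det1 -[RHS]subr0 -(mulr0 e0) -{1}pc' /mu; ring.
  have mu0 : mu != 0.
    by apply: contraNneq dz => m0; rewrite Ec' Ee' m0 !mul0r !mulr0 subrr.
  move: hb; rewrite Ec' Ee' oZ => hb.
  by rewrite -[o _ _ c1 e1]scale1r -(mulVf mu0) -scalerA memvZ.
rewrite Ek in ey; have [c Ey] := even_root_space hpsi ey; rewrite Ey lfZ tau_even.
have [->|nz] := eqVneq c 0; first by rewrite scale0r mem0v.
by apply/memvZ/even_opp; rewrite -[ev s r]scale1r -(mulVf nz) -scalerA -Ey memvZ.
Qed.
End HalfTwist.

Section Psl22Kostant.
Variables (F : numClosedFieldType) (g : lieSuperalgebra F) (kappa : g -> g -> F).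
Variables (p l n nb : {vspace g}) (d : nat) (xi xid : d.-tuple g).
Local Notation part := (lsa_part g).
Hypothesis kf : killing_form kappa.
Hypothesis xi_basis : homogeneous_basis n xi.
Hypothesis xid_basis : homogeneous_basis nb xid.
Hypothesis dual : forall a b : 'I_d, kappa (tnth xid a) (tnth xi b) = (a == b)%:R.

Theorem psl22_kostant : is_psl g 2 -> parabolic_decomposition p l n nb -> kostant_statement p l n nb xi xid.
Proof.
case=> psi1 m1 [nm [h [np [tri pP psP nP dec]]]].
have [[hs1 [v1 [tau1 [sf1 _ hs1E]]]] cc] := psl2_split m1.
have [nm1 [np1 [X1 et1]]] := triangular_even tri; have [nm2 [np2 et2]] := sf_even sf1.
have [th [eth hh hh']] := cartan_conj kf et1 et2 cc.
pose psi M := th (psi1 M); have m : psl2_model psi := psl2_conj m1 eth.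
have hE x : x \in h <-> exists d, [/\ supertrace d = 0, is_diag_mx d & x = psi d].
  split=> [/hh'[y /hs1E[e [e0 de ->]] ->]|[e [e0 de ->]]]; first by exists e.
  by apply: hh; apply/hs1E; exists e.
pose D := psi (psl2_grading F).
have split_at psi' : psl2_model psi' -> (forall e, is_diag_mx e -> psi' e = psi e) ->
    exists v tau, split_form h D v tau /\ forall M, supertrace M = 0 -> tau (psi' M) = psi' M^T.
  move=> m' E; have [[hs [v [tau [sf tauE hsE]]]] _] := psl2_split m'.
  have hsh : hs = h.
    apply/eqP; rewrite eqEsubv; apply/andP; split; apply/subvP=> x.
      by move=> /hsE[e [e0 de ->]]; apply/hE; exists e; rewrite E.
    by move=> /hE[e [e0 de ->]]; apply/hsE; exists e; rewrite E.
  by exists v, tau; split=> //; rewrite -hsh /D -(E _ (grading_diag F)).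
have [v0 [tau0 [sf0 _]]] := split_at psi m (fun _ _ => erefl).
have [nh nbh _ _] := nil_caps tri pP nP dec.
have [[gp pp] hp pE] := pP; have [[gps pps] hps _] := psP.
have [[gn np' pn] _ [gnb nbps pnb] _] := nP; have [dfull _] := dec.
have Dh : D \in h by exact: sf_t sf0.
have Dp' : D \in p by apply: (subvP hp); apply: (subvP (addvSl _ _)).
have Dps : D \in (nb + l)%VS by apply: (subvP hps); apply: (subvP (addvSr _ _)).
have dX := sf_diag sf0 Dh.
have Dn y : y \in n -> bracket D y \in n by apply: pn.
have Dnb y : y \in nb -> bracket D y \in nb by apply: pnb.
have Dp y : y \in p -> bracket D y \in p by apply: pp.
have Dps' y : y \in (nb + l)%VS -> bracket D y \in (nb + l)%VS by apply: pps.
have full1 : (nb + p)%VS = fullv by rewrite pE addvA.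
have full2 : (n + (nb + l))%VS = fullv by rewrite addvC.
have nbb : br_sub nb nb nb by move=> x y xn; apply: pnb; apply: (subvP nbps).
have nn : br_sub n n n by move=> x y xn; apply: pn; apply: (subvP np').
have npn : br_sub n p n by apply: ideal_flip => //; exact/graded_subP.
have nbpn : br_sub nb (nb + l)%VS nb by apply: ideal_flip => //; exact/graded_subP.
have n0 e : supertrace e = 0 -> is_diag_mx e -> psi e \in n -> psi e = 0.
  by move=> e0 de en; apply/eqP; rewrite -memv0 -nh memv_cap en; apply/hE; exists e.
have nb0 e : supertrace e = 0 -> is_diag_mx e -> psi e \in nb -> psi e = 0.
  by move=> e0 de en; apply/eqP; rewrite -memv0 -nbh memv_cap en; apply/hE; exists e.
have n_cent y : y \in n -> bracket D y = 0 -> y = 0.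
  by move=> yn /(sf_cent sf0) yh; apply/eqP; rewrite -memv0 -nh memv_cap yn.
have nb_cent y : y \in nb -> bracket D y = 0 -> y = 0.
  by move=> yn /(sf_cent sf0) yh; apply/eqP; rewrite -memv0 -nbh memv_cap yn.
have par1 := cut_parallel m dX Dp Dnb full1 np' pn npn nbb n0 nb0.
have par2 := cut_parallel m dX Dps' Dn full2 nbps pnb nbpn nn nb0 n0.
have opp1 := odd_opp m dX Dp Dnb full1 npn n0.
have opp2 := odd_opp m dX Dps' Dn full2 nbpn nb0.
have fl1 := full_opp m dX Dp Dnb full1 npn n0.
have fl2 := full_opp m dX Dps' Dn full2 nbpn nb0.
have nz_det (c e c' e' : F) : c * e' - e * c' != 0 -> (c != 0) || (e != 0).
  by apply: contraR; rewrite negb_or !negbK => /andP[/eqP-> /eqP->]; rewrite !mul0r subrr.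
(* If [n] cuts a root space in a line, take a vector of this line and a vector of [nb] in the
   opposite root space, scaled to determinant one. Otherwise there is no non-zero cut vector and the
   standard basis serves. *)
have [c0 [e0 [c1 [e1 [det1 cut1 cut2]]]]] : exists c0 e0 c1 e1 : F, [/\ c0 * e1 - e0 * c1 = 1,
    forall c e, cut_odd psi n c e -> c0 * e - e0 * c = 0 & forall c e, cut_odd psi nb c e -> c1 * e - e1 * c = 0].
  have [[c [e [S nz]]]|none] := EM (exists c e, cut_odd psi n c e /\ ((c != 0) || (e != 0))).
    have [i [j [h1 nf]]] := S; have [c' [e' [h2 dz]]] := opp1 i j c e h1 nz.
    have S' : cut_odd psi nb c' e'.
      by exists (~~ i), (~~ j); split=> // /fl2; rewrite !negbK.
    pose dt := c * e' - e * c'; exists c, e, (c' / dt), (e' / dt); split.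
    - by rewrite !mulrA -mulrBl divff.
    - by move=> u w /(par1 _ _ _ _ S).
    by move=> u w /(par2 _ _ _ _ S') E; rewrite ![_ / dt * _]mulrAC -mulrBl E mul0r.
  exists 1, 0, 0, 1; split; first by rewrite mulr1 mulr0 subr0.
    move=> c e S; rewrite mul1r mul0r subr0; apply/eqP; apply: contraT => e0.
    by case: none; exists c, e; rewrite e0 orbT.
  move=> c e [i [j [h1 nf]]]; rewrite mul0r mul1r sub0r; apply/eqP; rewrite oppr_eq0; apply: contraT => c0.
  have [|c' [e' [h2 dz]]] := opp2 i j c e h1; first by rewrite c0.
  case: none; exists c', e'; split; first by exists (~~ i), (~~ j); split=> // /fl1; rewrite !negbK.
  by apply: (@nz_det _ _ c e); rewrite -oppr_eq0 opprB [e' * c]mulrC [c' * e]mulrC.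
have det2 : c1 * (- e0) - e1 * (- c0) = 1 by rewrite -det1; ring.
have detA : c0 * e1 - c1 * e0 = 1 by rewrite [c1 * e0]mulrC.
(* The twist carries the two coordinate axes to the lines chosen for [n] and [nb]. Transposition
   exchanges the axes, so the twisted [tau] exchanges the lines; diagonal matrices are
   unaffected. *)
pose psi' M := psi (twist c0 c1 e0 e1 M); have m' : psl2_model psi' := psl2_twist detA m.
have [v [tau [sf tauE]]] : exists v tau, split_form h D v tau /\ forall M, supertrace M = 0 -> tau (psi' M) = psi' M^T.
  by apply: split_at => // e /diag_even de; rewrite /psi' twist_even.
have oE i j x y : psi' (odd4 i j x y) = psi (odd4 i j (c0 * x + c1 * y) (e0 * x + e1 * y)).
  by rewrite /psi' odd4_twist.
have tau_o i j x y : tau (psi (odd4 i j (c0 * x + c1 * y) (e0 * x + e1 * y))) =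
    psi (odd4 (~~ i) (~~ j) (c0 * (osg F i j * y) + c1 * (osg F i j * x)) (e0 * (osg F i j * y) + e1 * (osg F i j * x))).
  by rewrite -oE tauE ?odd4_str // odd4_tr oE.
have tau_odd i j c e : exists c' e', tau (psi (odd4 i j c e)) = psi (odd4 (~~ i) (~~ j) c' e').
  have Ec : c = c0 * (c * e1 - c1 * e) + c1 * (c0 * e - e0 * c) by rewrite -[LHS]mulr1 -det1; ring.
  have Ee : e = e0 * (c * e1 - c1 * e) + e1 * (c0 * e - e0 * c) by rewrite -[LHS]mulr1 -det1; ring.
  by have := tau_o i j (c * e1 - c1 * e) (c0 * e - e0 * c); rewrite -Ec -Ee => ->; do 2!eexists.
have tau_line i j x : exists y, tau (psi (odd4 i j (x * c0) (x * e0))) = psi (odd4 (~~ i) (~~ j) (y * c1) (y * e1)).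
  exists (osg F i j * x); have := tau_o i j x 0; rewrite !mulr0 !addr0 !add0r ![_ * x]mulrC => ->.
  by rewrite ![_ * (_ * _)]mulrC.
have tau_line' i j x : exists y, tau (psi (odd4 i j (x * c1) (x * e1))) = psi (odd4 (~~ i) (~~ j) (y * c0) (y * e0)).
  exists (osg F i j * x); have := tau_o i j 0 x; rewrite !mulr0 !addr0 !add0r ![_ * x]mulrC => ->.
  by rewrite ![_ * (_ * _)]mulrC.
have tau_even s r : tau (psi (even4 F s r)) = psi (even4 F s (~~ r)).
  have evE r' : psi' (even4 F s r') = psi (even4 F s r') by rewrite /psi' twist_even //; apply: even4_part.
  by rewrite -!evE tauE ?even4_str // even4_tr.
have det3 : c1 * e0 - e1 * c0 = - 1 by rewrite -det1; ring.
apply: (adapted_kostant kf xi_basis xid_basis dual tri pP psP nP dec sf).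
  exact: (twist_opp m dX Dn Dp Dnb full1 npn n0 det1 cut1 cut2 tau_line tau_odd tau_even n_cent).
have cut1' c e : cut_odd psi n c e -> (- c0) * e - (- e0) * c = 0.
  by move/cut1 => E; rewrite -[RHS]oppr0 -E; ring.
(* Here [n] and [nb] change roles; the sign on [c0] and [e0] keeps the determinant equal to one. *)
apply: (twist_opp m dX Dnb Dps' Dn full2 nbpn nb0 (c0 := c1) (e0 := e1) (c1 := - c0) (e1 := - e0)) => //.
by move=> i j x; have [y ->] := tau_line' i j x; exists (- y); rewrite !mulrNN.
Qed.
End Psl22Kostant.

Theorem theorem4p3 (R : realType) (g : lieSuperalgebra R[i])
    (kappa : g -> g -> R[i]) (p l n nb : {vspace g})
    (d : nat) (xi xid : d.-tuple g) :
  basic_classical kappa ->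
  parabolic_decomposition p l n nb ->
  homogeneous_basis n xi ->
  homogeneous_basis nb xid ->
  (forall a b : 'I_d, kappa (tnth xid a) (tnth xi b) = (a == b)%:R) ->
  (forall V : actspace g, irreducible_module V ->
    let fr := frame_n l n nb xi xid in
    [<-> (* (1) *) forall k, (im_bdry fr V k :&: ker_quabla fr V k = 0)%VS;
         (* (2) *) forall k, (im_bdry fr V k :&: quabla0 fr V k = 0)%VS;
         (* (3) *) forall k, (quabla0 fr V k <= ker_bdry fr V k)%VS;
         (* (4) *) forall k, lmod_iso l (homology fr V k) (quabla0_module fr V k);
         (* (5) *) forall k, (im_cobdry fr V k :&: ker_quabla fr V k = 0)%VS;
         (* (6) *) forall k, lmod_iso l (cohomology fr V k) (quabla0_module fr V k);
         (* (7) *) forall k, (ker_cobdry fr V k :&: im_bdry fr V k = 0)%VS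
                          /\ (ker_bdry fr V k :&: im_cobdry fr V k = 0)%VS])
  /\
  (forall W : actspace g, irreducible_module W ->
    let fr := frame_nb p nb xi xid in
    [<-> (* (1) *) forall k, (im_bdry fr W k :&: ker_quabla fr W k = 0)%VS;
         (* (2) *) forall k, (im_bdry fr W k :&: quabla0 fr W k = 0)%VS;
         (* (3) *) forall k, (quabla0 fr W k <= ker_bdry fr W k)%VS;
         (* (4) *) forall k, lmod_iso l (homology fr W k) (quabla0_module fr W k);
         (* (5) *) forall k, (im_cobdry fr W k :&: ker_quabla fr W k = 0)%VS;
         (* (6) *) forall k, lmod_iso l (cohomology fr W k) (quabla0_module fr W k);
         (* (7) *) forall k, (ker_cobdry fr W k :&: im_bdry fr W k = 0)%VS
                          /\ (ker_bdry fr W k :&: im_cobdry fr W k = 0)%VS]).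
Proof.
move=> [kf type_g] par xb xdb dual.
have go : has_split g -> kostant_statement p l n nb xi xid.
  by move=> [h [t [v [tau [sf sep cc]]]]]; exact: (split_kostant kf xb xdb dual par sf sep cc).
suff: kostant_statement p l n nb xi xid by [].
case: type_g => [[m [k gk]]|[[m [k [mk gk]]]|[[k [k2 gk]]|[[m [k gk]]|[gk|[gk|[al [_ al1 gk]]]]]]]].
- exact/go/(gl_split gk).
- exact/go/(sl_split mk gk).
- case: k k2 gk => [|[|[|k]]] // _ gk; first exact: (psl22_kostant kf xb xdb dual gk par).
  exact/go/(psl_split _ gk).
- exact/go/(osp_split gk).
- exact/go/(F4_split gk).
- exact/go/(G3_split gk).
- exact/go/(D21_split al1 gk).
Qed.
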